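(* Let $a,b,c,d$ be integers with $c,d\ge1$. Each of the following functions of $\tau$ is a modular form of weight $\frac12$ on some congruence subgroup of $\mathrm{SL}_2(\mathbb{Z})$: (1) when $d$ is odd (and $c\nmid2a$ or $cd\nmid b$), $$\frac{1+\zeta_c^aq^{b/c}}{1-\zeta_c^aq^{b/c}}q^{-\frac{b^2}{c^2d^2}}\mathcal{O}_d(\zeta_c^aq^{b/c};q)-\frac{1+\zeta_c^{2a}q^{2b/c}}{1-\zeta_c^{2a}q^{2b/c}}q^{-\frac{b^2}{c^2d^2}}\mathcal{O}_{2d}(\zeta_c^{2a}q^{2b/c};q);$$ (2) when $d\equiv2\pmod4$ (and $c\nmid2a$ or $cd\nmid2b$), $$\frac{1+\zeta_c^aq^{b/c}}{1-\zeta_c^aq^{b/c}}q^{-\frac{b^2}{c^2d^2}}\mathcal{O}_d(\zeta_c^aq^{b/c};q)-\frac{1-\zeta_c^{a}q^{b/c}}{1+\zeta_c^{a}q^{b/c}}q^{-\frac{b^2}{c^2d^2}}\mathcal{O}_{2d}\left(-\zeta_c^{a}q^{b/c};q^{1/4}\right);$$ (3) when $d\equiv0\pmod4$ (and $c\nmid2a$ or $cd\nmid2b$), $$\frac{1+\zeta_c^aq^{b/c}}{1-\zeta_c^aq^{b/c}}q^{-\frac{b^2}{c^2d^2}}\mathcal{O}_d(\zeta_c^aq^{b/c};q)-\frac{1+\zeta_c^{a}q^{b/c}}{1-\zeta_c^{a}q^{b/c}}q^{-\frac{b^2}{c^2d^2}}\mathcal{O}_{2d}\left(\zeta_c^{a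}q^{b/c};q^{1/4}\right).$$
   Context: Notation: $\tau$ lies in the upper half-plane, $q=e^{2\pi i\tau}$, $q^s=e^{2\pi i s\tau}$, $\zeta_c^a=e^{2\pi i a/c}$, $(w;q)_\infty=\prod_{k\ge0}(1-wq^k)$. For a positive integer $d$, the generating function of the $M_d$-rank of overpartitions is $$\mathcal{O}_d(z;q)=\frac{(-q;q)_\infty}{(q;q)_\infty}\left(1+2\sum_{n\ge1}\frac{(1-z)(1-z^{-1})(-1)^nq^{n^2+dn}}{(1-zq^{dn})(1-z^{-1}q^{dn})}\right);$$ $\mathcal{O}_{2d}(z;q^{1/4})$ means that $q$ is replaced by $q^{1/4}=e^{2\pi i\tau/4}$ in the series while $z$ is as displayed. A modular form of weight $\frac12$ on a subgroup $\Gamma$ means a function holomorphic on the upper half-plane, meromorphic at the cusps (poles at the cusps are allowed), transforming as $f(A\tau)=\psi(A)(\gamma\tau+\delta)^{1/2}f(\tau)$ for $A=\begin{pmatrix}\alpha&\beta\\\gamma&\delta\end{pmatrix}\in\Gamma$ with some multiplier $\psi$, $|\psi|=1$. *)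

(* Defs.v *)
From Stdlib Require Import Reals ZArith.
From Coquelicot Require Import Coquelicot.
Open Scope C_scope.

Definition Cexp (w : C) : C :=
  (exp (Re w) * cos (Im w), exp (Re w) * sin (Im w))%R.

(* Principal branch: the argument of the root lies in ]-PI/2, PI/2], so that
   Csqrt (-1) = Ci. *)
Definition Csqrt (w : C) : C :=
  (sqrt ((Cmod w + Re w) / 2),
   if Rle_dec 0 (Im w) then sqrt ((Cmod w - Re w) / 2)
   else - sqrt ((Cmod w - Re w) / 2))%R.

(* Limits and sums as total functions, with an arbitrary value in case of
   divergence. *)
Definition CLim_seq (u : nat -> C) : C :=
  iota (T := C_CompleteNormedModule)
    (fun l : C => filterlim u eventually (locally l)).

Definition CSeries (u : nat -> C) : C :=
  iota (T := C_CompleteNormedModule)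
    (fun l : C => is_series (V := C_NormedModule) u l).

Lemma CLim_seq_unique (u : nat -> C) (l : C) :
  filterlim u eventually (locally l) -> CLim_seq u = l.
Proof.
exact (iota_filterlim_locally (V := C_CompleteNormedModule) u l).
Qed.

Lemma CSeries_unique (u : nat -> C) (l : C) :
  is_series (V := C_NormedModule) u l -> CSeries u = l.
Proof.
exact (iota_filterlim_locally (V := C_CompleteNormedModule)
         (sum_n (G := C_NormedModule) u) l).
Qed.

Fixpoint qprod (w q : C) (n : nat) : C :=
  match n with
  | O => 1
  | S m => qprod w q m * (1 - w * q ^ m)
  end.

(* (w; q)_infinity *)
Definition qpoch_inf (w q : C) : C := CLim_seq (qprod w q).

(* The generating function O_d(z; q) of the M_d-rank of overpartitions.
   CSeries starts at index 0, whereas the sum runs over n >= 1. *)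
Definition rank_term (d : nat) (z q : C) (n : nat) : C :=
  (1 - z) * (1 - / z) * (-1) ^ n * q ^ (n * n + d * n)
    / ((1 - z * q ^ (d * n)) * (1 - / z * q ^ (d * n))).

Definition overrank (d : nat) (z q : C) : C :=
  qpoch_inf (- q) q / qpoch_inf q q
    * (1 + 2 * CSeries (fun n => rank_term d z q (S n))).

(* q^s = exp (2 PI i s tau) for real s, and zeta_c^a = exp (2 PI i a / c). *)
Definition qpow (s : R) (tau : C) : C := Cexp (2 * PI * Ci * s * tau).

Definition zeta (c : nat) (a : Z) : C := Cexp (2 * PI * Ci * (IZR a / INR c)%R).

Definition upper_half_plane (tau : C) : Prop := (0 < Im tau)%R.

Record mat2 := Mat2 { m11 : Z; m12 : Z; m21 : Z; m22 : Z }.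

Definition mat2_id : mat2 := Mat2 1 0 0 1.

Definition mat2_mul (A B : mat2) : mat2 :=
  Mat2 (m11 A * m11 B + m12 A * m21 B) (m11 A * m12 B + m12 A * m22 B)
       (m21 A * m11 B + m22 A * m21 B) (m21 A * m12 B + m22 A * m22 B).

Definition SL2Z (A : mat2) : Prop := (m11 A * m22 A - m12 A * m21 A = 1)%Z.

(* The inverse of a matrix of determinant 1. *)
Definition mat2_inv (A : mat2) : mat2 :=
  Mat2 (m22 A) (- m12 A) (- m21 A) (m11 A).

Definition principal_congruence (N : nat) (A : mat2) : Prop :=
  SL2Z A /\
  (Z.of_nat N | m11 A - 1)%Z /\ (Z.of_nat N | m12 A)%Z /\
  (Z.of_nat N | m21 A)%Z /\ (Z.of_nat N | m22 A - 1)%Z.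

Definition SL2Z_subgroup (G : mat2 -> Prop) : Prop :=
  (forall A, G A -> SL2Z A) /\
  G mat2_id /\
  (forall A B, G A -> G B -> G (mat2_mul A B)) /\
  (forall A, G A -> G (mat2_inv A)).

Definition congruence_subgroup (G : mat2 -> Prop) : Prop :=
  SL2Z_subgroup G /\
  exists N : nat, (1 <= N)%nat /\ forall A, principal_congruence N A -> G A.

Definition autf (A : mat2) (tau : C) : C := IZR (m21 A) * tau + IZR (m22 A).

Definition mobius (A : mat2) (tau : C) : C :=
  (IZR (m11 A) * tau + IZR (m12 A)) / autf A tau.

(* Every cusp is A(oo) for some A in SL2(Z).  The expansion at it is that of
   (gamma tau + delta)^(-1/2) f(A tau), a Laurent series in q^(1/h) with
   finitely many negative exponents.  The exponents are shifted by a common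
   real number, as the multiplier need not be trivial on the stabilizer of the
   cusp; nu is the sum of this shift and of the lowest exponent. *)
Definition meromorphic_at_cusps_half (f : C -> C) : Prop :=
  forall A, SL2Z A ->
  exists (h : nat) (nu : R) (coef : nat -> C), (1 <= h)%nat /\
    forall tau, upper_half_plane tau ->
      is_series (V := C_NormedModule)
        (fun n => coef n * qpow (nu + INR n / INR h) tau)
        (/ Csqrt (autf A tau) * f (mobius A tau)).

Definition modular_form_half (G : mat2 -> Prop) (f : C -> C) : Prop :=
  (forall tau, upper_half_plane tau ->
     ex_derive (K := C_AbsRing) (V := C_NormedModule) f tau) /\
  meromorphic_at_cusps_half f /\
  exists psi : mat2 -> C, forall A, G A ->
    Cmod (psi A) = 1%R /\
    forall tau, upper_half_plane tau ->
      f (mobius A tau) = psi A * Csqrt (autf A tau) * f tau.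

Definition is_modular_half (f : C -> C) : Prop :=
  exists G, congruence_subgroup G /\ modular_form_half G f.

(* Main.v *)
(** Multiplied by (1 + z) / (1 - z), the function O_d(z; q) becomes the bilateral
    sum of (-1)^n q^(n^2) (1 + z q^(dn)) / (1 - z q^(dn)) over all integers n,
    divided by theta_4, the sum of (-1)^n q^(n^2).  Sorting n by its residue
    modulo d (d odd, after subtracting the two ranks) or modulo d/2 (d even)
    writes this as a combination of Appell sums
      Ap(T; u, v) = sum_n (-1)^n e(T n(n+1)/2 + n v) / (1 - e(u + n T)),
    e(x) = exp(2 PI i x), with T = N tau, in which rho = u - v is the same for
    all residues.  Up to a quotient of theta functions, Ap(T; u, v) is a multiple
    of Ap(T; lam, lam + rho), for any lam.  The total coefficient of the latter,
    the only non-modular part, is a theta sum: it vanishes for odd d because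
    n -> d - n changes the sign of (-1)^n q^(n^2 - dn), and for even d it is the
    same for the two ranks, as z' = (-1)^(d/2) z, 2d and q^(1/4) lead to the same
    T and rho.  The factor q^(-b^2/(c^2 d^2)) is what makes the remaining theta
    quotients modular.

    Theta functions are transformed by Jacobi's inversion formula, with one
    multiplier for all rational characteristics of bounded denominator on a
    congruence subgroup, and expanded at the cusps by the triple product. *)

(* Only absolutely convergent sums are used in place of complex function theory. What is usually
   drawn from elliptic functions, the relation between Appell sums with equal [u - v], comes from
   evaluating one double series in two orders and from a limit at the simple zero of theta;
   holomorphy comes from the expansions in powers of q^(1/h). The multiplier shapes the statements:
   K(al, be; N tau) has one multiplier for all characteristics of bounded denominator, but it
   changes with N. Hence every factor is brought to the same N, which is 2 d^2 for odd d and d^2 / 2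
   for even d: the factor (q; q)^3 of the theta quotients becomes a product of three thetas, and
   theta_4 is cut into thetas of level N. Each correction term then has five thetas over three,
   divided by theta_4, whence weight 1/2. The free point lam is T / 2 plus a real number chosen so
   that lam + rho has second characteristic 1/2: its theta then never vanishes, whatever a, b, c
   are. The weight is expressed by the principal root, so the sign of its cocycle must be shown to
   be independent of tau, and the constant of the inversion formula must be identified with its
   sign. *)
Require Import Defs.
From Stdlib Require Import Reals ZArith Lra Lia Psatz List Permutation Classical ClassicalEpsilon FunctionalExtensionality.
From Coquelicot Require Import Coquelicot.
Import ListNotations.
Open Scope C_scope.

(** * Unordered sums of complex families *)

Definition lsum {I : Type} (f : I -> C) (L : list I) : C :=
  fold_right (fun i s => f i + s) 0 L.

Definition rsum {I : Type} (f : I -> R) (L : list I) : R :=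
  fold_right (fun i s => f i + s)%R 0%R L.

(** Convergence along finite subsets, given as lists without repetition. No order or enumeration of
    the index type enters, so reindexing by bijections and exchanging double sums are direct. *)
Definition csum {I : Type} (f : I -> C) (s : C) : Prop :=
  forall eps : R, (0 < eps)%R -> exists L0, forall L, NoDup L -> incl L0 L ->
    (Cmod (lsum f L - s) < eps)%R.

Definition rbound {I : Type} (g : I -> R) (M : R) : Prop :=
  forall L, NoDup L -> (rsum g L <= M)%R.

Definition summable {I : Type} (f : I -> C) : Prop :=
  exists M, rbound (fun i => Cmod (f i)) M.

(** The value is arbitrary for a family without a sum; [csum_Sum] and [summable_csum] give it a
    meaning. *)
Definition Sum {I : Type} (f : I -> C) : C := epsilon (inhabits (RtoC 0)) (csum f).

Definition Clim (u : nat -> C) (l : C) : Prop :=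
  forall eps : R, (0 < eps)%R -> exists N, forall n, (N <= n)%nat -> (Cmod (u n - l) < eps)%R.

Lemma filterlim_Clim (u : nat -> C) (l : C) :
  filterlim u eventually (locally l) <-> Clim u l.
Proof.
  rewrite (filterlim_locally_ball_norm (K := C_AbsRing) (U := C_NormedModule) (F := eventually) u l).
  unfold eventually, ball_norm, norm; simpl. split; intros H.
  - intros eps He. exact (H (mkposreal eps He)).
  - intros eps. exact (H eps (cond_pos eps)).
Qed.

Lemma Clim_unique u l l' : Clim u l -> Clim u l' -> l = l'.
Proof.
  rewrite <- !filterlim_Clim. apply (filterlim_locally_unique (K := C_AbsRing) (V := C_NormedModule)).
Qed.

Lemma Clim_const c : Clim (fun _ => c) c.
Proof.
  intros eps He. exists 0%nat. intros n _. replace (c - c) with (RtoC 0) by ring.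
  rewrite Cmod_0; auto.
Qed.

Lemma Clim_plus u v l m : Clim u l -> Clim v m -> Clim (fun n => u n + v n) (l + m).
Proof.
  intros Hu Hv eps He.
  destruct (Hu (eps / 2)%R) as [N1 H1]; [lra|].
  destruct (Hv (eps / 2)%R) as [N2 H2]; [lra|].
  exists (max N1 N2). intros n Hn.
  specialize (H1 n ltac:(lia)). specialize (H2 n ltac:(lia)).
  replace (u n + v n - (l + m)) with ((u n - l) + (v n - m)) by ring.
  eapply Rle_lt_trans; [apply Cmod_triangle|]. lra.
Qed.

Lemma Clim_mult u v l m : Clim u l -> Clim v m -> Clim (fun n => u n * v n) (l * m).
Proof.
  intros Hu Hv eps He.
  assert (Hl := Cmod_ge_0 l). assert (Hm := Cmod_ge_0 m).
  set (B := (Cmod l + Cmod m + 2)%R).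
  destruct (Hu (Rmin 1 (eps / B))) as [N1 H1].
  { apply Rmin_glb_lt; [lra|]. apply Rdiv_lt_0_compat; unfold B; lra. }
  destruct (Hv (eps / B)%R) as [N2 H2].
  { apply Rdiv_lt_0_compat; unfold B; lra. }
  exists (max N1 N2). intros n Hn.
  specialize (H1 n ltac:(lia)). specialize (H2 n ltac:(lia)).
  assert (H3 := Rlt_le_trans _ _ _ H1 (Rmin_l _ _)).
  assert (H4 := Rlt_le_trans _ _ _ H1 (Rmin_r _ _)).
  replace (u n * v n - l * m) with ((u n - l) * (v n - m) + (l * (v n - m) + (u n - l) * m)) by ring.
  eapply Rle_lt_trans; [apply Cmod_triangle|].
  eapply Rle_lt_trans; [apply Rplus_le_compat_l, Cmod_triangle|].
  rewrite !Cmod_mult.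
  assert (H5 := Cmod_ge_0 (u n - l)). assert (H6 := Cmod_ge_0 (v n - m)).
  replace eps with ((Cmod l + Cmod m + 2) * (eps / B))%R by (unfold B; field; lra).
  assert (0 < eps / B)%R by (apply Rdiv_lt_0_compat; unfold B; lra).
  nra.
Qed.

Lemma Clim_ext u v l : (forall n, u n = v n) -> Clim u l -> Clim v l.
Proof. intros H. replace v with u; auto. apply functional_extensionality; auto. Qed.

Lemma Clim_bound u l M : Clim u l -> (forall n, (Cmod (u n) <= M)%R) -> (Cmod l <= M)%R.
Proof.
  intros H HM. apply le_epsilon; intros eps He.
  destruct (H eps He) as [N HN]. specialize (HN N (Nat.le_refl _)).
  replace l with (u N + - (u N - l)) by ring.
  eapply Rle_trans; [apply Cmod_triangle|]. rewrite Cmod_opp. specialize (HM N). lra.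
Qed.

Section Lists.
Context {I : Type}.
Implicit Types (f g : I -> C) (L : list I).

(** Index types carry no decision procedure for equality, but [nodup] asks for one. *)
Lemma eqdec_classic (x y : I) : {x = y} + {x <> y}.
Proof. apply excluded_middle_informative. Qed.

Lemma lsum_ext f g L : (forall i, In i L -> f i = g i) -> lsum f L = lsum g L.
Proof.
  induction L as [|a L IH]; intros H; simpl; auto.
  rewrite H, IH; auto with datatypes.
Qed.

Lemma rsum_le (f g : I -> R) L :
  (forall i, In i L -> (f i <= g i)%R) -> (rsum f L <= rsum g L)%R.
Proof.
  induction L as [|a L IH]; intros H; simpl; [lra|].
  apply Rplus_le_compat; auto with datatypes.
Qed.

Lemma rsum_nonneg (f : I -> R) L :
  (forall i, (0 <= f i)%R) -> (0 <= rsum f L)%R.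
Proof.
  induction L as [|a L IH]; intros H; simpl; [lra|].
  specialize (IH H); specialize (H a); lra.
Qed.

Lemma lsum_plus f g L : lsum (fun i => f i + g i) L = lsum f L + lsum g L.
Proof. induction L as [|a L IH]; simpl; [|rewrite IH]; ring. Qed.

Lemma lsum_scal c f L : lsum (fun i => c * f i) L = c * lsum f L.
Proof. induction L as [|a L IH]; simpl; [|rewrite IH]; ring. Qed.

Lemma rsum_scal c (f : I -> R) L :
  (rsum (fun i => c * f i) L = c * rsum f L)%R.
Proof. induction L as [|a L IH]; simpl; [|rewrite IH]; ring. Qed.

Lemma rsum_plus (f g : I -> R) L :
  (rsum (fun i => f i + g i) L = rsum f L + rsum g L)%R.
Proof. induction L as [|a L IH]; simpl; [|rewrite IH]; ring. Qed.

Lemma lsum_app f L L' : lsum f (L ++ L') = lsum f L + lsum f L'.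
Proof. induction L as [|a L IH]; simpl; [|rewrite IH]; ring. Qed.

Lemma rsum_app (f : I -> R) L L' : rsum f (L ++ L') = (rsum f L + rsum f L')%R.
Proof. induction L as [|a L IH]; simpl; [|rewrite IH]; ring. Qed.

Lemma lsum_perm f L L' : Permutation L L' -> lsum f L = lsum f L'.
Proof.
  induction 1; simpl; auto; [rewrite IHPermutation; auto|ring|congruence].
Qed.

Lemma rsum_perm (f : I -> R) L L' : Permutation L L' -> rsum f L = rsum f L'.
Proof.
  induction 1; simpl; auto; [rewrite IHPermutation; auto|ring|congruence].
Qed.

Lemma lsum_zero f L : (forall i, In i L -> f i = 0) -> lsum f L = 0.
Proof.
  induction L as [|a L IH]; intros H; simpl; auto.
  rewrite H, IH; auto with datatypes. ring.
Qed.

Lemma Cmod_lsum f L : (Cmod (lsum f L) <= rsum (fun i => Cmod (f i)) L)%R.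
Proof.
  induction L as [|a L IH]; simpl; [rewrite Cmod_0; lra|].
  eapply Rle_trans; [apply Cmod_triangle|]. lra.
Qed.

Lemma incl_perm L0 L : NoDup L0 -> incl L0 L -> exists L', Permutation L (L0 ++ L').
Proof.
  revert L; induction L0 as [|a L0 IH]; intros L H0 Hi.
  - exists L; reflexivity.
  - inversion H0; subst.
    destruct (in_split a L) as [l1 [l2 ->]]; [apply Hi; left; auto|].
    destruct (IH (l1 ++ l2)) as [L' HL']; auto.
    + intros x Hx. assert (x <> a) by congruence.
      assert (H4 : In x (l1 ++ a :: l2)) by (apply Hi; right; auto).
      apply in_app_or in H4; apply in_or_app; simpl in H4; intuition congruence.
    + exists L'. simpl. rewrite <- HL'. symmetry. apply Permutation_middle.
Qed.

Lemma rsum_incl (f : I -> R) L0 L : (forall i, (0 <= f i)%R) ->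
  NoDup L0 -> incl L0 L -> (rsum f L0 <= rsum f L)%R.
Proof.
  intros Hf H0 Hi. destruct (incl_perm L0 L H0 Hi) as [L' HP].
  rewrite (rsum_perm _ _ _ HP), rsum_app.
  assert (H1 := rsum_nonneg f L' Hf); lra.
Qed.

Lemma NoDup_cover L : exists L', NoDup L' /\ incl L L' /\ incl L' L.
Proof.
  exists (nodup eqdec_classic L); repeat split.
  - apply NoDup_nodup.
  - intros x; apply nodup_In.
  - intros x; apply nodup_In.
Qed.

Lemma csum_unique f s t : csum f s -> csum f t -> s = t.
Proof.
  intros Hs Ht.
  apply NNPP; intros Hne.
  assert (Hp : (0 < Cmod (s - t))%R).
  { apply Cmod_gt_0. intros E. apply Hne.
    replace s with (s - t + t) by ring. rewrite E; ring. }
  destruct (Hs (Cmod (s - t) / 2)%R) as [L1 H1]; [lra|].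
  destruct (Ht (Cmod (s - t) / 2)%R) as [L2 H2]; [lra|].
  destruct (NoDup_cover (L1 ++ L2)) as [L [HL [Hi _]]].
  assert (A1 := H1 L HL (fun x Hx => Hi x (in_or_app _ _ _ (or_introl Hx)))).
  assert (A2 := H2 L HL (fun x Hx => Hi x (in_or_app _ _ _ (or_intror Hx)))).
  assert (Hc : (Cmod (s - t) <= Cmod (lsum f L - t) + Cmod (lsum f L - s))%R).
  { replace (s - t) with ((lsum f L - t) + - (lsum f L - s)) by ring.
    eapply Rle_trans; [apply Cmod_triangle|]. rewrite Cmod_opp. lra. }
  lra.
Qed.

Lemma csum_Sum f s : csum f s -> Sum f = s.
Proof.
  intros H. apply (csum_unique f); auto. unfold Sum. apply epsilon_spec. eauto.
Qed.

Lemma csum_ext f g s : (forall i, f i = g i) -> csum f s -> csum g s.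
Proof.
  intros H Hf. replace g with f; auto. apply functional_extensionality; auto.
Qed.

Lemma Sum_ext f g : (forall i, f i = g i) -> Sum f = Sum g.
Proof. intros H. f_equal. apply functional_extensionality; auto. Qed.

Lemma csum_plus f g s t : csum f s -> csum g t -> csum (fun i => f i + g i) (s + t).
Proof.
  intros Hf Hg eps He.
  destruct (Hf (eps / 2)%R) as [L1 H1]; [lra|].
  destruct (Hg (eps / 2)%R) as [L2 H2]; [lra|].
  exists (L1 ++ L2); intros L HL Hi.
  assert (A1 := H1 L HL (fun x Hx => Hi x (in_or_app _ _ _ (or_introl Hx)))).
  assert (A2 := H2 L HL (fun x Hx => Hi x (in_or_app _ _ _ (or_intror Hx)))).
  rewrite lsum_plus.
  replace (lsum f L + lsum g L - (s + t)) with ((lsum f L - s) + (lsum g L - t)) by ring.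
  eapply Rle_lt_trans; [apply Cmod_triangle|]. lra.
Qed.

Lemma csum_scal c f s : csum f s -> csum (fun i => c * f i) (c * s).
Proof.
  intros Hf eps He.
  assert (Hc := Cmod_ge_0 c).
  destruct (Hf (eps / (Cmod c + 1))%R) as [L1 H1].
  { apply Rdiv_lt_0_compat; lra. }
  exists L1; intros L HL Hi. rewrite lsum_scal.
  replace (c * lsum f L - c * s) with (c * (lsum f L - s)) by ring.
  rewrite Cmod_mult. specialize (H1 L HL Hi).
  apply Rle_lt_trans with (Cmod c * (eps / (Cmod c + 1)))%R.
  { apply Rmult_le_compat_l; lra. }
  apply Rlt_le_trans with ((Cmod c + 1) * (eps / (Cmod c + 1)))%R.
  { apply Rmult_lt_compat_r; [apply Rdiv_lt_0_compat|]; lra. }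
  apply Req_le. field. lra.
Qed.

Lemma csum_minus f g s t : csum f s -> csum g t -> csum (fun i => f i - g i) (s - t).
Proof.
  intros Hf Hg.
  replace (s - t) with (s + (-(1)) * t) by ring.
  eapply csum_ext; [|apply csum_plus; [exact Hf|apply (csum_scal (-(1)) g t Hg)]].
  intros i; simpl; ring.
Qed.

Lemma csum_fin f L : NoDup L -> (forall i, ~ In i L -> f i = 0) -> csum f (lsum f L).
Proof.
  intros HL Hz eps He. exists L; intros L' HL' Hi.
  destruct (incl_perm L L' HL Hi) as [L'' HP].
  rewrite (lsum_perm _ _ _ HP), lsum_app.
  rewrite (lsum_zero f L'').
  - replace (lsum f L + 0 - lsum f L) with (RtoC 0) by ring. rewrite Cmod_0; auto.
  - intros i Hin. apply Hz. intros Hin'.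
    assert (HN : NoDup (L ++ L'')) by (eapply Permutation_NoDup; eauto).
    destruct (in_split _ _ Hin) as [l1 [l2 ->]].
    rewrite app_assoc in HN. apply NoDup_remove_2 in HN. apply HN.
    apply in_or_app; left; apply in_or_app; left; auto.
Qed.

Lemma csum_at f i : (forall k, k <> i -> f k = 0) -> csum f (f i).
Proof.
  intros H. replace (f i) with (lsum f [i]) by (simpl; ring). apply csum_fin.
  - constructor; [auto|constructor].
  - intros k Hk. apply H. intros ->. apply Hk. left; auto.
Qed.

Lemma csum_zero : csum (fun _ : I => RtoC 0) 0.
Proof.
  apply (csum_fin (fun _ => RtoC 0) []); [constructor|auto].
Qed.

Lemma csum_bound f s M : csum f s -> rbound (fun i => Cmod (f i)) M -> (Cmod s <= M)%R.
Proof.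
  intros Hs HM. apply le_epsilon; intros eps He.
  destruct (Hs eps He) as [L0 H0].
  destruct (NoDup_cover L0) as [L [HL [Hi _]]].
  specialize (H0 L HL Hi). specialize (HM L HL).
  replace s with (lsum f L + - (lsum f L - s)) by ring.
  eapply Rle_trans; [apply Cmod_triangle|]. rewrite Cmod_opp.
  assert (H1 := Cmod_lsum f L). lra.
Qed.

Lemma rbound_ge0 (g : I -> R) M : rbound g M -> (0 <= M)%R.
Proof. intros H. apply (H []). constructor. Qed.

Lemma rbound_le (f g : I -> R) M :
  (forall i, (f i <= g i)%R) -> rbound g M -> rbound f M.
Proof.
  intros H Hg L HL. eapply Rle_trans; [|apply (Hg L HL)]. apply rsum_le; auto.
Qed.

Lemma rbound_weaken (f : I -> R) M M' : (M <= M')%R -> rbound f M -> rbound f M'.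
Proof. intros H H' L HL. specialize (H' L HL). lra. Qed.

Lemma rbound_scal (f : I -> R) c M : (0 <= c)%R -> rbound f M ->
  rbound (fun i => (c * f i)%R) (c * M).
Proof.
  intros Hc H L HL. rewrite rsum_scal. apply Rmult_le_compat_l; auto.
Qed.

Lemma rbound_plus (f g : I -> R) M N : rbound f M -> rbound g N ->
  rbound (fun i => (f i + g i)%R) (M + N).
Proof. intros Hf Hg L HL. rewrite rsum_plus. apply Rplus_le_compat; auto. Qed.

Lemma rbound_term (f : I -> R) M i : (forall i, (0 <= f i)%R) -> rbound f M -> (f i <= M)%R.
Proof.
  intros Hf H. specialize (H [i]). simpl in H.
  assert (NoDup [i]) by (constructor; simpl; auto; constructor). specialize (H H0). lra.
Qed.

Lemma summable_le (f : I -> C) (g : I -> R) M :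
  (forall i, (Cmod (f i) <= g i)%R) -> rbound g M -> summable f.
Proof. intros H Hg. exists M. eapply rbound_le; eauto. Qed.

Lemma summable_plus f g : summable f -> summable g -> summable (fun i => f i + g i).
Proof.
  intros [M HM] [N HN]. exists (M + N)%R.
  eapply rbound_le; [|apply (rbound_plus _ _ _ _ HM HN)].
  intros i; apply Cmod_triangle.
Qed.

Lemma summable_scal c f : summable f -> summable (fun i => c * f i).
Proof.
  intros [M HM]. exists (Cmod c * M)%R.
  eapply rbound_le; [|apply (rbound_scal _ _ _ (Cmod_ge_0 c) HM)].
  intros i; simpl. rewrite Cmod_mult. lra.
Qed.

(** The sum is the supremum of the finite partial sums: a list within [eps] of it stays so when
    enlarged, the terms being nonnegative. *)
Lemma csum_real_nonneg (f : I -> R) M : (forall i, (0 <= f i)%R) -> rbound f M ->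
  exists s : R, csum (fun i => RtoC (f i)) (RtoC s).
Proof.
  intros Hf HM.
  destruct (completeness (fun x => exists L, NoDup L /\ x = rsum f L)) as [s [Hub Hlub]].
  - exists M. intros x [L [HL ->]]. auto.
  - exists 0%R. exists []. split; [constructor|reflexivity].
  - exists s. intros eps He.
    assert (Hex : exists L, NoDup L /\ (s - eps < rsum f L)%R).
    { apply NNPP; intros Hn.
      assert (Hs : (s <= s - eps)%R); [|lra].
      apply Hlub. intros x [L [HL ->]]. apply Rnot_lt_le. intros Hlt.
      apply Hn. exists L; auto. }
    destruct Hex as [L0 [HL0 Hlt]]. exists L0. intros L HL Hi.
    assert (H1 := rsum_incl f L0 L Hf HL0 Hi).
    assert (H2 : (rsum f L <= s)%R) by (apply Hub; eauto).
    assert (E : lsum (fun i => RtoC (f i)) L = RtoC (rsum f L)).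
    { clear. induction L as [|a L IH]; simpl; auto. rewrite IH, RtoC_plus; auto. }
    rewrite E, <- RtoC_minus, Cmod_R. rewrite Rabs_left1; lra.
Qed.

Lemma rabs_pos_neg_csum (f : I -> R) M : rbound (fun i => Rabs (f i)) M ->
  exists s : R, csum (fun i => RtoC (f i)) (RtoC s).
Proof.
  intros HM.
  destruct (csum_real_nonneg (fun i => Rmax 0 (f i)) M) as [s1 H1].
  - intros i; apply Rmax_l.
  - eapply rbound_le; [|exact HM]. intros i. apply Rmax_lub; [apply Rabs_pos|apply Rle_abs].
  - destruct (csum_real_nonneg (fun i => Rmax 0 (- f i)) M) as [s2 H2].
    + intros i; apply Rmax_l.
    + eapply rbound_le; [|exact HM]. intros i. apply Rmax_lub; [apply Rabs_pos|].
      rewrite <- Rabs_Ropp; apply Rle_abs.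
    + exists (s1 - s2)%R. rewrite RtoC_minus.
      eapply csum_ext; [|apply csum_minus; [exact H1|exact H2]].
      intros i; simpl. rewrite <- RtoC_minus. f_equal.
      unfold Rmax; destruct (Rle_dec 0 (f i)), (Rle_dec 0 (- f i)); lra.
Qed.

(** The positive and negative parts of the real and imaginary components are each bounded by the
    modulus and so have sums. *)
Lemma summable_csum f : summable f -> csum f (Sum f).
Proof.
  intros [M HM].
  destruct (rabs_pos_neg_csum (fun i => Re (f i)) M) as [a Ha].
  { eapply rbound_le; [|exact HM]. intros i; apply re_le_Cmod. }
  destruct (rabs_pos_neg_csum (fun i => Im (f i)) M) as [b Hb].
  { eapply rbound_le; [|exact HM]. intros i; simpl.
    replace (Im (f i)) with (- Re (Ci * f i))%R by (unfold Re, Im; simpl; ring).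
    rewrite Rabs_Ropp. eapply Rle_trans; [apply re_le_Cmod|].
    rewrite Cmod_mult. replace (Cmod Ci) with 1%R; [lra|].
    unfold Cmod, Ci; simpl. symmetry.
    replace (0 * (0 * 1) + 1 * (1 * 1))%R with 1%R by ring. apply sqrt_1. }
  assert (H : csum f (RtoC a + Ci * RtoC b)).
  { eapply csum_ext; [|apply csum_plus; [exact Ha|apply (csum_scal Ci _ _ Hb)]].
    intros i; simpl. unfold RtoC, Ci, Cplus, Cmult, Re, Im; destruct (f i); simpl.
    f_equal; ring. }
  rewrite (csum_Sum _ _ H). exact H.
Qed.

Lemma csum_tail f s eps : csum f s -> (0 < eps)%R -> exists L0, NoDup L0 /\
  forall L, NoDup L -> incl L0 L -> (Cmod (lsum f L - s) < eps)%R.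
Proof.
  intros H He. destruct (H eps He) as [L0 H0].
  destruct (NoDup_cover L0) as [L1 [HL1 [Hi _]]].
  exists L1; split; auto. intros L HL HiL. apply H0; auto.
  intros x Hx; auto.
Qed.

Lemma Clim_lsum (F : nat -> I -> C) f L : (forall i, Clim (fun n => F n i) (f i)) ->
  Clim (fun n => lsum (F n) L) (lsum f L).
Proof.
  intros H. induction L as [|a L IH]; simpl; [apply Clim_const|].
  apply Clim_plus; auto.
Qed.

(** [L0] comes within [eps] of the supremum of all partial sums, so a list disjoint from it cannot
    add as much as [eps]. *)
Lemma rbound_remainder (g : I -> R) M eps : (forall i, (0 <= g i)%R) -> rbound g M ->
  (0 < eps)%R -> exists L0, NoDup L0 /\ forall L, NoDup (L0 ++ L) -> (rsum g L < eps)%R.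
Proof.
  intros Hg HM He.
  destruct (completeness (fun x => exists L, NoDup L /\ x = rsum g L)) as [s [Hub Hlub]].
  - exists M. intros x [L [HL ->]]. auto.
  - exists 0%R. exists []. split; [constructor|reflexivity].
  - assert (Hex : exists L, NoDup L /\ (s - eps < rsum g L)%R).
    { apply NNPP; intros Hn.
      assert (Hs : (s <= s - eps)%R); [|lra].
      apply Hlub. intros x [L [HL ->]]. apply Rnot_lt_le. intros Hlt.
      apply Hn. exists L; auto. }
    destruct Hex as [L0 [HL0 Hlt]]. exists L0. split; auto. intros L HL.
    assert (H2 : (rsum g (L0 ++ L) <= s)%R) by (apply Hub; eauto).
    rewrite rsum_app in H2. lra.
Qed.

(** The list depends on the majorant only and serves all dominated families at once; this uniformity
    lets an integral pass through a sum. *)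
Lemma dominated_tail (g : I -> R) M eps : (forall i, (0 <= g i)%R) -> rbound g M -> (0 < eps)%R ->
  exists L0, forall f s, (forall i, (Cmod (f i) <= g i)%R) -> csum f s ->
    forall L, NoDup L -> incl L0 L -> (Cmod (s - lsum f L) <= eps)%R.
Proof.
  intros Hg HM He.
  destruct (rbound_remainder g M eps) as [L0 [HL0 Hr]]; auto.
  exists L0. intros f s Hf Hs L HL Hi. apply le_epsilon. intros e1 He1.
  destruct (csum_tail f s e1 Hs He1) as [L1 [HL1 H1]].
  destruct (NoDup_cover (L ++ L1)) as [LL [HLL [HiL _]]].
  specialize (H1 LL HLL (fun x Hx => HiL x (in_or_app _ _ _ (or_intror Hx)))).
  destruct (incl_perm L LL HL (fun x Hx => HiL x (in_or_app _ _ _ (or_introl Hx)))) as [L' HP].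
  rewrite (lsum_perm _ _ _ HP), lsum_app in H1.
  assert (HN : NoDup (L ++ L')) by (eapply Permutation_NoDup; eauto).
  assert (HN0 : NoDup (L0 ++ L')).
  { apply NoDup_app; auto.
    - apply NoDup_app_remove_l in HN; auto.
    - intros x Hx Hx'. apply Hi in Hx.
      destruct (in_split _ _ Hx) as [l1 [l2 El]]. rewrite El, <- app_assoc in HN.
      apply NoDup_remove_2 in HN. apply HN. apply in_or_app; right. apply in_or_app; right; auto. }
  specialize (Hr L' HN0).
  assert (H2 : (Cmod (lsum f L') <= rsum g L')%R).
  { eapply Rle_trans; [apply Cmod_lsum|]. apply rsum_le; auto. }
  replace (s - lsum f L) with (lsum f L' + - (lsum f L + lsum f L' - s)) by ring.
  eapply Rle_trans; [apply Cmod_triangle|]. rewrite Cmod_opp. lra.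
Qed.

(** Dominated convergence: outside one finite list all the families are small together, and on that
    list the limit is taken term by term. *)
Lemma csum_dominated (F : nat -> I -> C) f (g : I -> R) M (s : nat -> C) :
  (forall n i, (Cmod (F n i) <= g i)%R) -> rbound g M ->
  (forall i, Clim (fun n => F n i) (f i)) ->
  (forall n, csum (F n) (s n)) ->
  csum f (Sum f) /\ Clim s (Sum f).
Proof.
  intros Hd HM Hl Hs.
  assert (Hlb : forall i, (Cmod (f i) <= g i)%R).
  { intros i. apply (Clim_bound (fun n => F n i)); auto. }
  assert (Hg : forall i, (0 <= g i)%R).
  { intros i. eapply Rle_trans; [apply Cmod_ge_0|apply Hlb]. }
  assert (Hsf : csum f (Sum f)) by (apply summable_csum; eapply summable_le; eauto).
  split; auto. intros eps He.
  (* The two tails cost at most [2 * (eps / 5)] each, and the finite part less than [eps / 5]. *)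
  destruct (rbound_remainder g M (eps / 5)) as [L0 [HL0 Hr]]; auto; [lra|].
  assert (Hfar : forall h t, csum h t -> (forall i, (Cmod (h i) <= g i)%R) ->
    (Cmod (t - lsum h L0) <= 2 * (eps / 5))%R).
  { intros h t Ht Hh.
    destruct (csum_tail h t (eps / 5)) as [L1 [HL1 H1]]; auto; [lra|].
    destruct (NoDup_cover (L0 ++ L1)) as [L [HL [Hi _]]].
    specialize (H1 L HL (fun x Hx => Hi x (in_or_app _ _ _ (or_intror Hx)))).
    destruct (incl_perm L0 L HL0 (fun x Hx => Hi x (in_or_app _ _ _ (or_introl Hx)))) as [L' HP].
    rewrite (lsum_perm _ _ _ HP), lsum_app in H1.
    assert (HN : NoDup (L0 ++ L')) by (eapply Permutation_NoDup; eauto).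
    specialize (Hr L' HN).
    assert (H2 : (Cmod (lsum h L') <= rsum g L')%R).
    { eapply Rle_trans; [apply Cmod_lsum|]. apply rsum_le; auto. }
    replace (t - lsum h L0) with (lsum h L' + - (lsum h L0 + lsum h L' - t)) by ring.
    eapply Rle_trans; [apply Cmod_triangle|]. rewrite Cmod_opp. lra. }
  destruct (Clim_lsum F f L0 Hl (eps / 5)%R) as [N HN]; [lra|].
  exists N. intros n Hn. specialize (HN n Hn).
  assert (A := Hfar (F n) (s n) (Hs n) (Hd n)).
  assert (B := Hfar f (Sum f) Hsf Hlb).
  replace (s n - Sum f) with ((s n - lsum (F n) L0) + ((lsum (F n) L0 - lsum f L0) + - (Sum f - lsum f L0))) by ring.
  eapply Rle_lt_trans; [apply Cmod_triangle|].
  apply Rle_lt_trans with (Cmod (s n - lsum (F n) L0) + (Cmod (lsum (F n) L0 - lsum f L0) + Cmod (Sum f - lsum f L0)))%R.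
  { apply Rplus_le_compat_l. eapply Rle_trans; [apply Cmod_triangle|]. rewrite Cmod_opp. lra. }
  lra.
Qed.
End Lists.

Lemma lsum_map {I J : Type} (h : I -> J) (f : J -> C) L :
  lsum f (map h L) = lsum (fun i => f (h i)) L.
Proof. induction L as [|a L IH]; simpl; [|rewrite IH]; auto. Qed.

Lemma rsum_map {I J : Type} (h : I -> J) (f : J -> R) L :
  rsum f (map h L) = rsum (fun i => f (h i)) L.
Proof. induction L as [|a L IH]; simpl; [|rewrite IH]; auto. Qed.

Lemma NoDup_map_inj {I J : Type} (h : I -> J) L : (forall x y, h x = h y -> x = y) ->
  NoDup L -> NoDup (map h L).
Proof.
  intros Hh; induction 1; simpl; constructor; auto.
  rewrite in_map_iff. intros [y [Hy Hin]]. apply Hh in Hy; subst; auto.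
Qed.

Lemma rbound_inj {I J : Type} (h : I -> J) (g : J -> R) M :
  (forall x y, h x = h y -> x = y) -> rbound g M -> rbound (fun i => g (h i)) M.
Proof.
  intros Hh HM L HL. rewrite <- rsum_map. apply HM. apply NoDup_map_inj; auto.
Qed.

Lemma summable_inj {I J : Type} (h : I -> J) (f : J -> C) :
  (forall x y, h x = h y -> x = y) -> summable f -> summable (fun i => f (h i)).
Proof.
  intros Hh [M HM]. exists M. apply (rbound_inj h (fun j => Cmod (f j)) M Hh HM).
Qed.

(** Terms off the image of [h] vanish, so a finite list counts only through its image points; these
    are separated classically, as no inverse of [h] is given. This serves both for extension by zero
    and for a change of index type. *)
Lemma csum_push {I J : Type} (h : I -> J) (g : J -> C) s :
  (forall x y, h x = h y -> x = y) ->
  (forall j, (forall i, h i <> j) -> g j = 0) ->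
  csum (fun i => g (h i)) s -> csum g s.
Proof.
  intros Hh Hz Hs eps He.
  destruct (Hs eps He) as [L0 H0]. exists (map h L0). intros L HL Hi.
  destruct (NoDup_cover L0) as [L1 [HL1 [Hi1 Hi1']]].
  assert (Hdec : exists LA LB, Permutation L (map h LA ++ LB) /\
     forall j, In j LB -> forall i, h i <> j).
  { clear. induction L as [|a L [LA [LB [HP HB]]]].
    - exists [], []. split; [reflexivity|simpl; tauto].
    - destruct (classic (exists i, h i = a)) as [[i <-]|Hn].
      + exists (i :: LA), LB. simpl. split; auto.
      + exists LA, (a :: LB). split.
        * rewrite HP. apply Permutation_middle.
        * simpl. intros j [->|Hj]; eauto. }
  destruct Hdec as [LA [LB [HP HB]]].
  rewrite (lsum_perm _ _ _ HP), lsum_app, lsum_map.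
  rewrite (lsum_zero g LB) by (intros j Hj; apply Hz; auto).
  rewrite Cplus_0_r. apply H0.
  - assert (HN : NoDup (map h LA ++ LB)) by (eapply Permutation_NoDup; eauto).
    apply NoDup_app_remove_r in HN. eapply NoDup_map_inv; eauto.
  - intros x Hx. assert (Hin : In (h x) L) by (apply Hi; apply in_map; auto).
    apply (Permutation_in _ HP) in Hin. apply in_app_or in Hin. destruct Hin as [Hin|Hin].
    + apply in_map_iff in Hin. destruct Hin as [y [Hy Hin]]. apply Hh in Hy; subst; auto.
    + exfalso. apply (HB _ Hin x); auto.
Qed.

Lemma csum_bij {I J : Type} (h : I -> J) (k : J -> I) (g : J -> C) s :
  (forall i, k (h i) = i) -> (forall j, h (k j) = j) ->
  csum g s -> csum (fun i => g (h i)) s.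
Proof.
  intros Hk Hh Hs. apply (csum_push k).
  - intros x y E. rewrite <- (Hh x), <- (Hh y), E; auto.
  - intros i Hi. exfalso. apply (Hi (h i)); auto.
  - eapply csum_ext; [|exact Hs]. intros j; simpl. rewrite Hh; auto.
Qed.

Lemma csum_lsum {I J : Type} (f : I -> J -> C) (r : I -> C) L :
  (forall i, In i L -> csum (f i) (r i)) -> csum (fun j => lsum (fun i => f i j) L) (lsum r L).
Proof.
  induction L as [|a L IH]; intros H; simpl; [apply csum_zero|].
  apply csum_plus; auto with datatypes.
Qed.

Lemma NoDup_list_prod {I J : Type} (L : list I) (L' : list J) :
  NoDup L -> NoDup L' -> NoDup (list_prod L L').
Proof.
  intros HL HL'. induction HL as [|a L Ha HL IH]; simpl; [constructor|].
  apply NoDup_app; auto.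
  - apply NoDup_map_inj; auto. congruence.
  - intros [x y] Hx Hx'. apply in_map_iff in Hx. destruct Hx as [z [Hz _]].
    inversion Hz; subst. apply in_prod_iff in Hx'. tauto.
Qed.

Lemma lsum_list_prod {I J : Type} (f : I * J -> C) L L' :
  lsum f (list_prod L L') = lsum (fun i => lsum (fun j => f (i, j)) L') L.
Proof.
  induction L as [|a L IH]; simpl; auto.
  rewrite lsum_app, lsum_map, IH; auto.
Qed.

Lemma rsum_list_prod {I J : Type} (f : I * J -> R) L L' :
  rsum f (list_prod L L') = rsum (fun i => rsum (fun j => f (i, j)) L') L.
Proof.
  induction L as [|a L IH]; simpl; auto.
  rewrite rsum_app, rsum_map, IH; auto.
Qed.

Lemma lsum_swap {I J : Type} (f : I -> J -> C) L L' :
  lsum (fun i => lsum (fun j => f i j) L') L = lsum (fun j => lsum (fun i => f i j) L) L'.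
Proof.
  induction L as [|a L IH]; simpl.
  - symmetry. apply lsum_zero; auto.
  - rewrite IH, lsum_plus; auto.
Qed.

(** For a finite set of rows, the set of columns is taken so large that the rectangle sum is close
    to [s] and also to the total of the chosen row sums. *)
Lemma csum_rows {I J : Type} (f : I * J -> C) (r : I -> C) s :
  csum f s -> (forall i, csum (fun j => f (i, j)) (r i)) -> csum r s.
Proof.
  intros Hs Hr eps He.
  destruct (Hs (eps / 2)%R) as [L0 H0]; [lra|].
  exists (map fst L0). intros LI HLI Hi.
  destruct (csum_lsum (fun i j => f (i, j)) r LI (fun i _ => Hr i) (eps / 2)%R) as [L1 H1]; [lra|].
  destruct (NoDup_cover (map snd L0 ++ L1)) as [LJ [HLJ [HiJ _]]].
  specialize (H1 LJ HLJ (fun x Hx => HiJ x (in_or_app _ _ _ (or_intror Hx)))).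
  assert (Hin : incl L0 (list_prod LI LJ)).
  { intros [x y] Hx. apply in_prod_iff. split.
    - apply Hi. apply (in_map fst _ _ Hx).
    - apply HiJ. apply in_or_app; left. apply (in_map snd _ _ Hx). }
  specialize (H0 _ (NoDup_list_prod _ _ HLI HLJ) Hin).
  rewrite lsum_list_prod, lsum_swap in H0.
  match type of H1 with (Cmod (?a - _) < _)%R => set (A := a) in * end.
  replace (lsum r LI - s) with ((A - s) + - (A - lsum r LI)) by ring.
  eapply Rle_lt_trans; [apply Cmod_triangle|]. rewrite Cmod_opp. lra.
Qed.

Lemma csum_cols {I J : Type} (f : I * J -> C) (r : J -> C) s :
  csum f s -> (forall j, csum (fun i => f (i, j)) (r j)) -> csum r s.
Proof.
  intros Hs Hr. apply (csum_rows (fun p : J * I => f (snd p, fst p))); auto.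
  apply (csum_bij (fun p : J * I => (snd p, fst p)) (fun p : I * J => (snd p, fst p))); auto;
    intros [x y]; auto.
Qed.

(** Every finite list of pairs lies in the rectangle spanned by its two projections. *)
Lemma rbound_prod {I J : Type} (f : I -> R) (g : J -> R) M N :
  (forall i, (0 <= f i)%R) -> (forall j, (0 <= g j)%R) -> rbound f M -> rbound g N ->
  rbound (fun p : I * J => (f (fst p) * g (snd p))%R) (M * N).
Proof.
  intros Hf Hg HM HN L HL.
  destruct (NoDup_cover (map fst L)) as [L1 [HL1 [Hi1 _]]].
  destruct (NoDup_cover (map snd L)) as [L2 [HL2 [Hi2 _]]].
  eapply Rle_trans; [apply (rsum_incl _ L (list_prod L1 L2)); auto|].
  - intros [x y]; simpl. apply Rmult_le_pos; auto.
  - intros [x y] Hx. apply in_prod_iff. split.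
    + apply Hi1. apply (in_map fst _ _ Hx).
    + apply Hi2. apply (in_map snd _ _ Hx).
  - rewrite rsum_list_prod. simpl.
    apply Rle_trans with (rsum (fun i => (N * f i)%R) L1).
    + apply rsum_le. intros i _. rewrite rsum_scal. rewrite (Rmult_comm N).
      apply Rmult_le_compat_l; auto.
    + rewrite rsum_scal. rewrite (Rmult_comm M). apply Rmult_le_compat_l; auto.
      eapply rbound_ge0; eauto.
Qed.

Lemma summable_prod {I J : Type} (f : I -> C) (g : J -> C) : summable f -> summable g ->
  summable (fun p : I * J => f (fst p) * g (snd p)).
Proof.
  intros [M HM] [N HN]. exists (M * N)%R.
  eapply rbound_le; [|apply (rbound_prod _ _ _ _ (fun i => Cmod_ge_0 (f i)) (fun j => Cmod_ge_0 (g j)) HM HN)].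
  intros i; simpl. rewrite Cmod_mult. lra.
Qed.

Lemma csum_prod {I J : Type} (f : I -> C) (g : J -> C) : summable f -> summable g ->
  csum (fun p : I * J => f (fst p) * g (snd p)) (Sum f * Sum g).
Proof.
  intros Hf Hg.
  assert (H := summable_csum _ (summable_prod f g Hf Hg)).
  replace (Sum f * Sum g) with (Sum (fun p : I * J => f (fst p) * g (snd p))); auto.
  apply (csum_unique (fun i => Sum g * f i)).
  - apply (csum_rows _ _ _ H). intros i. simpl.
    rewrite (Cmult_comm (Sum g)). apply csum_scal. apply summable_csum; auto.
  - rewrite Cmult_comm. apply csum_scal. apply summable_csum; auto.
Qed.

(** * The complex exponential *)

Lemma C_eq (z w : C) : Re z = Re w -> Im z = Im w -> z = w.
Proof. destruct z, w; simpl; intros; subst; auto. Qed.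

Lemma Re_plus z w : (Re (z + w) = Re z + Re w)%R. Proof. reflexivity. Qed.
Lemma Im_plus z w : (Im (z + w) = Im z + Im w)%R. Proof. reflexivity. Qed.
Lemma Re_opp z : (Re (- z) = - Re z)%R. Proof. reflexivity. Qed.
Lemma Im_opp z : (Im (- z) = - Im z)%R. Proof. reflexivity. Qed.
Lemma Re_minus z w : (Re (z - w) = Re z - Re w)%R. Proof. reflexivity. Qed.
Lemma Im_minus z w : (Im (z - w) = Im z - Im w)%R. Proof. reflexivity. Qed.
Lemma Re_mult z w : (Re (z * w) = Re z * Re w - Im z * Im w)%R. Proof. reflexivity. Qed.
Lemma Im_mult z w : (Im (z * w) = Re z * Im w + Im z * Re w)%R. Proof. reflexivity. Qed.
Lemma Re_RtoC (x : R) : Re (RtoC x) = x. Proof. reflexivity. Qed.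
Lemma Im_RtoC (x : R) : Im (RtoC x) = 0%R. Proof. reflexivity. Qed.
Lemma Re_Ci : Re Ci = 0%R. Proof. reflexivity. Qed.
Lemma Im_Ci : Im Ci = 1%R. Proof. reflexivity. Qed.
Lemma Im_scal (x : R) w : (Im (RtoC x * w) = x * Im w)%R.
Proof. rewrite Im_mult, Re_RtoC, Im_RtoC. ring. Qed.
Lemma Re_scal (x : R) w : (Re (RtoC x * w) = x * Re w)%R.
Proof. rewrite Re_mult, Re_RtoC, Im_RtoC. ring. Qed.

Lemma C_div_R (z : C) (x : R) : x <> 0%R -> z / RtoC x = RtoC (/ x) * z.
Proof. intros H. rewrite RtoC_inv by auto. unfold Cdiv. ring. Qed.

Ltac C_simpl := repeat progress rewrite ?Re_plus, ?Im_plus, ?Re_minus, ?Im_minus, ?Re_opp, ?Im_opp,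
  ?Re_mult, ?Im_mult, ?Re_RtoC, ?Im_RtoC, ?Re_Ci, ?Im_Ci.

Lemma RtoC_neq0 (x : R) : x <> 0%R -> RtoC x <> 0.
Proof. intros H E. apply RtoC_inj in E. auto. Qed.

Lemma Im_div2 z : (Im (z / 2) = Im z / 2)%R.
Proof. rewrite C_div_R by lra. rewrite Im_scal. field. Qed.

Lemma Cmod_pos (z : C) : z <> 0 -> (0 < Cmod z)%R.
Proof. apply Cmod_gt_0. Qed.

Lemma Cmod_Ci : Cmod Ci = 1%R.
Proof.
  unfold Cmod, Ci; simpl. replace (0 * (0 * 1) + 1 * (1 * 1))%R with 1%R by ring. apply sqrt_1.
Qed.

Lemma Cmod_le_ReIm z : (Cmod z <= Rabs (Re z) + Rabs (Im z))%R.
Proof.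
  replace z with (RtoC (Re z) + Ci * RtoC (Im z)) at 1.
  - eapply Rle_trans; [apply Cmod_triangle|]. rewrite Cmod_mult, Cmod_Ci, !Cmod_R. lra.
  - apply C_eq; C_simpl; ring.
Qed.

Lemma im_le_Cmod z : (Rabs (Im z) <= Cmod z)%R.
Proof.
  eapply Rle_trans; [|apply Rmax_Cmod]. apply Rmax_r.
Qed.

Lemma Cmod_sub_ge a b : (Cmod a - Cmod b <= Cmod (a - b))%R.
Proof.
  assert (H := Cmod_triangle (a - b) b). replace (a - b + b) with a in H by ring. lra.
Qed.

Lemma Cexp_plus z w : Cexp (z + w) = Cexp z * Cexp w.
Proof.
  unfold Cexp. apply C_eq; C_simpl; simpl; rewrite ?exp_plus, ?cos_plus, ?sin_plus; ring.
Qed.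

Lemma Cexp_0 : Cexp 0 = 1.
Proof. unfold Cexp; simpl. rewrite exp_0, cos_0, sin_0. apply C_eq; simpl; ring. Qed.

Lemma Cmod_Cexp z : Cmod (Cexp z) = exp (Re z).
Proof.
  unfold Cmod, Cexp; simpl.
  set (c := cos (Im z)). set (s := sin (Im z)).
  assert (H : (c * c + s * s = 1)%R).
  { unfold c, s. assert (H := sin2_cos2 (Im z)). unfold Rsqr in H. lra. }
  replace (exp (Re z) * c * (exp (Re z) * c * 1) + exp (Re z) * s * (exp (Re z) * s * 1))%R
    with (exp (Re z) * exp (Re z) * (c * c + s * s))%R by ring.
  rewrite H, Rmult_1_r. apply sqrt_square. left; apply exp_pos.
Qed.

Lemma Cexp_neq0 z : Cexp z <> 0.
Proof.
  intros H. assert (E := Cmod_Cexp z). rewrite H, Cmod_0 in E.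
  assert (P := exp_pos (Re z)). lra.
Qed.

Lemma Cexp_opp z : Cexp (- z) = / Cexp z.
Proof.
  assert (H := Cexp_neq0 z).
  assert (E : Cexp z * Cexp (- z) = 1).
  { rewrite <- Cexp_plus. replace (z + - z) with (RtoC 0) by ring. apply Cexp_0. }
  replace (Cexp (- z)) with (/ Cexp z * (Cexp z * Cexp (- z))) by (field; auto).
  rewrite E. ring.
Qed.

Lemma abs_exp_m1 x : (Rabs (exp x - 1) <= Rabs x * exp (Rabs x))%R.
Proof.
  assert (H1 := exp_ineq1_le x). assert (H2 := exp_ineq1_le (- x)).
  assert (P := exp_pos x). assert (P' := exp_pos (- x)).
  assert (E : (exp x * exp (- x) = 1)%R) by (rewrite <- exp_plus, Rplus_opp_r; apply exp_0).
  unfold Rabs at 2 3. destruct (Rcase_abs x).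
  - apply Rabs_le. assert (exp x <= 1)%R by nra.
    assert (1 <= exp (-x))%R by nra. nra.
  - apply Rabs_le. nra.
Qed.

Lemma abs_exp_m1_x x : (Rabs (exp x - 1 - x) <= x * x * exp (Rabs x))%R.
Proof.
  assert (H1 := exp_ineq1_le x). assert (H2 := exp_ineq1_le (- x)).
  assert (P := exp_pos x). assert (P' := exp_pos (- x)).
  assert (E : (exp x * exp (- x) = 1)%R) by (rewrite <- exp_plus, Rplus_opp_r; apply exp_0).
  assert (H := abs_exp_m1 x).
  rewrite (Rabs_pos_eq (exp x - 1 - x)) by lra.
  assert (exp x - 1 - x <= x * (exp x - 1))%R by nra.
  assert (x * (exp x - 1) <= Rabs x * Rabs (exp x - 1))%R.
  { rewrite <- Rabs_mult. apply Rle_abs. }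
  assert (Rabs x * Rabs x = x * x)%R by (rewrite <- Rabs_mult; apply Rabs_pos_eq; nra).
  assert (Rabs x * Rabs (exp x - 1) <= Rabs x * (Rabs x * exp (Rabs x)))%R.
  { apply Rmult_le_compat_l; auto. apply Rabs_pos. }
  replace (x * x * exp (Rabs x))%R with (Rabs x * (Rabs x * exp (Rabs x)))%R; [lra|].
  rewrite <- Rmult_assoc. congruence.
Qed.

Lemma mvt_bound (f f' : R -> R) x K : (forall c, is_derive f c (f' c)) -> f 0%R = 0%R ->
  (forall c, (Rabs c <= Rabs x)%R -> (Rabs (f' c) <= K)%R) -> (Rabs (f x) <= K * Rabs x)%R.
Proof.
  intros Hd H0 HK.
  destruct (MVT_gen f 0 x f') as [c [Hc E]].
  - intros; apply Hd.
  - intros c _. apply continuity_pt_filterlim. apply (ex_derive_continuous f). exists (f' c). apply Hd.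
  - rewrite H0, !Rminus_0_r in E. rewrite E, Rabs_mult. apply Rmult_le_compat_r; [apply Rabs_pos|].
    apply HK. unfold Rmin, Rmax in Hc. destruct (Rle_dec 0 x).
    + rewrite !Rabs_pos_eq; lra.
    + rewrite !Rabs_left1; lra.
Qed.

Lemma abs_sin_le x : (Rabs (sin x) <= Rabs x)%R.
Proof.
  replace (Rabs x) with (1 * Rabs x)%R by ring.
  apply (mvt_bound sin cos).
  - intros c. apply is_derive_Reals. apply derivable_pt_lim_sin.
  - apply sin_0.
  - intros c _. apply Rabs_le. assert (H := COS_bound c). lra.
Qed.

Lemma abs_cos_m1_le x : (Rabs (cos x - 1) <= Rabs x)%R.
Proof.
  replace (Rabs x) with (1 * Rabs x)%R by ring.
  apply (mvt_bound (fun x => cos x - 1)%R (fun x => - sin x)%R).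
  - intros c. auto_derive; auto. ring.
  - rewrite cos_0; ring.
  - intros c _. apply Rabs_le. assert (H := SIN_bound c). lra.
Qed.

Lemma abs_cos_m1_sq x : (Rabs (cos x - 1) <= x * x)%R.
Proof.
  replace (x * x)%R with (Rabs x * Rabs x)%R.
  2:{ rewrite <- Rabs_mult. apply Rabs_pos_eq. nra. }
  apply (mvt_bound (fun x => cos x - 1)%R (fun x => - sin x)%R).
  - intros c. auto_derive; auto. ring.
  - rewrite cos_0; ring.
  - intros c Hc. rewrite Rabs_Ropp. assert (H := abs_sin_le c). lra.
Qed.

Lemma abs_sin_mx_sq x : (Rabs (sin x - x) <= x * x)%R.
Proof.
  replace (x * x)%R with (Rabs x * Rabs x)%R.
  2:{ rewrite <- Rabs_mult. apply Rabs_pos_eq. nra. }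
  apply (mvt_bound (fun x => sin x - x)%R (fun x => cos x - 1)%R).
  - intros c. auto_derive; auto. ring.
  - rewrite sin_0; ring.
  - intros c Hc. assert (H := abs_cos_m1_le c). lra.
Qed.

Lemma exp_le_le x y : (x <= y)%R -> (exp x <= exp y)%R.
Proof. intros [H| ->]; [left; apply exp_increasing; auto|lra]. Qed.

(** The real and imaginary parts are bounded separately and added, whence the crude constant; here
    and in [Cexp_bound2] only the order in [Cmod w] matters. *)
Lemma Cexp_bound1 w : (Cmod (Cexp w - 1) <= 3 * Cmod w * exp (Cmod w))%R.
Proof.
  eapply Rle_trans; [apply Cmod_le_ReIm|].
  assert (Hx := re_le_Cmod w). assert (Hy := im_le_Cmod w).
  unfold Cexp; C_simpl; simpl. set (x := Re w) in *. set (y := Im w) in *. set (r := Cmod w) in *.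
  assert (E1 : (exp (Rabs x) <= exp r)%R) by (apply exp_le_le; auto).
  assert (E2 : (exp x <= exp r)%R) by (apply exp_le_le; eapply Rle_trans; [apply Rle_abs|auto]).
  assert (P := exp_pos x). assert (P' := exp_pos (Rabs x)).
  assert (A := abs_exp_m1 x). assert (B := abs_cos_m1_le y). assert (D := abs_sin_le y).
  assert (Px := Rabs_pos x). assert (Py := Rabs_pos y).
  replace (exp x * cos y - 1)%R with ((exp x - 1) + exp x * (cos y - 1))%R by ring.
  assert (Rabs (exp x - 1 + exp x * (cos y - 1)) <= Rabs (exp x - 1) + exp x * Rabs (cos y - 1))%R.
  { eapply Rle_trans; [apply Rabs_triang|]. rewrite Rabs_mult, (Rabs_pos_eq (exp x)); lra. }
  rewrite Rminus_0_r, Rabs_mult, (Rabs_pos_eq (exp x)) by lra.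
  assert (exp x * Rabs (sin y) <= exp r * r)%R by (apply Rmult_le_compat; try lra; apply Rabs_pos).
  assert (exp x * Rabs (cos y - 1) <= exp r * r)%R by (apply Rmult_le_compat; try lra; apply Rabs_pos).
  assert (Rabs x * exp (Rabs x) <= r * exp r)%R by (apply Rmult_le_compat; lra).
  lra.
Qed.

Lemma Cexp_bound2 w : (Cmod (Cexp w - 1 - w) <= 4 * (Cmod w * Cmod w) * exp (Cmod w))%R.
Proof.
  eapply Rle_trans; [apply Cmod_le_ReIm|].
  assert (Hx := re_le_Cmod w). assert (Hy := im_le_Cmod w).
  unfold Cexp; C_simpl; simpl. set (x := Re w) in *. set (y := Im w) in *. set (r := Cmod w) in *.
  assert (E1 : (exp (Rabs x) <= exp r)%R) by (apply exp_le_le; auto).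
  assert (E2 : (exp x <= exp r)%R) by (apply exp_le_le; eapply Rle_trans; [apply Rle_abs|auto]).
  assert (P := exp_pos x). assert (P' := exp_pos (Rabs x)).
  assert (A := abs_exp_m1 x). assert (A' := abs_exp_m1_x x).
  assert (B := abs_cos_m1_sq y). assert (D := abs_sin_mx_sq y).
  assert (Px := Rabs_pos x). assert (Py := Rabs_pos y).
  assert (X2 : (x * x <= r * r)%R).
  { replace (x * x)%R with (Rabs x * Rabs x)%R by (rewrite <- Rabs_mult; apply Rabs_pos_eq; nra). nra. }
  assert (Y2 : (y * y <= r * r)%R).
  { replace (y * y)%R with (Rabs y * Rabs y)%R by (rewrite <- Rabs_mult; apply Rabs_pos_eq; nra). nra. }
  replace (exp x * cos y - 1 - x)%R with ((exp x - 1 - x) + exp x * (cos y - 1))%R by ring.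
  replace (exp x * sin y - 0 - y)%R with (exp x * (sin y - y) + y * (exp x - 1))%R by ring.
  assert (Rabs (exp x - 1 - x + exp x * (cos y - 1)) <= Rabs (exp x - 1 - x) + exp x * Rabs (cos y - 1))%R.
  { eapply Rle_trans; [apply Rabs_triang|]. rewrite Rabs_mult, (Rabs_pos_eq (exp x)); lra. }
  assert (Rabs (exp x * (sin y - y) + y * (exp x - 1)) <= exp x * Rabs (sin y - y) + Rabs y * Rabs (exp x - 1))%R.
  { eapply Rle_trans; [apply Rabs_triang|]. rewrite !Rabs_mult, (Rabs_pos_eq (exp x)); lra. }
  assert (exp x * Rabs (sin y - y) <= exp r * (r * r))%R by (apply Rmult_le_compat; try lra; apply Rabs_pos).
  assert (exp x * Rabs (cos y - 1) <= exp r * (r * r))%R by (apply Rmult_le_compat; try lra; apply Rabs_pos).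
  assert (Rabs x * exp (Rabs x) <= r * exp r)%R by (apply Rmult_le_compat; lra).
  assert (x * x * exp (Rabs x) <= r * r * exp r)%R by (apply Rmult_le_compat; nra).
  assert (Rabs y * Rabs (exp x - 1) <= r * (r * exp r))%R by (apply Rmult_le_compat; try lra; apply Rabs_pos).
  lra.
Qed.

(** * The character exp(2 pi i z) *)

Definition ex (z : C) : C := Cexp (2 * PI * Ci * z).

Lemma ex_plus z w : ex (z + w) = ex z * ex w.
Proof. unfold ex. rewrite <- Cexp_plus. f_equal. ring. Qed.

Lemma ex_0 : ex 0 = 1.
Proof. unfold ex. rewrite Cmult_0_r. apply Cexp_0. Qed.

Lemma ex_opp z : ex (- z) = / ex z.
Proof. unfold ex. rewrite <- Cexp_opp. f_equal. ring. Qed.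

Lemma ex_minus z w : ex (z - w) = ex z / ex w.
Proof. unfold Cminus, Cdiv. rewrite ex_plus, ex_opp. auto. Qed.

Lemma ex_neq0 z : ex z <> 0.
Proof. apply Cexp_neq0. Qed.

Lemma Cmod_ex z : Cmod (ex z) = exp (- 2 * PI * Im z).
Proof. unfold ex. rewrite Cmod_Cexp. f_equal. C_simpl. ring. Qed.

Lemma ex_real (x : R) : ex x = (cos (2 * PI * x), sin (2 * PI * x))%R.
Proof.
  unfold ex, Cexp. C_simpl.
  match goal with |- (exp ?a * cos ?b, _)%R = _ =>
    replace a with 0%R by ring; replace b with (2 * PI * x)%R by ring end.
  rewrite exp_0, !Rmult_1_l; auto.
Qed.

Lemma ex_nat (n : nat) : ex (RtoC (INR n)) = 1.
Proof.
  rewrite ex_real. replace (2 * PI * INR n)%R with (0 + 2 * INR n * PI)%R by ring.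
  rewrite cos_period, sin_period, cos_0, sin_0; auto.
Qed.

Lemma ex_int (n : Z) : ex (RtoC (IZR n)) = 1.
Proof.
  destruct (Z_le_gt_dec 0 n).
  - rewrite <- (Z2Nat.id n), <- INR_IZR_INZ by auto. apply ex_nat.
  - replace (IZR n) with (- IZR (- n))%R by (rewrite opp_IZR; lra).
    rewrite RtoC_opp, ex_opp. rewrite <- (Z2Nat.id (- n)), <- INR_IZR_INZ by lia.
    rewrite ex_nat. field.
Qed.

Lemma ex_half : ex (1 / 2) = -1.
Proof.
  replace (1 / 2) with (RtoC (1 / 2)) by (rewrite RtoC_div; auto; lra).
  rewrite ex_real. replace (2 * PI * (1 / 2))%R with PI by field.
  rewrite cos_PI, sin_PI; auto.
Qed.

Lemma ex_shift_int z (n : Z) : ex (z + RtoC (IZR n)) = ex z.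
Proof. rewrite ex_plus, ex_int. ring. Qed.

Lemma ex_eq z w (n : Z) : z = w + RtoC (IZR n) -> ex z = ex w.
Proof. intros ->. apply ex_shift_int. Qed.

Lemma sin_eq_0_Z x : sin x = 0%R -> exists k : Z, (x = IZR k * PI)%R.
Proof. apply sin_eq_0_0. Qed.

(** Modulus 1 forces a real argument x, and cos(2 pi x) = 1 forces sin(pi x) = 0. *)
Lemma ex_eq_1 z : ex z = 1 -> exists n : Z, z = RtoC (IZR n).
Proof.
  intros H.
  assert (Hm := Cmod_ex z). rewrite H, Cmod_1 in Hm.
  assert (PIpos := PI_RGT_0).
  assert (HI : Im z = 0%R).
  { rewrite <- exp_0 in Hm. apply exp_inv in Hm. nra. }
  assert (Ez : z = RtoC (Re z)) by (apply C_eq; simpl; auto).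
  rewrite Ez, ex_real in H. injection H as Hc Hs.
  set (x := Re z) in *.
  assert (Hh : sin (PI * x) = 0%R).
  { assert (D := cos_2a_sin (PI * x)). replace (2 * (PI * x))%R with (2 * PI * x)%R in D by ring. nra. }
  apply sin_eq_0_Z in Hh. destruct Hh as [k Hk]. exists k. rewrite Ez. f_equal.
  apply (Rmult_eq_reg_l PI); lra.
Qed.

Lemma Cmod_ex_real (x : R) : Cmod (ex x) = 1%R.
Proof. rewrite Cmod_ex. simpl. rewrite Rmult_0_r. apply exp_0. Qed.

Lemma ex_pow z (n : nat) : ex z ^ n = ex (RtoC (INR n) * z).
Proof.
  induction n as [|n IH]; simpl Cpow.
  - simpl. rewrite Cmult_0_l, ex_0; auto.
  - rewrite IH, <- ex_plus, S_INR, RtoC_plus. f_equal. ring.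
Qed.

Lemma m1_pow (n : nat) : (- (1)) ^ n = ex (RtoC (INR n) / 2).
Proof.
  replace (- (1)) with (ex (1 / 2)) by (rewrite ex_half; apply C_eq; simpl; ring).
  rewrite ex_pow. f_equal. field.
Qed.

Lemma qpow_ex s tau : qpow s tau = ex (RtoC s * tau).
Proof. unfold qpow, ex. f_equal. ring. Qed.

Lemma zeta_ex c a : zeta c a = ex (RtoC (IZR a / INR c)).
Proof. reflexivity. Qed.

(** * Geometric and Gaussian majorants *)

Lemma exp_pow x n : (exp x ^ n = exp (INR n * x))%R.
Proof.
  induction n as [|n IH]; simpl pow.
  - simpl; rewrite Rmult_0_l, exp_0; auto.
  - rewrite IH, <- exp_plus, S_INR. f_equal; ring.
Qed.

Lemma rsum_geom r n : (0 <= r < 1)%R -> (rsum (fun k => r ^ k) (seq 0 n) = (1 - r ^ n) / (1 - r))%R.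
Proof.
  intros Hr. induction n as [|n IH].
  - simpl. field. lra.
  - rewrite seq_S, rsum_app, IH. simpl. field. lra.
Qed.

Lemma list_max_nat (L : list nat) : exists N, incl L (seq 0 N).
Proof.
  induction L as [|a L [N HN]].
  - exists 0%nat. intros x [].
  - exists (max (S a) N). intros x [<-|Hx].
    + apply in_seq; lia.
    + apply HN in Hx. apply in_seq in Hx. apply in_seq. lia.
Qed.

Lemma rbound_geom r : (0 <= r < 1)%R -> rbound (fun k : nat => (r ^ k)%R) (1 / (1 - r)).
Proof.
  intros Hr L HL. destruct (list_max_nat L) as [N HN].
  eapply Rle_trans; [apply (rsum_incl _ L (seq 0 N)); auto|].
  - intros; apply pow_le; lra.
  - rewrite rsum_geom by auto. apply Rmult_le_compat_r.
    + left. apply Rinv_0_lt_compat. lra.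
    + assert (0 <= r ^ N)%R by (apply pow_le; lra). lra.
Qed.

Lemma rbound_geom_Z r : (0 <= r < 1)%R ->
  rbound (fun k : Z => (r ^ Z.abs_nat k)%R) (2 / (1 - r)).
Proof.
  intros Hr L HL. destruct (list_max_nat (map Z.abs_nat L)) as [N HN].
  eapply Rle_trans; [apply (rsum_incl _ L (map Z.of_nat (seq 0 N) ++ map (fun n => (- Z.of_nat n)%Z) (seq 0 N))); auto|].
  - intros; apply pow_le; lra.
  - intros x Hx. assert (Hi := HN _ (in_map Z.abs_nat _ _ Hx)).
    apply in_or_app. destruct (Z_le_gt_dec 0 x); [left|right]; apply in_map_iff;
      exists (Z.abs_nat x); split; auto; lia.
  - rewrite rsum_app, !rsum_map.
    assert (E : forall h : nat -> Z, (forall n, Z.abs_nat (h n) = n) ->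
      (rsum (fun i => r ^ Z.abs_nat (h i)) (seq 0 N) <= 1 / (1 - r))%R).
    { intros h Hh. eapply Rle_trans; [|apply (rbound_geom r Hr (seq 0 N)); apply seq_NoDup].
      apply rsum_le. intros i _. rewrite Hh. lra. }
    assert (E1 := E Z.of_nat ltac:(intros; lia)).
    assert (E2 := E (fun n => (- Z.of_nat n)%Z) ltac:(intros; lia)).
    replace (2 / (1 - r))%R with (1 / (1 - r) + 1 / (1 - r))%R by (field; lra). lra.
Qed.

Lemma exp_abs_Z (n : Z) : exp (- Rabs (IZR n)) = (exp (-1) ^ Z.abs_nat n)%R.
Proof.
  rewrite exp_pow. f_equal. rewrite INR_IZR_INZ, Zabs2Nat.id_abs, abs_IZR. ring.
Qed.

Lemma exp_m1_lt1 : (0 <= exp (-1) < 1)%R.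
Proof. split; [left; apply exp_pos|]. rewrite <- exp_0. apply exp_increasing. lra. Qed.

Lemma rbound_exp_Z : exists M, rbound (fun n : Z => exp (- Rabs (IZR n))) M.
Proof.
  exists (2 / (1 - exp (-1)))%R.
  eapply rbound_le; [|apply (rbound_geom_Z _ exp_m1_lt1)].
  intros n. simpl. rewrite exp_abs_Z. lra.
Qed.

(** Completing the square in [Rabs y]: a Gaussian with a linear perturbation is at most a constant
    times exp(-|y|), which is geometric along the integers. *)
Lemma gauss_le c b y : (0 < c)%R ->
  (exp (- c * (y * y) + b * Rabs y) <= exp ((b + 1) * (b + 1) / (4 * c)) * exp (- Rabs y))%R.
Proof.
  intros Hc. rewrite <- exp_plus. apply exp_le_le.
  assert (E : (Rabs y * Rabs y = y * y)%R) by (rewrite <- Rabs_mult; apply Rabs_pos_eq; nra).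
  rewrite <- E. set (a := Rabs y).
  assert (H : (0 <= c * ((a - (b + 1) / (2 * c)) * (a - (b + 1) / (2 * c))))%R).
  { apply Rmult_le_pos; [lra|]. apply Rle_0_sqr. }
  replace (c * ((a - (b + 1) / (2 * c)) * (a - (b + 1) / (2 * c))))%R
    with (c * (a * a) - (b + 1) * a + (b + 1) * (b + 1) / (4 * c))%R in H by (field; lra).
  lra.
Qed.

Lemma gauss_summable (f : Z -> C) c b K : (0 < c)%R ->
  (forall n, (Cmod (f n) <= K * exp (- c * (IZR n * IZR n) + b * Rabs (IZR n)))%R) -> summable f.
Proof.
  intros Hc H. destruct rbound_exp_Z as [M HM].
  assert (HK : (0 <= K)%R).
  { specialize (H 0%Z). assert (P := exp_pos (- c * (IZR 0 * IZR 0) + b * Rabs (IZR 0))).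
    assert (P' := Cmod_ge_0 (f 0%Z)). nra. }
  exists (K * exp ((b + 1) * (b + 1) / (4 * c)) * M)%R.
  eapply rbound_le; [|apply rbound_scal; [|exact HM]].
  - intros n. simpl. eapply Rle_trans; [apply H|]. rewrite Rmult_assoc.
    apply Rmult_le_compat_l; auto. apply gauss_le; auto.
  - apply Rmult_le_pos; auto. left; apply exp_pos.
Qed.

(** * Unordered sums and series *)

Lemma sum_n_lsum (u : nat -> C) n : sum_n (G := C_NormedModule) u n = lsum u (seq 0 (S n)).
Proof.
  induction n as [|n IH].
  - rewrite sum_O. simpl. ring.
  - rewrite sum_Sn, IH, (seq_S (S n)), lsum_app. unfold plus; simpl. ring.
Qed.

Lemma csum_is_series (u : nat -> C) s : csum u s -> is_series (V := C_NormedModule) u s.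
Proof.
  intros H. unfold is_series. apply filterlim_Clim. intros eps He.
  destruct (H eps He) as [L0 H0]. destruct (list_max_nat L0) as [N HN].
  exists N. intros n Hn. rewrite sum_n_lsum. apply H0; [apply seq_NoDup|].
  intros x Hx. apply HN in Hx. apply in_seq in Hx. apply in_seq. lia.
Qed.

(** Pairs n with -n, because the series in [overrank] over n >= 1 is a bilateral sum folded at 0. *)
Lemma csum_Z_series (f : Z -> C) s : csum f s ->
  is_series (V := C_NormedModule)
    (fun n => f (Z.of_nat (S n)) + f (- Z.of_nat (S n))%Z) (s - f 0%Z).
Proof.
  intros H. unfold is_series. apply filterlim_Clim. intros eps He.
  destruct (H eps He) as [L0 H0]. destruct (list_max_nat (map Z.abs_nat L0)) as [N HN].
  exists N. intros n Hn. rewrite sum_n_lsum, lsum_plus.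
  set (L := (0%Z :: map (fun k => Z.of_nat (S k)) (seq 0 (S n)) ++ map (fun k => (- Z.of_nat (S k))%Z) (seq 0 (S n)))).
  assert (HL : NoDup L).
  { constructor.
    - intros Hi. apply in_app_or in Hi. rewrite !in_map_iff in Hi.
      destruct Hi as [[x [Hx _]]|[x [Hx _]]]; lia.
    - apply NoDup_app.
      + apply NoDup_map_inj; [intros; lia|apply seq_NoDup].
      + apply NoDup_map_inj; [intros; lia|apply seq_NoDup].
      + intros x Hx Hy. rewrite in_map_iff in Hx, Hy.
        destruct Hx as [y [Hy1 _]], Hy as [z [Hz1 _]]. lia. }
  assert (HI : incl L0 L).
  { intros x Hx. assert (Hi := HN _ (in_map Z.abs_nat _ _ Hx)). apply in_seq in Hi.
    destruct (Z.eq_dec x 0) as [->|Hx0]; [left; auto|right].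
    apply in_or_app. destruct (Z_le_gt_dec 0 x); [left|right]; apply in_map_iff;
      exists (Z.abs_nat x - 1)%nat; (split; [lia|apply in_seq; lia]). }
  specialize (H0 L HL HI).
  assert (E : lsum f L = f 0%Z + (lsum (fun k => f (Z.of_nat (S k))) (seq 0 (S n)) +
     lsum (fun k => f (- Z.of_nat (S k))%Z) (seq 0 (S n)))).
  { rewrite <- (lsum_map (fun k => Z.of_nat (S k)) f), <- (lsum_map (fun k => (- Z.of_nat (S k))%Z) f), <- lsum_app.
    reflexivity. }
  rewrite E in H0.
  match goal with |- (Cmod ?a < _)%R => match type of H0 with (Cmod ?b < _)%R => replace a with b by ring end end; auto.
Qed.

(** Multiplication by [x] shifts the family and loses the term at 0, so the sum S satisfies x S = S
    - 1. *)
Lemma csum_geom (x : C) : (Cmod x < 1)%R -> csum (fun n : nat => x ^ n) (1 / (1 - x)).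
Proof.
  intros Hx.
  assert (Hs : summable (fun n : nat => x ^ n)).
  { exists (1 / (1 - Cmod x))%R. eapply rbound_le; [|apply rbound_geom].
    - intros n. simpl. rewrite <- Cmod_pow. lra.
    - split; [apply Cmod_ge_0|auto]. }
  assert (H := summable_csum _ Hs).
  assert (E : x * Sum (fun n : nat => x ^ n) = Sum (fun n : nat => x ^ n) - 1).
  { apply (csum_unique (fun n => x * x ^ n)); [apply csum_scal; auto|].
    set (g := fun n : nat => match n with O => RtoC 0 | S _ => x ^ n end).
    assert (Hg : csum g (Sum (fun n : nat => x ^ n) - 1)).
    { assert (H1 : csum (fun n : nat => match n with O => RtoC 1 | _ => 0 end) 1).
      { apply (csum_at (fun n : nat => match n with O => RtoC 1 | _ => 0 end) 0%nat).
        intros [|n] Hn; congruence. }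
      eapply csum_ext; [|apply csum_minus; [exact H|exact H1]].
      intros [|n]; simpl; ring. }
    assert (Hsm : summable (fun n : nat => g (S n))).
    { apply (summable_inj S g); [intros; lia|]. destruct Hs as [M HM].
      exists M. eapply rbound_le; [|exact HM]. intros [|n]; simpl; [rewrite Cmod_0, Cmod_1; lra|lra]. }
    assert (Hp := csum_push S g _ ltac:(intros; lia)
       ltac:(intros [|n] Hn; [reflexivity|exfalso; apply (Hn n); auto]) (summable_csum _ Hsm)).
    rewrite (csum_unique _ _ _ Hg Hp). exact (summable_csum _ Hsm). }
  assert (Hne : 1 - x <> 0).
  { intros E0. assert (E1 : x = 1) by (replace x with (1 - (1 - x)) by ring; rewrite E0; ring).
    rewrite E1, Cmod_1 in Hx. lra. }
  replace (1 / (1 - x)) with (Sum (fun n : nat => x ^ n)); auto.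
  replace (Sum (fun n : nat => x ^ n)) with ((Sum (fun n : nat => x ^ n) - x * Sum (fun n : nat => x ^ n)) / (1 - x)) by (field; auto).
  rewrite E. field. auto.
Qed.

(** * Differential calculus along the real line *)

(** A quadratic error term instead of a limit: stronger than differentiability, yet stable under
    products and exponentials, and easily made uniform in a parameter, which suits differentiation
    under sums and integrals. *)
Definition Der (f : R -> C) (x : R) (l : C) : Prop :=
  exists delta K : R, (0 < delta)%R /\
    forall h : R, (Rabs h <= delta)%R -> (Cmod (f (x + h)%R - f x - h * l) <= K * (h * h))%R.

Lemma Der_real f x l (g : R -> R) m : Der f x l ->
  (forall y, (Rabs (g y - g x - (y - x) * m) <= Cmod (f y - f x - RtoC (y - x) * l))%R) ->
  is_derive g x m.
Proof.
  intros [d [K [Hd H]]] Hg. apply is_derive_Reals. intros eps He.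
  set (K' := (Rabs K + 1)%R). assert (HK : (0 < K')%R) by (unfold K'; assert (H0 := Rabs_pos K); lra).
  assert (Hd' : (0 < Rmin d (eps / K'))%R).
  { apply Rmin_glb_lt; auto. apply Rdiv_lt_0_compat; auto. }
  exists (mkposreal _ Hd'). simpl. intros h Hh0 Hh.
  assert (H1 : (Rabs h <= d)%R) by (left; eapply Rlt_le_trans; [exact Hh|apply Rmin_l]).
  assert (H2 : (Rabs h < eps / K')%R) by (eapply Rlt_le_trans; [exact Hh|apply Rmin_r]).
  specialize (Hg (x + h)%R). replace (x + h - x)%R with h in Hg by ring.
  specialize (H h H1).
  assert (Hp : (0 < Rabs h)%R) by (apply Rabs_pos_lt; auto).
  replace ((g (x + h)%R - g x) / h - m)%R with ((g (x + h)%R - g x - h * m) / h)%R by (field; auto).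
  unfold Rdiv. rewrite Rabs_mult, Rabs_inv.
  apply Rle_lt_trans with (K' * (h * h) * / Rabs h)%R.
  - apply Rmult_le_compat_r; [left; apply Rinv_0_lt_compat; auto|].
    eapply Rle_trans; [exact Hg|]. eapply Rle_trans; [exact H|].
    apply Rmult_le_compat_r; [nra|]. unfold K'. assert (H0 := Rle_abs K). lra.
  - replace (h * h)%R with (Rabs h * Rabs h)%R.
    2:{ rewrite <- Rabs_mult. apply Rabs_pos_eq. nra. }
    replace (K' * (Rabs h * Rabs h) * / Rabs h)%R with (K' * Rabs h)%R by (field; lra).
    apply Rlt_le_trans with (K' * (eps / K'))%R; [apply Rmult_lt_compat_l; auto|].
    apply Req_le; field; lra.
Qed.

Lemma Der_Re f x l : Der f x l -> is_derive (fun y => Re (f y)) x (Re l).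
Proof.
  intros H. apply (Der_real f x l _ _ H). intros y.
  eapply Rle_trans; [|apply re_le_Cmod]. apply Req_le. f_equal. C_simpl. ring.
Qed.

Lemma Der_Im f x l : Der f x l -> is_derive (fun y => Im (f y)) x (Im l).
Proof.
  intros H. apply (Der_real f x l _ _ H). intros y.
  eapply Rle_trans; [|apply im_le_Cmod]. apply Req_le. f_equal. C_simpl. ring.
Qed.

Lemma Der_const c x : Der (fun _ => c) x 0.
Proof.
  exists 1%R, 0%R. split; [lra|]. intros h _.
  replace (c - c - h * 0) with (RtoC 0) by ring. rewrite Cmod_0; lra.
Qed.

Lemma Der_id x : Der RtoC x 1.
Proof.
  exists 1%R, 0%R. split; [lra|]. intros h _. rewrite RtoC_plus.
  replace (x + h - x - h * 1) with (RtoC 0) by ring. rewrite Cmod_0; lra.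
Qed.

Lemma Der_eq f x l m : l = m -> Der f x l -> Der f x m.
Proof. intros ->; auto. Qed.

Lemma Der_ext f g x l : (forall y, f y = g y) -> Der f x l -> Der g x l.
Proof. intros H. replace g with f; auto. apply functional_extensionality; auto. Qed.

Lemma Der_plus f g x l m : Der f x l -> Der g x m -> Der (fun y => f y + g y) x (l + m).
Proof.
  intros [d1 [K1 [H1 A1]]] [d2 [K2 [H2 A2]]].
  exists (Rmin d1 d2), (K1 + K2)%R. split; [apply Rmin_glb_lt; auto|]. intros h Hh.
  specialize (A1 h (Rle_trans _ _ _ Hh (Rmin_l _ _))). specialize (A2 h (Rle_trans _ _ _ Hh (Rmin_r _ _))).
  replace (f (x + h)%R + g (x + h)%R - (f x + g x) - h * (l + m))
    with ((f (x + h)%R - f x - h * l) + (g (x + h)%R - g x - h * m)) by ring.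
  eapply Rle_trans; [apply Cmod_triangle|]. lra.
Qed.

Lemma Der_mult f g x l m : Der f x l -> Der g x m ->
  Der (fun y => f y * g y) x (l * g x + f x * m).
Proof.
  intros [d1 [K1 [H1 A1]]] [d2 [K2 [H2 A2]]].
  set (d := Rmin 1 (Rmin d1 d2)).
  assert (Hd1 : (d <= 1)%R) by apply Rmin_l.
  assert (Hd2 : (d <= d1)%R) by (eapply Rle_trans; [apply Rmin_r|apply Rmin_l]).
  assert (Hd3 : (d <= d2)%R) by (eapply Rle_trans; [apply Rmin_r|apply Rmin_r]).
  exists d, ((Rabs K1) * (Cmod (g x) + Cmod m + Rabs K2) + Cmod l * (Cmod m + Rabs K2) + Cmod (f x) * Rabs K2)%R.
  split; [unfold d; repeat apply Rmin_glb_lt; auto; lra|]. intros h Hh.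
  specialize (A1 h ltac:(lra)). specialize (A2 h ltac:(lra)).
  set (r1 := f (x + h)%R - f x - h * l) in *. set (r2 := g (x + h)%R - g x - h * m) in *.
  replace (f (x + h)%R * g (x + h)%R - f x * g x - h * (l * g x + f x * m))
    with (r1 * (g x + h * m + r2) + h * l * (h * m + r2) + f x * r2) by (unfold r1, r2; ring).
  assert (P1 := Cmod_ge_0 (g x)). assert (P2 := Cmod_ge_0 m). assert (P3 := Cmod_ge_0 l).
  assert (P4 := Cmod_ge_0 (f x)). assert (P5 := Rabs_pos K2). assert (P6 := Rabs_pos K1).
  assert (P7 := Rabs_pos h). assert (P8 := Rle_abs K1). assert (P9 := Rle_abs K2).
  assert (E : (h * h = Rabs h * Rabs h)%R) by (rewrite <- Rabs_mult; symmetry; apply Rabs_pos_eq; nra).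
  assert (h2 : (h * h <= Rabs h)%R) by (rewrite E; nra).
  assert (h2' : (0 <= h * h)%R) by nra.
  assert (B1 : (Cmod r1 <= Rabs K1 * (h * h))%R) by nra.
  assert (B2 : (Cmod r2 <= Rabs K2 * (h * h))%R) by nra.
  assert (B2' : (Cmod r2 <= Rabs K2 * Rabs h)%R) by nra.
  assert (Q1 := Cmod_ge_0 r1). assert (Q2 := Cmod_ge_0 r2).
  assert (C1 : (Cmod (g x + h * m + r2) <= Cmod (g x) + Cmod m + Rabs K2)%R).
  { eapply Rle_trans; [apply Cmod_triangle|]. eapply Rle_trans; [apply Rplus_le_compat_r, Cmod_triangle|].
    rewrite Cmod_mult, Cmod_R. nra. }
  assert (C2 : (Cmod (h * m + r2) <= Rabs h * (Cmod m + Rabs K2))%R).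
  { eapply Rle_trans; [apply Cmod_triangle|]. rewrite Cmod_mult, Cmod_R. nra. }
  eapply Rle_trans; [apply Cmod_triangle|].
  eapply Rle_trans; [apply Rplus_le_compat_r, Cmod_triangle|].
  rewrite !Cmod_mult, Cmod_R.
  assert (D1 : (Cmod r1 * Cmod (g x + h * m + r2) <= Rabs K1 * (h * h) * (Cmod (g x) + Cmod m + Rabs K2))%R).
  { apply Rmult_le_compat; auto. apply Cmod_ge_0. }
  assert (D2 : (Rabs h * Cmod l * Cmod (h * m + r2) <= Rabs h * Cmod l * (Rabs h * (Cmod m + Rabs K2)))%R).
  { apply Rmult_le_compat_l; auto. nra. }
  assert (D3 : (Cmod (f x) * Cmod r2 <= Cmod (f x) * (Rabs K2 * (h * h)))%R).
  { apply Rmult_le_compat_l; auto. }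
  replace (Rabs h * Cmod l * (Rabs h * (Cmod m + Rabs K2)))%R with (Cmod l * (Cmod m + Rabs K2) * (h * h))%R in D2 by (rewrite E; ring).
  nra.
Qed.

Lemma Der_scal c f x l : Der f x l -> Der (fun y => c * f y) x (c * l).
Proof.
  intros H. eapply Der_eq; [|apply Der_mult; [apply Der_const|exact H]]. cbv beta. ring.
Qed.

Lemma Der_at f x l : Der (fun h => f (x + h)%R) 0 l -> Der f x l.
Proof.
  intros [d [K [Hd H]]]. exists d, K. split; auto. intros h Hh. specialize (H h Hh).
  rewrite Rplus_0_l, Rplus_0_r in H. auto.
Qed.

Lemma Der_Cexp (w : R -> C) x l : Der w x l -> Der (fun y => Cexp (w y)) x (l * Cexp (w x)).
Proof.
  intros [d [K [Hd H]]].
  set (d' := Rmin 1 d).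
  assert (Hd1 : (d' <= 1)%R) by apply Rmin_l.
  assert (Hd2 : (d' <= d)%R) by apply Rmin_r.
  set (B := (Cmod l + Rabs K)%R).
  exists d', (Cmod (Cexp (w x)) * (Rabs K + 4 * (B * B) * exp B))%R.
  split; [unfold d'; apply Rmin_glb_lt; auto; lra|]. intros h Hh.
  specialize (H h ltac:(lra)).
  set (u := w (x + h)%R - w x).
  replace (w (x + h)%R) with (w x + u) by (unfold u; ring). rewrite Cexp_plus.
  replace (Cexp (w x) * Cexp u - Cexp (w x) - h * (l * Cexp (w x)))
    with (Cexp (w x) * ((Cexp u - 1 - u) + (u - h * l))) by ring.
  rewrite Cmod_mult, Rmult_assoc. apply Rmult_le_compat_l; [apply Cmod_ge_0|].
  eapply Rle_trans; [apply Cmod_triangle|].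
  assert (P2 := Rabs_pos K). assert (P3 := Cmod_ge_0 l). assert (P7 := Rabs_pos h). assert (P8 := Rle_abs K).
  assert (E : (h * h = Rabs h * Rabs h)%R) by (rewrite <- Rabs_mult; symmetry; apply Rabs_pos_eq; nra).
  assert (h2 : (h * h <= Rabs h)%R) by (rewrite E; nra).
  assert (h2' : (0 <= h * h)%R) by nra.
  assert (A : (Cmod (u - h * l) <= Rabs K * (h * h))%R) by (unfold u; nra).
  assert (U : (Cmod u <= B * Rabs h)%R).
  { replace u with (h * l + (u - h * l)) by ring. eapply Rle_trans; [apply Cmod_triangle|].
    rewrite Cmod_mult, Cmod_R. unfold B. nra. }
  assert (U1 : (Cmod u <= B)%R) by (unfold B in *; nra).
  assert (U0 := Cmod_ge_0 u).
  assert (E1 := Cexp_bound2 u).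
  assert (E2 : (exp (Cmod u) <= exp B)%R) by (apply exp_le_le; auto).
  assert (PE := exp_pos (Cmod u)).
  assert (E3 : (Cmod u * Cmod u <= B * B * (h * h))%R).
  { rewrite E. replace (B * B * (Rabs h * Rabs h))%R with ((B * Rabs h) * (B * Rabs h))%R by ring.
    apply Rmult_le_compat; auto. }
  assert (E4 : (Cmod u * Cmod u * exp (Cmod u) <= B * B * (h * h) * exp B)%R).
  { apply Rmult_le_compat; auto; nra. }
  nra.
Qed.

Lemma Der_ex (w : R -> C) x l : Der w x l -> Der (fun y => ex (w y)) x (2 * PI * Ci * l * ex (w x)).
Proof.
  intros H. unfold ex. apply Der_Cexp. apply Der_scal. auto.
Qed.

Lemma Der_zero_const f x y : (forall z, (Rmin y x <= z <= Rmax y x)%R -> Der f z 0) -> f x = f y.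
Proof.
  intros H.
  assert (A : forall g : R -> R, (forall z, (Rmin y x <= z <= Rmax y x)%R -> is_derive g z 0%R) -> g x = g y).
  { intros g Hg.
    destruct (MVT_gen g y x (fun _ => 0%R)) as [c [_ E]]; [intros; apply Hg; lra| |lra].
    intros z Hz. apply continuity_pt_filterlim. apply (ex_derive_continuous g). exists 0%R. apply Hg; auto. }
  apply C_eq.
  - apply (A (fun x => Re (f x))). intros z Hz. exact (Der_Re f z 0 (H z Hz)).
  - apply (A (fun x => Im (f x))). intros z Hz. exact (Der_Im f z 0 (H z Hz)).
Qed.

(** * Complex integrals over a period *)

Definition Cont (f : R -> C) : Prop :=
  forall x, continuous (fun y => Re (f y)) x /\ continuous (fun y => Im (f y)) x.

Lemma Der_Cont f f' : (forall x, Der f x (f' x)) -> Cont f.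
Proof.
  intros H x; split.
  - apply (ex_derive_continuous (fun y => Re (f y))). exists (Re (f' x)). apply Der_Re; auto.
  - apply (ex_derive_continuous (fun y => Im (f y))). exists (Im (f' x)). apply Der_Im; auto.
Qed.

Lemma Cont_const c : Cont (fun _ => c).
Proof. apply (Der_Cont _ (fun _ => 0)). intros; apply Der_const. Qed.

Lemma Cont_plus f g : Cont f -> Cont g -> Cont (fun x => f x + g x).
Proof.
  intros Hf Hg x; split; simpl.
  - apply (continuous_plus (V := R_NormedModule) (fun y => Re (f y)) (fun y => Re (g y))); [apply Hf|apply Hg].
  - apply (continuous_plus (V := R_NormedModule) (fun y => Im (f y)) (fun y => Im (g y))); [apply Hf|apply Hg].
Qed.

Lemma Cont_mult f g : Cont f -> Cont g -> Cont (fun x => f x * g x).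
Proof.
  intros Hf Hg x; split; simpl.
  - apply (continuous_minus (V := R_NormedModule) (fun y => (Re (f y) * Re (g y))%R) (fun y => (Im (f y) * Im (g y))%R));
      apply (continuous_mult (K := R_AbsRing)); [apply Hf|apply Hg|apply Hf|apply Hg].
  - apply (continuous_plus (V := R_NormedModule) (fun y => (Re (f y) * Im (g y))%R) (fun y => (Im (f y) * Re (g y))%R));
      apply (continuous_mult (K := R_AbsRing)); [apply Hf|apply Hg|apply Hf|apply Hg].
Qed.

Lemma Cont_ext f g : (forall x, f x = g x) -> Cont f -> Cont g.
Proof. intros H. replace g with f; auto. apply functional_extensionality; auto. Qed.

Lemma Cont_scal c f : Cont f -> Cont (fun x => c * f x).
Proof. intros H. apply (Cont_mult (fun _ => c)); auto. apply Cont_const. Qed.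

Lemma Cont_minus f g : Cont f -> Cont g -> Cont (fun x => f x - g x).
Proof.
  intros Hf Hg. apply (Cont_ext (fun x => f x + (-(1)) * g x)); [intros; ring|].
  apply Cont_plus; auto. apply Cont_scal; auto.
Qed.

Lemma Cont_lsum {I} (f : I -> R -> C) L : (forall i, Cont (f i)) -> Cont (fun x => lsum (fun i => f i x) L).
Proof.
  intros H. induction L as [|a L IH]; simpl; [apply Cont_const|]. apply Cont_plus; auto.
Qed.

Definition CI (f : R -> C) : C :=
  RtoC (RInt (fun x => Re (f x)) 0 1) + Ci * RtoC (RInt (fun x => Im (f x)) 0 1).

Lemma Re_CI f : Re (CI f) = RInt (fun x => Re (f x)) 0 1.
Proof.
  unfold CI. generalize (RInt (fun x => Im (f x)) 0 1). generalize (RInt (fun x => Re (f x)) 0 1).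
  simpl. intros u v. C_simpl. ring.
Qed.

Lemma Cont_ex_Re f : Cont f -> ex_RInt (fun x => Re (f x)) 0 1.
Proof. intros H. apply (ex_RInt_continuous (V := R_CompleteNormedModule)). intros z _. apply H. Qed.

Lemma Cont_ex_Im f : Cont f -> ex_RInt (fun x => Im (f x)) 0 1.
Proof. intros H. apply (ex_RInt_continuous (V := R_CompleteNormedModule)). intros z _. apply H. Qed.

Lemma CI_ext f g : (forall x, f x = g x) -> CI f = CI g.
Proof. intros H. f_equal. apply functional_extensionality; auto. Qed.

Lemma CI_plus f g : Cont f -> Cont g -> CI (fun x => f x + g x) = CI f + CI g.
Proof.
  intros Hf Hg. unfold CI.
  assert (E1 : RInt (fun x => Re (f x + g x)) 0 1 = (RInt (fun x => Re (f x)) 0 1 + RInt (fun x => Re (g x)) 0 1)%R)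
    by (apply (RInt_plus (V := R_CompleteNormedModule) (fun x => Re (f x)) (fun x => Re (g x))); apply Cont_ex_Re; auto).
  assert (E2 : RInt (fun x => Im (f x + g x)) 0 1 = (RInt (fun x => Im (f x)) 0 1 + RInt (fun x => Im (g x)) 0 1)%R)
    by (apply (RInt_plus (V := R_CompleteNormedModule) (fun x => Im (f x)) (fun x => Im (g x))); apply Cont_ex_Im; auto).
  rewrite E1, E2, !RtoC_plus. ring.
Qed.

Lemma CI_scal c f : Cont f -> CI (fun x => c * f x) = c * CI f.
Proof.
  intros Hf. unfold CI.
  assert (ER := Cont_ex_Re f Hf). assert (EI := Cont_ex_Im f Hf).
  assert (S : forall (k : R) (g : R -> R), ex_RInt g 0 1 -> RInt (fun x => (k * g x)%R) 0 1 = (k * RInt g 0 1)%R)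
    by (intros k g Hg; apply (RInt_scal (V := R_CompleteNormedModule) g 0 1 k); auto).
  assert (X : forall (k : R) (g : R -> R), ex_RInt g 0 1 -> ex_RInt (fun x => (k * g x)%R) 0 1)
    by (intros k g Hg; apply (ex_RInt_scal (V := R_CompleteNormedModule) g 0 1 k); auto).
  assert (E1 : RInt (fun x => Re (c * f x)) 0 1 = (Re c * RInt (fun x => Re (f x)) 0 1 - Im c * RInt (fun x => Im (f x)) 0 1)%R).
  { rewrite <- !S by auto. apply (RInt_minus (V := R_CompleteNormedModule) (fun x => (Re c * Re (f x))%R) (fun x => (Im c * Im (f x))%R)); auto. }
  assert (E2 : RInt (fun x => Im (c * f x)) 0 1 = (Re c * RInt (fun x => Im (f x)) 0 1 + Im c * RInt (fun x => Re (f x)) 0 1)%R).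
  { rewrite <- !S by auto. apply (RInt_plus (V := R_CompleteNormedModule) (fun x => (Re c * Im (f x))%R) (fun x => (Im c * Re (f x))%R)); auto. }
  rewrite E1, E2. apply C_eq; C_simpl; ring.
Qed.

Lemma CI_lsum {I} (f : I -> R -> C) L : (forall i, Cont (f i)) ->
  CI (fun x => lsum (fun i => f i x) L) = lsum (fun i => CI (f i)) L.
Proof.
  intros H. induction L as [|a L IH]; simpl.
  - unfold CI. rewrite !RInt_const. unfold scal; simpl; unfold mult; simpl. rewrite !Rmult_0_r. ring.
  - rewrite CI_plus, IH; auto. apply Cont_lsum; auto.
Qed.

(** The factor 2 comes from bounding the real and the imaginary part of the integral separately. *)
Lemma CI_bound f (g : R -> R) : Cont f -> (forall x, continuous g x) ->
  (forall x, (0 <= x <= 1)%R -> (Cmod (f x) <= g x)%R) -> (Cmod (CI f) <= 2 * RInt g 0 1)%R.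
Proof.
  intros Hf Hg H.
  assert (Hx : ex_RInt g 0 1) by (apply (ex_RInt_continuous (V := R_CompleteNormedModule)); auto).
  assert (A : forall k : R -> R, ex_RInt k 0 1 -> (forall x, (0 <= x <= 1)%R -> (Rabs (k x) <= g x)%R) ->
    (Rabs (RInt k 0 1) <= RInt g 0 1)%R).
  { intros k Hk Hb. apply (norm_RInt_le (V := R_NormedModule) k g 0 1); auto; [lra| |].
    - apply (RInt_correct (V := R_CompleteNormedModule)); auto.
    - apply (RInt_correct (V := R_CompleteNormedModule)); auto. }
  assert (A1 := A _ (Cont_ex_Re f Hf) (fun x Hx => Rle_trans _ _ _ (re_le_Cmod _) (H x Hx))).
  assert (A2 := A _ (Cont_ex_Im f Hf) (fun x Hx => Rle_trans _ _ _ (im_le_Cmod _) (H x Hx))).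
  unfold CI. eapply Rle_trans; [apply Cmod_triangle|]. rewrite Cmod_mult, Cmod_Ci, !Cmod_R. lra.
Qed.

Lemma CI_bound_const f M : Cont f -> (forall x, (0 <= x <= 1)%R -> (Cmod (f x) <= M)%R) ->
  (Cmod (CI f) <= 2 * M)%R.
Proof.
  intros Hf H. replace M with (RInt (fun _ => M) 0 1).
  - apply (CI_bound f (fun _ => M)); [auto|intros; apply continuous_const|auto].
  - rewrite RInt_const. unfold scal; simpl; unfold mult; simpl. ring.
Qed.

Lemma CI_deriv f f' : (forall x, Der f x (f' x)) -> Cont f' -> CI f' = f 1%R - f 0%R.
Proof.
  intros H Hc. unfold CI.
  assert (E1 : RInt (fun x => Re (f' x)) 0 1 = (Re (f 1%R) - Re (f 0%R))%R).
  { apply is_RInt_unique. apply (is_RInt_derive (V := R_CompleteNormedModule) (fun x => Re (f x)) (fun x => Re (f' x))); intros; [apply Der_Re; auto|apply Hc]. }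
  assert (E2 : RInt (fun x => Im (f' x)) 0 1 = (Im (f 1%R) - Im (f 0%R))%R).
  { apply is_RInt_unique. apply (is_RInt_derive (V := R_CompleteNormedModule) (fun x => Im (f x)) (fun x => Im (f' x))); intros; [apply Der_Im; auto|apply Hc]. }
  rewrite E1, E2. apply C_eq; C_simpl; ring.
Qed.

Lemma CI_const c : CI (fun _ => c) = c.
Proof.
  unfold CI. rewrite !RInt_const. unfold scal; simpl; unfold mult; simpl.
  apply C_eq; C_simpl; ring.
Qed.

(** The quadratic error is uniform on the interval of integration and survives integrating:
    differentiation under the integral sign. *)
Lemma CI_Der (F : R -> R -> C) (F1 : R -> C) s d K : (0 < d)%R ->
  (forall u, (Rabs (u - s) <= d)%R -> Cont (F u)) -> Cont F1 ->
  (forall h x, (Rabs h <= d)%R -> (0 <= x <= 1)%R -> (Cmod (F (s + h)%R x - F s x - h * F1 x) <= K * (h * h))%R) ->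
  Der (fun u => CI (F u)) s (CI F1).
Proof.
  intros Hd HF' HF1 H. exists d, (2 * K)%R. split; auto. intros h Hh.
  assert (HF : Cont (F s)) by (apply HF'; rewrite Rminus_diag, Rabs_R0; lra).
  assert (HFh : Cont (F (s + h)%R)) by (apply HF'; replace (s + h - s)%R with h by ring; auto).
  replace (CI (F (s + h)%R) - CI (F s) - h * CI F1) with (CI (fun x => F (s + h)%R x + (-(1)) * F s x + (- h) * F1 x)).
  - rewrite Rmult_assoc. apply CI_bound_const.
    + repeat apply Cont_plus; auto; apply Cont_scal; auto.
    + intros x Hx. replace (F (s + h)%R x + (-(1)) * F s x + - h * F1 x) with (F (s + h)%R x - F s x - h * F1 x) by ring.
      auto.
  - rewrite CI_plus, CI_plus, !CI_scal; auto; try ring; try (apply Cont_scal; auto).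
    apply Cont_plus; auto. apply Cont_scal; auto.
Qed.

Lemma Der_ex_lin (k : R) x0 x : Der (fun y => ex (RtoC (k * (y - x0)))) x (2 * PI * Ci * RtoC k * ex (RtoC (k * (x - x0)))).
Proof.
  apply (Der_ex (fun y => RtoC (k * (y - x0)))). apply (Der_ext (fun y => RtoC k * RtoC y + RtoC (- (k * x0)))).
  - intros y. rewrite <- RtoC_mult, <- RtoC_plus. f_equal. ring.
  - eapply Der_eq; [|apply Der_plus; [apply Der_scal, Der_id|apply Der_const]]. ring.
Qed.

(** The integrand is, up to a nonzero constant, the derivative of a function of period 1. *)
Lemma CI_ex_Z (m : Z) x0 : m <> 0%Z -> CI (fun x => ex (RtoC (IZR m * (x - x0)))) = 0.
Proof.
  intros Hm.
  assert (Hc : Cont (fun x => ex (RtoC (IZR m * (x - x0))))) by (eapply Der_Cont; intros; apply Der_ex_lin).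
  assert (Hm' : IZR m <> 0%R) by (apply not_0_IZR; auto).
  assert (E := CI_deriv (fun y => ex (RtoC (IZR m * (y - x0)))) _ (fun x => Der_ex_lin (IZR m) x0 x) (Cont_scal _ _ Hc)).
  rewrite CI_scal in E by auto.
  assert (Hs : ex (RtoC (IZR m * (1 - x0))) = ex (RtoC (IZR m * (0 - x0)))).
  { apply (ex_eq _ _ m). rewrite <- RtoC_plus. f_equal. ring. }
  rewrite Hs in E.
  assert (Hn : 2 * PI * Ci * RtoC (IZR m) <> 0).
  { repeat apply Cmult_neq_0; try (apply RtoC_neq0; auto; try lra; apply PI_neq0).
    intros E0. assert (E1 := Cmod_Ci). rewrite E0, Cmod_0 in E1. lra. }
  replace (CI (fun x => ex (RtoC (IZR m * (x - x0))))) with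
    (2 * PI * Ci * RtoC (IZR m) * CI (fun x => ex (RtoC (IZR m * (x - x0)))) / (2 * PI * Ci * RtoC (IZR m)))
    by (field; repeat split; intros E0; apply Hn; rewrite E0; ring).
  rewrite E. unfold Cdiv, Cminus. ring.
Qed.

(** * Uniqueness of Fourier coefficients *)

(** The Taylor polynomial of degree 7 bounds the sine from below, and on [0, 2] it is at least a /
    4. *)
Lemma sin_ge_quarter a : (0 <= a <= PI / 2)%R -> (a / 4 <= sin a)%R.
Proof.
  intros [H0 H1]. assert (HP := PI_4). assert (HP0 := PI_RGT_0).
  destruct (SIN a H0 ltac:(lra)) as [H _]. eapply Rle_trans; [|exact H].
  assert (E : sin_lb a = (a * (1 - a * a / 6 + (a * a) * (a * a) * (42 - a * a) / 5040))%R).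
  { unfold sin_lb, sin_approx, sin_term, sum_f_R0.
    change (fact (2 * 0 + 1)) with 1%nat. change (fact (2 * 1 + 1)) with 6%nat.
    change (fact (2 * 2 + 1)) with 120%nat. rewrite (INR_IZR_INZ (fact (2 * 3 + 1))).
    change (Z.of_nat (fact (2 * 3 + 1))) with 5040%Z. rewrite !INR_IZR_INZ. simpl. field. }
  rewrite E. assert (Ha : (a <= 2)%R) by lra.
  assert (Hu : (0 <= a * a <= 4)%R) by nra. revert Hu. generalize (a * a)%R. intros u Hu.
  assert (0 <= u * u * (42 - u))%R by (apply Rmult_le_pos; nra).
  assert (0 <= a * (3 / 4 - u / 6 + u * u * (42 - u) / 5040))%R by (apply Rmult_le_pos; lra).
  lra.
Qed.

Lemma Cmod_sq z : (Cmod z * Cmod z = Re z * Re z + Im z * Im z)%R.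
Proof.
  assert (H := Cmod2_alt z). simpl in H. lra.
Qed.

(** The modulus is 2 |sin(pi h)|, and pi |h| stays within [0, pi / 2]. *)
Lemma ex_m1_ge h : (Rabs h <= 1 / 2)%R -> (Rabs h <= Cmod (ex (RtoC h) - 1))%R.
Proof.
  intros Hh. assert (HP := PI2_1).
  apply Rsqr_incr_0_var; [|apply Cmod_ge_0]. unfold Rsqr. rewrite Cmod_sq, ex_real.
  C_simpl. unfold Re, Im; simpl fst; simpl snd.
  assert (Hs : (Rabs h / 2 <= Rabs (sin (PI * h)))%R).
  { assert (A : (Rabs (PI * h) / 4 <= sin (Rabs (PI * h)))%R).
    { apply sin_ge_quarter. split; [apply Rabs_pos|]. rewrite Rabs_mult, (Rabs_pos_eq PI) by lra.
      apply Rle_trans with (PI * (1 / 2))%R; [apply Rmult_le_compat_l; lra|lra]. }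
    assert (B : (sin (Rabs (PI * h)) <= Rabs (sin (PI * h)))%R).
    { unfold Rabs at 1. destruct (Rcase_abs (PI * h)).
      - rewrite sin_neg, <- Rabs_Ropp. apply Rle_abs.
      - apply Rle_abs. }
    assert (AB := Rle_trans _ _ _ A B). rewrite (Rabs_mult PI), (Rabs_pos_eq PI) in AB by lra. assert (P := Rabs_pos h).
    assert (2 * Rabs h <= PI * Rabs h)%R by (apply Rmult_le_compat_r; lra). lra. }
  assert (D := cos_2a_sin (PI * h)). replace (2 * (PI * h))%R with (2 * PI * h)%R in D by ring.
  assert (D' := sin2_cos2 (2 * PI * h)). unfold Rsqr in D'.
  assert (E : (Rabs (sin (PI * h)) * Rabs (sin (PI * h)) = sin (PI * h) * sin (PI * h))%R).
  { rewrite <- Rabs_mult. apply Rabs_pos_eq. nra. }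
  assert (P := Rabs_pos h). nra.
Qed.

Lemma periodic_Z (f : R -> C) : (forall x, f (x + 1)%R = f x) -> forall (n : Z) x, f (x + IZR n)%R = f x.
Proof.
  intros H.
  assert (A : forall (n : nat) x, f (x + INR n)%R = f x).
  { induction n as [|n IH]; intros x; [simpl; rewrite Rplus_0_r; auto|].
    rewrite S_INR, <- Rplus_assoc, H. auto. }
  intros n x. destruct (Z_le_gt_dec 0 n).
  - rewrite <- (Z2Nat.id n), <- INR_IZR_INZ by auto. auto.
  - rewrite <- (A (Z.to_nat (- n)) (x + IZR n)%R). f_equal.
    rewrite INR_IZR_INZ, Z2Nat.id, opp_IZR by lia. ring.
Qed.

Lemma nearest_int (x : R) : exists n : Z, (Rabs (x - IZR n) <= 1 / 2)%R.
Proof.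
  exists (up (x - 1 / 2)). assert (H := archimed (x - 1 / 2)). apply Rabs_le. lra.
Qed.

(** The bound is expressed by [ex] so that it is periodic and meets the telescoping [dk_tele]. Near
    [x0] modulo 1 it comes from the derivative, farther away from boundedness. *)
Lemma lipschitz_at (D : R -> C) x0 l B : (forall x, D (x + 1)%R = D x) -> Der D x0 l ->
  (forall x, (Cmod (D x) <= B)%R) ->
  exists L, (0 <= L)%R /\ forall x, (Cmod (D x0 - D x) <= L * Cmod (ex (RtoC (x - x0)) - 1))%R.
Proof.
  intros Hp [d [K [Hd H]]] HB.
  assert (HB0 : (0 <= B)%R) by (eapply Rle_trans; [apply Cmod_ge_0|apply (HB 0%R)]).
  assert (P1 := Cmod_ge_0 l). assert (P2 := Rabs_pos K).
  assert (P3 : (0 <= 2 * B / d)%R) by (apply Rmult_le_pos; [lra|left; apply Rinv_0_lt_compat; auto]).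
  assert (P4 : (0 <= Rabs K * d)%R) by (apply Rmult_le_pos; lra).
  set (L := (Cmod l + Rabs K * d + 2 * B / d)%R).
  exists L. split; [unfold L; lra|]. intros x.
  destruct (nearest_int (x - x0)) as [n Hn]. set (h := (x - x0 - IZR n)%R) in *.
  assert (E1 : D x = D (x0 + h)%R).
  { rewrite <- (periodic_Z D Hp n (x0 + h)%R). f_equal. unfold h; ring. }
  assert (E2 : ex (RtoC (x - x0)) = ex (RtoC h)).
  { apply (ex_eq _ _ n). rewrite <- RtoC_plus. f_equal. unfold h; ring. }
  rewrite E1, E2. apply Rle_trans with (L * Rabs h)%R.
  2:{ apply Rmult_le_compat_l; [unfold L; lra|]. apply ex_m1_ge; auto. }
  assert (P7 := Rabs_pos h). assert (P8 := Rle_abs K).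
  destruct (Rle_dec (Rabs h) d) as [Hs|Hs].
  - specialize (H h Hs).
    replace (D x0 - D (x0 + h)%R) with (- ((D (x0 + h)%R - D x0 - h * l) + h * l)) by ring.
    rewrite Cmod_opp. eapply Rle_trans; [apply Cmod_triangle|]. rewrite Cmod_mult, Cmod_R.
    replace (h * h)%R with (Rabs h * Rabs h)%R in H by (rewrite <- Rabs_mult; apply Rabs_pos_eq; nra).
    assert (K * (Rabs h * Rabs h) <= Rabs K * d * Rabs h)%R.
    { apply Rle_trans with (Rabs K * (Rabs h * Rabs h))%R; [apply Rmult_le_compat_r; nra|].
      rewrite (Rmult_assoc (Rabs K)). apply Rmult_le_compat_l; nra. }
    unfold L. nra.
  - apply Rle_trans with (2 * B)%R.
    + unfold Cminus. eapply Rle_trans; [apply Cmod_triangle|]. rewrite Cmod_opp.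
      assert (A := HB x0). assert (A' := HB (x0 + h)%R). lra.
    + replace (2 * B)%R with (2 * B / d * d)%R by (field; lra). unfold L. nra.
Qed.

Section Fejer.
Variable x0 : R.

(** A one-sided Dirichlet sum centred at [x0]; its product with the conjugate [dk'] is N times the
    Fejer kernel. *)
Definition dk (N : nat) (x : R) : C := lsum (fun k : nat => ex (RtoC (INR k * (x - x0)))) (seq 0 N).
Definition dk' (N : nat) (x : R) : C := lsum (fun k : nat => ex (RtoC (- INR k * (x - x0)))) (seq 0 N).

Lemma ex_conj (r : R) : ex (RtoC (- r)) = Cconj (ex (RtoC r)).
Proof.
  rewrite !ex_real. unfold Cconj; simpl. replace (2 * PI * - r)%R with (- (2 * PI * r))%R by ring.
  rewrite cos_neg, sin_neg; auto.
Qed.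

Lemma dk'_conj N x : dk' N x = Cconj (dk N x).
Proof.
  unfold dk, dk'. induction (seq 0 N) as [|a L IH]; simpl.
  - unfold Cconj; simpl. apply C_eq; simpl; ring.
  - rewrite IH. replace (- INR a * (x - x0))%R with (- (INR a * (x - x0)))%R by ring.
    rewrite ex_conj. apply C_eq; simpl; ring.
Qed.

Lemma dk_sq N x : dk N x * dk' N x = RtoC (Cmod (dk N x) * Cmod (dk N x)).
Proof.
  rewrite dk'_conj, Cmod_sq. destruct (dk N x) as [u v]. unfold Cconj; simpl.
  apply C_eq; simpl; ring.
Qed.

Lemma dk_prod N x : dk N x * dk' N x =
  lsum (fun k => lsum (fun l => ex (RtoC (IZR (Z.of_nat k - Z.of_nat l) * (x - x0)))) (seq 0 N)) (seq 0 N).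
Proof.
  unfold dk, dk'. rewrite Cmult_comm, <- lsum_scal. apply lsum_ext. intros k _.
  rewrite Cmult_comm, <- lsum_scal. apply lsum_ext. intros l _.
  rewrite <- ex_plus, <- RtoC_plus. do 2 f_equal.
  rewrite minus_IZR, <- !INR_IZR_INZ. ring.
Qed.

Lemma Cont_ex_lin k : Cont (fun x => ex (RtoC (k * (x - x0)))).
Proof. eapply Der_Cont. intros; apply Der_ex_lin. Qed.

Lemma dk_Cont N : Cont (fun x => dk N x * dk' N x).
Proof. apply Cont_mult; apply Cont_lsum; intros; apply Cont_ex_lin. Qed.

Lemma dk_tele N x : (ex (RtoC (x - x0)) - 1) * dk N x = ex (RtoC (INR N * (x - x0))) - 1.
Proof.
  unfold dk. induction N as [|N IH].
  - simpl. rewrite Rmult_0_l, ex_0. ring.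
  - rewrite seq_S, lsum_app, Cmult_plus_distr_l, IH. simpl lsum.
    rewrite S_INR. replace ((INR N + 1) * (x - x0))%R with ((x - x0) + INR N * (x - x0))%R by ring.
    rewrite RtoC_plus, ex_plus. ring.
Qed.

Lemma CI_dk N : CI (fun x => dk N x * dk' N x) = RtoC (INR N).
Proof.
  rewrite (CI_ext _ _ (dk_prod N)).
  rewrite (CI_lsum (fun k x => lsum (fun l => ex (RtoC (IZR (Z.of_nat k - Z.of_nat l) * (x - x0)))) (seq 0 N)))
    by (intros; apply Cont_lsum; intros; apply Cont_ex_lin).
  rewrite (lsum_ext _ (fun _ => RtoC 1)).
  - rewrite <- (length_seq N 0) at 2. generalize (seq 0 N). intros L.
    induction L as [|a L IH]; [reflexivity|].
    change (length (a :: L)) with (S (length L)). rewrite S_INR, RtoC_plus, <- IH. simpl. ring.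
  - intros k Hk. rewrite (CI_lsum (fun l x => ex (RtoC (IZR (Z.of_nat k - Z.of_nat l) * (x - x0)))))
      by (intros; apply Cont_ex_lin).
    apply (csum_unique (fun l => if Nat.eq_dec l k then RtoC 1 else 0)).
    + rewrite (lsum_ext _ (fun l => if Nat.eq_dec l k then RtoC 1 else 0)).
      * apply csum_fin; [apply seq_NoDup|]. intros l Hl. destruct (Nat.eq_dec l k); auto. subst; tauto.
      * intros l _. destruct (Nat.eq_dec l k) as [->|Hn].
        -- rewrite Z.sub_diag. rewrite (CI_ext _ (fun _ => RtoC 1)); [apply CI_const|].
           intros x. rewrite Rmult_0_l. apply ex_0.
        -- apply CI_ex_Z. lia.
    + assert (H : csum (fun l => if Nat.eq_dec l k then RtoC 1 else 0) (if Nat.eq_dec k k then RtoC 1 else 0)).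
      { apply (csum_at (fun l => if Nat.eq_dec l k then RtoC 1 else 0) k).
        intros l Hl. destruct (Nat.eq_dec l k); congruence. }
      destruct (Nat.eq_dec k k); [exact H|congruence].
Qed.

(* D is orthogonal to the Fejer kernels centred at x0, which concentrate there. *)
Lemma fejer_unique (D : R -> C) l B : Cont D -> (forall x, D (x + 1)%R = D x) -> Der D x0 l ->
  (forall x, (Cmod (D x) <= B)%R) ->
  (forall m : Z, CI (fun x => D x * ex (RtoC (IZR m * x))) = 0) -> D x0 = 0.
Proof.
  intros Hc Hp Hd HB H0.
  destruct (lipschitz_at D x0 l B Hp Hd HB) as [L [HL Hlip]].
  (* The kernel is a trigonometric polynomial, so orthogonality to all exponentials suffices. *)
  assert (HDP : forall N, CI (fun x => D x * (dk N x * dk' N x)) = 0).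
  { intros N.
    assert (Hcc : forall k l : nat, Cont (fun x => D x * ex (RtoC (IZR (Z.of_nat k - Z.of_nat l) * (x - x0)))))
      by (intros; apply Cont_mult; auto; apply Cont_ex_lin).
    rewrite (CI_ext _ (fun x => lsum (fun k => lsum (fun l => D x * ex (RtoC (IZR (Z.of_nat k - Z.of_nat l) * (x - x0)))) (seq 0 N)) (seq 0 N))).
    2:{ intros x. rewrite dk_prod, <- lsum_scal. apply lsum_ext; intros k _. rewrite <- lsum_scal. auto. }
    rewrite (CI_lsum (fun k x => lsum (fun l => D x * ex (RtoC (IZR (Z.of_nat k - Z.of_nat l) * (x - x0)))) (seq 0 N)))
      by (intros; apply Cont_lsum; intros; apply Hcc).
    apply lsum_zero. intros k _.
    rewrite (CI_lsum (fun l x => D x * ex (RtoC (IZR (Z.of_nat k - Z.of_nat l) * (x - x0))))) by auto.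
    apply lsum_zero. intros j _.
    set (m := (Z.of_nat k - Z.of_nat j)%Z).
    rewrite (CI_ext _ (fun x => ex (RtoC (- (IZR m * x0))) * (D x * ex (RtoC (IZR m * x))))).
    - rewrite CI_scal, H0 by (apply Cont_mult; auto; apply (Cont_ext (fun x => ex (RtoC (IZR m * (x - x0))) * ex (RtoC (IZR m * x0))));
        [intros x; rewrite <- ex_plus, <- RtoC_plus; do 2 f_equal; ring|
         apply Cont_mult; [apply Cont_ex_lin|apply Cont_const]]). ring.
    - intros x. replace (RtoC (IZR m * (x - x0))) with (RtoC (- (IZR m * x0)) + RtoC (IZR m * x))
        by (rewrite <- RtoC_plus; f_equal; ring).
      rewrite ex_plus. ring. }
  assert (Hmain : forall N, (1 <= N)%nat -> (Cmod (D x0) * sqrt (INR N) <= 4 * L)%R).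
  { intros N HN. set (r := sqrt (INR N)).
    assert (HNpos : (1 <= INR N)%R) by (apply (le_INR 1); auto).
    assert (Hr : (0 < r)%R) by (apply sqrt_lt_R0; lra).
    assert (Hrr : (r * r = INR N)%R) by (apply sqrt_sqrt; lra).
    assert (E : INR N * D x0 = CI (fun x => (D x0 - D x) * (dk N x * dk' N x))).
    { rewrite (CI_ext _ (fun x => D x0 * (dk N x * dk' N x) + (-(1)) * (D x * (dk N x * dk' N x)))) by (intros; ring).
      rewrite CI_plus, !CI_scal, CI_dk, HDP; try ring; auto using dk_Cont, Cont_mult, Cont_scal. }
    (* With p = |dk|, telescoping bounds |e(x - x0) - 1| p by 2, and 2 p <= p^2 / r + r with r =
       sqrt N balances the two terms, as the mean of p^2 is N. *)
    set (g := fun x => (L * (/ r * Re (dk N x * dk' N x) + r))%R).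
    assert (Hb : (Cmod (CI (fun x => ((D x0 - D x) * (dk N x * dk' N x))%C)) <= 2 * RInt g 0 1)%R).
    { apply CI_bound.
      - apply Cont_mult; [|apply dk_Cont]. apply Cont_minus; auto. apply Cont_const.
      - intros x. unfold g.
        apply (continuous_scal_r (K := R_AbsRing) (V := R_NormedModule) L (fun x => (/ r * Re (dk N x * dk' N x) + r)%R)).
        apply (continuous_plus (V := R_NormedModule) (fun x => (/ r * Re (dk N x * dk' N x))%R) (fun _ => r)).
        + apply (continuous_scal_r (K := R_AbsRing) (V := R_NormedModule) (/ r)%R (fun x => Re (dk N x * dk' N x))). exact (proj1 (dk_Cont N x)).
        + apply continuous_const.
      - intros x _. unfold g. rewrite dk_sq, Cmod_mult, Cmod_R, Re_RtoC.
        set (p := Cmod (dk N x)). assert (Hp0 : (0 <= p)%R) by apply Cmod_ge_0.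
        rewrite Rabs_pos_eq by nra.
        apply Rle_trans with (L * (2 * p))%R.
        + apply Rle_trans with (L * Cmod (ex (RtoC (x - x0)) - 1) * (p * p))%R.
          * apply Rmult_le_compat_r; [nra|]. apply Hlip.
          * assert (T : (Cmod (ex (RtoC (x - x0)) - 1) * p <= 2)%R).
            { unfold p. rewrite <- Cmod_mult, dk_tele. unfold Cminus.
              eapply Rle_trans; [apply Cmod_triangle|].
              rewrite Cmod_opp, Cmod_1, Cmod_ex_real. lra. }
            replace (L * Cmod (ex (RtoC (x - x0)) - 1) * (p * p))%R with (L * (Cmod (ex (RtoC (x - x0)) - 1) * p * p))%R by ring.
            apply Rmult_le_compat_l; auto. apply Rmult_le_compat_r; auto.
        + apply Rmult_le_compat_l; auto.
          assert (A : (0 <= (p - r) * (p - r) * / r)%R) by (apply Rmult_le_pos; [apply (Rle_0_sqr (p - r))|left; apply Rinv_0_lt_compat; auto]).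
          replace ((p - r) * (p - r) * / r)%R with (/ r * (p * p) + r - 2 * p)%R in A by (field; lra). lra. }
    assert (Hg : RInt g 0 1 = (2 * (L * r))%R).
    { assert (HR : RInt (fun x => Re (dk N x * dk' N x)) 0 1 = INR N).
      { rewrite <- (Re_CI (fun x => dk N x * dk' N x)), CI_dk. reflexivity. }
      assert (X0 : ex_RInt (fun x => Re (dk N x * dk' N x)) 0 1) by (apply Cont_ex_Re; apply dk_Cont).
      apply is_RInt_unique.
      replace (2 * (L * r))%R with (scal L (plus (scal (/ r)%R (INR N)) (scal (1 - 0)%R r))).
      - apply (is_RInt_scal (V := R_NormedModule)).
        apply (is_RInt_plus (V := R_NormedModule) (fun x => (/ r * Re (dk N x * dk' N x))%R) (fun _ => r)).
        + apply (is_RInt_scal (V := R_NormedModule)). rewrite <- HR. apply (RInt_correct (V := R_CompleteNormedModule)); auto.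
        + apply (is_RInt_const (V := R_NormedModule)).
      - unfold scal, plus; simpl; unfold mult; simpl. rewrite <- Hrr. field. lra. }
    rewrite <- E, Cmod_mult, Cmod_R, Hg, (Rabs_pos_eq (INR N)) in Hb by lra.
    apply Rmult_le_reg_r with r; auto. rewrite Rmult_assoc, Hrr. lra. }
  apply NNPP. intros Hne. apply Cmod_pos in Hne.
  destruct (INR_unbounded ((4 * L / Cmod (D x0) + 1) * (4 * L / Cmod (D x0) + 1))) as [N HN].
  assert (Hq : (0 <= 4 * L / Cmod (D x0))%R) by (apply Rmult_le_pos; [lra|left; apply Rinv_0_lt_compat; auto]).
  assert (HN1 : (1 <= N)%nat).
  { destruct N; [simpl in HN; nra|lia]. }
  specialize (Hmain N HN1).
  assert (Hs : (4 * L / Cmod (D x0) + 1 < sqrt (INR N))%R).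
  { rewrite <- (sqrt_square (4 * L / Cmod (D x0) + 1)) by lra. apply sqrt_lt_1; nra. }
  assert (Cmod (D x0) * (4 * L / Cmod (D x0) + 1) < Cmod (D x0) * sqrt (INR N))%R by (apply Rmult_lt_compat_l; auto).
  replace (Cmod (D x0) * (4 * L / Cmod (D x0) + 1))%R with (4 * L + Cmod (D x0))%R in H by (field; lra).
  lra.
Qed.
End Fejer.

(** * Moments of the Gaussian sums *)

Lemma Sum_bij {I J : Type} (h : I -> J) (k : J -> I) (g : J -> C) :
  (forall i, k (h i) = i) -> (forall j, h (k j) = j) -> summable g -> Sum (fun i => g (h i)) = Sum g.
Proof.
  intros Hk Hh Hg. apply csum_Sum. apply (csum_bij h k); auto. apply summable_csum; auto.
Qed.

Lemma Sum_scal {I : Type} c (f : I -> C) : summable f -> Sum (fun i => c * f i) = c * Sum f.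
Proof. intros H. apply csum_Sum, csum_scal, summable_csum; auto. Qed.

Lemma Sum_plus {I : Type} (f g : I -> C) : summable f -> summable g ->
  Sum (fun i => f i + g i) = Sum f + Sum g.
Proof. intros H H'. apply csum_Sum, csum_plus; apply summable_csum; auto. Qed.

Lemma Sum_bound {I : Type} (f : I -> C) M : rbound (fun i => Cmod (f i)) M -> (Cmod (Sum f) <= M)%R.
Proof.
  intros H. apply (csum_bound f); auto. apply summable_csum. exists M; auto.
Qed.

Lemma summable_ext {I : Type} (f g : I -> C) : (forall i, f i = g i) -> summable f -> summable g.
Proof. intros H. replace g with f; auto. apply functional_extensionality; auto. Qed.

(** The quadratic remainders of the single exponentials are summed; the second moment [M], with the
    margin exp(d |B|), controls them. The derivatives of the Gaussian sums in x, b and tau and those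
    of the q-expansions are instances. *)
Lemma expsum_deriv {I : Type} (a B : I -> C) d M : (0 <= d)%R -> summable a ->
  rbound (fun i => (Cmod (a i) * (Cmod (B i) * Cmod (B i)) * exp (d * Cmod (B i)))%R) M ->
  summable (fun i => a i * B i) /\
  forall h : C, (Cmod h <= d)%R -> summable (fun i => a i * Cexp (h * B i)) /\
    (Cmod (Sum (fun i => (a i * Cexp (h * B i))%C) - Sum a - h * Sum (fun i => (a i * B i)%C))%C <= 4 * M * (Cmod h * Cmod h))%R.
Proof.
  intros Hd [N HN] HM.
  assert (HaB : summable (fun i => a i * B i)).
  { exists (N + M)%R. eapply rbound_le; [|exact (rbound_plus _ _ _ _ HN HM)].
    intros i. cbv beta. rewrite Cmod_mult.
    assert (A := Cmod_ge_0 (a i)). assert (B0 := Cmod_ge_0 (B i)).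
    assert (E : (1 <= exp (d * Cmod (B i)))%R).
    { rewrite <- exp_0. apply exp_le_le. nra. }
    assert (X : (Cmod (a i) * Cmod (B i) <= Cmod (a i) * (1 + Cmod (B i) * Cmod (B i)))%R)
      by (apply Rmult_le_compat_l; nra).
    assert (Y : (Cmod (a i) * (Cmod (B i) * Cmod (B i)) * 1 <= Cmod (a i) * (Cmod (B i) * Cmod (B i)) * exp (d * Cmod (B i)))%R).
    { apply Rmult_le_compat_l; auto. apply Rmult_le_pos; nra. }
    nra. }
  split; auto. intros h Hh.
  set (r := fun i => a i * (Cexp (h * B i) - 1 - h * B i)).
  assert (Hr : rbound (fun i => Cmod (r i)) (4 * M * (Cmod h * Cmod h))).
  { replace (4 * M * (Cmod h * Cmod h))%R with (4 * (Cmod h * Cmod h) * M)%R by ring.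
    eapply rbound_le; [|apply rbound_scal; [|exact HM]].
    - intros i. cbv beta. unfold r. rewrite Cmod_mult.
      assert (A := Cmod_ge_0 (a i)). assert (B0 := Cmod_ge_0 (B i)). assert (H0 := Cmod_ge_0 h).
      assert (E := Cexp_bound2 (h * B i)). rewrite Cmod_mult in E.
      assert (E' : (exp (Cmod h * Cmod (B i)) <= exp (d * Cmod (B i)))%R)
        by (apply exp_le_le; apply Rmult_le_compat_r; auto).
      assert (E2 : (Cmod (Cexp (h * B i) - 1 - h * B i) <=
        4 * (Cmod h * Cmod (B i) * (Cmod h * Cmod (B i))) * exp (d * Cmod (B i)))%R).
      { eapply Rle_trans; [exact E|]. apply Rmult_le_compat_l; auto.
        apply Rmult_le_pos; [lra|]. apply (Rle_0_sqr (Cmod h * Cmod (B i))). }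
      eapply Rle_trans; [apply Rmult_le_compat_l; [exact A|exact E2]|]. apply Req_le. ring.
    - assert (H0 := Cmod_ge_0 h). nra. }
  assert (Hsr : summable r) by (eexists; exact Hr).
  assert (Ha : summable a) by (exists N; auto).
  assert (HhB : summable (fun i => h * (a i * B i))) by (apply summable_scal; auto).
  assert (E : forall i, a i + h * (a i * B i) + r i = a i * Cexp (h * B i)) by (intros i; unfold r; ring).
  split.
  - eapply summable_ext; [exact E|]. repeat apply summable_plus; auto.
  - rewrite <- (Sum_ext _ _ E), Sum_plus, Sum_plus, Sum_scal; auto using summable_plus.
    replace (Sum a + h * Sum (fun i => a i * B i) + Sum r - Sum a - h * Sum (fun i => a i * B i)) with (Sum r) by ring.
    apply Sum_bound; auto.
Qed.

Definition gt (tau : C) (b y : R) : C := ex (RtoC (y * y / 2) * tau + RtoC (y * b)).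

(** A moment of the Gaussian over x + Z, of period 1 in [x]. Its mean over a period is the
    corresponding Gaussian integral over the real line, which therefore never has to be
    introduced. *)
Definition mom (k : nat) (tau : C) (b x : R) : C :=
  Sum (fun n : Z => RtoC ((IZR n + x) ^ k) * gt tau b (IZR n + x)).

Lemma Cmod_gt tau b y : Cmod (gt tau b y) = exp (- (PI * Im tau) * (y * y)).
Proof.
  unfold gt. rewrite Cmod_ex, Im_plus, Im_scal, Im_RtoC. f_equal. field.
Qed.

Lemma abs_pow_exp y k : (Rabs (y ^ k) <= exp (INR k * Rabs y))%R.
Proof.
  rewrite <- RPow_abs, <- exp_pow. apply pow_incr. split; [apply Rabs_pos|].
  assert (H := exp_ineq1_le (Rabs y)). lra.
Qed.

Lemma gauss_unif v c X : (0 < v)%R -> (0 <= X)%R -> exists M, forall x, (Rabs x <= X)%R ->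
  rbound (fun n : Z => exp (- v * ((IZR n + x) * (IZR n + x)) + c * Rabs (IZR n + x))) M.
Proof.
  intros Hv HX. destruct rbound_exp_Z as [M HM].
  exists (exp ((c + 1) * (c + 1) / (4 * v)) * exp X * M)%R. intros x Hx.
  eapply rbound_le; [|apply rbound_scal; [|exact HM]].
  - intros n. cbv beta. eapply Rle_trans; [apply gauss_le; auto|].
    rewrite Rmult_assoc. apply Rmult_le_compat_l; [left; apply exp_pos|].
    rewrite <- exp_plus. apply exp_le_le.
    assert (T := Rabs_triang (IZR n + x) (- x)). rewrite Rabs_Ropp in T.
    replace (IZR n + x + - x)%R with (IZR n) in T by ring. lra.
  - apply Rmult_le_pos; left; apply exp_pos.
Qed.

Section Gauss.
Variable tau : C.
Hypothesis Htau : (0 < Im tau)%R.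

Lemma gt_v : (0 < PI * Im tau)%R.
Proof. apply Rmult_lt_0_compat; auto. apply PI_RGT_0. Qed.

Lemma mom_unif k b (kap : C) X : (0 <= X)%R -> exists M, forall x, (Rabs x <= X)%R ->
  summable (fun n : Z => RtoC ((IZR n + x) ^ k) * gt tau b (IZR n + x)) /\
  rbound (fun n : Z => (Cmod (RtoC ((IZR n + x) ^ k) * gt tau b (IZR n + x)) *
    (Cmod (kap * RtoC (IZR n + x)) * Cmod (kap * RtoC (IZR n + x))) * exp (1 * Cmod (kap * RtoC (IZR n + x))))%R) M.
Proof.
  intros HX.
  destruct (gauss_unif (PI * Im tau) (INR k) X gt_v HX) as [M1 H1].
  destruct (gauss_unif (PI * Im tau) (INR k + 2 + Cmod kap) X gt_v HX) as [M2 H2].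
  exists (Cmod kap * Cmod kap * M2)%R. intros x Hx. split.
  - eapply summable_le; [|apply (H1 x Hx)]. intros n. cbv beta. set (y := (IZR n + x)%R).
    rewrite Cmod_mult, Cmod_R, Cmod_gt, Rplus_comm, exp_plus.
    apply Rmult_le_compat_r; [left; apply exp_pos|]. apply abs_pow_exp.
  - eapply rbound_le; [|apply rbound_scal; [|apply (H2 x Hx)]].
    2:{ assert (H0 := Cmod_ge_0 kap). nra. }
    intros n. cbv beta. set (y := (IZR n + x)%R).
    rewrite !Cmod_mult, !Cmod_R, Cmod_gt.
    assert (Hk := abs_pow_exp y k). assert (H0 := Cmod_ge_0 kap). assert (Hy := Rabs_pos y).
    assert (Hy1 := exp_ineq1_le (Rabs y)).
    replace (- (PI * Im tau) * (y * y) + (INR k + 2 + Cmod kap) * Rabs y)%R with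
      (INR k * Rabs y + (- (PI * Im tau) * (y * y)) + (Rabs y + Rabs y) + (Cmod kap * Rabs y))%R by ring.
    rewrite !exp_plus, Rmult_1_l.
    set (E1 := exp (INR k * Rabs y)) in *. set (E2 := exp (- (PI * Im tau) * (y * y))).
    set (E3 := exp (Rabs y)) in *. set (E4 := exp (Cmod kap * Rabs y)).
    assert (P2 : (0 < E2)%R) by apply exp_pos. assert (P4 : (0 < E4)%R) by apply exp_pos.
    assert (P0 := Rabs_pos (y ^ k)).
    replace (Rabs (y ^ k) * E2 * (Cmod kap * Rabs y * (Cmod kap * Rabs y)) * E4)%R
      with (Cmod kap * Cmod kap * (Rabs (y ^ k) * E2 * (Rabs y * Rabs y) * E4))%R by ring.
    apply Rmult_le_compat_l; [nra|]. apply Rmult_le_compat_r; [lra|].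
    apply Rmult_le_compat; try nra.
Qed.

Lemma mom_summable k b x : summable (fun n : Z => RtoC ((IZR n + x) ^ k) * gt tau b (IZR n + x)).
Proof.
  destruct (mom_unif k b 0 (Rabs x) (Rabs_pos x)) as [M H]. apply H. lra.
Qed.

Lemma mom_per k b x : mom k tau b (x + 1) = mom k tau b x.
Proof.
  unfold mom. rewrite <- (Sum_bij (fun n => (n + 1)%Z) (fun n => (n - 1)%Z) (fun n : Z => RtoC ((IZR n + x) ^ k) * gt tau b (IZR n + x))).
  - apply Sum_ext. intros n. rewrite plus_IZR. replace (IZR n + 1 + x)%R with (IZR n + (x + 1))%R by ring. auto.
  - intros; lia.
  - intros; lia.
  - apply mom_summable.
Qed.

(** By [gt_shift], moving x by h multiplies the Gaussian by a common factor and by an exponential in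
    h; what remains is an exponential sum in h, fit for [expsum_deriv]. *)
Definition momh (k : nat) (b x : R) (h : C) : C :=
  Sum (fun n : Z => RtoC ((IZR n + x) ^ k) * gt tau b (IZR n + x) * Cexp (h * (2 * PI * Ci * tau * RtoC (IZR n + x)))).

Lemma momh_prop k b x :
  Der (fun h => momh k b x (RtoC h)) 0 (2 * PI * Ci * tau * mom (S k) tau b x) /\
  (forall h : R, (Rabs h <= 1)%R -> summable (fun n : Z => RtoC ((IZR n + x) ^ k) * gt tau b (IZR n + x) * Cexp (RtoC h * (2 * PI * Ci * tau * RtoC (IZR n + x))))) /\
  momh k b x 0 = mom k tau b x.
Proof.
  assert (H0 : momh k b x 0 = mom k tau b x).
  { unfold momh, mom. apply Sum_ext. intros n. rewrite Cmult_0_l, Cexp_0. ring. }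
  destruct (mom_unif k b (2 * PI * Ci * tau) (Rabs x) (Rabs_pos x)) as [M HM].
  destruct (HM x (Rle_refl _)) as [Hs Hb].
  destruct (expsum_deriv _ _ 1 M Rle_0_1 Hs Hb) as [H1 H2].
  repeat split; auto.
  - exists 1%R, (4 * M)%R. split; [lra|]. intros h Hh.
    destruct (H2 (RtoC h)) as [_ H3]; [rewrite Cmod_R; auto|].
    rewrite Rplus_0_l, H0.
    replace (h * h)%R with (Cmod (RtoC h) * Cmod (RtoC h))%R.
    2:{ rewrite Cmod_R, <- Rabs_mult. apply Rabs_pos_eq. nra. }
    eapply Rle_trans; [|exact H3]. apply Req_le. f_equal. unfold momh, mom.
    f_equal. f_equal.
    rewrite <- Sum_scal by apply mom_summable. apply Sum_ext. intros n.
    simpl pow. rewrite !RtoC_mult. ring.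
  - intros h Hh. apply (H2 (RtoC h)). rewrite Cmod_R; auto.
Qed.

Lemma gt_shift b y h : gt tau b (y + h) = gt tau b h * (gt tau b y * Cexp (RtoC h * (2 * PI * Ci * tau * RtoC y))).
Proof.
  unfold gt. replace (Cexp (RtoC h * (2 * PI * Ci * tau * RtoC y))) with (ex (RtoC h * RtoC y * tau)).
  2:{ unfold ex. f_equal. ring. }
  rewrite <- !ex_plus. f_equal. unfold Rdiv. rewrite !RtoC_mult, !RtoC_plus, !RtoC_inv by lra. field.
Qed.

Lemma Der_gt0 b : Der (fun h => gt tau b h) 0 (2 * PI * Ci * RtoC b).
Proof.
  unfold gt. eapply Der_eq; [|apply (Der_ex (fun h => RtoC (h * h / 2) * tau + RtoC (h * b)))].
  2:{ apply (Der_ext (fun h => (/ 2) * tau * (RtoC h * RtoC h) + RtoC b * RtoC h)).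
      - intros h. unfold Rdiv. rewrite !RtoC_mult, !RtoC_inv by lra. ring.
      - apply Der_plus; [apply Der_scal, Der_mult; apply Der_id|apply Der_scal, Der_id]. }
  replace (RtoC (0 * 0 / 2) * tau + RtoC (0 * b)) with (RtoC 0).
  - rewrite ex_0. ring.
  - replace (0 * 0 / 2)%R with 0%R by field. rewrite Rmult_0_l. ring.
Qed.

Lemma gt_0 b : gt tau b 0 = 1.
Proof.
  unfold gt. replace (0 * 0 / 2)%R with 0%R by field. rewrite Rmult_0_l, Cmult_0_l, Cplus_0_l. apply ex_0.
Qed.

Lemma Der_local f g x l : (forall h : R, (Rabs h <= 1)%R -> f (x + h)%R = g (x + h)%R) -> Der f x l -> Der g x l.
Proof.
  intros E [d [K [Hd H]]]. exists (Rmin 1 d), K. split; [apply Rmin_glb_lt; lra|].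
  intros h Hh. assert (A := Rmin_l 1 d). assert (B := Rmin_r 1 d).
  specialize (H h ltac:(lra)). rewrite <- (E h) by lra.
  assert (E0 := E 0%R). rewrite Rplus_0_r in E0. rewrite <- E0; auto. rewrite Rabs_R0; lra.
Qed.

Lemma mom_Der0 b x : Der (mom 0 tau b) x (2 * PI * Ci * (tau * mom 1 tau b x + RtoC b * mom 0 tau b x)).
Proof.
  apply Der_at. destruct (momh_prop 0 b x) as [D0 [S0 E0]].
  apply (Der_local (fun h => gt tau b h * momh 0 b x (RtoC h))).
  - intros h Hh. rewrite Rplus_0_l. unfold momh. rewrite <- Sum_scal by (apply S0; auto).
    unfold mom. apply Sum_ext. intros n. rewrite <- Rplus_assoc, (gt_shift b (IZR n + x) h). simpl pow. ring.
  - eapply Der_eq; [|apply Der_mult; [apply Der_gt0|exact D0]].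
    cbv beta. rewrite gt_0, E0. ring.
Qed.

Lemma mom_Der1 b x : Der (mom 1 tau b) x (mom 0 tau b x + 2 * PI * Ci * (tau * mom 2 tau b x + RtoC b * mom 1 tau b x)).
Proof.
  apply Der_at. destruct (momh_prop 0 b x) as [D0 [S0 E0]]. destruct (momh_prop 1 b x) as [D1 [S1 E1]].
  apply (Der_local (fun h => gt tau b h * (momh 1 b x (RtoC h) + RtoC h * momh 0 b x (RtoC h)))).
  - intros h Hh. rewrite Rplus_0_l. unfold momh.
    rewrite <- Sum_scal by (apply S0; auto).
    rewrite <- Sum_plus by (try apply summable_scal; auto).
    rewrite <- Sum_scal by (apply summable_plus; try apply summable_scal; auto).
    unfold mom. apply Sum_ext. intros n. rewrite <- Rplus_assoc, (gt_shift b (IZR n + x) h). simpl pow.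
    rewrite !Rmult_1_r, !RtoC_plus. ring.
  - eapply Der_eq; [|apply Der_mult; [apply Der_gt0|apply Der_plus; [exact D1|apply Der_mult; [apply Der_id|exact D0]]]].
    cbv beta. rewrite gt_0, E0, E1. ring.
Qed.

Lemma mom_Der2 b x : exists l, Der (mom 2 tau b) x l.
Proof.
  destruct (momh_prop 0 b x) as [D0 [S0 E0]]. destruct (momh_prop 1 b x) as [D1 [S1 E1]].
  destruct (momh_prop 2 b x) as [D2 [S2 E2]].
  eexists. apply Der_at.
  apply (Der_local (fun h => gt tau b h * (momh 2 b x (RtoC h) + (2 * RtoC h * momh 1 b x (RtoC h) + RtoC h * RtoC h * momh 0 b x (RtoC h))))).
  - intros h Hh. rewrite Rplus_0_l. unfold momh.
    rewrite <- !Sum_scal by auto.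
    rewrite <- Sum_plus by (apply summable_scal; auto).
    rewrite <- Sum_plus by (try apply summable_plus; try apply summable_scal; auto).
    rewrite <- Sum_scal by (repeat apply summable_plus; try apply summable_scal; auto).
    unfold mom. apply Sum_ext. intros n. rewrite <- Rplus_assoc, (gt_shift b (IZR n + x) h). simpl pow.
    rewrite !Rmult_1_r, !RtoC_mult, !RtoC_plus. ring.
  - apply Der_mult; [apply Der_gt0|apply Der_plus; [exact D2|apply Der_plus]].
    + apply Der_mult; [apply Der_scal, Der_id|exact D1].
    + apply Der_mult; [apply Der_mult; apply Der_id|exact D0].
Qed.

Lemma mom_Cont0 b : Cont (mom 0 tau b).
Proof. eapply Der_Cont. intros; apply mom_Der0. Qed.

Lemma mom_Cont1 b : Cont (mom 1 tau b).
Proof. eapply Der_Cont. intros; apply mom_Der1. Qed.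

Lemma mom_Cont2 b : Cont (mom 2 tau b).
Proof.
  apply (Der_Cont _ (fun x => epsilon (inhabits (RtoC 0)) (Der (mom 2 tau b) x))).
  intros x. apply epsilon_spec. apply mom_Der2.
Qed.

(** The derivative of a periodic function has mean zero: this is integration by parts for the
    Gaussian integral. *)
Lemma CI_mom1 b : tau * CI (mom 1 tau b) + RtoC b * CI (mom 0 tau b) = 0.
Proof.
  assert (H := CI_deriv (mom 0 tau b) _ (mom_Der0 b)
    (Cont_scal _ _ (Cont_plus _ _ (Cont_scal _ _ (mom_Cont1 b)) (Cont_scal _ _ (mom_Cont0 b))))).
  rewrite CI_scal, CI_plus, !CI_scal in H; auto using mom_Cont0, mom_Cont1, Cont_scal, Cont_plus.
  replace 1%R with (0 + 1)%R in H by ring. rewrite mom_per in H.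
  assert (E : (2 * PI * Ci) * (tau * CI (mom 1 tau b) + RtoC b * CI (mom 0 tau b)) = 0) by (rewrite H; ring).
  apply NNPP. intros Hn. apply (Cmult_neq_0 (2 * PI * Ci)) in Hn; [auto|].
  apply Cmult_neq_0; [apply Cmult_neq_0; apply RtoC_neq0; [lra|apply PI_neq0]|].
  intros E0. assert (E1 := Cmod_Ci). rewrite E0, Cmod_0 in E1. lra.
Qed.

Lemma CI_mom2 : CI (mom 0 tau 0) + 2 * PI * Ci * tau * CI (mom 2 tau 0) = 0.
Proof.
  assert (H := CI_deriv (mom 1 tau 0) _ (mom_Der1 0)
    (Cont_plus _ _ (mom_Cont0 0) (Cont_scal _ _ (Cont_plus _ _ (Cont_scal _ _ (mom_Cont2 0)) (Cont_scal _ _ (mom_Cont1 0)))))).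
  rewrite CI_plus, CI_scal, CI_plus, !CI_scal in H; auto using mom_Cont0, mom_Cont1, mom_Cont2, Cont_scal, Cont_plus.
  replace 1%R with (0 + 1)%R in H by ring. rewrite mom_per in H.
  replace (CI (mom 0 tau 0) + 2 * PI * Ci * tau * CI (mom 2 tau 0)) with (mom 1 tau 0 0 - mom 1 tau 0 0); [ring|].
  rewrite <- H. ring.
Qed.

Lemma gt_shift_b b y h : gt tau (b + h) y = gt tau b y * Cexp (RtoC h * (2 * PI * Ci * RtoC y)).
Proof.
  unfold gt. replace (Cexp (RtoC h * (2 * PI * Ci * RtoC y))) with (ex (RtoC h * RtoC y)).
  2:{ unfold ex. f_equal. ring. }
  rewrite <- ex_plus. f_equal. rewrite !RtoC_mult, !RtoC_plus. ring.
Qed.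

Lemma mom_b_unif b X : (0 <= X)%R -> exists M, forall x h : R, (Rabs x <= X)%R -> (Rabs h <= 1)%R ->
  (Cmod (mom 0 tau (b + h) x - mom 0 tau b x - h * (2 * PI * Ci * mom 1 tau b x)) <= 4 * M * (h * h))%R.
Proof.
  intros HX. destruct (mom_unif 0 b (2 * PI * Ci) X HX) as [M HM]. exists M. intros x h Hx Hh.
  destruct (HM x Hx) as [Hs Hb].
  destruct (expsum_deriv _ _ 1 M Rle_0_1 Hs Hb) as [H1 H2].
  destruct (H2 (RtoC h)) as [_ H3]; [rewrite Cmod_R; auto|].
  replace (h * h)%R with (Cmod (RtoC h) * Cmod (RtoC h))%R.
  2:{ rewrite Cmod_R, <- Rabs_mult. apply Rabs_pos_eq. nra. }
  eapply Rle_trans; [|exact H3]. apply Req_le. f_equal.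
  assert (E1 : mom 0 tau (b + h) x = Sum (fun n : Z => RtoC ((IZR n + x) ^ 0) * gt tau b (IZR n + x) * Cexp (RtoC h * (2 * PI * Ci * RtoC (IZR n + x))))).
  { apply Sum_ext. intros n. rewrite gt_shift_b. ring. }
  assert (E2 : 2 * PI * Ci * mom 1 tau b x = Sum (fun n : Z => RtoC ((IZR n + x) ^ 0) * gt tau b (IZR n + x) * (2 * PI * Ci * RtoC (IZR n + x)))).
  { unfold mom. rewrite <- Sum_scal by apply mom_summable. apply Sum_ext. intros n. simpl pow.
    rewrite !RtoC_mult. ring. }
  rewrite E1, E2. reflexivity.
Qed.

Lemma CI_mom_b b : Der (fun u => CI (mom 0 tau u)) b (2 * PI * Ci * CI (mom 1 tau b)).
Proof.
  rewrite <- CI_scal by apply mom_Cont1.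
  destruct (mom_b_unif b 1 Rle_0_1) as [M HM].
  apply (CI_Der (fun u => mom 0 tau u) _ b 1 (4 * M)); [lra| | |].
  - intros; apply mom_Cont0.
  - apply Cont_scal, mom_Cont1.
  - intros h x Hh Hx. apply HM; auto. rewrite Rabs_pos_eq; lra.
Qed.

Lemma tau_neq0 : tau <> 0.
Proof. intros E. rewrite E in Htau. simpl in Htau. lra. Qed.

(** Differentiation in b brings down 2 pi i times the first moment, which [CI_mom1] leads back to
    the integral itself. The resulting first-order equation yields the Fourier transform of the
    Gaussian up to its constant. *)
Lemma CI_mom_gauss b : CI (mom 0 tau b) = CI (mom 0 tau 0) * ex (- (RtoC (b * b / 2) / tau)).
Proof.
  assert (Hn := tau_neq0).
  set (W := fun u => CI (mom 0 tau u) * ex (RtoC (u * u / 2) * / tau)).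
  assert (HD : forall u, Der W u 0).
  { intros u.
    assert (DE : Der (fun u => ex (RtoC (u * u / 2) * / tau)) u (2 * PI * Ci * (RtoC u / tau) * ex (RtoC (u * u / 2) * / tau))).
    { apply (Der_ex (fun u => RtoC (u * u / 2) * / tau)).
      apply (Der_ext (fun h => (/ 2) * / tau * (RtoC h * RtoC h))).
      - intros h. unfold Rdiv. rewrite !RtoC_mult, !RtoC_inv by lra. ring.
      - eapply Der_eq; [|apply Der_scal, Der_mult; apply Der_id]. field. auto. }
    eapply Der_eq; [|apply (Der_mult _ _ _ _ _ (CI_mom_b u) DE)].
    assert (E := CI_mom1 u).
    assert (E' : CI (mom 1 tau u) = - (RtoC u * CI (mom 0 tau u)) / tau).
    { replace (CI (mom 1 tau u)) with ((tau * CI (mom 1 tau u) + RtoC u * CI (mom 0 tau u) - RtoC u * CI (mom 0 tau u)) / tau) by (field; auto).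
      rewrite E. field. auto. }
    rewrite E'. field. auto. }
  assert (E := Der_zero_const W b 0 (fun z _ => HD z)). unfold W in E.
  replace (0 * 0 / 2)%R with 0%R in E by field.
  replace (RtoC 0 * / tau) with (RtoC 0) in E by ring. rewrite ex_0, Cmult_1_r in E.
  rewrite <- E, <- Cmult_assoc, <- ex_plus.
  replace (RtoC (b * b / 2) * / tau + - (RtoC (b * b / 2) / tau)) with (RtoC 0) by (unfold Cdiv; ring).
  rewrite ex_0. ring.
Qed.
End Gauss.

(** * Jacobi's inversion formula *)

(** The tail outside a finite list is small uniformly in [x], hence so is its integral. *)
Lemma CI_csum {I : Type} (f : I -> R -> C) (g : I -> R) M : (forall i, Cont (f i)) ->
  (forall i x, (Cmod (f i x) <= g i)%R) -> rbound g M -> Cont (fun x => Sum (fun i => f i x)) ->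
  csum (fun i => CI (f i)) (CI (fun x => Sum (fun i => f i x))).
Proof.
  intros Hf Hg HM HC eps He.
  destruct (dominated_tail g M (eps / 4)) as [L0 H0]; auto; [|lra|].
  - intros i. eapply Rle_trans; [apply Cmod_ge_0|apply (Hg i 0%R)].
  - exists L0. intros L HL Hi.
    rewrite <- CI_lsum by auto.
    replace (CI (fun x => lsum (fun i => f i x) L) - CI (fun x => Sum (fun i => f i x)))
      with (- (CI (fun x => Sum (fun i => f i x) + (-(1)) * lsum (fun i => f i x) L))).
    2:{ rewrite CI_plus, CI_scal; auto using Cont_lsum, Cont_scal. ring. }
    rewrite Cmod_opp. apply Rle_lt_trans with (2 * (eps / 4))%R; [|lra].
    apply CI_bound_const.
    + apply Cont_plus; auto. apply Cont_scal, Cont_lsum; auto.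
    + intros x _. replace (Sum (fun i => f i x) + - (1) * lsum (fun i => f i x) L) with (Sum (fun i => f i x) - lsum (fun i => f i x) L) by ring.
      apply (H0 (fun i => f i x)); auto. apply summable_csum. eapply summable_le; eauto.
Qed.

Lemma mom_t_unif tau sig : (0 < Im tau)%R -> exists d M, (0 < d)%R /\
  forall x h : R, (Rabs x <= 1)%R -> (Rabs h <= d)%R -> (0 < Im (tau + RtoC h * sig))%R /\
  (Cmod (mom 0 (tau + RtoC h * sig) 0 x - mom 0 tau 0 x - h * (PI * Ci * sig * mom 2 tau 0 x)) <= 4 * M * (h * h))%R.
Proof.
  intros Ht. assert (HPI := PI_RGT_0). assert (Hs0 := Cmod_ge_0 sig).
  (* With this [d], moving tau by h sig uses up at most half of the Gaussian decay. *)
  set (d := (Im tau / (2 * (Cmod sig + 1)))%R).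
  assert (Hd : (0 < d)%R) by (apply Rdiv_lt_0_compat; lra).
  assert (Hds : (d * Cmod sig <= Im tau / 2)%R).
  { replace (Im tau / 2)%R with (d * (Cmod sig + 1))%R by (unfold d; field; lra). nra. }
  destruct (gauss_unif (PI * Im tau / 2) 4 1) as [M HM]; [nra|lra|].
  exists d, (PI * Cmod sig * (PI * Cmod sig) * M)%R. split; auto. intros x h Hx Hh. split.
  { rewrite Im_plus, Im_scal. assert (H1 := im_le_Cmod sig).
    assert (Rabs (h * Im sig) <= d * Cmod sig)%R.
    { rewrite Rabs_mult. apply Rmult_le_compat; auto using Rabs_pos. }
    apply Rabs_le_between in H. lra. }
  set (B := fun n : Z => PI * Ci * sig * RtoC ((IZR n + x) * (IZR n + x))).
  assert (HB : forall n, (Cmod (B n) = PI * Cmod sig * ((IZR n + x) * (IZR n + x)))%R).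
  { intros n. unfold B. rewrite !Cmod_mult, Cmod_Ci, !Cmod_R, (Rabs_pos_eq PI) by lra.
    rewrite Rabs_pos_eq by apply (Rle_0_sqr (IZR n + x)). ring. }
  assert (Hb : rbound (fun n : Z => (Cmod (RtoC ((IZR n + x) ^ 0) * gt tau 0 (IZR n + x)) * (Cmod (B n) * Cmod (B n)) * exp (d * Cmod (B n)))%R)
     (PI * Cmod sig * (PI * Cmod sig) * M)).
  { eapply rbound_le; [|apply rbound_scal; [|apply (HM x Hx)]].
    2:{ assert (0 <= PI * Cmod sig)%R by nra. nra. }
    intros n. cbv beta. rewrite HB, Cmod_mult, Cmod_gt, Cmod_R. set (y := (IZR n + x)%R).
    simpl pow. rewrite Rabs_R1, Rmult_1_l.
    assert (Hy4 := abs_pow_exp y 4). assert (Hy0 : (0 <= y * y)%R) by nra.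
    replace (Rabs (y ^ 4)) with (y * y * (y * y))%R in Hy4.
    2:{ simpl. rewrite Rmult_1_r, Rabs_pos_eq; [ring|nra]. }
    simpl INR in Hy4. replace (1 + 1 + 1 + 1)%R with 4%R in Hy4 by ring.
    rewrite exp_plus.
    assert (HE : (exp (- (PI * Im tau) * (y * y)) * exp (d * (PI * Cmod sig * (y * y))) <= exp (- (PI * Im tau / 2) * (y * y)))%R).
    { rewrite <- exp_plus. apply exp_le_le.
      assert (d * Cmod sig * (PI * (y * y)) <= Im tau / 2 * (PI * (y * y)))%R by (apply Rmult_le_compat_r; nra).
      nra. }
    set (E1 := exp (- (PI * Im tau) * (y * y))) in *. set (E2 := exp (d * (PI * Cmod sig * (y * y)))) in *.
    set (E3 := exp (- (PI * Im tau / 2) * (y * y))) in *. set (E4 := exp (4 * Rabs y)) in *.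
    assert (0 < E1)%R by apply exp_pos. assert (0 < E2)%R by apply exp_pos. assert (0 < E3)%R by apply exp_pos.
    replace (E1 * (PI * Cmod sig * (y * y) * (PI * Cmod sig * (y * y))) * E2)%R
      with (PI * Cmod sig * (PI * Cmod sig) * ((E1 * E2) * (y * y * (y * y))))%R by ring.
    apply Rmult_le_compat_l; [assert (0 <= PI * Cmod sig)%R by nra; nra|].
    apply Rmult_le_compat; nra. }
  destruct (expsum_deriv _ B d _ (Rlt_le _ _ Hd) (mom_summable tau Ht 0 0 x) Hb) as [H1 H2].
  destruct (H2 (RtoC h)) as [_ H3]; [rewrite Cmod_R; auto|].
  replace (h * h)%R with (Cmod (RtoC h) * Cmod (RtoC h))%R.
  2:{ rewrite Cmod_R, <- Rabs_mult. apply Rabs_pos_eq. nra. }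
  eapply Rle_trans; [|exact H3]. apply Req_le. f_equal.
  assert (E1 : mom 0 (tau + RtoC h * sig) 0 x = Sum (fun n : Z => RtoC ((IZR n + x) ^ 0) * gt tau 0 (IZR n + x) * Cexp (RtoC h * B n))).
  { apply Sum_ext. intros n. rewrite <- Cmult_assoc. f_equal. unfold gt, B.
    replace (Cexp (RtoC h * (PI * Ci * sig * RtoC ((IZR n + x) * (IZR n + x))))) with (ex (RtoC h * sig * RtoC ((IZR n + x) * (IZR n + x) / 2))).
    - rewrite <- ex_plus. f_equal. ring.
    - unfold ex. f_equal. unfold Rdiv. rewrite (RtoC_mult _ (/ 2)), RtoC_inv by lra. field. }
  assert (E2 : PI * Ci * sig * mom 2 tau 0 x = Sum (fun n : Z => RtoC ((IZR n + x) ^ 0) * gt tau 0 (IZR n + x) * B n)).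
  { unfold mom. rewrite <- Sum_scal by (apply mom_summable; auto). apply Sum_ext. intros n. unfold B. simpl pow.
    rewrite Rmult_1_r, !RtoC_mult. ring. }
  rewrite E1, E2. reflexivity.
Qed.

(** The integral of e(x^2 tau / 2) over the real line, that is (tau / i)^(-1/2): the constant of the
    inversion formula. It is pinned down by a differential equation and by its value at [Ci]. *)
Definition cth (tau : C) : C := CI (mom 0 tau 0).

Lemma cth_Der tau sig (s : R) : (0 < Im (tau + RtoC s * sig))%R ->
  Der (fun u => cth (tau + RtoC u * sig)) s (- (sig * cth (tau + RtoC s * sig) / (2 * (tau + RtoC s * sig)))).
Proof.
  intros H. set (t := tau + RtoC s * sig) in *.
  assert (Ht := tau_neq0 t H).
  destruct (mom_t_unif t sig H) as [d [M [Hd HM]]].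
  assert (Et : forall h : R, tau + RtoC (s + h) * sig = t + RtoC h * sig).
  { intros h. unfold t. rewrite RtoC_plus. ring. }
  assert (D : Der (fun u => CI (mom 0 (tau + RtoC u * sig) 0)) s (CI (fun x => PI * Ci * sig * mom 2 t 0 x))).
  { apply (CI_Der (fun u => mom 0 (tau + RtoC u * sig) 0) _ s d (4 * M)); auto.
    - intros u Hu. apply mom_Cont0.
      replace u with (s + (u - s))%R by ring. rewrite Et. apply (HM 0%R); auto. rewrite Rabs_R0; lra.
    - apply Cont_scal, mom_Cont2; auto.
    - intros h x Hh Hx. rewrite Et. fold t. apply HM; auto. rewrite Rabs_pos_eq; lra. }
  rewrite CI_scal in D by (apply mom_Cont2; auto).
  eapply Der_eq; [|exact D].
  assert (E := CI_mom2 t H). fold (cth t) in E.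
  assert (HPC : 2 * PI * Ci <> 0).
  { apply Cmult_neq_0; [apply Cmult_neq_0; apply RtoC_neq0; [lra|apply PI_neq0]|].
    intros E0. assert (E1 := Cmod_Ci). rewrite E0, Cmod_0 in E1. lra. }
  replace (PI * Ci * sig * CI (mom 2 t 0)) with (sig * (cth t + 2 * PI * Ci * t * CI (mom 2 t 0) - cth t) / (2 * t)) by (field; auto).
  rewrite E. field. auto.
Qed.

(** Along a segment the equation c' = - c / (2 tau) makes c^2 tau constant; squaring avoids the
    choice of a branch. *)
Lemma cth_sq_path t0 t1 : (0 < Im t0)%R -> (0 < Im t1)%R -> cth t1 * cth t1 * t1 = cth t0 * cth t0 * t0.
Proof.
  intros H0 H1. set (sig := t1 - t0).
  assert (Hp : forall s : R, (0 <= s <= 1)%R -> (0 < Im (t0 + RtoC s * sig))%R).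
  { intros s Hs. unfold sig. rewrite Im_plus, Im_scal, Im_minus.
    destruct (Rle_dec (Im t0) (Im t1)); nra. }
  set (W := fun s : R => cth (t0 + RtoC s * sig) * cth (t0 + RtoC s * sig) * (t0 + RtoC s * sig)).
  assert (E : W 1%R = W 0%R).
  { apply Der_zero_const. intros z Hz. rewrite Rmin_left, Rmax_right in Hz by lra.
    assert (Hz' := Hp z Hz). assert (Hn := tau_neq0 _ Hz').
    assert (D := cth_Der t0 sig z Hz').
    unfold W. eapply Der_eq; [|apply Der_mult; [apply Der_mult; exact D|
      apply Der_plus; [apply Der_const|apply (Der_mult RtoC (fun _ => sig)); [apply Der_id|apply Der_const]]]].
    cbv beta. field. auto. }
  unfold W in E. replace (t0 + 1 * sig) with t1 in E by (unfold sig; ring).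
  replace (t0 + 0 * sig) with t0 in E by ring. exact E.
Qed.

Lemma Im_neg_inv tau : (0 < Im tau)%R -> (0 < Im (- / tau))%R.
Proof.
  intros H. assert (Hn := tau_neq0 tau H).
  destruct tau as [x y]. simpl in H. unfold Cinv, Copp; simpl.
  replace (- (- y / (x * (x * 1) + y * (y * 1))))%R with (y / (x * x + y * y))%R by (field; nra).
  apply Rdiv_lt_0_compat; auto. nra.
Qed.

Definition th (a b : R) (tau : C) : C := Sum (fun n : Z => gt tau b (IZR n + a)).

Lemma th_mom a b tau : th a b tau = mom 0 tau b a.
Proof. apply Sum_ext. intros n. simpl. ring. Qed.

Lemma gt_summable tau a b : (0 < Im tau)%R -> summable (fun n : Z => gt tau b (IZR n + a)).
Proof.
  intros H. eapply summable_ext; [|apply (mom_summable tau H 0 b a)]. intros n; simpl; ring.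
Qed.

Lemma mom_bounded tau : (0 < Im tau)%R -> exists M, forall b x, (Cmod (mom 0 tau b x) <= M)%R.
Proof.
  intros H. destruct (gauss_unif (PI * Im tau) 0 1) as [M HM]; [apply gt_v; auto|lra|].
  exists M. intros b x. destruct (nearest_int x) as [n Hn].
  replace x with ((x - IZR n) + IZR n)%R by ring.
  rewrite (periodic_Z (mom 0 tau b)) by (intros; apply mom_per; auto).
  apply Sum_bound. eapply rbound_le; [|apply (HM (x - IZR n)%R); lra].
  intros k. cbv beta. rewrite Cmod_mult, Cmod_gt, Cmod_R. simpl pow. rewrite Rabs_R1. apply Req_le.
  rewrite Rmult_1_l. f_equal. ring.
Qed.

(** Poisson summation: both sides have period 1 in [a] and the same Fourier coefficients, given by
    [CI_mom_gauss] on the left and visible in the series on the right; [fejer_unique] then gives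
    equality at the point [a]. *)
Lemma th_inv tau a b : (0 < Im tau)%R ->
  th a b tau = cth tau * ex (RtoC (a * b)) * th (- b) a (- / tau).
Proof.
  intros H. set (tau' := - / tau). assert (H' : (0 < Im tau')%R) by (apply Im_neg_inv; auto).
  assert (Hn := tau_neq0 tau H).
  (* The right-hand side as a function of x = a; [fm] below are its terms as a Fourier series. *)
  set (Hf := fun x : R => cth tau * (ex (RtoC (b * (x - 0))) * mom 0 tau' x (- b))).
  set (D := fun x => mom 0 tau b x - Hf x).
  set (A := fun m : Z => cth tau * gt tau' 0 (IZR m + - b)).
  set (fm := fun (m : Z) (x : R) => A m * ex (RtoC (IZR m * (x - 0)))).
  assert (EH : forall x, Hf x = Sum (fun m => fm m x)).
  { intros x. unfold Hf, fm, A, mom. rewrite <- Sum_scal by (apply mom_summable; auto).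
    rewrite <- Sum_scal by (apply summable_scal, mom_summable; auto). apply Sum_ext. intros m.
    simpl pow. replace x with (0 + x)%R at 2 by ring. rewrite gt_shift_b.
    replace (Cexp (RtoC x * (2 * PI * Ci * RtoC (IZR m + - b)))) with (ex (RtoC (x * (IZR m + - b)))).
    2:{ unfold ex. rewrite RtoC_mult. f_equal. ring. }
    replace (RtoC (IZR m * (x - 0))) with (RtoC (b * (x - 0)) + RtoC (x * (IZR m + - b))).
    2:{ rewrite <- RtoC_plus. f_equal. ring. }
    rewrite ex_plus. ring. }
  (* After inversion, x occupies the place of the linear parameter b of the Gaussian, so
     [mom_b_unif] applies. *)
  assert (DH : forall x, exists l, Der Hf x l).
  { intros x. destruct (mom_b_unif tau' H' x (Rabs (- b)) (Rabs_pos _)) as [M HM].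
    eexists. apply Der_scal. apply Der_mult; [apply Der_ex_lin|].
    exists 1%R, (4 * M)%R. split; [lra|]. intros h Hh. apply HM; auto. lra. }
  assert (CH : Cont Hf).
  { apply (Der_Cont _ (fun x => epsilon (inhabits (RtoC 0)) (Der Hf x))).
    intros x. apply epsilon_spec. apply DH. }
  assert (SA : forall x, summable (fun m => fm m x)).
  { intros x. destruct (gt_summable tau' (- b) 0 H') as [M HM].
    exists (Cmod (cth tau) * M)%R. eapply rbound_le; [|apply rbound_scal; [apply Cmod_ge_0|exact HM]].
    intros m. cbv beta. unfold fm, A. rewrite !Cmod_mult, Cmod_ex_real. lra. }
  assert (HD0 : D a = 0).
  { destruct (DH a) as [l Hl].
    destruct (mom_bounded tau H) as [M1 HM1]. destruct (mom_bounded tau' H') as [M2 HM2].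
    apply (fejer_unique a D (2 * PI * Ci * (tau * mom 1 tau b a + RtoC b * mom 0 tau b a) + (-(1)) * l) (M1 + Cmod (cth tau) * M2)).
    - apply Cont_minus; auto. apply mom_Cont0; auto.
    - intros x. unfold D. rewrite mom_per by auto.
      replace (Hf (x + 1)%R) with (Hf x); auto. rewrite !EH. symmetry.
      apply Sum_ext. intros m. unfold fm. f_equal. apply (ex_eq _ _ m). rewrite <- RtoC_plus. f_equal. ring.
    - apply (Der_ext (fun x => mom 0 tau b x + (-(1)) * Hf x)); [intros; unfold D; ring|].
      apply Der_plus; [apply mom_Der0; auto|apply Der_scal; auto].
    - intros x. unfold D, Cminus. eapply Rle_trans; [apply Cmod_triangle|]. rewrite Cmod_opp.
      apply Rplus_le_compat; [apply HM1|]. unfold Hf. rewrite !Cmod_mult, Cmod_ex_real, Rmult_1_l.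
      apply Rmult_le_compat_l; [apply Cmod_ge_0|apply HM2].
    - intros m. assert (Cm : Cont (fun x => ex (RtoC (IZR m * x)))).
      { apply (Cont_ext (fun x => ex (RtoC (IZR m * (x - 0))))); [intros x; do 3 f_equal; ring|apply Cont_ex_lin]. }
      rewrite (CI_ext _ (fun x => mom 0 tau (b + IZR m) x + (-(1)) * (Hf x * ex (RtoC (IZR m * x))))).
      + rewrite CI_plus, CI_scal; auto using Cont_mult, Cont_scal, mom_Cont0.
        rewrite CI_mom_gauss by auto. fold (cth tau).
        rewrite (CI_ext (fun x => Hf x * ex (RtoC (IZR m * x))) (fun x => Sum (fun k => fm k x * ex (RtoC (IZR m * x))))).
        2:{ intros x. rewrite EH, Cmult_comm, <- Sum_scal by auto. apply Sum_ext. intros; ring. }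
        destruct (gt_summable tau' (- b) 0 H') as [M HM].
        assert (Hc : csum (fun k => CI (fun x => fm k x * ex (RtoC (IZR m * x)))) (CI (fun x => Sum (fun k => fm k x * ex (RtoC (IZR m * x)))))).
        { apply (CI_csum (fun k x => fm k x * ex (RtoC (IZR m * x))) (fun k => (Cmod (cth tau) * Cmod (gt tau' 0 (IZR k + - b)))%R) (Cmod (cth tau) * M)).
          - intros k. apply Cont_mult; auto. apply Cont_scal, Cont_ex_lin.
          - intros k x. unfold fm, A. rewrite !Cmod_mult, !Cmod_ex_real. lra.
          - apply rbound_scal; auto. apply Cmod_ge_0.
          - apply (Cont_ext (fun x => Hf x * ex (RtoC (IZR m * x)))); [|apply Cont_mult; auto].
            intros x. rewrite EH, Cmult_comm, <- Sum_scal by auto. apply Sum_ext. intros; ring. }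
        (* Only the index k = - m survives the orthogonality of the exponentials. *)
        assert (Hv : csum (fun k => CI (fun x => fm k x * ex (RtoC (IZR m * x)))) (A (- m)%Z)).
        { replace (A (- m)%Z) with (CI (fun x => fm (- m)%Z x * ex (RtoC (IZR m * x)))).
          - apply (csum_at (fun k => CI (fun x => fm k x * ex (RtoC (IZR m * x))))). intros k Hk.
            rewrite (CI_ext _ (fun x => A k * ex (RtoC (IZR (k + m) * (x - 0))))).
            + rewrite CI_scal, CI_ex_Z by (try lia; apply Cont_ex_lin). ring.
            + intros x. unfold fm. rewrite <- Cmult_assoc, <- ex_plus, <- RtoC_plus, plus_IZR. do 3 f_equal. ring.
          - rewrite (CI_ext _ (fun x => A (- m)%Z)); [apply CI_const|].
            intros x. unfold fm. rewrite <- Cmult_assoc, <- ex_plus, <- RtoC_plus, opp_IZR.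
            replace (- IZR m * (x - 0) + IZR m * x)%R with 0%R by ring. rewrite ex_0. ring. }
        rewrite (csum_unique _ _ _ Hc Hv). unfold A, gt, tau'. rewrite opp_IZR.
        replace (RtoC ((- IZR m + - b) * (- IZR m + - b) / 2) * (- / tau) + RtoC ((- IZR m + - b) * 0)) with
          (- (RtoC ((b + IZR m) * (b + IZR m) / 2) / tau)); [ring|].
        rewrite Rmult_0_r. replace ((- IZR m + - b) * (- IZR m + - b))%R with ((b + IZR m) * (b + IZR m))%R by ring.
        unfold Cdiv. ring.
      + intros x. unfold D.
        assert (E : mom 0 tau b x * ex (RtoC (IZR m * x)) = mom 0 tau (b + IZR m) x).
        { unfold mom. rewrite Cmult_comm, <- Sum_scal by (apply mom_summable; auto).
          apply Sum_ext. intros n. rewrite gt_shift_b. simpl pow.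
          replace (Cexp (RtoC (IZR m) * (2 * PI * Ci * RtoC (IZR n + x)))) with (ex (RtoC (IZR m * x))); [ring|].
          transitivity (ex (RtoC (IZR m * (IZR n + x)))).
          - symmetry. apply (ex_eq _ _ (m * n)). rewrite <- RtoC_plus, mult_IZR. f_equal. ring.
          - unfold ex. rewrite RtoC_mult. f_equal. ring. }
        rewrite <- E. ring. }
  rewrite !th_mom. unfold D, Hf in HD0.
  replace (b * (a - 0))%R with (a * b)%R in HD0 by ring.
  replace (mom 0 tau b a) with (mom 0 tau b a - cth tau * (ex (RtoC (a * b)) * mom 0 tau' a (- b)) + cth tau * (ex (RtoC (a * b)) * mom 0 tau' a (- b))) by ring.
  rewrite HD0. ring.
Qed.

(** At tau = i and a = b = 0 the inversion formula reads theta = c theta, and theta is a sum of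
    positive terms one of which is 1. *)
Lemma cth_i_sq : cth Ci = 1.
Proof.
  assert (Hi : (0 < Im Ci)%R) by (simpl; lra).
  assert (E := th_inv Ci 0 0 Hi).
  replace (- / Ci) with Ci in E.
  2:{ apply C_eq; simpl; field. }
  rewrite Ropp_0, Rmult_0_l, ex_0 in E.
  assert (Hne : th 0 0 Ci <> 0).
  { intros E0.
    assert (Hs := summable_csum _ (gt_summable Ci 0 0 Hi)). fold (th 0 0 Ci) in Hs. rewrite E0 in Hs.
    destruct (Hs 1%R Rlt_0_1) as [L0 H0].
    destruct (NoDup_cover (0%Z :: L0)) as [L [HL [Hi2 _]]].
    specialize (H0 L HL (fun x Hx => Hi2 x (or_intror Hx))).
    assert (Eg : forall y, gt Ci 0 y = RtoC (exp (- PI * (y * y)))).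
    { intros y. unfold gt, ex, Cexp. apply C_eq; C_simpl; simpl.
      - match goal with |- (exp ?u * cos ?v = _)%R => replace v with 0%R by ring; replace u with (- PI * (y * y))%R by field end.
        rewrite cos_0. ring.
      - match goal with |- (exp ?u * sin ?v = _)%R => replace v with 0%R by ring end.
        rewrite sin_0. ring. }
    assert (El : forall L, lsum (fun n : Z => gt Ci 0 (IZR n + 0)) L = RtoC (rsum (fun n : Z => exp (- PI * ((IZR n + 0) * (IZR n + 0)))) L)).
    { intros l. induction l as [|x l IH]; simpl; auto. rewrite IH, Eg, RtoC_plus. auto. }
    rewrite El in H0. replace (RtoC (rsum (fun n : Z => exp (- PI * ((IZR n + 0) * (IZR n + 0)))) L) - 0) with (RtoC (rsum (fun n : Z => exp (- PI * ((IZR n + 0) * (IZR n + 0)))) L)) in H0 by ring.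
    rewrite Cmod_R in H0. apply Rabs_def2 in H0. destruct H0 as [H0 _].
    assert (H1 : (rsum (fun n : Z => exp (- PI * ((IZR n + 0) * (IZR n + 0)))) [0%Z] <= rsum (fun n : Z => exp (- PI * ((IZR n + 0) * (IZR n + 0)))) L)%R).
    { apply rsum_incl.
      - intros; left; apply exp_pos.
      - constructor; [auto|constructor].
      - intros x [<-|[]]. apply Hi2. left; auto. }
    simpl in H1. replace (- PI * ((0 + 0) * (0 + 0)))%R with 0%R in H1 by ring. rewrite exp_0 in H1. lra. }
  replace (cth Ci) with (cth Ci * 1 * th 0 0 Ci / th 0 0 Ci) by (field; auto).
  rewrite <- E. field. auto.
Qed.

Lemma cth_sq tau : (0 < Im tau)%R -> cth tau * cth tau * tau = Ci.
Proof.
  intros H. rewrite (cth_sq_path Ci tau); auto; [|simpl; lra]. rewrite cth_i_sq. ring.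
Qed.

(** * The square root cocycle *)

Lemma Re_pair (x y : R) : Re (x, y) = x. Proof. reflexivity. Qed.
Lemma Im_pair (x y : R) : Im (x, y) = y. Proof. reflexivity. Qed.

Lemma Csqrt_sq w : Csqrt w * Csqrt w = w.
Proof.
  assert (H := Cmod_sq w). assert (H1 := re_le_Cmod w). apply Rabs_le_between in H1.
  assert (A : (0 <= (Cmod w + Re w) / 2)%R) by lra.
  assert (B : (0 <= (Cmod w - Re w) / 2)%R) by lra.
  assert (A' := sqrt_sqrt _ A). assert (B' := sqrt_sqrt _ B).
  assert (E : (sqrt ((Cmod w + Re w) / 2) * sqrt ((Cmod w - Re w) / 2) = Rabs (Im w) / 2)%R).
  { rewrite <- sqrt_mult by auto.
    replace ((Cmod w + Re w) / 2 * ((Cmod w - Re w) / 2))%R with (Rabs (Im w) / 2 * (Rabs (Im w) / 2))%R.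
    - apply sqrt_square. assert (H2 := Rabs_pos (Im w)). lra.
    - replace (Rabs (Im w) / 2 * (Rabs (Im w) / 2))%R with ((Rabs (Im w) * Rabs (Im w)) / 4)%R by field.
      rewrite <- Rabs_mult, Rabs_pos_eq by apply (Rle_0_sqr (Im w)).
      replace (Im w * Im w)%R with (Cmod w * Cmod w - Re w * Re w)%R by lra. field. }
  unfold Csqrt. destruct (Rle_dec 0 (Im w)) as [P|P]; apply C_eq; C_simpl; rewrite ?Re_pair, ?Im_pair.
  - lra.
  - rewrite Rabs_pos_eq in E by auto. lra.
  - nra.
  - rewrite Rabs_left in E by lra. lra.
Qed.

Lemma Csqrt_facts (w : C) : w <> 0 ->
  (0 <= Re (Csqrt w))%R /\
  ((0 < Im w)%R -> (0 < Re (Csqrt w))%R /\ (0 < Im (Csqrt w))%R) /\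
  ((Im w < 0)%R -> (0 < Re (Csqrt w))%R /\ (Im (Csqrt w) < 0)%R) /\
  (Im w = 0%R -> ((0 < Re (Csqrt w))%R /\ Im (Csqrt w) = 0%R) \/ (Re (Csqrt w) = 0%R /\ (0 < Im (Csqrt w))%R)).
Proof.
  intros Hw. assert (Hs := Csqrt_sq w).
  assert (HR : (0 <= Re (Csqrt w))%R) by (unfold Csqrt; simpl; apply sqrt_pos).
  assert (HI : (0 <= Im w -> 0 <= Im (Csqrt w))%R).
  { intros P. unfold Csqrt; simpl. destruct (Rle_dec 0 (Im w)); [apply sqrt_pos|tauto]. }
  assert (HI' : (Im w < 0 -> Im (Csqrt w) <= 0)%R).
  { intros P. unfold Csqrt; simpl. destruct (Rle_dec 0 (Im w)); [lra|].
    assert (H := sqrt_pos ((Cmod w - Re w) / 2)). lra. }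
  set (p := Csqrt w) in *.
  assert (EI : (Im w = 2 * (Re p * Im p))%R) by (rewrite <- Hs, Im_mult; ring).
  assert (Hp : p <> 0) by (intros E; apply Hw; rewrite <- Hs, E; ring).
  split; [auto|]. repeat split; intros; try nra.
  - assert (0 <= Im p)%R by (apply HI; lra).
    destruct (Rle_lt_or_eq_dec _ _ HR) as [P|P].
    + left. split; auto. nra.
    + right. split; auto. destruct (Rle_lt_or_eq_dec _ _ H0) as [Q|Q]; auto.
      exfalso. apply Hp. apply C_eq; simpl; auto.
Qed.

(** The cases in which the branch of [Csqrt] cannot jump between [u] and [u']: the same open
    half-plane, or the same real number. The automorphy factors of one matrix at two points are
    always so related, which replaces a connectedness argument. *)
Definition same_type (u u' : C) : Prop :=
  (0 < Im u /\ 0 < Im u')%R \/ (Im u < 0 /\ Im u' < 0)%R \/ (u = u' /\ Im u = 0%R).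

Lemma C_sq_eq (a b : C) : a * a = b * b -> a = b \/ a = - b.
Proof.
  intros H. destruct (classic (a = b)) as [E|E]; auto. right.
  assert (H1 : (a - b) * (a + b) = 0) by (replace ((a - b) * (a + b)) with (a * a - b * b) by ring; rewrite H; ring).
  apply NNPP. intros N. revert H1. apply Cmult_neq_0.
  - intros Z. apply E. replace a with (a - b + b) by ring. rewrite Z. ring.
  - intros Z. apply N. replace a with (a + b - b) by ring. rewrite Z. ring.
Qed.

Lemma Rmult_pos_neg x y : (0 < x -> y < 0 -> x * y < 0)%R.
Proof. intros; nra. Qed.

(** The signs of the real and imaginary parts of the two roots decide how their product compares
    with the root of the product, and these signs depend only on the types. When both factors lie in
    the same open half-plane, the type of the product is consulted as well. *)
Lemma Csqrt_sign_aux (u w u' w' : C) : u <> 0 -> w <> 0 -> u' <> 0 -> w' <> 0 ->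
  same_type u u' -> same_type w w' -> same_type (u * w) (u' * w') ->
  Csqrt (u * w) = Csqrt u * Csqrt w -> Csqrt (u' * w') = - (Csqrt u' * Csqrt w') -> False.
Proof.
  intros Hu Hw Hu' Hw' T1 T2 T3 E E'.
  assert (Hv : u * w <> 0) by (apply Cmult_neq_0; auto).
  assert (Hv' : u' * w' <> 0) by (apply Cmult_neq_0; auto).
  destruct (Csqrt_facts u Hu) as [A0 [A1 [A2 A3]]]. destruct (Csqrt_facts w Hw) as [B0 [B1 [B2 B3]]].
  destruct (Csqrt_facts u' Hu') as [A0' [A1' [A2' A3']]]. destruct (Csqrt_facts w' Hw') as [B0' [B1' [B2' B3']]].
  destruct (Csqrt_facts _ Hv) as [D0 [D1 [D2 D3]]]. destruct (Csqrt_facts _ Hv') as [D0' [D1' [D2' D3']]].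
  assert (F : u = u' -> w = w' -> False).
  { intros <- <-. rewrite E in E'. assert (N : Csqrt u * Csqrt w = 0).
    { replace (Csqrt u * Csqrt w) with ((Csqrt u * Csqrt w - - (Csqrt u * Csqrt w)) / 2) by field.
      rewrite <- E'. field. }
    rewrite <- E in N. apply Hv. rewrite <- (Csqrt_sq (u * w)), N. ring. }
  assert (G : u * w = u' * w' -> Csqrt u' * Csqrt w' = - (Csqrt u * Csqrt w)).
  { intros Z. rewrite <- E, Z, E'. ring. }
  assert (e1 := f_equal Re E). assert (e2 := f_equal Im E). assert (e1' := f_equal Re E'). assert (e2' := f_equal Im E').
  rewrite ?Re_opp, ?Im_opp, Re_mult in e1. rewrite Im_mult in e2.
  rewrite Re_opp, Re_mult in e1'. rewrite Im_opp, Im_mult in e2'.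
  assert (z : u * w = u' * w' -> Im (Csqrt (u * w)) = Im (Csqrt (u' * w'))) by (intros ->; auto).
  revert A0 A1 A2 A3 B0 B1 B2 B3 A0' A1' A2' A3' B0' B1' B2' B3' D0 D1 D2 D3 D0' D1' D2' D3' e1 e2 e1' e2' z.
  set (a1 := Re (Csqrt u)). set (b1 := Im (Csqrt u)). set (a2 := Re (Csqrt w)). set (b2 := Im (Csqrt w)).
  set (c1 := Re (Csqrt u')). set (d1 := Im (Csqrt u')). set (c2 := Re (Csqrt w')). set (d2 := Im (Csqrt w')).
  set (a3 := Re (Csqrt (u * w))). set (b3 := Im (Csqrt (u * w))).
  set (c3 := Re (Csqrt (u' * w'))). set (d3 := Im (Csqrt (u' * w'))). intros.
  assert (pp := Rmult_lt_0_compat). assert (pn := Rmult_pos_neg).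
  destruct T1 as [[T1 T1']|[[T1 T1']|[T1 T1']]]; destruct T2 as [[T2 T2']|[[T2 T2']|[T2 T2']]].
  - destruct (A1 T1), (A1' T1'), (B1 T2), (B1' T2').
    assert (Q1 := pp a1 b2 ltac:(lra) ltac:(lra)). assert (Q2 := pp b1 a2 ltac:(lra) ltac:(lra)). assert (Q3 := pp c1 d2 ltac:(lra) ltac:(lra)). assert (Q4 := pp d1 c2 ltac:(lra) ltac:(lra)).
    destruct T3 as [[T3 T3']|[[T3 T3']|[T3 T3']]]; [destruct (D1' T3'); lra|destruct (D2 T3); lra|].
    specialize (z T3). lra.
  - destruct (A1' T1'), (B2' T2'). assert (Q1 := pp c1 c2 ltac:(lra) ltac:(lra)). assert (Q2 := pn d1 d2 ltac:(lra) ltac:(lra)). lra.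
  - assert (X : c2 = a2) by (unfold c2; rewrite <- T2; auto). assert (X' : d2 = b2) by (unfold d2; rewrite <- T2; auto).
    destruct (A1 T1), (A1' T1'). rewrite X, X' in *. destruct (B3 T2') as [[P Q]|[P Q]]; [rewrite Q in *|rewrite P in *].
    + assert (Q1 := pp c1 a2 ltac:(lra) ltac:(lra)). lra.
    + assert (Q1 := pp b1 b2 ltac:(lra) ltac:(lra)). lra.
  - destruct (A2' T1'), (B1' T2'). assert (Q1 := pp c1 c2 ltac:(lra) ltac:(lra)). assert (Q2 := pn d2 d1 ltac:(lra) ltac:(lra)). lra.
  - destruct (A2 T1), (A2' T1'), (B2 T2), (B2' T2').
    assert (Q1 := pn a1 b2 ltac:(lra) ltac:(lra)). assert (Q2 := pn a2 b1 ltac:(lra) ltac:(lra)). assert (Q3 := pn c1 d2 ltac:(lra) ltac:(lra)). assert (Q4 := pn c2 d1 ltac:(lra) ltac:(lra)).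
    destruct T3 as [[T3 T3']|[[T3 T3']|[T3 T3']]]; [destruct (D1 T3); lra|destruct (D2' T3'); lra|].
    specialize (z T3). lra.
  - assert (X : c2 = a2) by (unfold c2; rewrite <- T2; auto). assert (X' : d2 = b2) by (unfold d2; rewrite <- T2; auto).
    destruct (A2 T1), (A2' T1'). rewrite X, X' in *. destruct (B3 T2') as [[P Q]|[P Q]]; [rewrite Q in *|rewrite P in *].
    + assert (Q1 := pp c1 a2 ltac:(lra) ltac:(lra)). lra.
    + assert (Q1 := pn b2 d1 ltac:(lra) ltac:(lra)). lra.
  - assert (X : c1 = a1) by (unfold c1; rewrite <- T1; auto). assert (X' : d1 = b1) by (unfold d1; rewrite <- T1; auto).
    destruct (B1 T2), (B1' T2'). rewrite X, X' in *. destruct (A3 T1') as [[P Q]|[P Q]]; [rewrite Q in *|rewrite P in *].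
    + assert (Q1 := pp a1 c2 ltac:(lra) ltac:(lra)). lra.
    + assert (Q1 := pp b1 b2 ltac:(lra) ltac:(lra)). lra.
  - assert (X : c1 = a1) by (unfold c1; rewrite <- T1; auto). assert (X' : d1 = b1) by (unfold d1; rewrite <- T1; auto).
    destruct (B2 T2), (B2' T2'). rewrite X, X' in *. destruct (A3 T1') as [[P Q]|[P Q]]; [rewrite Q in *|rewrite P in *].
    + assert (Q1 := pp a1 c2 ltac:(lra) ltac:(lra)). lra.
    + assert (Q1 := pn b1 d2 ltac:(lra) ltac:(lra)). lra.
  - auto.
Qed.

Lemma Csqrt_mul_pm u w : Csqrt (u * w) = Csqrt u * Csqrt w \/ Csqrt (u * w) = - (Csqrt u * Csqrt w).
Proof.
  apply C_sq_eq. rewrite Csqrt_sq.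
  replace (Csqrt u * Csqrt w * (Csqrt u * Csqrt w)) with ((Csqrt u * Csqrt u) * (Csqrt w * Csqrt w)) by ring.
  rewrite !Csqrt_sq. auto.
Qed.

Lemma same_type_sym u u' : same_type u u' -> same_type u' u.
Proof. unfold same_type. intros [H|[H|[-> H]]]; tauto. Qed.

Lemma Csqrt_sign (u w u' w' e : C) : u <> 0 -> w <> 0 -> u' <> 0 -> w' <> 0 ->
  same_type u u' -> same_type w w' -> same_type (u * w) (u' * w') -> e = 1 \/ e = -(1) ->
  Csqrt u * Csqrt w = e * Csqrt (u * w) -> Csqrt u' * Csqrt w' = e * Csqrt (u' * w').
Proof.
  intros Hu Hw Hu' Hw' T1 T2 T3 He E.
  destruct (Csqrt_mul_pm u' w') as [P|P]; destruct He as [-> | ->].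
  - rewrite P. ring.
  - exfalso. apply (Csqrt_sign_aux u' w' u w); auto using same_type_sym. rewrite E. ring.
  - exfalso. apply (Csqrt_sign_aux u w u' w'); auto. rewrite E. ring.
  - rewrite P. ring.
Qed.

Lemma autf_Im A tau : (Im (autf A tau) = IZR (m21 A) * Im tau)%R.
Proof. unfold autf. C_simpl. ring. Qed.

Lemma autf_type A t t' : (0 < Im t)%R -> (0 < Im t')%R -> same_type (autf A t) (autf A t').
Proof.
  intros H H'. unfold same_type. rewrite !autf_Im.
  destruct (Rtotal_order (IZR (m21 A)) 0) as [P|[P|P]].
  - right; left; nra.
  - right; right. split; [unfold autf; rewrite P; ring|rewrite P; ring].
  - left; nra.
Qed.

Lemma autf_neq0 A tau : SL2Z A -> (0 < Im tau)%R -> autf A tau <> 0.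
Proof.
  intros HA H E. assert (EI := autf_Im A tau). rewrite E in EI. simpl in EI.
  assert (Hc : IZR (m21 A) = 0%R).
  { symmetry in EI. apply Rmult_integral in EI. destruct EI; lra. }
  unfold autf in E. rewrite Hc in E. apply (f_equal Re) in E. revert E. C_simpl. intros E.
  assert (Hd : (m22 A = 0)%Z) by (apply eq_IZR; simpl in *; lra).
  apply eq_IZR in Hc. unfold SL2Z in HA. rewrite Hd, Hc in HA. lia.
Qed.

Lemma mobius_Im A tau : SL2Z A -> (0 < Im tau)%R ->
  Im (mobius A tau) = (Im tau / (Cmod (autf A tau) * Cmod (autf A tau)))%R.
Proof.
  intros HA H. assert (Hn := autf_neq0 A tau HA H). assert (Hp := Cmod_pos _ Hn).
  assert (HD : (IZR (m11 A) * IZR (m22 A) - IZR (m12 A) * IZR (m21 A) = 1)%R).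
  { rewrite <- !mult_IZR, <- minus_IZR, HA. auto. }
  rewrite Cmod_sq. unfold mobius. set (w := autf A tau) in *.
  assert (Ew : (Re w * Re w + Im w * Im w <> 0)%R) by (rewrite <- Cmod_sq; nra).
  unfold Cdiv. rewrite Im_mult.
  assert (Ei : Re (/ w) = (Re w / (Re w * Re w + Im w * Im w))%R /\ Im (/ w) = (- Im w / (Re w * Re w + Im w * Im w))%R).
  { destruct w as [x y]. unfold Cinv; simpl. rewrite !Rmult_1_r. split; auto. }
  destruct Ei as [-> ->].
  assert (Rw : Re w = (IZR (m21 A) * Re tau + IZR (m22 A))%R) by (unfold w, autf; C_simpl; ring).
  assert (Iw : Im w = (IZR (m21 A) * Im tau)%R) by apply autf_Im.
  set (N := (Re w * Re w + Im w * Im w)%R) in *.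
  transitivity ((Im (IZR (m11 A) * tau + IZR (m12 A)) * Re w - Re (IZR (m11 A) * tau + IZR (m12 A)) * Im w) / N)%R.
  { unfold Rdiv. ring. }
  f_equal. rewrite Rw, Iw. C_simpl.
  replace (Im tau) with (Im tau * (IZR (m11 A) * IZR (m22 A) - IZR (m12 A) * IZR (m21 A)))%R at 4 by (rewrite HD; ring).
  ring.
Qed.

Lemma mobius_H A tau : SL2Z A -> (0 < Im tau)%R -> (0 < Im (mobius A tau))%R.
Proof.
  intros HA H. rewrite mobius_Im by auto. assert (Hp := Cmod_pos _ (autf_neq0 A tau HA H)).
  apply Rdiv_lt_0_compat; auto. nra.
Qed.

Lemma SL2Z_mul A B : SL2Z A -> SL2Z B -> SL2Z (mat2_mul A B).
Proof. unfold SL2Z, mat2_mul; simpl. intros HA HB. nia. Qed.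

Lemma autf_mul A B tau : SL2Z B -> (0 < Im tau)%R ->
  autf (mat2_mul A B) tau = autf A (mobius B tau) * autf B tau.
Proof.
  intros HB H. assert (Hn := autf_neq0 B tau HB H). unfold mobius. 
  unfold autf at 1 2. simpl. rewrite !plus_IZR, !mult_IZR, !RtoC_plus, !RtoC_mult.
  set (w := autf B tau) in *. field_simplify; auto. unfold w, autf. ring.
Qed.

Lemma mobius_mul A B tau : SL2Z A -> SL2Z B -> (0 < Im tau)%R ->
  mobius (mat2_mul A B) tau = mobius A (mobius B tau).
Proof.
  intros HA HB H. assert (Hn := autf_neq0 B tau HB H).
  assert (Hn2 := autf_neq0 A _ HA (mobius_H B tau HB H)).
  unfold mobius at 1 2. rewrite autf_mul by auto.
  replace (IZR (m11 (mat2_mul A B)) * tau + IZR (m12 (mat2_mul A B)))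
    with ((IZR (m11 A) * mobius B tau + IZR (m12 A)) * autf B tau).
  - field. auto.
  - simpl. rewrite !plus_IZR, !mult_IZR, !RtoC_plus, !RtoC_mult. unfold mobius.
    set (w := autf B tau) in *. field_simplify; auto. unfold w, autf. ring.
Qed.

(** By [Csqrt_sign] the sign cannot change with tau, so it is read off at [Ci]. *)
Lemma Csqrt_cocycle A B : SL2Z A -> SL2Z B -> exists e : C, (e = 1 \/ e = -(1)) /\
  forall tau, (0 < Im tau)%R ->
    Csqrt (autf A (mobius B tau)) * Csqrt (autf B tau) = e * Csqrt (autf (mat2_mul A B) tau).
Proof.
  intros HA HB. assert (Hi : (0 < Im Ci)%R) by (simpl; lra).
  assert (HAB := SL2Z_mul A B HA HB).
  assert (Ex : exists e : C, (e = 1 \/ e = -(1)) /\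
    Csqrt (autf A (mobius B Ci)) * Csqrt (autf B Ci) = e * Csqrt (autf (mat2_mul A B) Ci)).
  { rewrite autf_mul by auto. destruct (Csqrt_mul_pm (autf A (mobius B Ci)) (autf B Ci)) as [E|E].
    - exists 1. split; auto. rewrite E; ring.
    - exists (-(1)). split; auto. rewrite E; ring. }
  destruct Ex as [e [He E]]. exists e. split; auto. intros tau H.
  rewrite autf_mul in * by auto.
  apply (Csqrt_sign (autf A (mobius B Ci)) (autf B Ci)); auto using autf_neq0, mobius_H, autf_type.
  rewrite <- !autf_mul by auto. apply autf_type; auto.
Qed.

(* Jacobi's theta function with characteristics, vanishing at the integral
   (al, be); the prefactor makes SL2(Z) act on (al, be) with a multiplier that
   does not depend on (al, be). *)
Definition K (al be : R) (tau : C) : C :=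
  ex (RtoC (- (al * be + al) / 2)) * th (al + 1 / 2) (be + 1 / 2) tau.

Lemma gt_mul_ex tau b y r : gt tau b y * ex (RtoC r) = ex (RtoC (y * y / 2) * tau + RtoC (y * b + r)).
Proof. unfold gt. rewrite <- ex_plus. f_equal. rewrite !RtoC_plus. ring. Qed.

Lemma K_scal_th c al be tau : (0 < Im tau)%R -> c * th al be tau = Sum (fun n : Z => c * gt tau be (IZR n + al)).
Proof. intros H. symmetry. apply Sum_scal. apply gt_summable; auto. Qed.

Lemma Zsq_even (n : Z) : exists k, (n * n = n + 2 * k)%Z.
Proof.
  destruct (Zeven_odd_dec n) as [E|E].
  - apply Zeven_ex in E. destruct E as [m ->]. exists (2 * m * m - m)%Z. ring.
  - apply Zodd_ex in E. destruct E as [m ->]. exists (2 * m * m + m)%Z. ring.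
Qed.

Lemma K_T (k : Z) al be tau : (0 < Im tau)%R ->
  K al be (tau + RtoC (IZR k)) = ex (RtoC (IZR k / 8)) * K al (be + IZR k * al) tau.
Proof.
  intros H. unfold K. rewrite Cmult_assoc, <- ex_plus, <- RtoC_plus.
  rewrite !K_scal_th by (C_simpl; lra). apply Sum_ext. intros n.
  unfold gt. rewrite <- !ex_plus.
  (* Since n^2 = n + 2 j, the phase k n^2 / 2 is linear in n modulo integers. *)
  destruct (Zsq_even n) as [j Hj]. apply (f_equal IZR) in Hj. rewrite mult_IZR, plus_IZR, mult_IZR in Hj.
  apply (ex_eq _ _ (k * j + k * n)).
  rewrite plus_IZR, !mult_IZR.
  set (y := (IZR n + (al + 1 / 2))%R).
  transitivity (RtoC (y * y / 2) * tau + RtoC (IZR k / 8 + - (al * (be + IZR k * al) + al) / 2 + y * (be + IZR k * al + 1 / 2) + (IZR k * IZR j + IZR k * IZR n))).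
  2:{ rewrite !RtoC_plus. ring. }
  transitivity (RtoC (y * y / 2) * tau + RtoC (- (al * be + al) / 2 + y * y / 2 * IZR k + y * (be + 1 / 2))).
  { rewrite !RtoC_plus, (RtoC_mult (y * y / 2) (IZR k)). ring. }
  f_equal. f_equal. unfold y.
  replace (IZR j) with ((IZR n * IZR n - IZR n) / 2)%R by lra. field.
Qed.

(** The reflection n -> - n - 1 of the lattice shifted by 1/2; the half-integral characteristics
    produce the sign. *)
Lemma K_neg al be tau : (0 < Im tau)%R -> K (- al) (- be) tau = - K al be tau.
Proof.
  intros H. replace (- K al be tau) with (ex (RtoC (1 / 2)) * K al be tau).
  2:{ replace (RtoC (1 / 2)) with (1 / 2) by (rewrite RtoC_div; auto; lra). rewrite ex_half. ring. }
  unfold K. rewrite Cmult_assoc, <- ex_plus, <- RtoC_plus. rewrite !K_scal_th by auto.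
  rewrite <- (Sum_bij (fun n : Z => (- n - 1)%Z) (fun n : Z => (- n - 1)%Z)).
  - apply Sum_ext. intros n. unfold gt. rewrite <- !ex_plus. apply (ex_eq _ _ (- n - 1)).
    rewrite minus_IZR, opp_IZR.
    replace ((- IZR n - 1 + (- al + 1 / 2)) * (- IZR n - 1 + (- al + 1 / 2)) / 2)%R with ((IZR n + (al + 1 / 2)) * (IZR n + (al + 1 / 2)) / 2)%R by field.
    match goal with |- RtoC ?a + (?b + RtoC ?c) = RtoC ?d + (?b + RtoC ?e) + RtoC ?f =>
      transitivity (b + RtoC (a + c)); [rewrite RtoC_plus; ring|];
      transitivity (b + RtoC (d + e + f)); [|rewrite !RtoC_plus; ring] end.
    f_equal. f_equal. field.
  - intros; lia.
  - intros; lia.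
  - apply summable_scal, gt_summable; auto.
Qed.

Lemma th_shift_b a b tau : (0 < Im tau)%R -> th a (b + 1) tau = ex (RtoC a) * th a b tau.
Proof.
  intros H. rewrite K_scal_th by auto. apply Sum_ext. intros n.
  rewrite Cmult_comm, gt_mul_ex. unfold gt. apply (ex_eq _ _ n).
  rewrite <- Cplus_assoc, <- RtoC_plus. f_equal. f_equal. ring.
Qed.

Lemma cth_neq0 tau : (0 < Im tau)%R -> cth tau <> 0.
Proof.
  intros H E. assert (E1 := cth_sq tau H). rewrite E in E1.
  assert (E2 := Cmod_Ci). rewrite <- E1, !Cmult_0_l, Cmod_0 in E2. lra.
Qed.

(** [th_inv] is taken at (be + 1/2, - al - 1/2); the half shifts built into [K] then differ by one
    unit from the desired ones, which [th_shift_b] corrects. *)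
Lemma K_S al be tau : (0 < Im tau)%R ->
  K al be (- / tau) = ex (RtoC (- (1) / 4)) / cth tau * K be (- al) tau.
Proof.
  intros H. assert (Hc := cth_neq0 tau H).
  assert (E := th_inv tau (be + 1 / 2) (- (al + 1 / 2)) H). rewrite Ropp_involutive in E.
  assert (E2 := th_shift_b (be + 1 / 2) (- (al + 1 / 2)) tau H).
  replace (- (al + 1 / 2) + 1)%R with (- al + 1 / 2)%R in E2 by field.
  rewrite E in E2. unfold K. rewrite E2.
  set (X := th (al + 1 / 2) (be + 1 / 2) (- / tau)).
  replace (ex (RtoC (- (1) / 4)) / cth tau * (ex (RtoC (- (be * - al + be) / 2)) * (ex (RtoC (be + 1 / 2)) * (cth tau * ex (RtoC ((be + 1 / 2) * - (al + 1 / 2))) * X))))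
    with (ex (RtoC (- (1) / 4)) * ex (RtoC (- (be * - al + be) / 2)) * ex (RtoC (be + 1 / 2)) * ex (RtoC ((be + 1 / 2) * - (al + 1 / 2))) * X)
    by (field; auto).
  rewrite <- !ex_plus, <- !RtoC_plus. f_equal. f_equal. f_equal. field.
Qed.

(** * Theta functions under the modular group *)

(** For a purely imaginary c the square c^2 would be real and nonpositive, and c^2 tau could not
    equal [Ci]. *)
Lemma cth_Re_neq0 t : (0 < Im t)%R -> Re (cth t) <> 0%R.
Proof.
  intros H E. assert (S := cth_sq t H). apply (f_equal Im) in S. revert S.
  C_simpl. rewrite E. intros S.
  assert (0 <= Im (cth t) * Im (cth t))%R by apply (Rle_0_sqr (Im (cth t))). nra.
Qed.

(** On the segment from [Ci], where the value is 1, the real part is continuous and has no zero. *)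
Lemma cth_Re_pos t : (0 < Im t)%R -> (0 < Re (cth t))%R.
Proof.
  intros H. set (sig := t - Ci).
  assert (Hp : forall s : R, (0 <= s <= 1)%R -> (0 < Im (Ci + RtoC s * sig))%R).
  { intros s Hs. unfold sig. rewrite Im_plus, Im_scal, Im_minus. simpl Im.
    destruct (Rle_dec (Im t) 1); nra. }
  assert (E1 : Ci + RtoC 1 * sig = t) by (unfold sig; ring).
  assert (E0 : Ci + RtoC 0 * sig = Ci) by ring.
  destruct (Rlt_or_le 0 (Re (cth t))) as [P|P]; auto. exfalso.
  assert (Q : (Re (cth t) < 0)%R) by (assert (N := cth_Re_neq0 t H); lra).
  destruct (Ranalysis5.IVT_interv (fun s => (- Re (cth (Ci + RtoC s * sig)))%R) 0 1) as [z [Hz Z]].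
  - intros s Hs. apply continuity_pt_opp. apply continuity_pt_filterlim.
    apply (ex_derive_continuous (fun s => Re (cth (Ci + RtoC s * sig)))). eexists.
    apply (Der_Re (fun s => cth (Ci + RtoC s * sig))). apply cth_Der. auto.
  - lra.
  - cbv beta. rewrite E0, cth_i_sq. simpl. lra.
  - cbv beta. rewrite E1. lra.
  - apply (cth_Re_neq0 _ (Hp z Hz)). lra.
Qed.

(** Both sides are square roots of [Ci] with positive real part. This trades the Gaussian integral
    for the principal root in which the weight is expressed. *)
Lemma cth_Csqrt t : (0 < Im t)%R -> cth t * Csqrt t = cth Ci * Csqrt Ci.
Proof.
  assert (F : forall t, (0 < Im t)%R -> (0 < Re (cth t * Csqrt t))%R /\ cth t * Csqrt t * (cth t * Csqrt t) = Ci).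
  { clear t. intros t H. set (z := cth t * Csqrt t).
    assert (S : z * z = Ci).
    { unfold z. replace (cth t * Csqrt t * (cth t * Csqrt t)) with (cth t * cth t * (Csqrt t * Csqrt t)) by ring.
      rewrite Csqrt_sq. apply cth_sq; auto. }
    split; auto.
    assert (HR := cth_Re_pos t H).
    destruct (Csqrt_facts t (tau_neq0 t H)) as [_ [A _]]. destruct (A H) as [Hp Hq].
    assert (SR := f_equal Re S). assert (SI := f_equal Im S). rewrite Re_mult, Re_Ci in SR. rewrite Im_mult, Im_Ci in SI.
    assert (ZR : Re z = (Re (cth t) * Re (Csqrt t) - Im (cth t) * Im (Csqrt t))%R) by apply Re_mult.
    assert (ZI : Im z = (Re (cth t) * Im (Csqrt t) + Im (cth t) * Re (Csqrt t))%R) by apply Im_mult.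
    set (x := Re (cth t)) in *. set (y := Im (cth t)) in *. set (p := Re (Csqrt t)) in *. set (q := Im (Csqrt t)) in *.
    assert (W : (p * Re z + q * Im z = x * (p * p + q * q))%R) by (rewrite ZR, ZI; ring).
    assert (X : (0 < x * (p * p + q * q))%R) by (apply Rmult_lt_0_compat; nra).
    assert (Y : Re z = Im z).
    { assert (Y : ((Re z - Im z) * (Re z + Im z) = 0)%R) by lra.
      apply Rmult_integral in Y. destruct Y as [Y|Y]; [lra|].
      assert (Y' : Re z = (- Im z)%R) by lra. rewrite Y' in SI.
      assert (Q := Rle_0_sqr (Im z)). unfold Rsqr in Q. lra. }
    rewrite Y in *. assert (0 < (p + q) * Im z)%R by lra.
    destruct (Rlt_or_le 0 (Im z)) as [G|G]; auto.
    assert ((p + q) * Im z <= 0)%R by (clear - Hp Hq G; nra). lra. }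
  intros H. destruct (F t H) as [A B]. destruct (F Ci) as [A' B']; [simpl; lra|].
  rewrite <- B' in B. apply C_sq_eq in B. destruct B as [E|E]; auto.
  rewrite E in A. rewrite Re_opp in A. lra.
Qed.

(** One multiplier [e] for all real characteristics at once, so that it cancels from quotients of
    equally many thetas. *)
Definition KT (A : mat2) : Prop := exists e : C, Cmod e = 1%R /\
  forall tau al be, (0 < Im tau)%R -> K al be (mobius A tau) =
    e * Csqrt (autf A tau) * K (al * IZR (m11 A) + be * IZR (m21 A)) (al * IZR (m12 A) + be * IZR (m22 A)) tau.

Lemma Csqrt_1 : Csqrt 1 = 1.
Proof.
  destruct (C_sq_eq (Csqrt 1) 1) as [E|E]; auto; [rewrite Csqrt_sq; ring|].
  destruct (Csqrt_facts 1) as [H _]; [apply RtoC_neq0; lra|]. rewrite E in H. simpl in H. lra.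
Qed.

Lemma Cmod_sq_1 z : (Cmod z * Cmod z = 1)%R -> Cmod z = 1%R.
Proof. intros H. assert (P := Cmod_ge_0 z). nra. Qed.

Lemma KT_T k : KT (Mat2 1 k 0 1).
Proof.
  exists (ex (RtoC (IZR k / 8))). split; [apply Cmod_ex_real|]. intros tau al be H.
  unfold mobius, autf; simpl m11; simpl m12; simpl m21; simpl m22.
  replace ((1 * tau + IZR k) / (0 * tau + 1)) with (tau + RtoC (IZR k)) by field.
  replace (0 * tau + 1) with (RtoC 1) by ring. rewrite Csqrt_1, K_T by auto.
  rewrite Cmult_1_r. f_equal. f_equal; ring.
Qed.

Lemma KT_S : KT (Mat2 0 (-1) 1 0).
Proof.
  set (z := cth Ci * Csqrt Ci).
  assert (Hz : z * z = Ci).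
  { unfold z. replace (cth Ci * Csqrt Ci * (cth Ci * Csqrt Ci)) with (cth Ci * cth Ci * (Csqrt Ci * Csqrt Ci)) by ring.
    rewrite Csqrt_sq. apply cth_sq; simpl; lra. }
  assert (Hm : Cmod z = 1%R) by (apply Cmod_sq_1; rewrite <- Cmod_mult, Hz; apply Cmod_Ci).
  assert (Hz0 : z <> 0) by (intros E; rewrite E, Cmod_0 in Hm; lra).
  exists (ex (RtoC (- (1) / 4)) / z). split.
  - rewrite Cmod_div, Hm, Cmod_ex_real by auto. field.
  - intros tau al be H. assert (Hn := tau_neq0 tau H).
    unfold mobius, autf; simpl m11; simpl m12; simpl m21; simpl m22.
    replace ((0 * tau + -1) / (1 * tau + 0)) with (- / tau) by (field; auto).
    replace (1 * tau + 0) with tau by ring. rewrite K_S by auto.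
    unfold z. rewrite <- (cth_Csqrt tau H).
    replace (K (al * 0 + be * 1) (al * -1 + be * 0) tau) with (K be (- al) tau) by (f_equal; ring).
    assert (Hc := cth_neq0 tau H).
    assert (Hs : Csqrt tau <> 0) by (intros E; apply Hn; rewrite <- (Csqrt_sq tau), E; ring).
    field. auto.
Qed.

Lemma KT_mul A B : SL2Z A -> SL2Z B -> KT A -> KT B -> KT (mat2_mul A B).
Proof.
  intros HA HB [eA [MA EA]] [eB [MB EB]].
  destruct (Csqrt_cocycle A B HA HB) as [s [Hs Es]].
  exists (eA * eB * s). split.
  - rewrite !Cmod_mult, MA, MB. destruct Hs as [-> | ->]; rewrite ?Cmod_opp, Cmod_1; ring.
  - intros tau al be H. rewrite mobius_mul, EA, EB by auto using mobius_H.
    replace (eA * eB * s * Csqrt (autf (mat2_mul A B) tau)) with (eA * eB * (s * Csqrt (autf (mat2_mul A B) tau))) by ring.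
    rewrite <- Es by auto.
    simpl. rewrite !plus_IZR, !mult_IZR.
    match goal with |- _ * (_ * K ?x ?y tau) = _ * K ?x' ?y' tau => replace x' with x by ring; replace y' with y by ring end.
    ring.
Qed.

Lemma KT_opp1 : KT (Mat2 (-1) 0 0 (-1)).
Proof.
  set (c := Csqrt (-1)).
  assert (Hc : c * c = -1) by apply Csqrt_sq.
  assert (Hm : Cmod c = 1%R).
  { apply Cmod_sq_1. rewrite <- Cmod_mult, Hc, Cmod_R, Rabs_left; lra. }
  assert (Hc0 : c <> 0) by (intros E; rewrite E, Cmod_0 in Hm; lra).
  exists (- / c). split; [rewrite Cmod_opp, Cmod_inv, Hm; auto; field|].
  intros tau al be H.
  unfold mobius, autf; simpl m11; simpl m12; simpl m21; simpl m22.
  replace ((-1 * tau + 0) / (0 * tau + -1)) with tau by (field; apply RtoC_neq0; lra).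
  replace (0 * tau + -1) with (RtoC (-1)) by ring. fold c.
  replace (K (al * -1 + be * 0) (al * 0 + be * -1) tau) with (K (- al) (- be) tau) by (f_equal; ring).
  rewrite K_neg by auto. field. auto.
Qed.

(** Induction on the absolute value of the lower left entry: a division step writes the matrix as a
    translation, the inversion and a matrix with a smaller such entry. *)
Lemma KT_all A : SL2Z A -> KT A.
Proof.
  assert (Main : forall n A, (Z.abs_nat (m21 A) < n)%nat -> SL2Z A -> KT A).
  2:{ intros H. apply (Main (S (Z.abs_nat (m21 A)))); auto. }
  clear A. induction n as [|n IH]; intros A Hn HA; [lia|].
  destruct A as [a b c d]. simpl in Hn. unfold SL2Z in HA; simpl in HA.
  destruct (Z.eq_dec c 0) as [->|Hc].
  - assert (Had : (a * d = 1)%Z) by lia.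
    destruct (Z.mul_eq_1 _ _ Had) as [-> | ->].
    + replace d with 1%Z by lia. apply KT_T.
    + change (- (1))%Z with (-1)%Z. replace d with (-1)%Z by lia.
      replace (Mat2 (-1) b 0 (-1)) with (mat2_mul (Mat2 (-1) 0 0 (-1)) (Mat2 1 (- b) 0 1)) by (unfold mat2_mul; cbn [m11 m12 m21 m22]; f_equal; ring).
      refine (KT_mul (Mat2 (-1) 0 0 (-1)) (Mat2 1 (- b) 0 1) _ _ KT_opp1 (KT_T (- b))); unfold SL2Z; cbn [m11 m12 m21 m22]; ring.
  (* Euclidean step A = T^q S A', where the new lower left entry is minus the remainder of a modulo
     c. *)
  - set (q := (a / c)%Z).
    set (A' := Mat2 c d (- (a - q * c)) (- (b - q * d))).
    assert (HA' : SL2Z A') by (unfold SL2Z, A'; simpl; lia).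
    replace (Mat2 a b c d) with (mat2_mul (Mat2 1 q 0 1) (mat2_mul (Mat2 0 (-1) 1 0) A')).
    2:{ unfold mat2_mul, A'; cbn [m11 m12 m21 m22]; f_equal; ring. }
    assert (Hr : (a - q * c = a mod c)%Z) by (unfold q; rewrite Z.mod_eq; lia).
    assert (Hb : (Z.abs (a mod c) < Z.abs c)%Z) by (apply Z.mod_bound_abs; auto).
    assert (S1 : SL2Z (Mat2 0 (-1) 1 0)) by (unfold SL2Z; simpl; ring).
    refine (KT_mul _ _ _ (SL2Z_mul _ _ S1 HA') (KT_T q) _).
    { unfold SL2Z; cbn [m11 m12 m21 m22]; ring. }
    refine (KT_mul _ _ S1 HA' KT_S _).
    { apply IH; auto. unfold A'; simpl. rewrite Hr. lia. }
Qed.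

Lemma K_shift_al al be tau (m : Z) : (0 < Im tau)%R ->
  K (al + IZR m) be tau = ex (RtoC (- (IZR m * (be + 1)) / 2)) * K al be tau.
Proof.
  intros H. unfold K. rewrite Cmult_assoc, <- ex_plus, <- RtoC_plus. f_equal.
  - f_equal. f_equal. field.
  - unfold th. rewrite <- (Sum_bij (fun n => (n + m)%Z) (fun n => (n - m)%Z) (fun n : Z => gt tau (be + 1 / 2) (IZR n + (al + 1 / 2)))).
    + apply Sum_ext. intros n. f_equal. rewrite plus_IZR. ring.
    + intros; lia.
    + intros; lia.
    + apply gt_summable; auto.
Qed.

Lemma K_shift_be al be tau (m : Z) : (0 < Im tau)%R ->
  K al (be + IZR m) tau = ex (RtoC (IZR m * (al + 1) / 2)) * K al be tau.
Proof.
  intros H. unfold K. rewrite Cmult_assoc, <- ex_plus, <- RtoC_plus.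
  rewrite !K_scal_th by auto. apply Sum_ext. intros n.
  unfold gt. rewrite <- !ex_plus. apply (ex_eq _ _ (m * n)). rewrite mult_IZR.
  set (y := (IZR n + (al + 1 / 2))%R).
  match goal with |- RtoC ?a + (?b + RtoC ?c) = RtoC ?d + (?b + RtoC ?e) + RtoC ?f =>
      transitivity (b + RtoC (a + c)); [rewrite RtoC_plus; ring|];
      transitivity (b + RtoC (d + e + f)); [|rewrite !RtoC_plus; ring] end.
  f_equal. f_equal. unfold y. field.
Qed.

Definition ratl (L : nat) (x : R) : Prop := exists u : Z, (INR L * x = IZR u)%R.

(** An integral shift by m multiplies [K] by e of m (be + 1) / 2 or m (al + 1) / 2 up to sign;
    multiples of 2 L clear both the half and the denominator. *)
Lemma K_period L al be tau (m n : Z) : (0 < Im tau)%R -> ratl L al -> ratl L be ->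
  K (al + IZR (2 * Z.of_nat L * m)) (be + IZR (2 * Z.of_nat L * n)) tau = K al be tau.
Proof.
  intros H [u Hu] [v Hv]. rewrite K_shift_al, K_shift_be by auto.
  rewrite Cmult_assoc, <- ex_plus, <- RtoC_plus.
  assert (E : ex (RtoC (- (IZR (2 * Z.of_nat L * m) * (be + IZR (2 * Z.of_nat L * n) + 1)) / 2 +
     IZR (2 * Z.of_nat L * n) * (al + 1) / 2)) = 1).
  { rewrite <- (ex_int (- (m * v) - Z.of_nat L * m * (2 * Z.of_nat L * n + 1) + n * u + Z.of_nat L * n)). do 2 f_equal.
    rewrite !plus_IZR, !minus_IZR, !opp_IZR, !mult_IZR, plus_IZR, !mult_IZR, <- INR_IZR_INZ, <- Hu, <- Hv. field. }
  rewrite E. ring.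
Qed.

(* The multiplier of the theta functions K(al, be; N tau) with al, be in (1/L)Z at the matrix A. *)
Definition Mult (N L : nat) (A : mat2) (e : C) : Prop :=
  forall al be tau, ratl L al -> ratl L be -> (0 < Im tau)%R ->
    K al be (RtoC (INR N) * mobius A tau) = e * Csqrt (autf A tau) * K al be (RtoC (INR N) * tau).

(** The lower left entry is divisible by N, so conjugation by diag(N, 1) stays in SL2(Z). The
    conjugate moves the characteristics by multiples of 2 L, since these have denominator L and the
    congruence is modulo 2 L^2. *)
Lemma Mult_exists (N L : nat) A : (1 <= N)%nat -> (1 <= L)%nat -> principal_congruence (N * (2 * L * L)) A ->
  exists e, Cmod e = 1%R /\ Mult N L A e.
Proof.
  intros HN HL [HA [[k1 H1] [[k2 H2] [[k3 H3] [k4 H4]]]]].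
  destruct A as [a b c d]. unfold SL2Z in HA. cbn [m11 m12 m21 m22] in *.
  rewrite !Nat2Z.inj_mul in *. change (Z.of_nat 2) with 2%Z in *.
  set (l := Z.of_nat L) in *. set (nn := Z.of_nat N) in *.
  assert (Hnn : (0 < nn)%Z) by (unfold nn; lia).
  assert (Hn0 : INR N <> 0%R) by (apply not_0_INR; lia).
  set (c' := (k3 * (2 * l * l))%Z). assert (Hc : c = (nn * c')%Z) by (unfold c'; lia).
  set (A' := Mat2 a (b * nn) c' d).
  assert (HA' : SL2Z A').
  { unfold SL2Z, A'; simpl. rewrite <- HA, Hc. ring. }
  destruct (KT_all A' HA') as [e [Me Ke]]. exists e. split; auto.
  intros al be tau Ral Rbe H.
  assert (HNt : (0 < Im (RtoC (INR N) * tau))%R).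
  { rewrite Im_scal. apply Rmult_lt_0_compat; auto. apply lt_0_INR. lia. }
  assert (EN : IZR nn = INR N) by (unfold nn; rewrite <- INR_IZR_INZ; auto).
  assert (Ea : autf A' (RtoC (INR N) * tau) = autf (Mat2 a b c d) tau).
  { unfold autf, A'; simpl. rewrite Hc, mult_IZR, RtoC_mult, EN. ring. }
  assert (Em : mobius A' (RtoC (INR N) * tau) = RtoC (INR N) * mobius (Mat2 a b c d) tau).
  { unfold mobius. rewrite Ea. unfold A'; simpl. rewrite mult_IZR, RtoC_mult, EN. unfold Cdiv. ring. }
  rewrite <- Em, Ke, Ea by auto. f_equal.
  destruct Ral as [u Hu], Rbe as [v Hv].
  assert (Hl0 : INR L <> 0%R) by (apply not_0_INR; lia).
  assert (El : IZR l = INR L) by (unfold l; rewrite <- INR_IZR_INZ; auto).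
  assert (Eal : al = (IZR u / IZR l)%R) by (rewrite El, <- Hu; field; auto).
  assert (Ebe : be = (IZR v / IZR l)%R) by (rewrite El, <- Hv; field; auto).
  assert (Hl0' : IZR l <> 0%R) by (rewrite El; auto).
  (* The two integers are al (a - 1) + be c' and al b N + be (d - 1), divided by 2 L. *)
  rewrite <- (K_period L al be _ (u * nn * k1 + v * k3) (u * nn * nn * k2 + v * nn * k4)); auto;
    [|exists u; auto|exists v; auto].
  unfold A'; simpl m11; simpl m12; simpl m21; simpl m22. fold l.
  replace a with (1 + k1 * (nn * (2 * l * l)))%Z by lia. replace d with (1 + k4 * (nn * (2 * l * l)))%Z by lia.
  rewrite H2. unfold c'.
  repeat rewrite ?plus_IZR, ?mult_IZR. rewrite Eal, Ebe. f_equal; field; auto.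
Qed.

(** * The Jacobi triple product *)

Lemma csum_shift (k : Z) (f : Z -> C) s : csum f s -> csum (fun j => f (j + k)%Z) s.
Proof.
  apply (csum_bij (fun j => (j + k)%Z) (fun j => (j - k)%Z)); intros; lia.
Qed.

Lemma csum_nat_lim (u : nat -> C) s : csum u s -> Clim (fun n => lsum u (seq 0 n)) s.
Proof.
  intros H eps He. destruct (H eps He) as [L0 H0]. destruct (list_max_nat L0) as [N HN].
  exists N. intros n Hn. apply H0; [apply seq_NoDup|].
  intros x Hx. apply HN in Hx. apply in_seq in Hx. apply in_seq. lia.
Qed.

Lemma Clim_sub (u : nat -> C) l (phi : nat -> nat) : Clim u l ->
  (forall N, exists M, forall n, (M <= n)%nat -> (N <= phi n)%nat) -> Clim (fun n => u (phi n)) l.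
Proof.
  intros H Hp eps He. destruct (H eps He) as [N HN]. destruct (Hp N) as [M HM].
  exists M. intros n Hn. apply HN. auto.
Qed.

Lemma Clim_eventually (u v : nat -> C) l N : (forall n, (N <= n)%nat -> u n = v n) -> Clim u l -> Clim v l.
Proof.
  intros E H eps He. destruct (H eps He) as [M HM]. exists (max N M). intros n Hn.
  rewrite <- E by lia. apply HM. lia.
Qed.

Lemma Clim_inv (u : nat -> C) (l : C) : l <> 0 -> Clim u l -> Clim (fun n => / u n) (/ l).
Proof.
  intros Hl H eps He. assert (Hp := Cmod_pos l Hl).
  assert (He2 : (0 < eps * (Cmod l * Cmod l) / 2)%R).
  { apply Rmult_lt_0_compat; [|lra]. apply Rmult_lt_0_compat; auto. nra. }
  destruct (H (Rmin (Cmod l / 2) (eps * (Cmod l * Cmod l) / 2))) as [N HN].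
  { apply Rmin_glb_lt; lra. }
  exists N. intros n Hn. specialize (HN n Hn).
  assert (H1 := Rlt_le_trans _ _ _ HN (Rmin_l _ _)). assert (H2 := Rlt_le_trans _ _ _ HN (Rmin_r _ _)).
  assert (H3 : (Cmod l / 2 <= Cmod (u n))%R).
  { assert (A := Cmod_sub_ge l (u n)). replace (l - u n) with (- (u n - l)) in A by ring. rewrite Cmod_opp in A. lra. }
  assert (Hu : u n <> 0) by (intros E; rewrite E, Cmod_0 in H3; lra).
  replace (/ u n - / l) with (- (u n - l) / (u n * l)) by (field; auto).
  rewrite Cmod_div by (apply Cmult_neq_0; auto). rewrite Cmod_opp, Cmod_mult.
  apply Rmult_lt_reg_r with (Cmod (u n) * Cmod l)%R; [nra|].
  unfold Rdiv. rewrite Rmult_assoc, Rinv_l, Rmult_1_r by nra.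
  apply Rlt_le_trans with (eps * (Cmod l * Cmod l) / 2)%R; auto.
  replace (eps * (Cmod l * Cmod l) / 2)%R with (eps * (Cmod l / 2 * Cmod l))%R by field.
  apply Rmult_le_compat_l; [lra|]. apply Rmult_le_compat_r; lra.
Qed.

(** * Infinite products *)

Fixpoint prodC (u : nat -> C) (n : nat) : C :=
  match n with O => 1 | S m => prodC u m * u m end.

Lemma prodC_ext u v n : (forall k, u k = v k) -> prodC u n = prodC v n.
Proof. intros H. induction n as [|n IH]; simpl; auto. rewrite IH, H; auto. Qed.

Lemma prodC_mult u v n : prodC (fun k => u k * v k) n = prodC u n * prodC v n.
Proof. induction n as [|n IH]; simpl; [ring|]. rewrite IH. ring. Qed.

Lemma qprod_prodC w q n : qprod w q n = prodC (fun k => 1 - w * q ^ k) n.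
Proof. induction n as [|n IH]; simpl; auto. rewrite IH; auto. Qed.

Lemma prodC_bound (c : nat -> C) B r n : (0 <= r < 1)%R -> (forall k, (Cmod (c k) <= B * r ^ k)%R) ->
  (Cmod (prodC (fun k => 1 + c k)%C n) <= exp (B * (1 / (1 - r))))%R.
Proof.
  intros Hr Hc.
  assert (HB : (0 <= B)%R).
  { specialize (Hc 0%nat). simpl in Hc. assert (A := Cmod_ge_0 (c 0%nat)). lra. }
  apply Rle_trans with (exp (B * rsum (fun k => r ^ k) (seq 0 n)))%R.
  - induction n as [|n IH].
    + simpl. rewrite Cmod_1, Rmult_0_r, exp_0. lra.
    + rewrite seq_S, rsum_app, Rmult_plus_distr_l, exp_plus. simpl prodC. rewrite Cmod_mult.
      apply Rmult_le_compat; auto using Cmod_ge_0.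
      eapply Rle_trans; [apply Cmod_triangle|]. rewrite Cmod_1. simpl rsum. rewrite Rplus_0_r.
      specialize (Hc n). assert (E := exp_ineq1_le (B * r ^ n)). lra.
  - apply exp_le_le. apply Rmult_le_compat_l; auto. apply rbound_geom; auto. apply seq_NoDup.
Qed.

(** Consecutive partial products differ by P_k c_k, which is geometrically small because the P_k are
    bounded; the limit is a telescoping sum. *)
Lemma prodC_cv (c : nat -> C) B r : (0 <= r < 1)%R -> (forall k, (Cmod (c k) <= B * r ^ k)%R) ->
  exists l, Clim (prodC (fun k => 1 + c k)) l.
Proof.
  intros Hr Hc. set (P := prodC (fun k => 1 + c k)).
  set (E := exp (B * (1 / (1 - r)))).
  assert (Hs : summable (fun k => P k * c k)).
  { apply (summable_le _ (fun k => E * B * r ^ k)%R (E * B * (1 / (1 - r)))).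
    - intros k. rewrite Cmod_mult, Rmult_assoc. apply Rmult_le_compat; auto using Cmod_ge_0.
      apply prodC_bound; auto.
    - apply rbound_scal; [|apply rbound_geom; auto].
      assert (HB : (0 <= B)%R).
      { specialize (Hc 0%nat). simpl in Hc. assert (A := Cmod_ge_0 (c 0%nat)). lra. }
      apply Rmult_le_pos; auto. left; apply exp_pos. }
  exists (1 + Sum (fun k => P k * c k)).
  apply (Clim_ext (fun n => 1 + lsum (fun k => P k * c k) (seq 0 n))).
  - intros n. induction n as [|n IH]; [unfold P; simpl; ring|].
    rewrite seq_S, lsum_app, Cplus_assoc, IH. unfold P; simpl. ring.
  - apply Clim_plus; [apply Clim_const|]. apply csum_nat_lim, summable_csum; auto.
Qed.

Lemma pow_small B r eps : (0 <= r < 1)%R -> (0 < eps)%R -> exists N, forall n, (N <= n)%nat -> (B * r ^ n < eps)%R.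
Proof.
  intros Hr He. set (B' := (Rabs B + 1)%R). assert (H0 := Rabs_pos B).
  destruct (pow_lt_1_zero r ltac:(rewrite Rabs_pos_eq; lra) (eps / B')) as [N HN].
  { apply Rdiv_lt_0_compat; unfold B'; lra. }
  exists N. intros n Hn. specialize (HN n Hn).
  assert (Hp : (0 <= r ^ n)%R) by (apply pow_le; lra). rewrite Rabs_pos_eq in HN by auto.
  apply Rle_lt_trans with (B' * r ^ n)%R.
  - apply Rmult_le_compat_r; auto. unfold B'. assert (A := Rle_abs B). lra.
  - replace eps with (B' * (eps / B'))%R by (unfold B'; field; lra).
    apply Rmult_lt_compat_l; auto. unfold B'; lra.
Qed.

Lemma nat_lower_bound (f : nat -> R) N : (forall k, (0 < f k)%R) -> (exists d, 0 < d /\ forall k, (N <= k)%nat -> d <= f k)%R ->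
  exists d, (0 < d)%R /\ forall k, (d <= f k)%R.
Proof.
  intros Hf. induction N as [|N IH]; intros [d [Hd H]].
  - exists d. split; auto. intros k. apply H. lia.
  - apply IH. exists (Rmin d (f N)). split; [apply Rmin_glb_lt; auto|].
    intros k Hk. destruct (Nat.eq_dec k N) as [->|Hn]; [apply Rmin_r|].
    eapply Rle_trans; [apply Rmin_l|]. apply H. lia.
Qed.

(** The inverse factors are 1 - c_k / (1 + c_k), again geometrically close to 1; their product
    converges too, and the two limits multiply to 1. *)
Lemma prodC_neq0 (c : nat -> C) B r l : (0 <= r < 1)%R -> (forall k, (Cmod (c k) <= B * r ^ k)%R) ->
  (forall k, 1 + c k <> 0) -> Clim (prodC (fun k => 1 + c k)) l -> l <> 0.
Proof.
  intros Hr Hc Hn Hl.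
  destruct (pow_small B r (1 / 2) Hr ltac:(lra)) as [N HN].
  destruct (nat_lower_bound (fun k => Cmod (1 + c k)) N) as [d [Hd Hdk]].
  { intros k. apply Cmod_pos; auto. }
  { exists (1 / 2)%R. split; [lra|]. intros k Hk. specialize (HN k Hk). specialize (Hc k).
    assert (A := Cmod_sub_ge 1 (- c k)). rewrite Cmod_1, Cmod_opp in A.
    replace (1 - - c k) with (1 + c k) in A by ring. lra. }
  assert (HB : (0 <= B)%R).
  { specialize (Hc 0%nat). simpl in Hc. assert (A := Cmod_ge_0 (c 0%nat)). lra. }
  destruct (prodC_cv (fun k => - c k / (1 + c k)) (B / d) r Hr) as [m Hm].
  { intros k. rewrite Cmod_div, Cmod_opp by auto.
    apply Rle_trans with (B * r ^ k / d)%R; [|apply Req_le; field; lra].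
    apply Rmult_le_compat; auto using Cmod_ge_0.
    - left. apply Rinv_0_lt_compat. apply Cmod_pos; auto.
    - apply Rinv_le_contravar; auto. }
  assert (E := Clim_mult _ _ _ _ Hl Hm).
  assert (E1 : Clim (fun _ => RtoC 1) (l * m)).
  { eapply Clim_ext; [|exact E]. intros n. cbv beta. rewrite <- prodC_mult.
    induction n as [|n IH]; simpl; auto. rewrite IH. field. auto. }
  assert (E2 := Clim_unique _ _ _ E1 (Clim_const 1)).
  intros Z. rewrite Z in E2. apply (RtoC_neq0 1); [lra|]. rewrite <- E2. ring.
Qed.

Section QProducts.
Variable q : C.
Hypothesis Hq : (Cmod q < 1)%R.

Lemma q_r : (0 <= Cmod q < 1)%R.
Proof. split; auto using Cmod_ge_0. Qed.

Lemma qpoch_lim w : Clim (qprod w q) (qpoch_inf w q).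
Proof.
  assert (Ex : exists l, Clim (qprod w q) l).
  { destruct (prodC_cv (fun k => - (w * q ^ k)) (Cmod w) (Cmod q) q_r) as [l Hl].
    - intros k. rewrite Cmod_opp, Cmod_mult, Cmod_pow. lra.
    - exists l. eapply Clim_ext; [|exact Hl]. intros n. rewrite qprod_prodC. apply prodC_ext. intros; ring. }
  destruct Ex as [l Hl]. unfold qpoch_inf. rewrite (CLim_seq_unique _ l); auto. apply filterlim_Clim; auto.
Qed.

Lemma qpoch_neq0 w : (forall k : nat, 1 - w * q ^ k <> 0) -> qpoch_inf w q <> 0.
Proof.
  intros H. apply (prodC_neq0 (fun k => - (w * q ^ k)) (Cmod w) (Cmod q) _ q_r).
  - intros k. rewrite Cmod_opp, Cmod_mult, Cmod_pow. lra.
  - intros k. apply H.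
  - eapply Clim_ext; [|apply (qpoch_lim w)]. intros n. rewrite qprod_prodC. apply prodC_ext. intros; ring.
Qed.

Lemma qpoch_neq0_small w : (Cmod w < 1)%R -> qpoch_inf w q <> 0.
Proof.
  intros Hw. apply qpoch_neq0. intros k E.
  assert (Em : Cmod (w * q ^ k) = 1%R).
  { replace (w * q ^ k) with (1 - (1 - w * q ^ k)) by ring. rewrite E. replace (1 - 0) with (RtoC 1) by ring. apply Cmod_1. }
  rewrite Cmod_mult, Cmod_pow in Em.
  assert (Hk : (Cmod q ^ k <= 1)%R).
  { rewrite <- (pow1 k). apply pow_incr. assert (A := q_r). lra. }
  assert (Hk0 : (0 <= Cmod q ^ k)%R) by (apply pow_le, Cmod_ge_0).
  assert (A := Cmod_ge_0 w). nra.
Qed.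

Lemma qprod_S w n : qprod w q (S n) = (1 - w) * qprod (w * q) q n.
Proof.
  induction n as [|n IH]; [simpl; ring|].
  change (qprod w q (S (S n))) with (qprod w q (S n) * (1 - w * q ^ (S n))).
  rewrite IH. simpl. ring.
Qed.

Lemma qpoch_S w : qpoch_inf w q = (1 - w) * qpoch_inf (w * q) q.
Proof.
  apply (Clim_unique (fun n => qprod w q (S n))).
  - apply (Clim_sub (qprod w q) _ S (qpoch_lim w)). intros N. exists N. lia.
  - apply (Clim_ext (fun n => (1 - w) * qprod (w * q) q n)); [intros; symmetry; apply qprod_S|].
    apply Clim_mult; [apply Clim_const|apply qpoch_lim].
Qed.

Lemma qpoch_pm w : qpoch_inf w q * qpoch_inf (- w) q = qpoch_inf (w * w) (q * q).
Proof.
  assert (Hqq : (Cmod (q * q) < 1)%R) by (rewrite Cmod_mult; assert (A := q_r); nra).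
  assert (Ex : Clim (qprod (w * w) (q * q)) (qpoch_inf w q * qpoch_inf (- w) q)).
  { eapply Clim_ext; [|apply (Clim_mult _ _ _ _ (qpoch_lim w) (qpoch_lim (- w)))].
    intros n. simpl. rewrite !qprod_prodC, <- prodC_mult. apply prodC_ext. intros k. rewrite Cpow_mult_l. ring. }
  unfold qpoch_inf at 3. symmetry. apply CLim_seq_unique. apply filterlim_Clim; auto.
Qed.
End QProducts.

Lemma qpoch_split (q : C) : (Cmod q < 1)%R -> qpoch_inf q q = qpoch_inf q (q * q) * qpoch_inf (q * q) (q * q).
Proof.
  intros Hq. assert (Hqq : (Cmod (q * q) < 1)%R) by (rewrite Cmod_mult; assert (A := q_r q Hq); nra).
  apply (Clim_unique (fun n => qprod q q (2 * n))).
  - apply (Clim_sub (qprod q q) _ (fun n => (2 * n)%nat) (qpoch_lim q Hq q)). intros N. exists N. lia.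
  - eapply Clim_ext; [|apply (Clim_mult _ _ _ _ (qpoch_lim (q * q) Hqq q) (qpoch_lim (q * q) Hqq (q * q)))].
    intros n. simpl. induction n as [|n IH]; [simpl; ring|].
    replace (S n + (S n + 0))%nat with (S (S (n + (n + 0)))) by lia. simpl. rewrite <- IH.
    assert (E : (q * q) ^ n = q ^ (n + (n + 0))).
    { rewrite Cpow_mult_l, Cpow_add_r, Cpow_add_r. simpl. ring. }
    rewrite E. ring.
Qed.

Lemma ex_lt1 tau : (0 < Im tau)%R -> (Cmod (ex tau) < 1)%R.
Proof.
  intros H. rewrite Cmod_ex, <- exp_0. apply exp_increasing. assert (P := PI_RGT_0). nra.
Qed.

(** The term (-1)^n q^(n (n - 1) / 2) x^n with x = e(u) and q = e(tau): [jt] is the theta function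
    of the triple product, normalised to vanish at u = 0. *)
Definition tj (tau u : C) (n : Z) : C :=
  ex (RtoC (IZR n) / 2 + tau * RtoC (IZR n * (IZR n - 1) / 2) + RtoC (IZR n) * u).

Definition jt (tau u : C) : C := Sum (tj tau u).

Definition notlat (tau u : C) : Prop := forall m n : Z, u <> RtoC (IZR m) * tau + RtoC (IZR n).

Lemma ex_gauss_summable (tau v : C) (c0 : C) : (0 < Im tau)%R ->
  summable (fun n : Z => ex (c0 * RtoC (IZR n) + tau * RtoC (IZR n * IZR n / 2) + RtoC (IZR n) * v)).
Proof.
  intros H. assert (P := PI_RGT_0).
  apply (gauss_summable _ (PI * Im tau) (2 * PI * (Rabs (Im v) + Rabs (Im c0))) 1); [nra|].
  intros n. rewrite Cmod_ex, Rmult_1_l. apply exp_le_le.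
  rewrite !Im_plus, Im_scal, !(Cmult_comm _ (RtoC _)), !Im_scal.
  assert (A : (- IZR n * Im v <= Rabs (IZR n) * Rabs (Im v))%R).
  { rewrite <- Rabs_mult. eapply Rle_trans; [apply Rle_abs|]. rewrite !Rabs_mult, Rabs_Ropp. lra. }
  assert (B : (- IZR n * Im c0 <= Rabs (IZR n) * Rabs (Im c0))%R).
  { rewrite <- Rabs_mult. eapply Rle_trans; [apply Rle_abs|]. rewrite !Rabs_mult, Rabs_Ropp. lra. }
  nra.
Qed.

Lemma tj_summable tau u : (0 < Im tau)%R -> summable (tj tau u).
Proof.
  intros H. eapply summable_ext; [|apply (ex_gauss_summable tau u (/ 2 - tau / 2) H)].
  intros n. unfold tj. f_equal. unfold Rdiv. rewrite !RtoC_mult, RtoC_minus, RtoC_inv by lra. field.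
Qed.

Section Triple.
Variables tau u : C.
Hypothesis Htau : (0 < Im tau)%R.
Let q := ex tau.

(** 1 / (q; q)_a, extended by 0 to negative a; with this convention the recursion [rf_pred] holds at
    every integer, because 1 - q^0 = 0. *)
Definition rf (a : Z) : C := if Z_lt_dec a 0 then 0 else / qprod q q (Z.to_nat a).

Lemma q_lt1 : (Cmod q < 1)%R.
Proof. apply ex_lt1; auto. Qed.

Lemma one_minus_neq0 (w : C) : (Cmod w < 1)%R -> 1 - w <> 0.
Proof.
  intros H E. assert (Ew : w = 1) by (replace w with (1 - (1 - w)) by ring; rewrite E; ring).
  rewrite Ew, Cmod_1 in H. lra.
Qed.

Lemma q_pow_lt1 (w : C) n : (Cmod w < 1)%R -> (Cmod (w ^ S n) < 1)%R.
Proof.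
  intros H. rewrite Cmod_pow. assert (P := Cmod_ge_0 w).
  assert (Hk : (Cmod w ^ n <= 1)%R) by (rewrite <- (pow1 n); apply pow_incr; lra).
  assert (Hk0 : (0 <= Cmod w ^ n)%R) by (apply pow_le; auto). simpl. nra.
Qed.

Lemma qf_neq0 n : qprod q q n <> 0.
Proof.
  induction n as [|n IH]; simpl; [apply RtoC_neq0; lra|].
  apply Cmult_neq_0; auto. apply one_minus_neq0. apply (q_pow_lt1 q n q_lt1).
Qed.

Lemma rf_pred a : rf (a - 1) = (1 - ex (RtoC (IZR a) * tau)) * rf a.
Proof.
  unfold rf. destruct (Z_lt_dec (a - 1) 0) as [H|H]; destruct (Z_lt_dec a 0) as [H'|H']; try lia.
  - ring.
  - replace a with 0%Z by lia. rewrite Cmult_0_l, ex_0. ring.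
  - replace (Z.to_nat a) with (S (Z.to_nat (a - 1))) by lia. simpl.
    assert (E : q * q ^ Z.to_nat (a - 1) = ex (RtoC (IZR a) * tau)).
    { unfold q. rewrite ex_pow, <- ex_plus. f_equal.
      rewrite INR_IZR_INZ, Z2Nat.id, minus_IZR, RtoC_minus by lia. ring. }
    rewrite E. assert (N1 := qf_neq0 (Z.to_nat (a - 1))).
    assert (N2 := qf_neq0 (S (Z.to_nat (a - 1)))). simpl in N2. rewrite E in N2.
    field. split; auto. intros Z. apply N2. rewrite Z. ring.
Qed.

(** The Gaussian binomial coefficient of 2 N over N + j. *)
Definition cN (N : nat) (j : Z) : C :=
  qprod q q (2 * N) * rf (Z.of_nat N - j) * rf (Z.of_nat N + j).

Lemma tj_S j : tj tau u (j + 1) = - ex (RtoC (IZR j) * tau) * ex u * tj tau u j.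
Proof.
  replace (- ex (RtoC (IZR j) * tau)) with (ex (1 / 2) * ex (RtoC (IZR j) * tau)).
  - unfold tj. rewrite <- !ex_plus. f_equal. rewrite plus_IZR. unfold Rdiv.
    rewrite !RtoC_mult, !RtoC_minus, !RtoC_plus, RtoC_inv by lra. field.
  - rewrite ex_half. ring.
Qed.

(** Cauchy's finite form of the triple product. Multiplication by x or 1 / x shifts j by one, so the
    step from N to N + 1 is a recursion for Gaussian binomial coefficients. *)
Lemma triple_fin N : csum (fun j => cN N j * tj tau u j) (qprod (ex u) q N * qprod (q / ex u) q N).
Proof.
  induction N as [|N IH].
  - replace (qprod (ex u) q 0 * qprod (q / ex u) q 0) with (cN 0 0 * tj tau u 0).
    + apply (csum_at (fun j => cN 0 j * tj tau u j)). intros j Hj. unfold cN, rf.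
      simpl Z.of_nat.
      destruct (Z_lt_dec (0 - j) 0); destruct (Z_lt_dec (0 + j) 0); try lia; ring.
    + unfold cN, rf, tj. simpl.
      replace (RtoC 0 / 2 + tau * RtoC (0 * (0 - 1) / 2) + 0 * u) with (RtoC 0).
      * rewrite ex_0. field.
      * replace (0 * (0 - 1) / 2)%R with 0%R by field. field.
  - set (X := ex u) in *. assert (HX : X <> 0) by apply ex_neq0.
    set (qN := ex (RtoC (INR N) * tau)).
    assert (EqN : q ^ N = qN) by (unfold q; rewrite ex_pow; auto).
    (* The two new factors multiply to 1 + q^(2 N + 1) - q^N x - q^(N + 1) / x. *)
    replace (qprod X q (S N) * qprod (q / X) q (S N)) with
      ((1 + q * qN * qN) * (qprod X q N * qprod (q / X) q N) + - (qN * X) * (qprod X q N * qprod (q / X) q N)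
        + - (q * qN / X) * (qprod X q N * qprod (q / X) q N)).
    2:{ simpl. rewrite EqN. field. auto. }
    assert (I1 := csum_scal (1 + q * qN * qN) _ _ IH).
    assert (I2 := csum_shift (-1) _ _ (csum_scal (- (qN * X)) _ _ IH)).
    assert (I3 := csum_shift 1 _ _ (csum_scal (- (q * qN / X)) _ _ IH)).
    eapply csum_ext; [|apply csum_plus; [apply csum_plus; [exact I1|exact I2]|exact I3]].
    intros j. cbv beta. clear I1 I2 I3 IH. change (j + -1)%Z with (j - 1)%Z.
    set (qj := ex (RtoC (IZR j) * tau)). assert (Hqj : qj <> 0) by apply ex_neq0.
    assert (T1 : tj tau u (j + 1) = - qj * X * tj tau u j) by apply tj_S.
    assert (T2 : tj tau u (j - 1) = - (q / (qj * X)) * tj tau u j).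
    { assert (T := tj_S (j - 1)). replace (j - 1 + 1)%Z with j in T by lia. rewrite T.
      replace (ex (RtoC (IZR (j - 1)) * tau)) with (qj / q).
      - fold X. field. repeat split; auto. apply (ex_neq0 tau).
      - unfold qj, q. rewrite <- ex_minus. f_equal. rewrite minus_IZR, RtoC_minus. ring. }
    rewrite T1, T2. unfold cN.
    set (n := Z.of_nat N).
    assert (R0 : forall k, rf (k - 1) = (1 - ex (RtoC (IZR k) * tau)) * rf k) by apply rf_pred.
    assert (En : RtoC (INR N) = RtoC (IZR n)) by (unfold n; rewrite <- INR_IZR_INZ; auto).
    replace (Z.of_nat (S N)) with (n + 1)%Z by lia.
    assert (A1 : rf (n - j) = (1 - qN * q / qj) * rf (n + 1 - j)).
    { replace (n - j)%Z with (n + 1 - j - 1)%Z by lia. rewrite R0. do 2 f_equal.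
      unfold qN, q, qj. rewrite <- ex_plus, <- ex_minus. f_equal. rewrite En, minus_IZR, plus_IZR, RtoC_minus, RtoC_plus. ring. }
    assert (A2 : rf (n + j) = (1 - qN * q * qj) * rf (n + 1 + j)).
    { replace (n + j)%Z with (n + 1 + j - 1)%Z by lia. rewrite R0. do 2 f_equal.
      unfold qN, q, qj. rewrite <- !ex_plus. f_equal. rewrite En, !plus_IZR, !RtoC_plus. ring. }
    assert (A3 : rf (n + (j - 1)) = (1 - qN * qj) * rf (n + j)).
    { replace (n + (j - 1))%Z with (n + j - 1)%Z by lia. rewrite R0. do 2 f_equal.
      unfold qN, q, qj. rewrite <- !ex_plus. f_equal. rewrite En, !plus_IZR, !RtoC_plus. ring. }
    assert (A4 : rf (n - (j + 1)) = (1 - qN / qj) * rf (n - j)).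
    { replace (n - (j + 1))%Z with (n - j - 1)%Z by lia. rewrite R0. do 2 f_equal.
      unfold qN, q, qj. rewrite <- ex_minus. f_equal. rewrite En, minus_IZR, RtoC_minus. ring. }
    replace (n - (j - 1))%Z with (n + 1 - j)%Z by lia. replace (n + (j + 1))%Z with (n + 1 + j)%Z by lia.
    rewrite A3, A4, A1, A2.
    replace (2 * S N)%nat with (S (S (2 * N))) by lia. simpl qprod.
    assert (E2 : q ^ (N + (N + 0)) = qN * qN) by (rewrite !Cpow_add_r, EqN; simpl; ring).
    rewrite E2. simpl Cpow.
    unfold X, q. field. split; [apply ex_neq0|auto].
Qed.

Lemma rf_bounded : exists B, forall a, (Cmod (rf a) <= B)%R.
Proof.
  assert (Hl := qpoch_lim q q_lt1 q). assert (Hn := qpoch_neq0_small q q_lt1 q q_lt1).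
  assert (HI := Clim_inv _ _ Hn Hl).
  destruct (HI 1%R Rlt_0_1) as [N HN].
  assert (Hb : forall M, exists B, (0 <= B)%R /\ forall n, (n < M)%nat -> (Cmod (/ qprod q q n) <= B)%R).
  { induction M as [|M [B [HB0 HB]]]; [exists 0%R; split; [lra|intros; lia]|].
    exists (Rmax B (Cmod (/ qprod q q M))). split; [eapply Rle_trans; [exact HB0|apply Rmax_l]|].
    intros n Hn'. destruct (Nat.eq_dec n M) as [->|Hne]; [apply Rmax_r|].
    eapply Rle_trans; [apply HB; lia|apply Rmax_l]. }
  destruct (Hb N) as [B [HB0 HB]]. exists (B + (Cmod (/ qpoch_inf q q) + 1))%R. intros a. unfold rf.
  assert (P := Cmod_ge_0 (/ qpoch_inf q q)).
  destruct (Z_lt_dec a 0); [rewrite Cmod_0; lra|].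
  destruct (le_lt_dec N (Z.to_nat a)) as [L|L].
  - specialize (HN _ L). assert (A := Cmod_sub_ge (/ qprod q q (Z.to_nat a)) (/ qpoch_inf q q)). lra.
  - specialize (HB _ L). lra.
Qed.

Lemma rf_lim (f : nat -> Z) : (forall M : Z, exists N, forall n, (N <= n)%nat -> (M <= f n)%Z) ->
  Clim (fun n => rf (f n)) (/ qpoch_inf q q).
Proof.
  intros Hf. destruct (Hf 0%Z) as [N0 H0].
  apply (Clim_eventually (fun n => / qprod q q (Z.to_nat (f n))) _ _ N0).
  - intros n Hn. unfold rf. specialize (H0 n Hn). destruct (Z_lt_dec (f n) 0); [lia|auto].
  - apply (Clim_sub (fun n => / qprod q q n) _ (fun n => Z.to_nat (f n))).
    + apply Clim_inv; [apply qpoch_neq0_small; apply q_lt1|apply qpoch_lim, q_lt1].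
    + intros N. destruct (Hf (Z.of_nat N)) as [M HM]. exists M. intros n Hn. specialize (HM n Hn). lia.
Qed.

(** In the finite form the binomial coefficients stay bounded and tend to 1 / (q; q), so dominated
    convergence applies. *)
Lemma triple_product : jt tau u = qpoch_inf q q * qpoch_inf (ex u) q * qpoch_inf (q / ex u) q.
Proof.
  assert (Hl := qpoch_lim q q_lt1). assert (Hn := qpoch_neq0_small q q_lt1 q q_lt1).
  destruct rf_bounded as [B HB].
  destruct (tj_summable tau u Htau) as [M HM].
  assert (HB2 : exists B2, forall n, (Cmod (qprod q q n) <= B2)%R).
  { eexists. intros n. rewrite qprod_prodC, (prodC_ext _ (fun k => 1 + - (q * q ^ k))) by (intros; ring).
    apply (prodC_bound (fun k => - (q * q ^ k)) (Cmod q) (Cmod q) n (q_r q q_lt1)).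
    intros k. rewrite Cmod_opp, Cmod_mult, Cmod_pow. lra. }
  destruct HB2 as [B2 HB2].
  destruct (csum_dominated (fun N j => cN N j * tj tau u j) (fun j => / qpoch_inf q q * tj tau u j)
     (fun j => (B2 * B * B * Cmod (tj tau u j))%R) (B2 * B * B * M)%R
     (fun N => qprod (ex u) q N * qprod (q / ex u) q N)) as [H1 H2].
  - intros n j. rewrite Cmod_mult. apply Rmult_le_compat_r; [apply Cmod_ge_0|].
    unfold cN. rewrite !Cmod_mult. apply Rmult_le_compat; auto using Cmod_ge_0.
    + apply Rmult_le_pos; apply Cmod_ge_0.
    + apply Rmult_le_compat; auto using Cmod_ge_0.
  - apply rbound_scal; auto.
    assert (A1 := Rle_trans _ _ _ (Cmod_ge_0 _) (HB2 0%nat)). assert (A2 := Rle_trans _ _ _ (Cmod_ge_0 _) (HB 0%Z)).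
    repeat apply Rmult_le_pos; auto.
  - intros j. apply Clim_mult; [|apply Clim_const]. unfold cN.
    replace (/ qpoch_inf q q) with (qpoch_inf q q * / qpoch_inf q q * / qpoch_inf q q) by (field; auto).
    apply Clim_mult; [apply Clim_mult|].
    + apply (Clim_sub (qprod q q) _ (fun n => (2 * n)%nat) (Hl q)). intros N. exists N. lia.
    + apply rf_lim. intros Z. exists (Z.to_nat (Z + j)). lia.
    + apply rf_lim. intros Z. exists (Z.to_nat (Z - j)). lia.
  - apply triple_fin.
  - assert (E := Clim_unique _ _ _ H2 (Clim_mult _ _ _ _ (Hl (ex u)) (Hl (q / ex u)))).
    rewrite Sum_scal in E by (exists M; auto). fold (jt tau u) in E.
    rewrite <- Cmult_assoc, <- E. field. auto.
Qed.

(** A vanishing factor of the triple product makes u + k tau or (k + 1) tau - u an integer for some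
    k >= 0. *)
Lemma jt_neq0 : notlat tau u -> jt tau u <> 0.
Proof.
  intros H. rewrite triple_product. apply Cmult_neq_0; [apply Cmult_neq_0|].
  - apply qpoch_neq0_small; apply q_lt1.
  - apply qpoch_neq0; [apply q_lt1|]. intros k E.
    assert (E1 : ex (u + RtoC (INR k) * tau) = 1).
    { rewrite ex_plus, <- ex_pow. replace (ex u * ex tau ^ k) with (1 - (1 - ex u * ex tau ^ k)) by ring.
      fold q. rewrite E. ring. }
    destruct (ex_eq_1 _ E1) as [n Hn]. apply (H (- Z.of_nat k)%Z n).
    rewrite opp_IZR, <- INR_IZR_INZ, RtoC_opp, <- Hn. ring.
  - apply qpoch_neq0; [apply q_lt1|]. intros k E.
    assert (E1 : ex (tau - u + RtoC (INR k) * tau) = 1).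
    { rewrite ex_plus, ex_minus, <- ex_pow. fold q. replace (q / ex u * q ^ k) with (1 - (1 - q / ex u * q ^ k)) by ring.
      rewrite E. ring. }
    destruct (ex_eq_1 _ E1) as [n Hn]. apply (H (Z.of_nat k + 1)%Z (- n)%Z).
    rewrite plus_IZR, opp_IZR, <- INR_IZR_INZ, RtoC_plus, RtoC_opp, <- Hn. ring.
Qed.
End Triple.

Definition J3 (tau : C) : C := qpoch_inf (ex tau) (ex tau) * qpoch_inf (ex tau) (ex tau) * qpoch_inf (ex tau) (ex tau).

(** Euler's identity between odd and distinct parts: (q; q) = (q; q^2) (q^2; q^2), while (q; q) (-q;
    q) = (q^2; q^2). *)
Lemma euler_odd (q : C) : (Cmod q < 1)%R -> qpoch_inf q (q * q) * qpoch_inf (- q) q = 1.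
Proof.
  intros Hq. assert (Hqq : (Cmod (q * q) < 1)%R) by (rewrite Cmod_mult; assert (A := q_r q Hq); nra).
  assert (E1 := qpoch_split q Hq). assert (E2 := qpoch_pm q Hq q).
  assert (N1 := qpoch_neq0_small q Hq q Hq). assert (N2 := qpoch_neq0_small (q * q) Hqq (q * q) Hqq).
  assert (E : qpoch_inf (q * q) (q * q) * (qpoch_inf q (q * q) * qpoch_inf (- q) q) = qpoch_inf (q * q) (q * q)).
  { rewrite <- E2 at 2. rewrite E1. ring. }
  replace (qpoch_inf q (q * q) * qpoch_inf (- q) q) with
    (qpoch_inf (q * q) (q * q) * (qpoch_inf q (q * q) * qpoch_inf (- q) q) / qpoch_inf (q * q) (q * q)) by (field; auto).
  rewrite E. field. auto.
Qed.

(** Brings the cube of the Euler product under the same multiplier as the other thetas, through the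
    thetas at the three half-periods. *)
Lemma J3_jt tau : (0 < Im tau)%R ->
  jt tau (1 / 2) * jt tau (tau / 2) * jt tau (tau / 2 + 1 / 2) = 2 * J3 tau.
Proof.
  intros H. rewrite !triple_product by auto. set (q := ex tau).
  assert (Hq : (Cmod q < 1)%R) by (apply ex_lt1; auto).
  rewrite ex_plus, ex_half. set (s := ex (tau / 2)).
  assert (Es : s * s = q) by (unfold s, q; rewrite <- ex_plus; f_equal; field).
  assert (Hs : s <> 0) by apply ex_neq0.
  assert (Hq0 : q <> 0) by apply ex_neq0.
  replace (q / -1) with (- q) by field.
  replace (q / s) with s by (rewrite <- Es; field; auto).
  replace (q / (s * -1)) with (- s) by (rewrite <- Es; field; auto).
  replace (s * -1) with (- s) by ring.
  rewrite (qpoch_S q Hq (-1)). replace (-1 * q) with (- q) by ring.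
  assert (E := qpoch_pm q Hq s). rewrite Es in E. assert (Eo := euler_odd q Hq).
  unfold J3. fold q. set (P := qpoch_inf q q).
  transitivity (2 * (P * P * P) * ((qpoch_inf s q * qpoch_inf (- s) q) * qpoch_inf (- q) q) * ((qpoch_inf s q * qpoch_inf (- s) q) * qpoch_inf (- q) q)).
  - replace (1 - -1) with (RtoC 2) by ring. ring.
  - rewrite E, Eo. ring.
Qed.

Definition th4 (tau : C) : C := jt (2 * tau) tau.

Lemma th4_eq tau : (0 < Im tau)%R -> th4 tau <> 0 /\ qpoch_inf (- ex tau) (ex tau) / qpoch_inf (ex tau) (ex tau) = / th4 tau.
Proof.
  intros H. set (q := ex tau). assert (Hq : (Cmod q < 1)%R) by (apply ex_lt1; auto).
  assert (H2 : (0 < Im (2 * tau))%R) by (rewrite Im_scal; lra).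
  assert (Hq0 : q <> 0) by apply ex_neq0.
  assert (E2 : ex (2 * tau) = q * q) by (unfold q; rewrite <- ex_plus; f_equal; ring).
  assert (Hqq : (Cmod (q * q) < 1)%R) by (rewrite Cmod_mult; assert (A := q_r q Hq); nra).
  assert (E : th4 tau = qpoch_inf q q * qpoch_inf q (q * q)).
  { unfold th4. rewrite triple_product by auto. rewrite E2. fold q.
    replace (q * q / q) with q by (field; auto). rewrite (qpoch_split q Hq). ring. }
  assert (Eo := euler_odd q Hq).
  assert (N1 := qpoch_neq0_small q Hq q Hq). assert (N2 := qpoch_neq0_small (q * q) Hqq q Hq).
  split; [rewrite E; apply Cmult_neq_0; auto|].
  rewrite E. replace (qpoch_inf (- q) q) with (/ qpoch_inf q (q * q)).
  - field. auto.
  - replace (qpoch_inf (- q) q) with (qpoch_inf q (q * q) * qpoch_inf (- q) q / qpoch_inf q (q * q)) by (field; auto).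
    rewrite Eo. field. auto.
Qed.

(** * Appell sums *)

Definition ZC (n : Z) : C := RtoC (IZR n).

Lemma ZC_plus m n : ZC (m + n) = ZC m + ZC n.
Proof. unfold ZC. rewrite plus_IZR, RtoC_plus. auto. Qed.
Lemma ZC_mult m n : ZC (m * n) = ZC m * ZC n.
Proof. unfold ZC. rewrite mult_IZR, RtoC_mult. auto. Qed.
Lemma ZC_opp n : ZC (- n) = - ZC n.
Proof. unfold ZC. rewrite opp_IZR, RtoC_opp. auto. Qed.
Lemma ZC_minus m n : ZC (m - n) = ZC m - ZC n.
Proof. unfold ZC. rewrite minus_IZR, RtoC_minus. auto. Qed.
Lemma Im_ZC n z : (Im (ZC n * z) = IZR n * Im z)%R.
Proof. apply Im_scal. Qed.

Ltac zc := rewrite ?ZC_plus, ?ZC_minus, ?ZC_mult, ?ZC_opp, ?ZC_plus, ?ZC_minus, ?ZC_mult, ?ZC_opp.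

Lemma ex_eqZ z w (n : Z) : z = w + ZC n -> ex z = ex w.
Proof. apply ex_eq. Qed.

Lemma tj_alt tau u n : tj tau u n = ex (ZC n / 2 + tau * (ZC n * (ZC n - 1)) / 2 + ZC n * u).
Proof.
  unfold tj, ZC. f_equal. unfold Rdiv. rewrite !RtoC_mult, RtoC_minus, RtoC_inv by lra. field.
Qed.

(** The coefficient of X^i in (1 - X^m) / (1 - X), for m of either sign. At fixed m it describes a
    finite geometric sum, at fixed i an infinite one; passing from one reading to the other drives
    the Appell identity. *)
Definition eps (i m : Z) : C :=
  if Z_le_dec 0 i then (if Z_lt_dec i m then 1 else 0) else (if Z_le_dec m i then -(1) else 0).

Lemma eps_step i m : eps i (m + 1) = eps i m + (if Z.eq_dec i m then 1 else 0).
Proof.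
  unfold eps. destruct (Z_le_dec 0 i); destruct (Z.eq_dec i m);
    repeat match goal with |- context [Z_lt_dec ?x ?y] => destruct (Z_lt_dec x y)
    | |- context [Z_le_dec ?x ?y] => destruct (Z_le_dec x y) end; try lia; ring.
Qed.

Lemma eps_geom_fin (X : C) m : ex X <> 1 ->
  csum (fun i => eps i m * ex (ZC i * X)) ((1 - ex (ZC m * X)) / (1 - ex X)).
Proof.
  intros HX.
  assert (HX1 : 1 - ex X <> 0).
  { intros E. apply HX. replace (ex X) with (1 - (1 - ex X)) by ring. rewrite E. ring. }
  assert (At : forall k : Z, csum (fun i => (if Z.eq_dec i k then RtoC 1 else 0) * ex (ZC i * X)) (ex (ZC k * X))).
  { intros k. assert (A : csum (fun i => (if Z.eq_dec i k then RtoC 1 else 0) * ex (ZC i * X)) ((if Z.eq_dec k k then RtoC 1 else 0) * ex (ZC k * X))).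
    { apply (csum_at (fun i => (if Z.eq_dec i k then RtoC 1 else 0) * ex (ZC i * X)) k). intros i Hi. destruct (Z.eq_dec i k); [congruence|ring]. }
    destruct (Z.eq_dec k k); [|congruence]. rewrite Cmult_1_l in A. exact A. }
  assert (Up : forall m, csum (fun i => eps i m * ex (ZC i * X)) ((1 - ex (ZC m * X)) / (1 - ex X)) <->
     csum (fun i => eps i (m + 1) * ex (ZC i * X)) ((1 - ex (ZC (m + 1) * X)) / (1 - ex X))).
  { intros k.
    assert (E : (1 - ex (ZC (k + 1) * X)) / (1 - ex X) = (1 - ex (ZC k * X)) / (1 - ex X) + ex (ZC k * X)).
    { rewrite ZC_plus, Cmult_plus_distr_r. replace (ZC 1 * X) with X by (unfold ZC; ring).
      rewrite ex_plus. field. auto. }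
    rewrite E. split; intros H.
    - eapply csum_ext; [|apply csum_plus; [exact H|apply (At k)]]. intros i. cbv beta. rewrite eps_step. ring.
    - replace ((1 - ex (ZC k * X)) / (1 - ex X)) with ((1 - ex (ZC k * X)) / (1 - ex X) + ex (ZC k * X) - ex (ZC k * X)) by ring.
      eapply csum_ext; [|apply csum_minus; [exact H|apply (At k)]]. intros i. cbv beta. rewrite eps_step. ring. }
  assert (Base : csum (fun i => eps i 0 * ex (ZC i * X)) ((1 - ex (ZC 0 * X)) / (1 - ex X))).
  { replace ((1 - ex (ZC 0 * X)) / (1 - ex X)) with (RtoC 0).
    - eapply csum_ext; [|apply csum_zero]. intros i. cbv beta. unfold eps.
      destruct (Z_le_dec 0 i); [destruct (Z_lt_dec i 0); [lia|ring]|ring].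
    - unfold ZC. rewrite Cmult_0_l, ex_0. field. auto. }
  assert (P : forall n : nat, csum (fun i => eps i (Z.of_nat n) * ex (ZC i * X)) ((1 - ex (ZC (Z.of_nat n) * X)) / (1 - ex X))).
  { induction n as [|n IH]; [exact Base|]. replace (Z.of_nat (S n)) with (Z.of_nat n + 1)%Z by lia. apply (proj1 (Up _)). exact IH. }
  assert (N : forall n : nat, csum (fun i => eps i (- Z.of_nat n) * ex (ZC i * X)) ((1 - ex (ZC (- Z.of_nat n) * X)) / (1 - ex X))).
  { induction n as [|n IH]; [exact Base|]. apply (proj2 (Up _)). replace (- Z.of_nat (S n) + 1)%Z with (- Z.of_nat n)%Z by lia. auto. }
  destruct (Z_le_dec 0 m).
  - rewrite <- (Z2Nat.id m) by auto. apply P.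
  - replace m with (- Z.of_nat (Z.to_nat (- m)))%Z by lia. apply N.
Qed.

Lemma eps_geom_inf (W : C) i : (0 <= i)%Z /\ (0 < Im W)%R \/ (i < 0)%Z /\ (Im W < 0)%R ->
  csum (fun m => eps i m * ex (ZC m * W)) (ex (ZC (i + 1) * W) / (1 - ex W)).
Proof.
  intros [[Hi HW]|[Hi HW]].
  - assert (HX := csum_geom _ (ex_lt1 W HW)).
    assert (Hn := one_minus_neq0 _ (ex_lt1 W HW)).
    apply (csum_push (fun k : nat => (i + 1 + Z.of_nat k)%Z)).
    + intros; lia.
    + intros m Hm. unfold eps. destruct (Z_le_dec 0 i); [|lia]. destruct (Z_lt_dec i m); [|ring].
      exfalso. apply (Hm (Z.to_nat (m - i - 1))). lia.
    + replace (ex (ZC (i + 1) * W) / (1 - ex W)) with (ex (ZC (i + 1) * W) * (1 / (1 - ex W))) by (field; auto).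
      eapply csum_ext; [|apply csum_scal; exact HX]. intros k. cbv beta.
      rewrite ex_pow, <- ex_plus. unfold eps. destruct (Z_le_dec 0 i); [|lia]. destruct (Z_lt_dec i (i + 1 + Z.of_nat k)); [|lia].
      rewrite Cmult_1_l. f_equal. rewrite INR_IZR_INZ. fold (ZC (Z.of_nat k)). zc. ring.
  - assert (HW' : (0 < Im (- W))%R) by (rewrite Im_opp; lra).
    assert (HX := csum_geom _ (ex_lt1 (- W) HW')).
    assert (Hn := one_minus_neq0 _ (ex_lt1 (- W) HW')).
    assert (E1 : ex W <> 0) by apply ex_neq0.
    assert (Hn2 : 1 - ex W <> 0).
    { intros E. apply Hn. rewrite ex_opp. replace (1 - / ex W) with (- (1 - ex W) / ex W) by (field; auto).
      rewrite E. field. auto. }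
    apply (csum_push (fun k : nat => (i - Z.of_nat k)%Z)).
    + intros; lia.
    + intros m Hm. unfold eps. destruct (Z_le_dec 0 i); [lia|]. destruct (Z_le_dec m i); [|ring].
      exfalso. apply (Hm (Z.to_nat (i - m))). lia.
    + replace (ex (ZC (i + 1) * W) / (1 - ex W)) with (- ex (ZC i * W) * (1 / (1 - ex (- W)))).
      * eapply csum_ext; [|apply csum_scal; exact HX]. intros k. cbv beta.
        rewrite ex_pow. unfold eps. destruct (Z_le_dec 0 i); [lia|]. destruct (Z_le_dec (i - Z.of_nat k) i); [|lia].
        replace (ex (ZC (i - Z.of_nat k) * W)) with (ex (ZC i * W) * ex (RtoC (INR k) * - W)); [ring|].
        rewrite <- ex_plus. f_equal. rewrite INR_IZR_INZ. fold (ZC (Z.of_nat k)). zc. ring.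
      * rewrite ZC_plus, Cmult_plus_distr_r, ex_plus. replace (ZC 1 * W) with W by (unfold ZC; ring).
        rewrite ex_opp. field. repeat split; auto.
        all: intros E; apply Hn2; replace (1 - ex W) with (- (ex W - 1)) by ring; rewrite E; ring.
Qed.

(** Far out, e(u + n tau) has modulus at most exp(-1) or at least exp(1), so the denominators stay
    away from 0; the finitely many others are nonzero. *)
Lemma den_bound tau u : (0 < Im tau)%R -> notlat tau u ->
  exists B, forall n : Z, (Cmod (/ (1 - ex (u + ZC n * tau))) <= B)%R.
Proof.
  intros Ht Hu.
  assert (Hne : forall n : Z, 1 - ex (u + ZC n * tau) <> 0).
  { intros n E. assert (E1 : ex (u + ZC n * tau) = 1).
    { replace (ex (u + ZC n * tau)) with (1 - (1 - ex (u + ZC n * tau))) by ring. rewrite E. ring. }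
    destruct (ex_eq_1 _ E1) as [k Hk]. apply (Hu (- n)%Z k). fold (ZC k) in Hk. fold (ZC (- n)). fold (ZC k).
    rewrite <- Hk, ZC_opp. ring. }
  assert (P := PI_RGT_0).
  assert (Half : forall h : nat -> Z, (exists N, forall k : nat, (N <= k)%nat ->
      (1 / 2 <= Cmod (1 - ex (u + ZC (h k) * tau)))%R) ->
    exists B, forall k : nat, (Cmod (/ (1 - ex (u + ZC (h k) * tau))) <= B)%R).
  { intros h [N HN]. destruct (nat_lower_bound (fun k => Cmod (1 - ex (u + ZC (h k) * tau))) N) as [d [Hd H]].
    - intros k. apply Cmod_pos; auto.
    - exists (1 / 2)%R. split; [lra|auto].
    - exists (/ d)%R. intros k. rewrite Cmod_inv by auto. apply Rinv_le_contravar; auto. }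
  assert (Big : forall x : R, exists N : nat, forall k, (N <= k)%nat -> (x <= INR k)%R).
  { intros x. destruct (INR_unbounded x) as [N HN]. exists N. intros k Hk. apply le_INR in Hk. lra. }
  assert (L2 : (exp (- (1)) < 1 / 2)%R).
  { assert (A := exp_ineq1 1 ltac:(lra)). rewrite exp_Ropp.
    replace (1 / 2)%R with (/ 2)%R by field. apply Rinv_lt_contravar; lra. }
  destruct (Half Z.of_nat) as [B1 H1].
  { destruct (Big ((1 - 2 * PI * Im u) / (2 * PI * Im tau))%R) as [N HN]. exists N. intros k Hk. specialize (HN k Hk).
    assert (A := Cmod_sub_ge 1 (ex (u + ZC (Z.of_nat k) * tau))). rewrite Cmod_1 in A.
    assert (B : (Cmod (ex (u + ZC (Z.of_nat k) * tau)) <= exp (- (1)))%R).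
    { rewrite Cmod_ex, Im_plus, Im_ZC, <- INR_IZR_INZ. apply exp_le_le.
      apply (Rmult_le_compat_r (2 * PI * Im tau)) in HN; [|nra].
      unfold Rdiv in HN. rewrite Rmult_assoc, Rinv_l in HN by nra. nra. }
    lra. }
  destruct (Half (fun k => (- Z.of_nat k)%Z)) as [B2 H2].
  { destruct (Big ((1 + 2 * PI * Im u) / (2 * PI * Im tau))%R) as [N HN]. exists N. intros k Hk. specialize (HN k Hk).
    assert (A := Cmod_sub_ge (ex (u + ZC (- Z.of_nat k) * tau)) 1). rewrite Cmod_1 in A.
    replace (ex (u + ZC (- Z.of_nat k) * tau) - 1) with (- (1 - ex (u + ZC (- Z.of_nat k) * tau))) in A by ring.
    rewrite Cmod_opp in A.
    assert (B : (exp 1 <= Cmod (ex (u + ZC (- Z.of_nat k) * tau)))%R).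
    { rewrite Cmod_ex, Im_plus, Im_ZC, opp_IZR, <- INR_IZR_INZ. apply exp_le_le.
      apply (Rmult_le_compat_r (2 * PI * Im tau)) in HN; [|nra].
      unfold Rdiv in HN. rewrite Rmult_assoc, Rinv_l in HN by nra. nra. }
    assert (C := exp_ineq1 1 ltac:(lra)). lra. }
  exists (Rmax B1 B2). intros n. destruct (Z_le_dec 0 n).
  - rewrite <- (Z2Nat.id n) by auto. eapply Rle_trans; [apply H1|apply Rmax_l].
  - replace n with (- Z.of_nat (Z.to_nat (- n)))%Z by lia. eapply Rle_trans; [apply H2|apply Rmax_r].
Qed.

(** The shift by tau replaces n (n - 1) / 2 by n (n + 1) / 2, the exponent of the Appell sums. *)
Definition ta (tau v : C) (n : Z) : C := tj tau (v + tau) n.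

Definition At (tau u v : C) (n : Z) : C := ta tau v n / (1 - ex (u + ZC n * tau)).

(* Appell sums, up to a theta factor the function mu(u, v) of Zwegers. *)
Definition Ap (tau u v : C) : C := Sum (At tau u v).

Lemma At_summable tau u v : (0 < Im tau)%R -> notlat tau u -> summable (At tau u v).
Proof.
  intros Ht Hu. destruct (den_bound tau u Ht Hu) as [B HB].
  destruct (tj_summable tau (v + tau) Ht) as [M HM].
  assert (HB0 : (0 <= B)%R) by (eapply Rle_trans; [apply Cmod_ge_0|apply (HB 0%Z)]).
  exists (B * M)%R. eapply rbound_le; [|apply rbound_scal; eauto].
  intros n. cbv beta. unfold At, Cdiv. rewrite Cmod_mult, Rmult_comm. apply Rmult_le_compat_r; auto using Cmod_ge_0.
Qed.

Lemma jt_shift tau s n : (0 < Im tau)%R ->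
  jt tau (s - ZC n * tau) = ex (ZC n / 2 - tau * (ZC n * (ZC n + 1)) / 2 + ZC n * s) * jt tau s.
Proof.
  intros H. unfold jt. rewrite <- Sum_scal by (apply tj_summable; auto).
  rewrite <- (Sum_bij (fun m => (m + n)%Z) (fun m => (m - n)%Z)).
  - apply Sum_ext. intros m. rewrite !tj_alt, <- ex_plus. f_equal. zc. field.
  - intros; lia.
  - intros; lia.
  - apply tj_summable; auto.
Qed.

Lemma jt_plus_tau tau v : (0 < Im tau)%R -> jt tau (v + tau) = - ex (- v) * jt tau v.
Proof.
  intros H. assert (E := jt_shift tau v (-1) H).
  replace (v - ZC (-1) * tau) with (v + tau) in E by (unfold ZC; ring). rewrite E. f_equal.
  replace (- ex (- v)) with (ex (1 / 2) * ex (- v)) by (rewrite ex_half; ring).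
  rewrite <- ex_plus. apply (ex_eqZ _ _ (-1)). unfold ZC. field.
Qed.

Lemma ta_alt tau v n : ta tau v n = ex (ZC n / 2 + tau * (ZC n * (ZC n + 1)) / 2 + ZC n * v).
Proof. unfold ta. rewrite tj_alt. f_equal. field. Qed.

Lemma strip_notlat tau w : (0 < Im w)%R -> (Im w < Im tau)%R -> notlat tau w.
Proof.
  intros H0 H1 m n E.
  assert (EI : Im w = (IZR m * Im tau)%R) by (rewrite E, Im_plus, Im_scal, Im_RtoC; ring).
  rewrite EI in H0, H1.
  assert (A : (0 < IZR m)%R) by nra. assert (B : (IZR m < 1)%R) by nra.
  apply (lt_IZR 0) in A. apply (lt_IZR m 1) in B. lia.
Qed.

(** * Two Appell sums and a bilateral series *)

Section AppellIdentity.
Variables tau u v s : C.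
Hypothesis Htau : (0 < Im tau)%R.
Hypothesis Hu : notlat tau u.
Hypothesis Hs0 : (0 < Im (v + s))%R.
Hypothesis Hs1 : (Im (v + s) < Im tau)%R.

(** The geometric expansion of the denominators in [Ap tau (v + s) (u + s)], with m as the new
    index; [eps] treats the two directions of expansion, i >= 0 and i < 0, at once. *)
Definition ee (p : Z * Z) : C := let (m, i) := p in
  - ex (ZC i / 2 - tau * (ZC i * (ZC i + 1)) / 2 + ZC i * (u - v)) * (eps i m * ex (ZC m * (v + s + ZC i * tau))).

Lemma ee_summable : summable ee.
Proof.
  set (dl := Rmin (Im (v + s)) (Im tau - Im (v + s))).
  assert (P := PI_RGT_0).
  assert (Hdl : (0 < dl)%R) by (apply Rmin_glb_lt; lra).
  assert (D1 : (dl <= Im (v + s))%R) by apply Rmin_l.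
  assert (D2 : (dl <= Im tau - Im (v + s))%R) by apply Rmin_r.
  destruct (tj_summable tau (u - v + tau) Htau) as [M HM].
  assert (Hr : (0 <= exp (- (2 * PI * dl)) < 1)%R).
  { split; [left; apply exp_pos|]. rewrite <- exp_0. apply exp_increasing. nra. }
  eapply (summable_le ee (fun p => (exp (- (2 * PI * dl)) ^ Z.abs_nat (fst p) * Cmod (tj tau (u - v + tau) (snd p)))%R));
    [|apply (rbound_prod (fun m : Z => (exp (- (2 * PI * dl)) ^ Z.abs_nat m)%R) (fun i => Cmod (tj tau (u - v + tau) i)) (2 / (1 - exp (- (2 * PI * dl)))) M);
      [intros; apply pow_le; apply Hr|intros; apply Cmod_ge_0|apply rbound_geom_Z; auto|exact HM]].
  intros [m i]. cbn [fst snd]. unfold ee. fold (ta tau (u - v) i). rewrite ta_alt.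
  rewrite !Cmod_mult, Cmod_opp, !Cmod_ex, exp_pow.
  assert (Em : INR (Z.abs_nat m) = Rabs (IZR m)) by (rewrite INR_IZR_INZ, Zabs2Nat.id_abs, abs_IZR; auto).
  rewrite Em, <- exp_plus.
  set (w := Im (u - v)). set (T := Im tau) in *. set (y := Im (v + s)) in *.
  assert (I1 : Im (ZC i / 2 - tau * (ZC i * (ZC i + 1)) / 2 + ZC i * (u - v)) = (- T * (IZR i * (IZR i + 1) / 2) + IZR i * w)%R).
  { replace (ZC i / 2 - tau * (ZC i * (ZC i + 1)) / 2 + ZC i * (u - v)) with (ZC i / 2 + RtoC (- (IZR i * (IZR i + 1) / 2)) * tau + RtoC (IZR i) * (u - v)).
    - rewrite !Im_plus, !Im_scal, Im_div2. unfold ZC. rewrite Im_RtoC. unfold T, w. field.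
    - unfold ZC, Rdiv. rewrite RtoC_opp, !RtoC_mult, RtoC_plus, RtoC_inv by lra. field. }
  assert (I2 : Im (ZC i / 2 + tau * (ZC i * (ZC i + 1)) / 2 + ZC i * (u - v)) = (T * (IZR i * (IZR i + 1) / 2) + IZR i * w)%R).
  { replace (ZC i / 2 + tau * (ZC i * (ZC i + 1)) / 2 + ZC i * (u - v)) with (ZC i / 2 + RtoC (IZR i * (IZR i + 1) / 2) * tau + RtoC (IZR i) * (u - v)).
    - rewrite !Im_plus, !Im_scal, Im_div2. unfold ZC. rewrite Im_RtoC. unfold T, w. field.
    - unfold ZC, Rdiv. rewrite !RtoC_mult, RtoC_plus, RtoC_inv by lra. field. }
  assert (I3 : Im (ZC m * (v + s + ZC i * tau)) = (IZR m * (y + IZR i * T))%R).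
  { rewrite Im_ZC, Im_plus, Im_ZC. auto. }
  rewrite I1, I2, I3.
  assert (HT : (0 < T)%R) by exact Htau.
  assert (Z0 : Cmod (eps i m) = 0%R \/ (Cmod (eps i m) = 1%R /\ ((0 <= i < m)%Z \/ (m <= i < 0)%Z))).
  { unfold eps. destruct (Z_le_dec 0 i); [destruct (Z_lt_dec i m)|destruct (Z_le_dec m i)];
      rewrite ?Cmod_opp, ?Cmod_1, ?Cmod_0; auto; right; split; auto; lia. }
  destruct Z0 as [-> | [-> Z0]].
  { rewrite Rmult_0_l, Rmult_0_r. left. apply exp_pos. }
  rewrite Rmult_1_l, <- exp_plus. apply exp_le_le.
  set (a := IZR i). set (b := IZR m).
  (* Where [eps i m] is nonzero, m lies beyond i on the same side of 0, so m i outweighs i (i + 1)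
     and leaves Gaussian decay in i together with exponential decay in m. *)
  assert (Key : (T * (a * (a + 1) / 2) + Rabs b * dl <= - T * (a * (a + 1) / 2) + b * (y + a * T))%R).
  { destruct Z0 as [[Z1 Z2]|[Z1 Z2]].
    - assert (Ha : (0 <= a)%R) by (apply (IZR_le 0); auto).
      assert (Hb : (a + 1 <= b)%R) by (unfold a, b; rewrite <- plus_IZR; apply IZR_le; lia).
      rewrite Rabs_pos_eq by lra.
      assert (0 <= T * a * (b - (a + 1)))%R by (apply Rmult_le_pos; [apply Rmult_le_pos; lra|lra]).
      assert (0 <= b * (y - dl))%R by (apply Rmult_le_pos; lra). lra.
    - assert (Ha : (a <= -1)%R) by (apply (IZR_le i (-1)); lia).
      assert (Hb : (b <= a)%R) by (apply IZR_le; lia).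
      rewrite Rabs_left by lra.
      assert (0 <= T * (-1 - a) * (a - b))%R by (apply Rmult_le_pos; [apply Rmult_le_pos; lra|lra]).
      assert (0 <= (- b) * (T - y - dl))%R by (apply Rmult_le_pos; lra). lra. }
  assert (Key2 := Rmult_le_compat_l (2 * PI) _ _ ltac:(lra) Key). lra.
Qed.

Lemma ee_csum : csum ee (- ex (v + s) * Ap tau (v + s) (u + s)).
Proof.
  assert (H := summable_csum _ ee_summable).
  replace (- ex (v + s) * Ap tau (v + s) (u + s)) with (Sum ee); auto.
  assert (Hc : csum (fun i => - ex (v + s) * At tau (v + s) (u + s) i) (Sum ee)).
  { apply (csum_cols ee _ _ H). intros i. unfold ee.
    replace (- ex (v + s) * At tau (v + s) (u + s) i) with
      (- ex (ZC i / 2 - tau * (ZC i * (ZC i + 1)) / 2 + ZC i * (u - v)) * (ex (ZC (i + 1) * (v + s + ZC i * tau)) / (1 - ex (v + s + ZC i * tau)))).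
    - apply csum_scal. apply eps_geom_inf. rewrite Im_plus, Im_ZC.
      destruct (Z_le_dec 0 i) as [Hi|Hi].
      + left. split; auto. apply IZR_le in Hi. nra.
      + right. split; [lia|]. assert (Hi' : (i <= -1)%Z) by lia. apply IZR_le in Hi'. nra.
    - unfold At. rewrite ta_alt.
      assert (E : ex (ZC i / 2 - tau * (ZC i * (ZC i + 1)) / 2 + ZC i * (u - v)) * ex (ZC (i + 1) * (v + s + ZC i * tau)) =
        ex (v + s) * ex (ZC i / 2 + tau * (ZC i * (ZC i + 1)) / 2 + ZC i * (u + s))).
      { rewrite <- !ex_plus. f_equal. zc. unfold ZC. field. }
      set (D := 1 - ex (v + s + ZC i * tau)).
      transitivity (- (ex (ZC i / 2 - tau * (ZC i * (ZC i + 1)) / 2 + ZC i * (u - v)) * ex (ZC (i + 1) * (v + s + ZC i * tau))) / D).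
      + unfold Cdiv. ring.
      + rewrite E. unfold Cdiv. ring. }
  rewrite <- (csum_Sum _ _ Hc).
  assert (Hsm : summable (fun i => - ex (v + s) * At tau (v + s) (u + s) i)).
  { apply summable_scal, At_summable; auto using strip_notlat. }
  apply Sum_scal. apply At_summable; auto using strip_notlat.
Qed.

(** The theta jt(s - n tau), proportional to jt(s), is expanded over m. Writing e(- n m tau) as e(m
    u) minus a difference, the first part factors as jt(s + u) Ap(u, v). The difference is divisible
    by 1 - e(u + n tau), and the resulting finite geometric sums recombine into a product of jt(v)
    and the other Appell sum. *)
Lemma appell_identity :
  csum (fun n => jt tau s * (ex (ZC n * (v + s)) / (1 - ex (u + ZC n * tau))))
    (jt tau (s + u) * Ap tau u v - ex s * jt tau v * Ap tau (v + s) (u + s)).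
Proof.
  assert (Hne : forall n : Z, ex (u + ZC n * tau) <> 1).
  { intros n E1. destruct (ex_eq_1 _ E1) as [k Hk]. apply (Hu (- n)%Z k). fold (ZC k) in Hk. fold (ZC (- n)). fold (ZC k).
    rewrite <- Hk, ZC_opp. ring. }
  assert (Hne' : forall n : Z, 1 - ex (u + ZC n * tau) <> 0).
  { intros n E. apply (Hne n). replace (ex (u + ZC n * tau)) with (1 - (1 - ex (u + ZC n * tau))) by ring. rewrite E. ring. }
  assert (H3 := csum_prod (ta tau v) ee (tj_summable _ _ Htau) ee_summable).
  rewrite (csum_Sum _ _ ee_csum) in H3.
  replace (Sum (ta tau v) * (- ex (v + s) * Ap tau (v + s) (u + s))) with (ex s * jt tau v * Ap tau (v + s) (u + s)) in H3.
  2:{ change (Sum (ta tau v)) with (jt tau (v + tau)). rewrite jt_plus_tau by auto.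
      rewrite ex_plus, ex_opp. field. apply ex_neq0. }
  (* The substitution k = n - m + i, bijective for fixed m and i, makes the sum over i the finite
     geometric one. *)
  assert (H4 : csum (fun p : (Z * Z) * Z => ta tau v (fst (fst p) - snd (fst p) + snd p)%Z * ee (snd (fst p), snd p))
     (ex s * jt tau v * Ap tau (v + s) (u + s))).
  { apply (csum_bij (fun p : (Z * Z) * Z => ((fst (fst p) - snd (fst p) + snd p)%Z, (snd (fst p), snd p)))
      (fun p : Z * (Z * Z) => ((fst p + fst (snd p) - snd (snd p), fst (snd p))%Z, snd (snd p))) _ _) in H3.
    - exact H3.
    - intros [[n m] i]. cbn [fst snd]. repeat f_equal. lia.
    - intros [k [m i]]. cbn [fst snd]. repeat f_equal. lia. }
  assert (H5 : csum (fun p : Z * Z => ta tau v (fst p) * tj tau s (snd p) * (ex (ZC (snd p) * u) - ex (- (ZC (fst p) * ZC (snd p) * tau))) / (1 - ex (u + ZC (fst p) * tau)))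
     (ex s * jt tau v * Ap tau (v + s) (u + s))).
  { apply (csum_rows _ _ _ H4). intros [n m]. cbn [fst snd].
    assert (G := csum_scal (- (ta tau v n * tj tau s m * ex (- (ZC n * ZC m * tau)))) _ _ (eps_geom_fin (u + ZC n * tau) m (Hne n))).
    replace (ta tau v n * tj tau s m * (ex (ZC m * u) - ex (- (ZC n * ZC m * tau))) / (1 - ex (u + ZC n * tau)))
      with (- (ta tau v n * tj tau s m * ex (- (ZC n * ZC m * tau))) * ((1 - ex (ZC m * (u + ZC n * tau))) / (1 - ex (u + ZC n * tau)))).
    - eapply csum_ext; [|exact G]. intros i. cbv beta. unfold ee.
      rewrite !ta_alt, tj_alt.
      match goal with |- - (ex ?a * ex ?b * ex ?c) * (?e * ex ?d) = ex ?a' * (- ex ?b' * (?e * ex ?d')) =>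
        transitivity (- e * ex (a + b + c + d)); [rewrite !ex_plus; ring|];
        transitivity (- e * ex (a' + b' + d')); [|rewrite !ex_plus; ring] end.
      f_equal. apply (ex_eqZ _ _ (m - i)). zc. field.
    - replace (ex (ZC m * (u + ZC n * tau))) with (ex (ZC m * u) / ex (- (ZC n * ZC m * tau))).
      + field. split; [apply Hne'|apply ex_neq0].
      + rewrite <- ex_minus. f_equal. ring. }
  assert (Hb : summable (fun m : Z => tj tau (s + u) m)) by (apply tj_summable; auto).
  assert (H6 := csum_prod (At tau u v) (tj tau (s + u)) (At_summable tau u v Htau Hu) Hb).
  change (Sum (tj tau (s + u))) with (jt tau (s + u)) in H6. fold (Ap tau u v) in H6.
  rewrite (Cmult_comm (jt tau (s + u))).
  assert (H7 := csum_minus _ _ _ _ H6 H5).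
  apply (csum_rows _ _ _ H7). intros n. cbn [fst snd].
  assert (G := csum_scal (ta tau v n / (1 - ex (u + ZC n * tau))) _ _ (summable_csum _ (tj_summable tau (s - ZC n * tau) Htau))).
  fold (jt tau (s - ZC n * tau)) in G.
  replace (jt tau s * (ex (ZC n * (v + s)) / (1 - ex (u + ZC n * tau)))) with (ta tau v n / (1 - ex (u + ZC n * tau)) * jt tau (s - ZC n * tau)).
  - eapply csum_ext; [|exact G]. intros m. cbv beta. unfold At.
    rewrite !tj_alt.
    replace (ex (ZC m / 2 + tau * (ZC m * (ZC m - 1)) / 2 + ZC m * (s - ZC n * tau))) with
      (ex (ZC m / 2 + tau * (ZC m * (ZC m - 1)) / 2 + ZC m * s) * ex (- (ZC n * ZC m * tau))) by (rewrite <- ex_plus; f_equal; ring).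
    replace (ex (ZC m / 2 + tau * (ZC m * (ZC m - 1)) / 2 + ZC m * (s + u))) with
      (ex (ZC m / 2 + tau * (ZC m * (ZC m - 1)) / 2 + ZC m * s) * ex (ZC m * u)) by (rewrite <- ex_plus; f_equal; ring).
    field. apply Hne'.
  - rewrite jt_shift by auto. rewrite ta_alt.
    replace (ex (ZC n * (v + s))) with (ex (ZC n / 2 + tau * (ZC n * (ZC n + 1)) / 2 + ZC n * v) * ex (ZC n / 2 - tau * (ZC n * (ZC n + 1)) / 2 + ZC n * s)).
    + field. apply Hne'.
    + rewrite <- ex_plus. apply (ex_eqZ _ _ n). field.
Qed.
End AppellIdentity.

(** * The transformation of Appell sums *)

Lemma ex_lim (w : nat -> C) l : Clim w l -> Clim (fun k => ex (w k)) (ex l).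
Proof.
  intros H.
  assert (H0 : Clim (fun k => ex (w k - l)) 1).
  { intros eps He. assert (P := PI_RGT_0).
    destruct (H (Rmin (1 / (2 * PI)) (eps / (3 * (2 * PI) * exp 1)))) as [N HN].
    { assert (E1 := exp_pos 1). apply Rmin_glb_lt; apply Rdiv_lt_0_compat; nra. }
    exists N. intros n Hn. specialize (HN n Hn).
    assert (A := Rlt_le_trans _ _ _ HN (Rmin_l _ _)). assert (B := Rlt_le_trans _ _ _ HN (Rmin_r _ _)).
    unfold ex. eapply Rle_lt_trans; [apply Cexp_bound1|].
    assert (E : Cmod (2 * PI * Ci * (w n - l)) = (2 * PI * Cmod (w n - l))%R).
    { rewrite !Cmod_mult, Cmod_Ci, !Cmod_R, !Rabs_pos_eq by lra. ring. }
    rewrite E. set (r := Cmod (w n - l)) in *. assert (Hr : (0 <= r)%R) by apply Cmod_ge_0.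
    assert (X : (2 * PI * r <= 1)%R).
    { apply (Rmult_lt_compat_l (2 * PI)) in A; [|lra]. replace (2 * PI * (1 / (2 * PI)))%R with 1%R in A by (field; lra). lra. }
    assert (Y : (exp (2 * PI * r) <= exp 1)%R) by (apply exp_le_le; auto).
    assert (E1 := exp_pos 1).
    apply Rle_lt_trans with (3 * (2 * PI) * exp 1 * r)%R.
    - replace (3 * (2 * PI) * exp 1 * r)%R with (3 * (2 * PI * r) * exp 1)%R by ring. apply Rmult_le_compat_l; nra.
    - apply (Rmult_lt_compat_l (3 * (2 * PI) * exp 1)) in B; [|nra].
      replace (3 * (2 * PI) * exp 1 * (eps / (3 * (2 * PI) * exp 1)))%R with eps in B by (field; nra). auto. }
  apply (Clim_ext (fun k => ex l * ex (w k - l))).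
  - intros k. rewrite <- ex_plus. f_equal. ring.
  - assert (X := Clim_mult _ _ _ _ (Clim_const (ex l)) H0). rewrite Cmult_1_r in X. exact X.
Qed.

Lemma Clim_scal c u l : Clim u l -> Clim (fun n => c * u n) (c * l).
Proof. intros H. apply Clim_mult; auto. apply Clim_const. Qed.

(** Induction on the partial products: the bound exp(bd S) S, with S the partial geometric sum,
    absorbs one more factor at each step. *)
Lemma qpoch_lip (q w w' : C) (bd : R) : (Cmod q < 1)%R -> (0 <= bd)%R -> (Cmod w <= bd)%R -> (Cmod w' <= bd)%R ->
  (Cmod (qpoch_inf w q - qpoch_inf w' q) <= Cmod (w - w') * (exp (bd * (1 / (1 - Cmod q))) * (1 / (1 - Cmod q))))%R.
Proof.
  intros Hq HR Hw Hw'. assert (Hr := q_r q Hq). set (r := Cmod q) in *.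
  assert (B : forall z n, (Cmod z <= bd)%R -> (Cmod (qprod z q n) <= exp (bd * rsum (fun k => r ^ k)%R (seq 0 n)))%R).
  { intros z n Hz. induction n as [|n IH].
    - simpl. rewrite Cmod_1, Rmult_0_r, exp_0. lra.
    - rewrite seq_S, rsum_app, Rmult_plus_distr_l, exp_plus. simpl qprod. rewrite Cmod_mult.
      apply Rmult_le_compat; auto using Cmod_ge_0.
      unfold Cminus. eapply Rle_trans; [apply Cmod_triangle|]. rewrite Cmod_1, Cmod_opp, Cmod_mult, Cmod_pow. simpl rsum. rewrite Rplus_0_r.
      fold r. assert (P : (0 <= r ^ n)%R) by (apply pow_le; lra).
      assert (X : (Cmod z * r ^ n <= bd * r ^ n)%R) by (apply Rmult_le_compat_r; auto).
      assert (E := exp_ineq1_le (bd * r ^ n)). lra. }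
  assert (D : forall n, (Cmod (qprod w q n - qprod w' q n) <= Cmod (w - w') * (exp (bd * rsum (fun k => r ^ k)%R (seq 0 n)) * rsum (fun k => r ^ k)%R (seq 0 n)))%R).
  { induction n as [|n IH].
    - simpl. replace (1 - 1) with (RtoC 0) by ring. rewrite Cmod_0. lra.
    - rewrite seq_S, rsum_app, (Rmult_plus_distr_l bd), exp_plus. simpl qprod. simpl rsum. rewrite Rplus_0_r.
      set (S := rsum (fun k => r ^ k)%R (seq 0 n)) in *.
      assert (HS : (0 <= S)%R) by (apply rsum_nonneg; intros; apply pow_le; lra).
      replace (qprod w q n * (1 - w * q ^ n) - qprod w' q n * (1 - w' * q ^ n)) with
        ((qprod w q n - qprod w' q n) * (1 - w * q ^ n) + qprod w' q n * ((w' - w) * q ^ n)) by ring.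
      eapply Rle_trans; [apply Cmod_triangle|]. rewrite !Cmod_mult, Cmod_pow. fold r.
      replace (Cmod (w' - w)) with (Cmod (w - w')) by (replace (w' - w) with (- (w - w')) by ring; symmetry; apply Cmod_opp).
      set (dl := Cmod (w - w')) in *. assert (Hd : (0 <= dl)%R) by apply Cmod_ge_0.
      assert (P : (0 <= r ^ n)%R) by (apply pow_le; lra). set (rn := (r ^ n)%R) in *.
      assert (X : (Cmod (1 - w * q ^ n) <= exp (bd * rn))%R).
      { unfold Cminus. eapply Rle_trans; [apply Cmod_triangle|]. rewrite Cmod_1, Cmod_opp, Cmod_mult, Cmod_pow. fold r. fold rn.
        assert (X : (Cmod w * rn <= bd * rn)%R) by (apply Rmult_le_compat_r; auto).
        assert (E := exp_ineq1_le (bd * rn)). lra. }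
      assert (E1 := exp_pos (bd * S)). assert (E2 : (1 <= exp (bd * rn))%R).
      { rewrite <- exp_0. apply exp_le_le. nra. }
      assert (Y : (Cmod (qprod w q n - qprod w' q n) * Cmod (1 - w * q ^ n) <= dl * (exp (bd * S) * S) * exp (bd * rn))%R).
      { apply Rmult_le_compat; auto using Cmod_ge_0. }
      assert (Z := B w' n Hw'). fold S in Z.
      assert (Z' : (Cmod (qprod w' q n) * (dl * rn) <= exp (bd * S) * (dl * rn))%R) by (apply Rmult_le_compat_r; auto; nra).
      assert (Z'' : (exp (bd * S) * (dl * rn) <= exp (bd * S) * (dl * rn) * exp (bd * rn))%R).
      { rewrite <- (Rmult_1_r (exp (bd * S) * (dl * rn))) at 1. apply Rmult_le_compat_l; auto. apply Rmult_le_pos; nra. }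
      apply Rle_trans with (dl * (exp (bd * S) * S) * exp (bd * rn) + exp (bd * S) * (dl * rn) * exp (bd * rn))%R; [lra|].
      apply Req_le. ring. }
  assert (HL : Clim (fun n => qprod w q n - qprod w' q n) (qpoch_inf w q - qpoch_inf w' q)).
  { apply (Clim_ext (fun n => qprod w q n + (-(1)) * qprod w' q n)); [intros; ring|].
    replace (qpoch_inf w q - qpoch_inf w' q) with (qpoch_inf w q + (-(1)) * qpoch_inf w' q) by ring.
    apply Clim_plus; [|apply Clim_scal]; apply qpoch_lim; auto. }
  apply (Clim_bound _ _ _ HL). intros n. eapply Rle_trans; [apply D|].
  apply Rmult_le_compat_l; [apply Cmod_ge_0|].
  assert (G := rbound_geom r Hr (seq 0 n) (seq_NoDup _ _)).
  assert (HS : (0 <= rsum (fun k => r ^ k)%R (seq 0 n))%R) by (apply rsum_nonneg; intros; apply pow_le; lra).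
  apply Rmult_le_compat; auto; [left; apply exp_pos|]. apply exp_le_le. apply Rmult_le_compat_l; auto.
Qed.

Lemma qpoch_cont q (w : nat -> C) l : (Cmod q < 1)%R -> Clim w l -> Clim (fun k => qpoch_inf (w k) q) (qpoch_inf l q).
Proof.
  intros Hq H.
  set (R := (Cmod l + 1)%R). set (Kc := (exp (R * (1 / (1 - Cmod q))) * (1 / (1 - Cmod q)))%R).
  assert (Hr := q_r q Hq). assert (Hl := Cmod_ge_0 l).
  assert (HK : (0 < Kc)%R).
  { apply Rmult_lt_0_compat; [apply exp_pos|]. apply Rdiv_lt_0_compat; lra. }
  intros eps He. destruct (H (Rmin 1 (eps / Kc))) as [N HN].
  { apply Rmin_glb_lt; [lra|]. apply Rdiv_lt_0_compat; auto. }
  exists N. intros n Hn. specialize (HN n Hn).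
  assert (A := Rlt_le_trans _ _ _ HN (Rmin_l _ _)). assert (B := Rlt_le_trans _ _ _ HN (Rmin_r _ _)).
  assert (Cw : (Cmod (w n) <= R)%R).
  { replace (w n) with (l + (w n - l)) by ring. eapply Rle_trans; [apply Cmod_triangle|]. unfold R. lra. }
  eapply Rle_lt_trans; [apply (qpoch_lip q (w n) l R); auto; unfold R; lra|]. fold Kc.
  apply (Rmult_lt_compat_r Kc) in B; auto. replace (eps / Kc * Kc)%R with eps in B by (field; lra). auto.
Qed.

Lemma jt_0 tau : (0 < Im tau)%R -> jt tau 0 = 0.
Proof.
  intros H. rewrite triple_product, ex_0 by auto. rewrite (qpoch_S _ (ex_lt1 tau H) 1). ring.
Qed.

(** The modulus is exponential in Im v, so on [0, y] it is at most its value at one of the ends; the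
    sum of both is a majorant independent of v. *)
Lemma Cmod_tj_le tau v y n : (0 <= Im v <= y)%R -> (Cmod (ta tau v n) <= Cmod (ta tau 0 n) + Cmod (ta tau (Ci * RtoC y) n))%R.
Proof.
  intros Hv. rewrite !ta_alt.
  assert (E : forall w, Cmod (ex (ZC n / 2 + tau * (ZC n * (ZC n + 1)) / 2 + ZC n * w)) =
    (Cmod (ex (ZC n / 2 + tau * (ZC n * (ZC n + 1)) / 2)) * exp (- 2 * PI * (IZR n * Im w)))%R).
  { intros w. rewrite ex_plus, Cmod_mult. f_equal. rewrite Cmod_ex, Im_ZC. auto. }
  rewrite (E v), (E 0), (E (Ci * RtoC y)).
  set (c := Cmod (ex (ZC n / 2 + tau * (ZC n * (ZC n + 1)) / 2))). assert (Hc : (0 <= c)%R) by apply Cmod_ge_0.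
  rewrite <- Rmult_plus_distr_l. apply Rmult_le_compat_l; auto.
  replace (Im (Ci * RtoC y)) with y by (C_simpl; ring). rewrite Im_RtoC, Rmult_0_r, Rmult_0_r, exp_0.
  assert (P := PI_RGT_0).
  destruct (Rle_dec 0 (IZR n)).
  - apply Rle_trans with 1%R; [|assert (Q := exp_pos (- 2 * PI * (IZR n * y))); lra].
    rewrite <- exp_0. apply exp_le_le. assert (0 <= IZR n * Im v)%R by (apply Rmult_le_pos; lra). nra.
  - apply Rle_trans with (exp (- 2 * PI * (IZR n * y))); [|lra].
    apply exp_le_le. assert (IZR n * y <= IZR n * Im v)%R by nra. nra.
Qed.

(** * The limit of the Appell identity at the zero of theta *)

Section Limit.
Variables tau u : C.
Hypothesis Htau : (0 < Im tau)%R.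
Hypothesis Hu : notlat tau u.

Let T := Im tau.
(** Heights of points [vk] that tend to 0 along the imaginary axis inside the strip required by
    [appell_identity]. *)
Definition yk (k : nat) : R := (Im tau / (2 * (INR k + 1)))%R.
Definition vk (k : nat) : C := Ci * RtoC (yk k).

Lemma yk_bounds k : (0 < yk k <= Im tau / 2)%R.
Proof.
  assert (P := pos_INR k). unfold yk. split.
  - apply Rdiv_lt_0_compat; lra.
  - unfold Rdiv. apply Rmult_le_compat_l; [lra|]. apply Rinv_le_contravar; lra.
Qed.

Lemma vk_Im k : Im (vk k) = yk k.
Proof. unfold vk. C_simpl. ring. Qed.

Lemma vk_lim : Clim vk 0.
Proof.
  intros eps He. destruct (INR_unbounded (Im tau / eps)) as [N HN]. exists N. intros n Hn.
  replace (vk n - 0) with (vk n) by ring. unfold vk. rewrite Cmod_mult, Cmod_Ci, Cmod_R, Rmult_1_l.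
  assert (B := yk_bounds n). rewrite Rabs_pos_eq by lra. apply le_INR in Hn.
  unfold yk. assert (P : (0 < Im tau / eps)%R) by (apply Rdiv_lt_0_compat; auto).
  apply Rmult_lt_reg_r with (2 * (INR n + 1))%R; [lra|].
  unfold Rdiv. rewrite Rmult_assoc, Rinv_l, Rmult_1_r by lra.
  assert (E : Im tau = (Im tau / eps * eps)%R) by (field; lra). rewrite E. nra.
Qed.

Lemma Ap_lim : Clim (fun k => Ap tau u (vk k)) (Ap tau u 0).
Proof.
  destruct (den_bound tau u Htau Hu) as [B HB].
  assert (HB0 : (0 <= B)%R) by (eapply Rle_trans; [apply Cmod_ge_0|apply (HB 0%Z)]).
  destruct (tj_summable tau (0 + tau) Htau) as [M1 HM1].
  destruct (tj_summable tau (Ci * RtoC (Im tau) + tau) Htau) as [M2 HM2].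
  destruct (csum_dominated (fun k n => At tau u (vk k) n) (At tau u 0)
    (fun n => (B * (Cmod (ta tau 0 n) + Cmod (ta tau (Ci * RtoC (Im tau)) n)))%R) (B * (M1 + M2))%R (fun k => Ap tau u (vk k))) as [_ H]; auto.
  - intros k n. unfold At, Cdiv. rewrite Cmod_mult, Rmult_comm. apply Rmult_le_compat; auto using Cmod_ge_0.
    apply Cmod_tj_le. rewrite vk_Im. assert (Q := yk_bounds k). lra.
  - apply rbound_scal; auto. apply rbound_plus; auto.
  - intros n. apply Clim_mult; [|apply Clim_const].
    apply (Clim_ext (fun k => ta tau 0 n * ex (ZC n * vk k))).
    + intros k. rewrite !ta_alt, <- ex_plus. f_equal. ring.
    + assert (X := Clim_scal (ta tau 0 n) _ _ (ex_lim _ _ (Clim_scal (ZC n) _ _ vk_lim))).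
      rewrite Cmult_0_r, ex_0, Cmult_1_r in X. exact X.
  - intros k. apply summable_csum. apply At_summable; auto.
Qed.

Lemma ex_vk_lim : Clim (fun k => ex (vk k)) 1.
Proof. rewrite <- ex_0. apply ex_lim, vk_lim. Qed.

Lemma ex_vk_neq1 k : 1 - ex (vk k) <> 0.
Proof.
  apply one_minus_neq0. apply ex_lt1. rewrite vk_Im. apply yk_bounds.
Qed.

(** The factor 1 - e(v) is split off the triple product, and the remaining factors tend to (q;
    q)^3. *)
Lemma jt_vk_lim : Clim (fun k => jt tau (vk k) / (1 - ex (vk k))) (J3 tau).
Proof.
  set (q := ex tau). assert (Hq : (Cmod q < 1)%R) by (apply ex_lt1; auto).
  apply (Clim_ext (fun k => qpoch_inf q q * qpoch_inf (ex (vk k) * q) q * qpoch_inf (q * / ex (vk k)) q)).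
  - intros k. rewrite triple_product by auto. fold q. rewrite (qpoch_S q Hq (ex (vk k))).
    assert (N := ex_vk_neq1 k). change (q / ex (vk k)) with (q * / ex (vk k)).
    set (a := qpoch_inf (q * / ex (vk k)) q). field. auto.
  - unfold J3. fold q. apply Clim_mult; [apply Clim_scal|].
    + apply qpoch_cont; auto. assert (X := Clim_mult _ _ _ _ ex_vk_lim (Clim_const q)). rewrite Cmult_1_l in X. exact X.
    + apply qpoch_cont; auto. assert (X := Clim_scal q _ _ (Clim_inv _ _ (RtoC_neq0 1 R1_neq_R0) ex_vk_lim)).
      replace (q * / 1) with q in X by field. exact X.
Qed.

(** The residue of the Appell sum in its first variable: only the term n = 0 has a denominator that
    tends to 0. *)
Lemma Ap_vk_lim : Clim (fun k => (1 - ex (vk k)) * Ap tau (vk k) u) 1.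
Proof.
  assert (P := PI_RGT_0).
  set (rho := exp (- (2 * PI * Im tau))). set (sg := exp (PI * Im tau)).
  assert (Hrho : (rho < 1)%R) by (unfold rho; rewrite <- exp_0; apply exp_increasing; nra).
  assert (Hsg : (1 < sg)%R) by (unfold sg; rewrite <- exp_0; apply exp_increasing; nra).
  set (B := (1 + 2 / (1 - rho) + 2 / (sg - 1))%R).
  assert (I1 : (0 < / (1 - rho))%R) by (apply Rinv_0_lt_compat; lra).
  assert (I2 : (0 < / (sg - 1))%R) by (apply Rinv_0_lt_compat; lra).
  assert (Hx : forall k, (Cmod (1 - ex (vk k)) <= 2)%R).
  { intros k. unfold Cminus. eapply Rle_trans; [apply Cmod_triangle|]. rewrite Cmod_1, Cmod_opp.
    assert (A := ex_lt1 (vk k) ltac:(rewrite vk_Im; apply yk_bounds)). lra. }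
  (* The quotients are bounded uniformly in k and n; the cases n = 0, n >= 1 and n <= -1 give the
     three summands of [B]. *)
  assert (HB : forall k (n : Z), (Cmod ((1 - ex (vk k)) / (1 - ex (vk k + ZC n * tau))) <= B)%R).
  { intros k n. assert (Q := yk_bounds k).
    assert (Em : Cmod (ex (vk k + ZC n * tau)) = exp (- 2 * PI * (yk k + IZR n * Im tau))).
    { rewrite Cmod_ex, Im_plus, vk_Im, Im_ZC. auto. }
    destruct (Z.eq_dec n 0) as [->|Hn].
    - replace (vk k + ZC 0 * tau) with (vk k) by (unfold ZC; ring).
      replace ((1 - ex (vk k)) / (1 - ex (vk k))) with (RtoC 1) by (field; apply ex_vk_neq1). rewrite Cmod_1.
      unfold B, Rdiv. nra.
    - assert (G : forall d, (0 < d)%R -> (d <= Cmod (1 - ex (vk k + ZC n * tau)))%R -> (Cmod ((1 - ex (vk k)) / (1 - ex (vk k + ZC n * tau))) <= 2 / d)%R).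
      { intros d Hd HD. rewrite Cmod_div by (intros E; rewrite E, Cmod_0 in HD; lra).
        apply Rmult_le_compat; auto using Cmod_ge_0.
        - left. apply Rinv_0_lt_compat. lra.
        - apply Rinv_le_contravar; auto. }
      destruct (Z_le_dec 1 n) as [L|L].
      + apply Rle_trans with (2 / (1 - rho))%R; [apply G; [lra|]|unfold B, Rdiv; nra].
        assert (A := Cmod_sub_ge 1 (ex (vk k + ZC n * tau))). rewrite Cmod_1, Em in A.
        assert (L' := IZR_le _ _ L).
        assert (E : (exp (- 2 * PI * (yk k + IZR n * Im tau)) <= rho)%R).
        { apply exp_le_le. assert (Im tau <= IZR n * Im tau)%R by nra. nra. }
        lra.
      + apply Rle_trans with (2 / (sg - 1))%R; [apply G; [lra|]|unfold B, Rdiv; nra].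
        assert (A := Cmod_sub_ge (ex (vk k + ZC n * tau)) 1).
        replace (ex (vk k + ZC n * tau) - 1) with (- (1 - ex (vk k + ZC n * tau))) in A by ring.
        rewrite Cmod_opp, Cmod_1, Em in A.
        assert (L' : (n <= -1)%Z) by lia. apply IZR_le in L'.
        assert (E : (sg <= exp (- 2 * PI * (yk k + IZR n * Im tau)))%R).
        { apply exp_le_le. assert (IZR n * Im tau <= - Im tau)%R by nra. nra. }
        lra. }
  assert (HB0 : (0 <= B)%R) by (unfold B, Rdiv; nra).
  destruct (tj_summable tau (u + tau) Htau) as [M HM].
  destruct (csum_dominated (fun k n => (1 - ex (vk k)) / (1 - ex (vk k + ZC n * tau)) * ta tau u n) (fun n => if Z.eq_dec n 0 then RtoC 1 else 0)
    (fun n => (B * Cmod (ta tau u n))%R) (B * M)%R (fun k => (1 - ex (vk k)) * Ap tau (vk k) u)) as [Hc H].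
  - intros k n. rewrite Cmod_mult. apply Rmult_le_compat_r; auto using Cmod_ge_0.
  - apply rbound_scal; auto.
  - intros n. destruct (Z.eq_dec n 0) as [->|Hn].
    + apply (Clim_ext (fun _ => RtoC 1)); [|apply Clim_const]. intros k.
      replace (vk k + ZC 0 * tau) with (vk k) by (unfold ZC; ring). rewrite ta_alt.
      replace (ZC 0 / 2 + tau * (ZC 0 * (ZC 0 + 1)) / 2 + ZC 0 * u) with (RtoC 0) by (unfold ZC; field).
      rewrite ex_0. field. apply ex_vk_neq1.
    + replace (RtoC 0) with (0 * / (1 - 1 * ex (ZC n * tau)) * ta tau u n) by ring.
      apply Clim_mult; [|apply Clim_const]. apply Clim_mult.
      * apply (Clim_ext (fun k => 1 + (-(1)) * ex (vk k))); [intros; ring|].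
        replace (RtoC 0) with (1 + (-(1)) * 1) by ring. apply Clim_plus; [apply Clim_const|]. apply Clim_scal, ex_vk_lim.
      * apply Clim_inv.
        -- intros E. assert (E1 : ex (ZC n * tau) = 1).
           { replace (ex (ZC n * tau)) with (1 - (1 - 1 * ex (ZC n * tau))) by ring. rewrite E. ring. }
           destruct (ex_eq_1 _ E1) as [j Hj]. apply (f_equal Im) in Hj. rewrite Im_ZC, Im_RtoC in Hj.
           apply Rmult_integral in Hj. destruct Hj as [Hj|Hj]; [apply eq_IZR in Hj; auto|lra].
        -- apply (Clim_ext (fun k => 1 + (- ex (ZC n * tau)) * ex (vk k))); [intros k; rewrite ex_plus; ring|].
           replace (1 - 1 * ex (ZC n * tau)) with (1 + (- ex (ZC n * tau)) * 1) by ring.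
           apply Clim_plus; [apply Clim_const|]. apply Clim_scal, ex_vk_lim.
  - intros k. assert (Hv : notlat tau (vk k)).
    { apply strip_notlat; rewrite vk_Im; assert (Q := yk_bounds k); lra. }
    eapply csum_ext; [|apply csum_scal, summable_csum, (At_summable tau (vk k) u Htau Hv)].
    intros n. unfold At, Cdiv. ring.
  - assert (E : Sum (fun n => if Z.eq_dec n 0 then RtoC 1 else 0) = 1).
    { apply csum_Sum. assert (A : csum (fun n => if Z.eq_dec n 0 then RtoC 1 else 0) (if Z.eq_dec 0 0 then RtoC 1 else 0)).
      { apply (csum_at (fun n => if Z.eq_dec n 0 then RtoC 1 else 0) 0%Z). intros n Hn. destruct (Z.eq_dec n 0); congruence. }
      exact A. }
    rewrite E in H. exact H.
Qed.

(** At s = 0 the bilateral series carries the factor jt(0) = 0, and the identity becomes the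
    symmetry jt(u) Ap(u, v) = jt(v) Ap(v, u). As v tends to 0, the zero of jt(v) meets the pole of
    Ap(v, u). *)
Lemma Ap_0 : jt tau u * Ap tau u 0 = J3 tau.
Proof.
  apply (Clim_unique (fun k => jt tau u * Ap tau u (vk k))).
  - apply Clim_scal, Ap_lim.
  - apply (Clim_ext (fun k => jt tau (vk k) / (1 - ex (vk k)) * ((1 - ex (vk k)) * Ap tau (vk k) u))).
    + intros k. assert (Q := yk_bounds k).
      assert (H := appell_identity tau u (vk k) 0 Htau Hu).
      replace (vk k + 0) with (vk k) in H by ring. rewrite vk_Im in H. specialize (H ltac:(lra) ltac:(lra)).
      rewrite jt_0, ex_0 in H by auto.
      assert (H0 : csum (fun n : Z => 0 * (ex (ZC n * vk k) / (1 - ex (u + ZC n * tau)))) 0).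
      { eapply csum_ext; [|apply csum_zero]. intros n; cbv beta; ring. }
      assert (E := csum_unique _ _ _ H H0). replace (0 + u) with u in E by ring. replace (u + 0) with u in E by ring.
      replace (jt tau u * Ap tau u (vk k)) with (jt tau u * Ap tau u (vk k) - 1 * jt tau (vk k) * Ap tau (vk k) u + jt tau (vk k) * Ap tau (vk k) u) by ring.
      rewrite E. field. apply ex_vk_neq1.
    + replace (J3 tau) with (J3 tau * 1) by ring. apply Clim_mult; [apply jt_vk_lim|apply Ap_vk_lim].
Qed.
End Limit.

(** The instances of [appell_identity] for (v, s) and for (0, v + s) share one bilateral series. In
    the second, jt(0) = 0 removes one Appell sum, and [Ap_0] evaluates the other by thetas. *)
Lemma appell_final tau u v s : (0 < Im tau)%R -> notlat tau u -> (0 < Im (v + s))%R -> (Im (v + s) < Im tau)%R ->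
  jt tau (s + u) * Ap tau u v =
    jt tau s * J3 tau * jt tau (u + (v + s)) / (jt tau u * jt tau (v + s)) + ex s * jt tau v * Ap tau (v + s) (u + s).
Proof.
  intros Ht Hu H0 H1. assert (Hl := strip_notlat tau (v + s) H0 H1).
  assert (N1 := jt_neq0 tau u Ht Hu). assert (N2 := jt_neq0 tau (v + s) Ht Hl).
  assert (A := appell_identity tau u v s Ht Hu H0 H1).
  assert (B := appell_identity tau u 0 (v + s) Ht Hu).
  replace (0 + (v + s)) with (v + s) in B by ring. specialize (B H0 H1). rewrite jt_0 in B by auto.
  assert (B' := csum_scal (jt tau s / jt tau (v + s)) _ _ B).
  assert (E : jt tau (s + u) * Ap tau u v - ex s * jt tau v * Ap tau (v + s) (u + s) =
    jt tau s / jt tau (v + s) * (jt tau (v + s + u) * Ap tau u 0 - ex (v + s) * 0 * Ap tau (v + s) (u + (v + s)))).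
  { apply (csum_unique (fun n => jt tau s * (ex (ZC n * (v + s)) / (1 - ex (u + ZC n * tau))))); auto.
    eapply csum_ext; [|exact B']. intros n. cbv beta. set (X := ex (ZC n * (v + s)) / (1 - ex (u + ZC n * tau))). field. auto. }
  rewrite <- (Ap_0 tau u Ht Hu).
  replace (jt tau (s + u) * Ap tau u v) with (jt tau (s + u) * Ap tau u v - ex s * jt tau v * Ap tau (v + s) (u + s) + ex s * jt tau v * Ap tau (v + s) (u + s)) by ring.
  rewrite E. replace (v + s + u) with (u + (v + s)) by ring. field. auto.
Qed.

(** * Laurent expansions at infinity *)

Definition conv (a b : nat -> C) (n : nat) : C := lsum (fun i => a i * b (n - i)%nat) (seq 0 (S n)).

Lemma csum_nonneg_rbound {I : Type} (f : I -> R) s : (forall i, (0 <= f i)%R) -> csum (fun i => RtoC (f i)) s -> rbound f (Cmod s).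
Proof.
  intros Hf H L HL. apply le_epsilon. intros e He.
  destruct (H e He) as [L0 H0]. destruct (NoDup_cover (L ++ L0)) as [L1 [H1 [Hi _]]].
  specialize (H0 L1 H1 (fun x Hx => Hi x (in_or_app _ _ _ (or_intror Hx)))).
  assert (E : lsum (fun i => RtoC (f i)) L1 = RtoC (rsum f L1)).
  { clear. induction L1 as [|a L IH]; simpl; auto. rewrite IH, RtoC_plus; auto. }
  rewrite E in H0. assert (A := rsum_incl f L L1 Hf HL (fun x Hx => Hi x (in_or_app _ _ _ (or_introl Hx)))).
  assert (B := Cmod_sub_ge (RtoC (rsum f L1)) s). rewrite Cmod_R, Rabs_pos_eq in B by (apply rsum_nonneg; auto). lra.
Qed.

Lemma conv_csum a b : summable a -> summable b -> csum (conv a b) (Sum a * Sum b).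
Proof.
  intros Ha Hb. assert (H := csum_prod a b Ha Hb).
  set (g := fun p : nat * nat => if le_lt_dec (snd p) (fst p) then a (snd p) * b (fst p - snd p)%nat else 0).
  assert (Hg : csum g (Sum a * Sum b)).
  { apply (csum_push (fun p : nat * nat => (fst p + snd p, fst p)%nat)).
    - intros [x y] [x' y'] E. cbn [fst snd] in E. injection E as E1 E2. f_equal; lia.
    - intros [n i] Hn. unfold g. cbn [fst snd]. destruct (le_lt_dec i n); auto.
      exfalso. apply (Hn (i, n - i)%nat). cbn [fst snd]. f_equal. lia.
    - eapply csum_ext; [|exact H]. intros [i j]. unfold g. cbn [fst snd].
      destruct (le_lt_dec i (i + j)); [|lia]. f_equal. f_equal. lia. }
  apply (csum_rows _ _ _ Hg). intros n. unfold conv.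
  rewrite (lsum_ext _ (fun i => g (n, i))).
  - apply csum_fin; [apply seq_NoDup|]. intros i Hi. unfold g. cbn [fst snd].
    destruct (le_lt_dec i n); auto. exfalso. apply Hi. apply in_seq. lia.
  - intros i Hi. apply in_seq in Hi. unfold g. cbn [fst snd]. destruct (le_lt_dec i n); [auto|lia].
Qed.

(** The Cauchy product of the moduli dominates the convolution termwise, and its sum is at most M
    N. *)
Lemma conv_rbound a b M N : rbound (fun i => Cmod (a i)) M -> rbound (fun i => Cmod (b i)) N ->
  rbound (fun n => Cmod (conv a b n)) (M * N).
Proof.
  intros HM HN.
  set (a' := fun i => RtoC (Cmod (a i))). set (b' := fun i => RtoC (Cmod (b i))).
  assert (HM' : rbound (fun i => Cmod (a' i)) M).
  { eapply rbound_le; [|exact HM]. intros i. cbv beta. unfold a'. rewrite Cmod_R, Rabs_pos_eq; [lra|apply Cmod_ge_0]. }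
  assert (HN' : rbound (fun i => Cmod (b' i)) N).
  { eapply rbound_le; [|exact HN]. intros i. cbv beta. unfold b'. rewrite Cmod_R, Rabs_pos_eq; [lra|apply Cmod_ge_0]. }
  assert (H := conv_csum a' b' (ex_intro _ M HM') (ex_intro _ N HN')).
  set (G := fun n => rsum (fun i => (Cmod (a i) * Cmod (b (n - i)%nat))%R) (seq 0 (S n))).
  assert (HG : rbound G (Cmod (Sum a' * Sum b'))).
  { apply csum_nonneg_rbound.
    - intros n. apply rsum_nonneg. intros i. apply Rmult_le_pos; apply Cmod_ge_0.
    - eapply csum_ext; [|exact H]. intros n. unfold conv, G. generalize (seq 0 (S n)). intros L.
      induction L as [|x L IH]; cbn [lsum rsum fold_right]; auto.
      unfold lsum, rsum in IH. rewrite IH, RtoC_plus, RtoC_mult. auto. }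
  eapply rbound_weaken; [|eapply rbound_le; [|exact HG]].
  - rewrite Cmod_mult. apply Rmult_le_compat; auto using Cmod_ge_0; apply Sum_bound; auto.
  - intros n. cbv beta. unfold conv, G. eapply Rle_trans; [apply Cmod_lsum|]. apply rsum_le. intros i _. rewrite Cmod_mult. lra.
Qed.

Lemma conv_pow a b (t : C) n : conv a b n * t ^ n = conv (fun i => a i * t ^ i) (fun i => b i * t ^ i) n.
Proof.
  unfold conv. rewrite Cmult_comm, <- lsum_scal. apply lsum_ext. intros i Hi. apply in_seq in Hi.
  replace (t ^ n) with (t ^ i * t ^ (n - i)) by (rewrite <- Cpow_add_r; f_equal; lia). ring.
Qed.

(** * Infinite products of power series *)

Section PowerProducts.
Variable g : nat -> nat -> C.
Hypothesis g0 : forall n, g n 0%nat = 1.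
Hypothesis gz : forall n m, (0 < m <= n)%nat -> g n m = 0.
Hypothesis g1 : forall n m, (Cmod (g n m) <= 1)%R.

(** Coefficients of the product of the first N series. The factor of index n is 1 + O(t^(n + 1)), so
    the coefficient of t^m no longer changes from N = m on, and the infinite product has the
    coefficients [AN m m]. *)
Fixpoint AN (N : nat) : nat -> C :=
  match N with O => fun m => match m with O => 1 | _ => 0 end | S M => conv (AN M) (g M) end.

Lemma AN_stable N m : (m <= N)%nat -> AN N m = AN m m.
Proof.
  intros H. induction H as [|N H IH]; auto. rewrite <- IH. simpl. unfold conv.
  rewrite seq_S, lsum_app. rewrite (lsum_zero _ (seq 0 m)).
  - simpl. rewrite Nat.sub_diag, g0. ring.
  - intros i Hi. apply in_seq in Hi. rewrite gz by lia. ring.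
Qed.

Lemma g_rbound n r : (0 <= r < 1)%R -> rbound (fun m => (Cmod (g n m) * r ^ m)%R) (1 + r ^ S n * (1 / (1 - r))).
Proof.
  intros Hr.
  assert (H1 : rbound (fun m : nat => match m with O => 1%R | _ => 0%R end) 1).
  { apply (rbound_weaken _ (Cmod (RtoC 1))); [rewrite Cmod_1; lra|]. apply csum_nonneg_rbound.
    - intros [|m]; lra.
    - apply (csum_at (fun m : nat => RtoC (match m with O => 1%R | _ => 0%R end)) 0%nat). intros [|m] Hm; congruence. }
  assert (H2 : rbound (fun m : nat => (if le_lt_dec (S n) m then r ^ m else 0)%R) (r ^ S n * (1 / (1 - r)))).
  { assert (E : csum (fun m => RtoC (if le_lt_dec (S n) m then r ^ m else 0)%R) (RtoC (r ^ S n) * (1 / (1 - RtoC r)))).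
    { apply (csum_push (fun j => (S n + j)%nat)).
      - intros; lia.
      - intros m Hm. destruct (le_lt_dec (S n) m); auto. exfalso. apply (Hm (m - S n)%nat). lia.
      - eapply csum_ext; [|apply csum_scal, (csum_geom (RtoC r))].
        + intros j. cbv beta. destruct (le_lt_dec (S n) (S n + j)); [|lia].
          rewrite pow_add, RtoC_mult, (RtoC_pow r j). auto.
        + rewrite Cmod_R, Rabs_pos_eq; lra. }
    assert (B0 : forall m : nat, (0 <= (if le_lt_dec (S n) m then r ^ m else 0))%R)
      by (intros m; destruct (le_lt_dec (S n) m); [apply pow_le; lra|lra]).
    assert (B := csum_nonneg_rbound (fun m : nat => (if le_lt_dec (S n) m then r ^ m else 0)%R) _ B0 E).
    eapply rbound_weaken; [|exact B]. rewrite Cmod_mult, Cmod_R, Rabs_pos_eq by (apply pow_le; lra).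
    apply Rmult_le_compat_l; [apply pow_le; lra|].
    replace (1 / (1 - RtoC r)) with (RtoC (1 / (1 - r))) by (rewrite RtoC_div, RtoC_minus by lra; auto).
    rewrite Cmod_R, Rabs_pos_eq; [lra|]. apply Rmult_le_pos; [lra|]. left. apply Rinv_0_lt_compat. lra. }
  eapply rbound_le; [|apply (rbound_plus _ _ _ _ H1 H2)].
  intros m. cbv beta. assert (P : (0 <= r ^ m)%R) by (apply pow_le; lra).
  destruct (le_lt_dec (S n) m) as [L|L].
  - assert (Q := g1 n m). assert (Cmod (g n m) * r ^ m <= 1 * r ^ m)%R by (apply Rmult_le_compat_r; auto).
    destruct m; lra.
  - destruct m as [|m].
    + rewrite g0, Cmod_1. simpl. lra.
    + rewrite gz by lia. rewrite Cmod_0. lra.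
Qed.

(** In the l^1 norm weighted by r^m, which is submultiplicative, the factor of index n has norm at
    most 1 + r^(n + 1) / (1 - r); the product of these bounds is finite. *)
Lemma AN_rbound N r : (0 <= r < 1)%R -> rbound (fun m => (Cmod (AN N m) * r ^ m)%R) (exp (1 / (1 - r) * (1 / (1 - r)))).
Proof.
  intros Hr.
  assert (I : (0 < 1 / (1 - r))%R) by (apply Rdiv_lt_0_compat; lra).
  assert (Hc : forall (a : nat -> C) m, (Cmod (a m * RtoC r ^ m) = Cmod (a m) * r ^ m)%R).
  { intros a m. rewrite Cmod_mult, Cmod_pow, Cmod_R, Rabs_pos_eq by lra. auto. }
  apply (rbound_weaken _ (exp (1 / (1 - r) * rsum (fun k => r ^ k)%R (seq 0 N)))).
  { apply exp_le_le. apply Rmult_le_compat_l; [lra|]. apply rbound_geom; auto. apply seq_NoDup. }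
  induction N as [|N IH].
  - simpl rsum. rewrite Rmult_0_r, exp_0. eapply rbound_le; [|apply (rbound_weaken _ (Cmod (RtoC 1)))].
    2:{ rewrite Cmod_1. apply Rle_refl. }
    2:{ apply (csum_nonneg_rbound (fun m : nat => match m with O => 1%R | _ => 0%R end)).
        - intros [|m]; lra.
        - apply (csum_at (fun m : nat => RtoC (match m with O => 1%R | _ => 0%R end)) 0%nat). intros [|m] Hm; congruence. }
    intros [|m]; simpl; rewrite ?Cmod_1, ?Cmod_0; lra.
  - rewrite seq_S, rsum_app, (Rmult_plus_distr_l (1 / (1 - r))), exp_plus.
    eapply rbound_weaken; [|eapply rbound_le; [|apply (conv_rbound (fun m => AN N m * RtoC r ^ m) (fun m => g N m * RtoC r ^ m))]].
    3:{ eapply rbound_le; [|exact IH]. intros m. cbv beta. rewrite Hc. lra. }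
    3:{ eapply rbound_le; [|apply (g_rbound N r Hr)]. intros m. cbv beta. rewrite Hc. lra. }
    + apply Rmult_le_compat_l; [left; apply exp_pos|]. simpl rsum. rewrite Rplus_0_r.
      assert (E := exp_ineq1_le (1 / (1 - r) * r ^ N)).
      assert (P : (0 <= r ^ N)%R) by (apply pow_le; lra).
      assert (r ^ S N * (1 / (1 - r)) <= 1 / (1 - r) * r ^ N)%R.
      { simpl. rewrite (Rmult_comm (1 / (1 - r))). apply Rmult_le_compat_r; [lra|]. nra. }
      lra.
    + intros m. cbv beta. rewrite <- conv_pow. rewrite Cmod_mult, Cmod_pow, Cmod_R, Rabs_pos_eq by lra. simpl. lra.
Qed.

Lemma power_product (t : C) : (Cmod t < 1)%R ->
  summable (fun m => AN m m * t ^ m) /\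
  Clim (prodC (fun n => Sum (fun m => g n m * t ^ m))) (Sum (fun m => AN m m * t ^ m)).
Proof.
  (* A radius strictly between |t| and 1: the bound at r gives geometric decay at t, with ratio |t|
     / r. *)
  intros Ht. assert (Ht0 := Cmod_ge_0 t). set (r := ((1 + Cmod t) / 2)%R).
  assert (Hr : (0 <= r < 1)%R) by (unfold r; lra). assert (Hr0 : (0 < r)%R) by (unfold r; lra).
  set (Cr := exp (1 / (1 - r) * (1 / (1 - r)))).
  set (x := (Cmod t / r)%R).
  assert (Hx : (0 <= x < 1)%R).
  { unfold x. split; [apply Rmult_le_pos; [lra|left; apply Rinv_0_lt_compat; lra]|].
    apply Rmult_lt_reg_r with r; auto. unfold Rdiv. rewrite Rmult_assoc, Rinv_l by lra. unfold r. lra. }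
  assert (HA : forall N m, (Cmod (AN N m * t ^ m) <= Cr * x ^ m)%R).
  { intros N m. rewrite Cmod_mult, Cmod_pow.
    assert (B := rbound_term (fun m => (Cmod (AN N m) * r ^ m)%R) Cr m
      ltac:(intros k; apply Rmult_le_pos; [apply Cmod_ge_0|apply pow_le; lra]) (AN_rbound N r Hr)). cbv beta in B.
    replace (Cmod t) with (r * x)%R by (unfold x; field; lra). rewrite Rpow_mult_distr, <- Rmult_assoc.
    apply Rmult_le_compat_r; auto. apply pow_le; lra. }
  assert (HCr : (0 <= Cr)%R) by (left; apply exp_pos).
  assert (Hsum : forall N, csum (fun m => AN N m * t ^ m) (prodC (fun n => Sum (fun m => g n m * t ^ m)) N)).
  { assert (Hg : forall n, summable (fun m => g n m * t ^ m)).
    { intros n. eexists. eapply rbound_le; [|apply (g_rbound n (Cmod t))]; [|lra].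
      intros m. cbv beta. rewrite Cmod_mult, Cmod_pow. lra. }
    assert (HAN : forall N, summable (fun m => AN N m * t ^ m)).
    { intros N. eapply summable_le; [apply HA|]. apply rbound_scal; auto. apply rbound_geom; auto. }
    induction N as [|N IH].
    - simpl. assert (H : csum (fun m : nat => match m with O => 1 | S _ => 0 end * t ^ m) (1 * t ^ 0)).
      { apply (csum_at (fun m : nat => match m with O => 1 | S _ => 0 end * t ^ m) 0%nat). intros [|m] Hm; [congruence|ring]. }
      replace (1 * t ^ 0) with (RtoC 1) in H by (simpl; ring). exact H.
    - simpl. rewrite <- (csum_Sum _ _ IH).
      eapply csum_ext; [|apply (conv_csum _ _ (HAN N) (Hg N))]. intros m. cbv beta. rewrite <- conv_pow. auto. }
  destruct (csum_dominated (fun N m => AN N m * t ^ m) (fun m => AN m m * t ^ m) (fun m => (Cr * x ^ m)%R) (Cr * (1 / (1 - x)))%R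
     (prodC (fun n => Sum (fun m => g n m * t ^ m)))) as [H1 H2]; auto.
  - apply rbound_scal; auto. apply rbound_geom; auto.
  - intros m. apply (Clim_eventually (fun _ => AN m m * t ^ m) _ _ m); [|apply Clim_const].
    intros n Hn. rewrite (AN_stable n m Hn). auto.
  - split; auto. eapply summable_le; [intros m; apply HA|]. apply rbound_scal; auto. apply rbound_geom; auto.
Qed.
End PowerProducts.

Lemma summable_at {I : Type} (f : I -> C) i : (forall k, k <> i -> f k = 0) -> summable f.
Proof.
  intros H. eexists. apply csum_nonneg_rbound; [intros; apply Cmod_ge_0|].
  apply (csum_at (fun k => RtoC (Cmod (f k))) i). intros k Hk. rewrite H, Cmod_0; auto.
Qed.

(** A Laurent series in q^(1/h). Absolute convergence is required on the whole half-plane, not only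
    near the cusp, so that one expansion yields products, sums and derivatives everywhere. *)
Definition LSh (h : nat) (f : C -> C) : Prop :=
  exists (k : nat) (a : nat -> C), forall tau, (0 < Im tau)%R ->
    summable (fun n => a n * ex (RtoC ((INR n - INR k) / INR h) * tau)) /\
    f tau = Sum (fun n => a n * ex (RtoC ((INR n - INR k) / INR h) * tau)).

(* All multiples of h0 are allowed, so that two expansions have a common h. *)
Definition LS (f : C -> C) : Prop := exists h0 : nat, (1 <= h0)%nat /\ forall m, (1 <= m)%nat -> LSh (h0 * m) f.

Lemma LSh_ext h f g : (forall tau, (0 < Im tau)%R -> f tau = g tau) -> LSh h f -> LSh h g.
Proof.
  intros E [k [a H]]. exists k, a. intros tau Ht. rewrite <- E by auto. auto.
Qed.

Lemma LS_ext f g : (forall tau, (0 < Im tau)%R -> f tau = g tau) -> LS f -> LS g.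
Proof. intros E [h0 [H0 H]]. exists h0. split; auto. intros m Hm. eapply LSh_ext; eauto. Qed.

Lemma LSh_mono h (p : Z) c : (1 <= h)%nat -> LSh h (fun tau => c * ex (RtoC (IZR p / INR h) * tau)).
Proof.
  intros Hh. exists (Z.to_nat (- p)), (fun n => if Nat.eq_dec n (Z.to_nat p) then c else 0). intros tau Ht.
  set (k := Z.to_nat (- p)).
  assert (H : csum (fun n => (if Nat.eq_dec n (Z.to_nat p) then c else 0) * ex (RtoC ((INR n - INR k) / INR h) * tau))
     ((if Nat.eq_dec (Z.to_nat p) (Z.to_nat p) then c else 0) * ex (RtoC ((INR (Z.to_nat p) - INR k) / INR h) * tau))).
  { apply (csum_at (fun n => (if Nat.eq_dec n (Z.to_nat p) then c else 0) * ex (RtoC ((INR n - INR k) / INR h) * tau))).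
    intros n Hn. destruct (Nat.eq_dec n (Z.to_nat p)); [congruence|ring]. }
  assert (Ep : (INR (Z.to_nat p) - INR k = IZR p)%R).
  { unfold k. rewrite !INR_IZR_INZ. destruct (Z_le_dec 0 p).
    - rewrite Z2Nat.id by auto. replace (Z.to_nat (- p)) with 0%nat by lia. simpl. ring.
    - replace (Z.to_nat p) with 0%nat by lia. rewrite Z2Nat.id by lia. rewrite opp_IZR. simpl. ring. }
  rewrite Ep in H. destruct (Nat.eq_dec (Z.to_nat p) (Z.to_nat p)); [|congruence].
  split; [|symmetry; apply csum_Sum; exact H].
  apply (summable_at _ (Z.to_nat p)). intros n Hn. destruct (Nat.eq_dec n (Z.to_nat p)); [congruence|ring].
Qed.

Lemma LSh_plus h f g : (1 <= h)%nat -> LSh h f -> LSh h g -> LSh h (fun tau => f tau + g tau).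
Proof.
  intros Hh [k [a Ha]] [l [b Hb]].
  assert (Hh0 : INR h <> 0%R) by (apply not_0_INR; lia).
  (* Coefficients moved by [j] places, to bring both series to the common pole order k + l. *)
  set (sh := fun (j : nat) (c : nat -> C) n => if le_lt_dec j n then c (n - j)%nat else 0).
  assert (S : forall (i j : nat) (c : nat -> C) tau, summable (fun n => c n * ex (RtoC ((INR n - INR i) / INR h) * tau)) ->
    csum (fun n => sh j c n * ex (RtoC ((INR n - INR (i + j)) / INR h) * tau)) (Sum (fun n => c n * ex (RtoC ((INR n - INR i) / INR h) * tau)))
    /\ summable (fun n => sh j c n * ex (RtoC ((INR n - INR (i + j)) / INR h) * tau))).
  { intros i j c tau Hs.
    assert (E : forall n, sh j c (j + n)%nat * ex (RtoC ((INR (j + n) - INR (i + j)) / INR h) * tau) = c n * ex (RtoC ((INR n - INR i) / INR h) * tau)).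
    { intros n. unfold sh. destruct (le_lt_dec j (j + n)); [|lia]. replace (j + n - j)%nat with n by lia.
      do 4 f_equal. rewrite !plus_INR. field. auto. }
    assert (Z : forall n, (forall m, (j + m)%nat <> n) -> sh j c n = 0).
    { intros n Hn. unfold sh. destruct (le_lt_dec j n); auto. exfalso. apply (Hn (n - j)%nat). lia. }
    split.
    - apply (csum_push (fun n => (j + n)%nat)); [intros; lia| |].
      + intros n Hn. rewrite Z; auto. ring.
      + eapply csum_ext; [|apply summable_csum; exact Hs]. intros n. rewrite E. auto.
    - assert (Hs' : summable (fun n => RtoC (Cmod (c n * ex (RtoC ((INR n - INR i) / INR h) * tau))))).
      { destruct Hs as [M HM]. exists M. eapply rbound_le; [|exact HM]. intros n. cbv beta. rewrite Cmod_R, Rabs_pos_eq; [lra|apply Cmod_ge_0]. }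
      eexists. apply csum_nonneg_rbound; [intros; apply Cmod_ge_0|].
      apply (csum_push (fun n => (j + n)%nat)); [intros; lia| |].
      + intros n Hn. rewrite Z, Cmult_0_l, Cmod_0; auto.
      + eapply csum_ext; [|apply summable_csum; exact Hs']. intros n. cbv beta. rewrite E. auto. }
  exists (k + l)%nat, (fun n => sh l a n + sh k b n). intros tau Ht.
  destruct (Ha tau Ht) as [Sa Ea]. destruct (Hb tau Ht) as [Sb Eb].
  destruct (S k l a tau Sa) as [A1 A2]. destruct (S l k b tau Sb) as [B1 B2].
  replace (l + k)%nat with (k + l)%nat in B1, B2 by lia.
  assert (E : forall n, sh l a n * ex (RtoC ((INR n - INR (k + l)) / INR h) * tau) + sh k b n * ex (RtoC ((INR n - INR (k + l)) / INR h) * tau) =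
    (sh l a n + sh k b n) * ex (RtoC ((INR n - INR (k + l)) / INR h) * tau)) by (intros; ring).
  split.
  - eapply summable_ext; [exact E|]. apply summable_plus; auto.
  - symmetry. apply csum_Sum. rewrite Ea, Eb. eapply csum_ext; [exact E|]. apply csum_plus; auto.
Qed.

Lemma LSh_mult h f g : (1 <= h)%nat -> LSh h f -> LSh h g -> LSh h (fun tau => f tau * g tau).
Proof.
  intros Hh [k [a Ha]] [l [b Hb]]. assert (Hh0 : INR h <> 0%R) by (apply not_0_INR; lia).
  exists (k + l)%nat, (conv a b). intros tau Ht.
  destruct (Ha tau Ht) as [Sa Ea]. destruct (Hb tau Ht) as [Sb Eb].
  assert (E : forall n, conv (fun n => a n * ex (RtoC ((INR n - INR k) / INR h) * tau)) (fun n => b n * ex (RtoC ((INR n - INR l) / INR h) * tau)) n =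
    conv a b n * ex (RtoC ((INR n - INR (k + l)) / INR h) * tau)).
  { intros n. unfold conv. rewrite (Cmult_comm _ (ex _)), <- lsum_scal. apply lsum_ext. intros i Hi. apply in_seq in Hi.
    replace (ex (RtoC ((INR n - INR (k + l)) / INR h) * tau)) with
      (ex (RtoC ((INR i - INR k) / INR h) * tau) * ex (RtoC ((INR (n - i) - INR l) / INR h) * tau)); [ring|].
    rewrite <- ex_plus, <- Cmult_plus_distr_r, <- RtoC_plus. do 3 f_equal.
    rewrite plus_INR, minus_INR by lia. field. auto. }
  split.
  - eapply summable_ext; [exact E|]. destruct Sa as [M HM], Sb as [N HN]. exists (M * N)%R. apply conv_rbound; auto.
  - symmetry. apply csum_Sum. rewrite Ea, Eb. eapply csum_ext; [exact E|]. apply conv_csum; auto.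
Qed.

Lemma LSh_const h c : (1 <= h)%nat -> LSh h (fun _ => c).
Proof.
  intros Hh. eapply LSh_ext; [|apply (LSh_mono h 0 c Hh)]. intros tau _. cbv beta.
  unfold Rdiv. rewrite Rmult_0_l, Cmult_0_l, ex_0. ring.
Qed.

Lemma LS_plus f g : LS f -> LS g -> LS (fun tau => f tau + g tau).
Proof.
  intros [h [Hh Hf]] [h' [Hh' Hg]]. exists (h * h')%nat. split; [nia|]. intros m Hm.
  apply LSh_plus; [nia| |].
  - replace (h * h' * m)%nat with (h * (h' * m))%nat by ring. apply Hf. nia.
  - replace (h * h' * m)%nat with (h' * (h * m))%nat by ring. apply Hg. nia.
Qed.

Lemma LS_mult f g : LS f -> LS g -> LS (fun tau => f tau * g tau).
Proof.
  intros [h [Hh Hf]] [h' [Hh' Hg]]. exists (h * h')%nat. split; [nia|]. intros m Hm.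
  apply LSh_mult; [nia| |].
  - replace (h * h' * m)%nat with (h * (h' * m))%nat by ring. apply Hf. nia.
  - replace (h * h' * m)%nat with (h' * (h * m))%nat by ring. apply Hg. nia.
Qed.

Lemma LS_const c : LS (fun _ => c).
Proof. exists 1%nat. split; [lia|]. intros m Hm. apply LSh_const. lia. Qed.

Lemma LS_mono (p : Z) (h : nat) : (1 <= h)%nat -> LS (fun tau => ex (RtoC (IZR p / INR h) * tau)).
Proof.
  intros Hh. exists h. split; auto. intros m Hm.
  eapply LSh_ext; [|apply (LSh_mono (h * m) (p * Z.of_nat m) 1); nia]. intros tau _. cbv beta.
  rewrite Cmult_1_l. do 3 f_equal. rewrite mult_IZR, <- INR_IZR_INZ, mult_INR. field. split; apply not_0_INR; lia.
Qed.

(** With t = ex (tau / h), the factor of index n is 1 - z t^k with |z| = 1 and k > n; hence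
    [power_product] applies to these factors and to their geometric inverses. *)
Lemma LS_qpoch (zw zq : C) (ew eq h0 : nat) (w q : C -> C) : Cmod zw = 1%R -> Cmod zq = 1%R ->
  (1 <= ew)%nat -> (1 <= eq)%nat -> (1 <= h0)%nat ->
  (forall tau, w tau = zw * ex (RtoC (INR ew / INR h0) * tau)) ->
  (forall tau, q tau = zq * ex (RtoC (INR eq / INR h0) * tau)) ->
  LS (fun tau => qpoch_inf (w tau) (q tau)) /\ LS (fun tau => / qpoch_inf (w tau) (q tau)).
Proof.
  intros Hzw Hzq Hew Heq Hh0 Ew Eq.
  assert (Main : forall m, (1 <= m)%nat -> LSh (h0 * m) (fun tau => qpoch_inf (w tau) (q tau)) /\ LSh (h0 * m) (fun tau => / qpoch_inf (w tau) (q tau))).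
  2:{ split; exists h0; (split; [auto|]); intros m Hm; apply Main; auto. }
  intros m Hm. set (h := (h0 * m)%nat). assert (Hh : (1 <= h)%nat) by (unfold h; nia).
  assert (Hh1 : INR h <> 0%R) by (apply not_0_INR; lia).
  assert (Hh01 : INR h0 <> 0%R) by (apply not_0_INR; lia).
  assert (Hm1 : INR m <> 0%R) by (apply not_0_INR; lia).
  set (kn := fun n => ((ew + n * eq) * m)%nat). assert (Hkn : forall n, (S n <= kn n)%nat) by (intros n; unfold kn; assert (n * 1 <= n * eq)%nat by (apply Nat.mul_le_mono_l; lia); nia).
  set (zn := fun n => zw * zq ^ n). assert (Hzn : forall n, Cmod (zn n) = 1%R).
  { intros n. unfold zn. rewrite Cmod_mult, Cmod_pow, Hzw, Hzq, pow1. ring. }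
  assert (Hfac : forall tau n, w tau * q tau ^ n = zn n * ex (RtoC (1 / INR h) * tau) ^ kn n).
  { intros tau n. rewrite Ew, Eq. unfold zn, kn. rewrite Cpow_mult_l, !ex_pow.
    transitivity (zw * zq ^ n * (ex (RtoC (INR ew / INR h0) * tau) * ex (RtoC (INR n) * (RtoC (INR eq / INR h0) * tau)))); [ring|].
    f_equal. rewrite <- ex_plus. f_equal. rewrite !Cmult_assoc, <- Cmult_plus_distr_r, <- !RtoC_mult, <- RtoC_plus. f_equal. f_equal.
    unfold h. rewrite !mult_INR, plus_INR, mult_INR. field. auto. }
  assert (Ht : forall tau, (0 < Im tau)%R -> (Cmod (ex (RtoC (1 / INR h) * tau)) < 1)%R).
  { intros tau H. apply ex_lt1. rewrite Im_scal. apply Rmult_lt_0_compat; auto.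
    apply Rdiv_lt_0_compat; [lra|]. apply lt_0_INR. lia. }
  assert (Hq : forall tau, (0 < Im tau)%R -> (Cmod (q tau) < 1)%R).
  { intros tau H. rewrite Eq, Cmod_mult, Hzq, Rmult_1_l. apply ex_lt1. rewrite Im_scal. apply Rmult_lt_0_compat; auto.
    apply Rdiv_lt_0_compat; apply lt_0_INR; lia. }
  assert (Hwl : forall tau, (0 < Im tau)%R -> (Cmod (w tau) < 1)%R).
  { intros tau H. rewrite Ew, Cmod_mult, Hzw, Rmult_1_l. apply ex_lt1. rewrite Im_scal. apply Rmult_lt_0_compat; auto.
    apply Rdiv_lt_0_compat; apply lt_0_INR; lia. }
  assert (Conv : forall (A : nat -> C) (f : C -> C), (forall tau, (0 < Im tau)%R ->
      summable (fun j => A j * ex (RtoC (1 / INR h) * tau) ^ j) /\ f tau = Sum (fun j => A j * ex (RtoC (1 / INR h) * tau) ^ j)) -> LSh h f).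
  { intros A f H. exists 0%nat, A. intros tau Hta. destruct (H tau Hta) as [H1 H2].
    assert (E : forall j, A j * ex (RtoC (1 / INR h) * tau) ^ j = A j * ex (RtoC ((INR j - INR 0) / INR h) * tau)).
    { intros j. rewrite ex_pow, Cmult_assoc, <- RtoC_mult. do 4 f_equal. simpl. field. auto. }
    split; [eapply summable_ext; [exact E|auto]|]. rewrite H2. apply Sum_ext. exact E. }
  split.
  (* Coefficients of the polynomial 1 - z t^k. *)
  - set (g := fun n j : nat => match j with O => RtoC 1 | _ => if Nat.eq_dec j (kn n) then - zn n else 0 end).
    apply (Conv (fun j => AN g j j)). intros tau Hta.
    destruct (power_product g) with (t := ex (RtoC (1 / INR h) * tau)) as [P1 P2]; auto.
    + intros n [|j] Hj; [lia|]. unfold g. specialize (Hkn n). destruct (Nat.eq_dec (S j) (kn n)); [lia|auto].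
    + intros n [|j]; unfold g; [rewrite Cmod_1; lra|]. destruct (Nat.eq_dec (S j) (kn n)); rewrite ?Cmod_opp, ?Hzn, ?Cmod_0; lra.
    + split; auto. apply (Clim_unique (qprod (w tau) (q tau))); [apply qpoch_lim; auto|].
      eapply Clim_ext; [|exact P2]. intros n. rewrite qprod_prodC. apply prodC_ext. intros k.
      rewrite Hfac. set (t := ex (RtoC (1 / INR h) * tau)). apply csum_Sum.
      assert (A1 := csum_at (fun j => match j with O => RtoC 1 | _ => 0 end * t ^ j) 0%nat ltac:(intros [|j] Hj; [congruence|cbv beta; ring])).
      assert (A2 : csum (fun j => (if Nat.eq_dec j (kn k) then - zn k else 0) * t ^ j) ((if Nat.eq_dec (kn k) (kn k) then - zn k else 0) * t ^ kn k)).
      { apply (csum_at (fun j => (if Nat.eq_dec j (kn k) then - zn k else 0) * t ^ j)). intros j Hj. destruct (Nat.eq_dec j (kn k)); [congruence|ring]. }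
      destruct (Nat.eq_dec (kn k) (kn k)); [|congruence].
      assert (A3 := csum_plus _ _ _ _ A1 A2). cbv beta in A3.
      replace (1 - zn k * t ^ kn k) with (1 * t ^ 0 + - zn k * t ^ kn k) by (simpl; ring).
      eapply csum_ext; [|exact A3]. intros [|j]; unfold g; cbv beta.
      * specialize (Hkn k). destruct (Nat.eq_dec 0 (kn k)); [lia|]. ring.
      * ring.
  (* Coefficients of the geometric series 1 / (1 - z t^k). *)
  - set (g := fun n j : nat => if Nat.eq_dec (j mod kn n) 0 then zn n ^ (j / kn n) else 0).
    apply (Conv (fun j => AN g j j)). intros tau Hta.
    destruct (power_product g) with (t := ex (RtoC (1 / INR h) * tau)) as [P1 P2]; auto.
    + intros n. unfold g. specialize (Hkn n). rewrite Nat.Div0.mod_0_l, Nat.Div0.div_0_l. reflexivity.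
    + intros n j Hj. unfold g. specialize (Hkn n). rewrite Nat.mod_small by lia. destruct (Nat.eq_dec j 0); [lia|auto].
    + intros n j. unfold g. destruct (Nat.eq_dec (j mod kn n) 0); [|rewrite Cmod_0; lra]. rewrite Cmod_pow, Hzn, pow1. lra.
    + split; auto. apply (Clim_unique (fun n => / qprod (w tau) (q tau) n)).
      * apply Clim_inv; [apply qpoch_neq0_small; auto|apply qpoch_lim; auto].
      * eapply Clim_ext; [|exact P2]. intros n. rewrite qprod_prodC.
        assert (F : forall k, Sum (fun j => g k j * ex (RtoC (1 / INR h) * tau) ^ j) = / (1 - w tau * q tau ^ k) /\ 1 - w tau * q tau ^ k <> 0).
        { intros k. rewrite Hfac. set (t := ex (RtoC (1 / INR h) * tau)). specialize (Hkn k).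
          assert (Hx : (Cmod (zn k * t ^ kn k) < 1)%R).
          { rewrite Cmod_mult, Hzn, Rmult_1_l. destruct (kn k) as [|k']; [lia|]. apply q_pow_lt1. apply Ht; auto. }
          split; [|apply one_minus_neq0; auto]. apply csum_Sum.
          apply (csum_push (fun i => (i * kn k)%nat)).
          - intros x y E. nia.
          - intros j Hj. unfold g. destruct (Nat.eq_dec (j mod kn k) 0) as [E|E]; [|ring].
            exfalso. apply (Hj (j / kn k)%nat). assert (D := Nat.div_mod_eq j (kn k)). nia.
          - replace (/ (1 - zn k * t ^ kn k)) with (1 / (1 - zn k * t ^ kn k)) by (field; apply one_minus_neq0; auto).
            eapply csum_ext; [|apply csum_geom; exact Hx]. intros i. cbv beta. unfold g.
            rewrite Nat.Div0.mod_mul, Nat.div_mul by lia. destruct (Nat.eq_dec 0 0); [|congruence].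
            rewrite Cpow_mult_l, <- Cpow_mult_r. do 2 f_equal. lia. }
        clear P2. induction n as [|n IH]; simpl; [field|]. rewrite IH. destruct (F n) as [-> F2].
        assert (F1 : prodC (fun k => 1 - w tau * q tau ^ k) n <> 0).
        { clear IH. induction n as [|n IH]; simpl; [apply RtoC_neq0; lra|]. apply Cmult_neq_0; [apply IH; apply F|apply F]. }
        field. auto.
Qed.

(** * Expansions at the cusps *)

Definition isint (x : R) : Prop := exists n : Z, x = IZR n.

Section TriangularCusp.
Variables p r : nat.
Variable s : Z.
Hypothesis Hp : (1 <= p)%nat.
Hypothesis Hr : (1 <= r)%nat.

(** The action of the triangular matrix with rows (p, s) and (0, r), to which [hermite] reduces the
    expansion at every cusp. *)
Definition sg (tau : C) : C := (RtoC (INR p) * tau + RtoC (IZR s)) / RtoC (INR r).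

Lemma sg_alt tau : sg tau = RtoC (INR p / INR r) * tau + RtoC (IZR s / INR r).
Proof.
  assert (H : INR r <> 0%R) by (apply not_0_INR; lia). assert (H' := RtoC_neq0 _ H).
  unfold sg, Rdiv. rewrite !RtoC_mult, RtoC_inv by auto. field. auto.
Qed.

Lemma sg_Im tau : (0 < Im tau)%R -> (0 < Im (sg tau))%R.
Proof.
  intros H. rewrite sg_alt, Im_plus, Im_scal, Im_RtoC, Rplus_0_r. apply Rmult_lt_0_compat; auto.
  apply Rdiv_lt_0_compat; apply lt_0_INR; lia.
Qed.

(** The triple product has three q-products; as a0 / L lies in [0, 1), their arguments are monomials
    of positive exponent, except for a constant one when a0 = 0. *)
Lemma jt_LS (L a0 : nat) (be : R) : (1 <= L)%nat -> (a0 < L)%nat ->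
  LS (fun tau => jt (sg tau) (RtoC (INR a0 / INR L) * sg tau + RtoC be)) /\
  (a0 <> 0%nat \/ ~ isint be -> LS (fun tau => / jt (sg tau) (RtoC (INR a0 / INR L) * sg tau + RtoC be))).
Proof.
  intros HL Ha.
  assert (Hr0 : INR r <> 0%R) by (apply not_0_INR; lia).
  assert (HL0 : INR L <> 0%R) by (apply not_0_INR; lia).
  set (q := fun tau => ex (sg tau)).
  set (zq := ex (RtoC (IZR s / INR r))).
  assert (Eq : forall tau, q tau = zq * ex (RtoC (INR (p * L) / INR (r * L)) * tau)).
  { intros tau. unfold q, zq. rewrite <- ex_plus, sg_alt, Cplus_comm. do 4 f_equal. rewrite !mult_INR. field. auto. }
  assert (Hzq : Cmod zq = 1%R) by apply Cmod_ex_real.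
  assert (HrL : (1 <= r * L)%nat) by nia. assert (HpL : (1 <= p * L)%nat) by nia.
  destruct (LS_qpoch zq zq (p * L) (p * L) (r * L) q q Hzq Hzq HpL HpL HrL Eq Eq) as [Q1 Q2].
  set (x := fun tau => ex (RtoC (INR a0 / INR L) * sg tau + RtoC be)).
  assert (Ex : forall (e : nat) (c : R) (w : C -> C), (forall tau, w tau = ex (RtoC (INR e / INR L) * sg tau + RtoC c)) ->
     forall tau, w tau = ex (RtoC (INR e / INR L * (IZR s / INR r) + c)) * ex (RtoC (INR (e * p) / INR (r * L)) * tau)).
  { intros e c w Hw tau. rewrite Hw, <- ex_plus, sg_alt. f_equal.
    rewrite RtoC_plus, RtoC_mult. rewrite !mult_INR.
    replace (INR e * INR p / (INR r * INR L))%R with (INR e / INR L * (INR p / INR r))%R by (field; auto).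
    rewrite (RtoC_mult (INR e / INR L) (INR p / INR r)). ring. }
  destruct (LS_qpoch (ex (RtoC (INR (L - a0) / INR L * (IZR s / INR r) + - be))) zq ((L - a0) * p) (p * L) (r * L)
     (fun tau => ex (RtoC (INR (L - a0) / INR L) * sg tau + RtoC (- be))) q) as [X1 X2]; auto; try nia.
  { apply Cmod_ex_real. }
  { apply Ex. auto. }
  assert (EX : forall tau, ex (sg tau) / ex (RtoC (INR a0 / INR L) * sg tau + RtoC be) = ex (RtoC (INR (L - a0) / INR L) * sg tau + RtoC (- be))).
  { intros tau. rewrite <- ex_minus. f_equal. rewrite minus_INR, RtoC_opp by lia.
    replace ((INR L - INR a0) / INR L)%R with (1 - INR a0 / INR L)%R by (field; auto). rewrite RtoC_minus. ring. }
  destruct (Nat.eq_dec a0 0) as [E0|E0].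
  - (* here x is a constant of modulus 1, and 1 - x has to be split off its product *)
    destruct (LS_qpoch (zq * ex (RtoC be)) zq (p * L) (p * L) (r * L) (fun tau => ex (RtoC be) * q tau) q) as [Y1 Y2]; auto; try nia.
    { rewrite Cmod_mult, Hzq, Cmod_ex_real. ring. }
    { intros tau. rewrite Eq. ring. }
    assert (E : forall tau, (0 < Im tau)%R -> jt (sg tau) (RtoC (INR a0 / INR L) * sg tau + RtoC be) =
      (1 - ex (RtoC be)) * (qpoch_inf (q tau) (q tau) * (qpoch_inf (ex (RtoC be) * q tau) (q tau) * qpoch_inf (ex (RtoC (INR (L - a0) / INR L) * sg tau + RtoC (- be))) (q tau)))).
    { intros tau H. rewrite triple_product by (apply sg_Im; auto). rewrite EX. fold (q tau).
      replace (ex (RtoC (INR a0 / INR L) * sg tau + RtoC be)) with (ex (RtoC be)).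
      - rewrite (qpoch_S (q tau) (ex_lt1 _ (sg_Im tau H)) (ex (RtoC be))). ring.
      - rewrite E0. simpl INR. unfold Rdiv. rewrite Rmult_0_l, Cmult_0_l, Cplus_0_l. auto. }
    split.
    + eapply LS_ext; [intros tau H; symmetry; apply E; auto|].
      apply LS_mult; [apply LS_const|]. apply LS_mult; auto. apply LS_mult; auto.
    + intros [Hn|Hn]; [tauto|].
      assert (Hx : 1 - ex (RtoC be) <> 0).
      { intros Z. assert (E1 : ex (RtoC be) = 1) by (replace (ex (RtoC be)) with (1 - (1 - ex (RtoC be))) by ring; rewrite Z; ring).
        destruct (ex_eq_1 _ E1) as [n Hn']. apply Hn. exists n. apply RtoC_inj. auto. }
      apply (LS_ext (fun tau => / (1 - ex (RtoC be)) * (/ qpoch_inf (q tau) (q tau) * (/ qpoch_inf (ex (RtoC be) * q tau) (q tau) * / qpoch_inf (ex (RtoC (INR (L - a0) / INR L) * sg tau + RtoC (- be))) (q tau))))).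
      * intros tau H. rewrite E by auto.
        assert (Hq1 : (Cmod (q tau) < 1)%R) by (apply ex_lt1, sg_Im; auto).
        assert (N1 := qpoch_neq0_small (q tau) Hq1 (q tau) Hq1).
        assert (N2 : qpoch_inf (ex (RtoC be) * q tau) (q tau) <> 0).
        { apply qpoch_neq0_small; auto. rewrite Cmod_mult, Cmod_ex_real. lra. }
        assert (N3 : qpoch_inf (ex (RtoC (INR (L - a0) / INR L) * sg tau + RtoC (- be))) (q tau) <> 0).
        { apply qpoch_neq0_small; auto. apply ex_lt1. rewrite Im_plus, Im_scal, Im_RtoC, Rplus_0_r.
          apply Rmult_lt_0_compat; [|apply sg_Im; auto]. apply Rdiv_lt_0_compat; apply lt_0_INR; lia. }
        field. auto.
      * apply LS_mult; [apply LS_const|]. apply LS_mult; auto. apply LS_mult; auto.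
  - destruct (LS_qpoch (ex (RtoC (INR a0 / INR L * (IZR s / INR r) + be))) zq (a0 * p) (p * L) (r * L) x q) as [Y1 Y2]; auto; try nia.
    { apply Cmod_ex_real. }
    assert (E : forall tau, (0 < Im tau)%R -> jt (sg tau) (RtoC (INR a0 / INR L) * sg tau + RtoC be) =
      qpoch_inf (q tau) (q tau) * (qpoch_inf (x tau) (q tau) * qpoch_inf (ex (RtoC (INR (L - a0) / INR L) * sg tau + RtoC (- be))) (q tau))).
    { intros tau H. rewrite triple_product by (apply sg_Im; auto). rewrite EX. fold (q tau). fold (x tau). ring. }
    split.
    + eapply LS_ext; [intros tau H; symmetry; apply E; auto|]. apply LS_mult; auto. apply LS_mult; auto.
    + intros _.
      apply (LS_ext (fun tau => / qpoch_inf (q tau) (q tau) * (/ qpoch_inf (x tau) (q tau) * / qpoch_inf (ex (RtoC (INR (L - a0) / INR L) * sg tau + RtoC (- be))) (q tau)))).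
      * intros tau H. rewrite E by auto.
        assert (Hq1 : (Cmod (q tau) < 1)%R) by (apply ex_lt1, sg_Im; auto).
        assert (N1 := qpoch_neq0_small (q tau) Hq1 (q tau) Hq1).
        assert (N : forall e c, (1 <= e)%nat -> qpoch_inf (ex (RtoC (INR e / INR L) * sg tau + RtoC c)) (q tau) <> 0).
        { intros e c He. apply qpoch_neq0_small; auto. apply ex_lt1. rewrite Im_plus, Im_scal, Im_RtoC, Rplus_0_r.
          apply Rmult_lt_0_compat; [|apply sg_Im; auto]. apply Rdiv_lt_0_compat; apply lt_0_INR; lia. }
        assert (N2 := N a0 be ltac:(lia)). assert (N3 := N (L - a0)%nat (- be)%R ltac:(lia)). fold (x tau) in N2.
        field. auto.
      * apply LS_mult; auto. apply LS_mult; auto.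
Qed.
End TriangularCusp.

Lemma jt_th al be tau : (0 < Im tau)%R ->
  jt tau (RtoC al * tau + RtoC be) = ex (- (RtoC ((al - 1 / 2) * (al - 1 / 2) / 2) * tau)) * ex (RtoC ((1 / 2 - al) * (be + 1 / 2))) * th (al + 1 / 2) (be + 1 / 2) tau.
Proof.
  intros H. rewrite <- ex_plus. rewrite K_scal_th by auto. unfold jt.
  rewrite <- (Sum_bij (fun n => (n + 1)%Z) (fun n => (n - 1)%Z) (tj tau (RtoC al * tau + RtoC be))).
  - apply Sum_ext. intros n. rewrite tj_alt. unfold gt. rewrite <- ex_plus. f_equal.
    rewrite ZC_plus. unfold ZC, Rdiv. repeat rewrite ?RtoC_mult, ?RtoC_plus, ?RtoC_minus. rewrite RtoC_inv by lra. field.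
  - intros; lia.
  - intros; lia.
  - apply tj_summable; auto.
Qed.

Lemma K_jt al be tau : (0 < Im tau)%R ->
  K al be tau = ex (RtoC ((al - 1 / 2) * (al - 1 / 2) / 2) * tau) * ex (RtoC (- (al * be + al) / 2 - (1 / 2 - al) * (be + 1 / 2))) * jt tau (RtoC al * tau + RtoC be).
Proof.
  intros H. rewrite jt_th by auto. unfold K. rewrite !Cmult_assoc, <- !ex_plus. f_equal. f_equal.
  rewrite RtoC_minus. ring.
Qed.

Lemma K_neq0 al be tau : (0 < Im tau)%R -> ~ (isint al /\ isint be) -> K al be tau <> 0.
Proof.
  intros H Hn. rewrite K_jt by auto. apply Cmult_neq_0; [apply Cmult_neq_0; apply ex_neq0|].
  apply jt_neq0; auto. intros m n E. apply Hn.
  assert (EI : (al * Im tau = IZR m * Im tau)%R).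
  { assert (X := f_equal Im E). rewrite (Im_plus (RtoC al * tau)), (Im_plus (RtoC (IZR m) * tau)), !Im_scal, !Im_RtoC in X. lra. }
  assert (Ea : al = IZR m) by (apply (Rmult_eq_reg_r (Im tau)); lra).
  split; [exists m; auto|]. exists n. apply RtoC_inj.
  rewrite Ea in E. replace (RtoC be) with (RtoC (IZR m) * tau + RtoC be - RtoC (IZR m) * tau) by ring. rewrite E. ring.
Qed.

(** The first characteristic is reduced modulo 1 to a0 / L, and the Gaussian prefactor of [K_jt]
    becomes a rational power of q times a constant. *)
Lemma K_LS (p r : nat) (s : Z) (L : nat) al be : (1 <= p)%nat -> (1 <= r)%nat -> (1 <= L)%nat -> ratl L al ->
  LS (fun tau => K al be (sg p r s tau)) /\ (~ (isint al /\ isint be) -> LS (fun tau => / K al be (sg p r s tau))).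
Proof.
  intros Hp Hr HL [u Hu].
  assert (HL0 : INR L <> 0%R) by (apply not_0_INR; lia).
  assert (Hr0 : INR r <> 0%R) by (apply not_0_INR; lia).
  set (a0 := Z.to_nat (u mod Z.of_nat L)). set (m := (u / Z.of_nat L)%Z).
  assert (Hb := Z.mod_pos_bound u (Z.of_nat L) ltac:(lia)).
  assert (Ha0 : (a0 < L)%nat) by (unfold a0; lia).
  assert (Eu : u = (Z.of_nat L * m + Z.of_nat a0)%Z).
  { unfold a0, m. rewrite Z2Nat.id by lia. apply Z.div_mod. lia. }
  set (al0 := (INR a0 / INR L)%R).
  assert (Eal : al = (al0 + IZR m)%R).
  { unfold al0. apply (Rmult_eq_reg_l (INR L)); auto. rewrite Hu, Eu, plus_IZR, mult_IZR, <- !INR_IZR_INZ. field. auto. }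
  set (c1 := ex (RtoC (- (IZR m * (be + 1)) / 2))).
  set (c2 := ex (RtoC (- (al0 * be + al0) / 2 - (1 / 2 - al0) * (be + 1 / 2)))).
  set (rho := ((al0 - 1 / 2) * (al0 - 1 / 2) / 2)%R).
  set (c3 := ex (RtoC (rho * (IZR s / INR r)))).
  set (P := ((2 * Z.of_nat a0 - Z.of_nat L) * (2 * Z.of_nat a0 - Z.of_nat L) * Z.of_nat p)%Z).
  set (H := (8 * L * L * r)%nat). assert (HH : (1 <= H)%nat) by (unfold H; nia).
  assert (Em : forall tau, ex (RtoC rho * sg p r s tau) = c3 * ex (RtoC (IZR P / INR H) * tau)).
  { intros tau. rewrite sg_alt by auto. unfold c3. rewrite <- ex_plus. f_equal.
    replace (IZR P / INR H)%R with (rho * (INR p / INR r))%R.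
    - rewrite !RtoC_mult. ring.
    - unfold P, H, rho, al0. rewrite !mult_IZR, minus_IZR, mult_IZR, <- !INR_IZR_INZ, !mult_INR.
      replace (INR 8) with 8%R by (simpl; ring). field. auto. }
  assert (EK : forall tau, (0 < Im tau)%R -> K al be (sg p r s tau) =
    c1 * c2 * c3 * (ex (RtoC (IZR P / INR H) * tau) * jt (sg p r s tau) (RtoC al0 * sg p r s tau + RtoC be))).
  { intros tau Ht. assert (Hs := sg_Im p r s Hp Hr tau Ht).
    rewrite Eal, K_shift_al, K_jt by auto. fold c1. fold c2. fold rho. rewrite Em. ring. }
  destruct (jt_LS p r s Hp Hr L a0 be HL Ha0) as [J1 J2].
  split.
  - eapply LS_ext; [intros tau Ht; symmetry; apply EK; auto|].
    apply LS_mult; [apply LS_const|]. apply LS_mult; auto. apply LS_mono; auto.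
  - intros Hn.
    assert (J3' : LS (fun tau => / jt (sg p r s tau) (RtoC al0 * sg p r s tau + RtoC be))).
    { apply J2. destruct (Nat.eq_dec a0 0) as [E|E]; [right|left; auto]. intros Hbe. apply Hn. split; auto.
      exists m. rewrite Eal. unfold al0. rewrite E. simpl. field. auto. }
    assert (Hc : c1 * c2 * c3 <> 0) by (apply Cmult_neq_0; [apply Cmult_neq_0|]; apply ex_neq0).
    apply (LS_ext (fun tau => / (c1 * c2 * c3) * (ex (RtoC (IZR (- P) / INR H) * tau) * / jt (sg p r s tau) (RtoC al0 * sg p r s tau + RtoC be)))).
    + intros tau Ht. rewrite EK by auto.
      replace (ex (RtoC (IZR (- P) / INR H) * tau)) with (/ ex (RtoC (IZR P / INR H) * tau)).
      2:{ rewrite <- ex_opp. f_equal. rewrite opp_IZR. unfold Rdiv. rewrite !RtoC_mult, RtoC_opp. ring. }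
      assert (N := K_neq0 al be (sg p r s tau) (sg_Im p r s Hp Hr tau Ht) Hn). rewrite EK in N by auto.
      assert (Nj : jt (sg p r s tau) (RtoC al0 * sg p r s tau + RtoC be) <> 0).
      { intros Z. apply N. rewrite Z. ring. }
      assert (Ne := ex_neq0 (RtoC (IZR P / INR H) * tau)).
      assert (N1 : c1 <> 0) by apply ex_neq0. assert (N2 : c2 <> 0) by apply ex_neq0. assert (N3 : c3 <> 0) by apply ex_neq0.
      field. auto.
    + apply LS_mult; [apply LS_const|]. apply LS_mult; auto. apply LS_mono; auto.
Qed.

Lemma Csqrt_scal (x : R) w : (0 < x)%R -> Csqrt (RtoC x * w) = RtoC (sqrt x) * Csqrt w.
Proof.
  intros Hx. unfold Csqrt. rewrite Cmod_mult, Cmod_R, Rabs_pos_eq, Re_scal, Im_scal by lra.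
  assert (H := re_le_Cmod w). apply Rabs_le_between in H.
  replace ((x * Cmod w + x * Re w) / 2)%R with (x * ((Cmod w + Re w) / 2))%R by field.
  replace ((x * Cmod w - x * Re w) / 2)%R with (x * ((Cmod w - Re w) / 2))%R by field.
  rewrite !sqrt_mult by lra.
  destruct (Rle_dec 0 (x * Im w)) as [A|A]; destruct (Rle_dec 0 (Im w)) as [B|B]; try (exfalso; nra);
    apply C_eq; C_simpl; rewrite ?Re_pair, ?Im_pair; ring.
Qed.

(** Hermite normal form of diag(n1, n2) A: the gcd of the first column becomes [p], and Bezout
    coefficients complete the reduced column to a matrix B of determinant 1. *)
Lemma hermite (n1 n2 : nat) A : (1 <= n1)%nat -> (1 <= n2)%nat -> SL2Z A ->
  exists (B : mat2) (p r : nat) (s : Z), SL2Z B /\ (1 <= p)%nat /\ (1 <= r)%nat /\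
   forall tau, (0 < Im tau)%R -> RtoC (INR n1 / INR n2) * mobius A tau = mobius B (sg p r s tau) /\
     autf B (sg p r s tau) = RtoC (INR n2 / INR r) * autf A tau.
Proof.
  intros Hn1 Hn2 HA. assert (HA' := HA). destruct A as [a b c d]. unfold SL2Z in HA. cbn [m11 m12 m21 m22] in HA.
  set (N1 := Z.of_nat n1). set (N2 := Z.of_nat n2).
  set (g := Z.gcd (N1 * a) (N2 * c)).
  assert (Hg0 : (0 <= g)%Z) by apply Z.gcd_nonneg.
  assert (Hg : (0 < g)%Z).
  { destruct (Z.eq_dec g 0) as [E|E]; [|lia]. apply Z.gcd_eq_0 in E. destruct E as [E1 E2].
    apply Z.mul_eq_0 in E1. apply Z.mul_eq_0 in E2. unfold N1, N2 in E1, E2.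
    assert (a = 0)%Z by lia. assert (c = 0)%Z by lia. subst. lia. }
  destruct (Z.gcd_divide_l (N1 * a) (N2 * c)) as [x0 Hx0]. destruct (Z.gcd_divide_r (N1 * a) (N2 * c)) as [z0 Hz0].
  fold g in Hx0, Hz0.
  destruct (Z.gcd_bezout (N1 * a) (N2 * c) g eq_refl) as [w [y' Hb]].
  set (y := (- y')%Z).
  assert (HB : (x0 * w - y * z0 = 1)%Z).
  { apply (Z.mul_reg_r _ _ g); [lia|]. unfold y. rewrite Z.mul_1_l.
    transitivity (w * (x0 * g) + y' * (z0 * g))%Z; [ring|]. rewrite <- Hx0, <- Hz0. exact Hb. }
  set (s := (w * (N1 * b) - y * (N2 * d))%Z). set (rz := (x0 * (N2 * d) - z0 * (N1 * b))%Z).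
  assert (Hr : (g * rz = N1 * N2)%Z).
  { unfold rz. transitivity (N1 * N2 * (a * d - b * c))%Z; [|rewrite HA; ring].
    replace (g * (x0 * (N2 * d) - z0 * (N1 * b)))%Z with ((x0 * g) * (N2 * d) - (z0 * g) * (N1 * b))%Z by ring.
    rewrite <- Hx0, <- Hz0. ring. }
  assert (Hrz : (0 < rz)%Z) by (unfold N1, N2 in *; nia).
  exists (Mat2 x0 y z0 w), (Z.to_nat g), (Z.to_nat rz), s.
  split; [exact HB|]. split; [lia|]. split; [lia|]. intros tau Ht.
  assert (Eg : INR (Z.to_nat g) = IZR g) by (rewrite INR_IZR_INZ, Z2Nat.id by lia; auto).
  assert (Er : INR (Z.to_nat rz) = IZR rz) by (rewrite INR_IZR_INZ, Z2Nat.id by lia; auto).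
  assert (E1 : INR n1 = IZR N1) by (unfold N1; rewrite <- INR_IZR_INZ; auto).
  assert (E2 : INR n2 = IZR N2) by (unfold N2; rewrite <- INR_IZR_INZ; auto).
  assert (F2 : IZR N2 <> 0%R) by (apply not_0_IZR; unfold N2; lia).
  assert (Fr : IZR rz <> 0%R) by (apply not_0_IZR; lia).
  assert (F2' := RtoC_neq0 _ F2). assert (Fr' := RtoC_neq0 _ Fr).
  assert (Hau := autf_neq0 _ tau HA' Ht).
  assert (Ea : autf (Mat2 x0 y z0 w) (sg (Z.to_nat g) (Z.to_nat rz) s tau) = RtoC (INR n2 / INR (Z.to_nat rz)) * autf (Mat2 a b c d) tau).
  { unfold autf, sg. cbn [m11 m12 m21 m22]. rewrite Eg, Er, E2. unfold Rdiv. rewrite RtoC_mult, RtoC_inv by auto.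
    assert (P1 : (IZR z0 * IZR g = IZR N2 * IZR c)%R) by (rewrite <- !mult_IZR; f_equal; lia).
    assert (P2 : (IZR z0 * IZR s + IZR w * IZR rz = IZR N2 * IZR d)%R).
    { rewrite <- !mult_IZR, <- plus_IZR. f_equal. unfold s, rz.
      transitivity ((x0 * w - y * z0) * (N2 * d))%Z; [ring|rewrite HB; ring]. }
    apply (f_equal RtoC) in P1. apply (f_equal RtoC) in P2. rewrite RtoC_plus in P2. repeat rewrite RtoC_mult in P1. rewrite (RtoC_mult (IZR _) (IZR _)) in P2. repeat rewrite RtoC_mult in P2.
    replace (RtoC (IZR z0) * ((RtoC (IZR g) * tau + RtoC (IZR s)) / RtoC (IZR rz)) + RtoC (IZR w))
      with (((RtoC (IZR z0) * RtoC (IZR g)) * tau + (RtoC (IZR z0) * RtoC (IZR s) + RtoC (IZR w) * RtoC (IZR rz))) / RtoC (IZR rz)) by (field; auto).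
    rewrite P1, P2. field. auto. }
  split; [|exact Ea].
  unfold mobius at 2. rewrite Ea. unfold mobius. cbn [m11 m12 m21 m22]. set (D := autf (Mat2 a b c d) tau) in *.
  unfold sg. rewrite Eg, Er, E1, E2. unfold Rdiv. rewrite !RtoC_mult, !RtoC_inv by auto.
  assert (P1 : (IZR x0 * IZR g = IZR N1 * IZR a)%R) by (rewrite <- !mult_IZR; f_equal; lia).
  assert (P2 : (IZR x0 * IZR s + IZR y * IZR rz = IZR N1 * IZR b)%R).
  { rewrite <- !mult_IZR, <- plus_IZR. f_equal. unfold s, rz.
    transitivity ((x0 * w - y * z0) * (N1 * b))%Z; [ring|rewrite HB; ring]. }
  apply (f_equal RtoC) in P1. apply (f_equal RtoC) in P2. rewrite RtoC_plus in P2. repeat rewrite RtoC_mult in P1. rewrite (RtoC_mult (IZR _) (IZR _)) in P2. repeat rewrite RtoC_mult in P2.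
  replace (RtoC (IZR x0) * ((RtoC (IZR g) * tau + RtoC (IZR s)) / RtoC (IZR rz)) + RtoC (IZR y))
    with (((RtoC (IZR x0) * RtoC (IZR g)) * tau + (RtoC (IZR x0) * RtoC (IZR s) + RtoC (IZR y) * RtoC (IZR rz))) / RtoC (IZR rz)) by (field; auto).
  rewrite P1, P2. field. auto.
Qed.

(* Weight w/2: CuspP says that f is meromorphic at the cusps, CuspI that 1 / f is. *)
Definition CuspP (w : nat) (f : C -> C) : Prop :=
  forall A, SL2Z A -> LS (fun tau => f (mobius A tau) * (/ Csqrt (autf A tau)) ^ w).

Definition CuspI (w : nat) (f : C -> C) : Prop :=
  forall A, SL2Z A -> LS (fun tau => Csqrt (autf A tau) ^ w * / f (mobius A tau)).

Lemma Csqrt_neq0 (w : C) : w <> 0 -> Csqrt w <> 0.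
Proof. intros H E. apply H. rewrite <- (Csqrt_sq w), E. ring. Qed.

(** The inverse matrix is integral as well. Hence a theta with nonintegral characteristic has
    nonintegral characteristics at every cusp, and its reciprocal can be expanded there. *)
Lemma isint_SL2 A al be : SL2Z A -> isint (al * IZR (m11 A) + be * IZR (m21 A)) ->
  isint (al * IZR (m12 A) + be * IZR (m22 A)) -> isint al /\ isint be.
Proof.
  intros HA [u Hu] [v Hv].
  assert (HD : (IZR (m11 A) * IZR (m22 A) - IZR (m12 A) * IZR (m21 A) = 1)%R).
  { rewrite <- !mult_IZR, <- minus_IZR, HA. auto. }
  split.
  - exists (u * m22 A - v * m21 A)%Z. rewrite minus_IZR, !mult_IZR, <- Hu, <- Hv.
    transitivity (al * (IZR (m11 A) * IZR (m22 A) - IZR (m12 A) * IZR (m21 A)))%R; [rewrite HD|]; ring.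
  - exists (v * m11 A - u * m12 A)%Z. rewrite minus_IZR, !mult_IZR, <- Hu, <- Hv.
    transitivity (be * (IZR (m11 A) * IZR (m22 A) - IZR (m12 A) * IZR (m21 A)))%R; [rewrite HD|]; ring.
Qed.

(** By [hermite] the scaling n1 / n2 moves past A and leaves a triangular map; by [KT_all] the
    matrix B acts on the characteristics, apart from a constant and the weight factor. *)
Lemma K_cusp (n1 n2 L : nat) al be : (1 <= n1)%nat -> (1 <= n2)%nat -> (1 <= L)%nat -> ratl L al -> ratl L be ->
  CuspP 1 (fun tau => K al be (RtoC (INR n1 / INR n2) * tau)) /\
  (~ (isint al /\ isint be) -> CuspI 1 (fun tau => K al be (RtoC (INR n1 / INR n2) * tau))).
Proof.
  intros Hn1 Hn2 HL [u Hu] [v Hv].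
  assert (Main : forall A, SL2Z A -> exists (c : C) B p r s, c <> 0 /\ SL2Z B /\ (1 <= p)%nat /\ (1 <= r)%nat /\ forall tau, (0 < Im tau)%R ->
    K al be (RtoC (INR n1 / INR n2) * mobius A tau) = c * Csqrt (autf A tau) * K (al * IZR (m11 B) + be * IZR (m21 B)) (al * IZR (m12 B) + be * IZR (m22 B)) (sg p r s tau)).
  { intros A HA. destruct (hermite n1 n2 A Hn1 Hn2 HA) as [B [p [r [s [HB [Hp [Hr H]]]]]]].
    destruct (KT_all B HB) as [e [He HK]].
    assert (Hx : (0 < INR n2 / INR r)%R) by (apply Rdiv_lt_0_compat; apply lt_0_INR; lia).
    exists (Cmult e (RtoC (sqrt (INR n2 / INR r)))), B, p, r, s. repeat split; auto.
    - apply Cmult_neq_0; [intros E; rewrite E, Cmod_0 in He; lra|]. apply RtoC_neq0. assert (Q := sqrt_lt_R0 _ Hx). lra.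
    - intros tau Ht. destruct (H tau Ht) as [-> E2]. rewrite HK by (apply sg_Im; auto).
      rewrite E2, Csqrt_scal by auto. ring. }
  assert (Rt : forall B, ratl L (al * IZR (m11 B) + be * IZR (m21 B))).
  { intros B. exists (u * m11 B + v * m21 B)%Z. rewrite plus_IZR, !mult_IZR, <- Hu, <- Hv. ring. }
  split.
  - intros A HA. destruct (Main A HA) as [c [B [p [r [s [Hc [HB [Hp [Hr E]]]]]]]]].
    destruct (K_LS p r s L _ (al * IZR (m12 B) + be * IZR (m22 B)) Hp Hr HL (Rt B)) as [L1 _].
    eapply LS_ext; [|apply (LS_mult (fun _ => c) _ (LS_const c) L1)]. intros tau Ht. cbv beta. rewrite E by auto.
    assert (N := Csqrt_neq0 _ (autf_neq0 A tau HA Ht)). simpl. field. auto.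
  - intros Hn A HA. destruct (Main A HA) as [c [B [p [r [s [Hc [HB [Hp [Hr E]]]]]]]]].
    assert (HnB : ~ (isint (al * IZR (m11 B) + be * IZR (m21 B)) /\ isint (al * IZR (m12 B) + be * IZR (m22 B)))).
    { intros [I1 I2]. apply Hn. apply (isint_SL2 B); auto. }
    destruct (K_LS p r s L _ (al * IZR (m12 B) + be * IZR (m22 B)) Hp Hr HL (Rt B)) as [_ L2].
    eapply LS_ext; [|apply (LS_mult (fun _ => / c) _ (LS_const (/ c)) (L2 HnB))]. intros tau Ht. cbv beta. rewrite E by auto.
    assert (N := Csqrt_neq0 _ (autf_neq0 A tau HA Ht)).
    assert (NK := K_neq0 _ _ (sg p r s tau) (sg_Im p r s Hp Hr tau Ht) HnB). simpl. field. auto.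
Qed.

(** * Weakly modular functions *)

Lemma Mult_mono N L L' A e : (1 <= L)%nat -> Mult N (L * L') A e -> Mult N L A e.
Proof.
  intros HL H al be tau [u Hu] [v Hv]. apply H.
  - exists (Z.of_nat L' * u)%Z. rewrite mult_INR, mult_IZR, <- Hu, <- INR_IZR_INZ. ring.
  - exists (Z.of_nat L' * v)%Z. rewrite mult_INR, mult_IZR, <- Hv, <- INR_IZR_INZ. ring.
Qed.

(* [f] has weight w/2 with the w-th power of the multiplier of the functions
   tau |-> K al be (N tau), [al] and [be] of denominator L. *)
Definition TrN (N w : nat) (f : C -> C) : Prop := exists L, (1 <= L)%nat /\
  forall A e, SL2Z A -> Cmod e = 1%R -> Mult N L A e -> forall tau, (0 < Im tau)%R ->
    f (mobius A tau) = (e * Csqrt (autf A tau)) ^ w * f tau.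

Definition WP (N w : nat) (f : C -> C) : Prop := TrN N w f /\ CuspP w f.

(** Admissible denominators in [WP_div]: meromorphy at the cusps is asked of the reciprocal. *)
Definition WI (N w : nat) (f : C -> C) : Prop :=
  TrN N w f /\ CuspI w f /\ forall tau, (0 < Im tau)%R -> f tau <> 0.

Lemma TrN_ext N w f g : (forall tau, (0 < Im tau)%R -> f tau = g tau) -> TrN N w f -> TrN N w g.
Proof.
  intros H [L [HL T]]. exists L. split; auto. intros A e HA He HM tau Ht.
  rewrite <- !H by (try apply mobius_H; auto). apply T; auto.
Qed.

Lemma WP_ext N w f g : (forall tau, (0 < Im tau)%R -> f tau = g tau) -> WP N w f -> WP N w g.
Proof.
  intros H [T P]. split; [apply (TrN_ext N w f); auto|]. intros A HA. eapply LS_ext; [|apply (P A HA)].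
  intros tau Ht. cbv beta. rewrite H by (apply mobius_H; auto). auto.
Qed.

Lemma TrN_mult N w w' f g : TrN N w f -> TrN N w' g -> TrN N (w + w') (fun tau => f tau * g tau).
Proof.
  intros [L [HL T]] [L' [HL' T']]. exists (L * L')%nat. split; [nia|]. intros A e HA He HM tau Ht.
  rewrite (T A e), (T' A e); auto.
  - rewrite Cpow_add_r. ring.
  - apply (Mult_mono N L' L); auto. rewrite Nat.mul_comm. auto.
  - apply (Mult_mono N L L'); auto.
Qed.

Lemma TrN_plus N w f g : TrN N w f -> TrN N w g -> TrN N w (fun tau => f tau + g tau).
Proof.
  intros [L [HL T]] [L' [HL' T']]. exists (L * L')%nat. split; [nia|]. intros A e HA He HM tau Ht.
  rewrite (T A e), (T' A e); auto.
  - ring.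
  - apply (Mult_mono N L' L); auto. rewrite Nat.mul_comm. auto.
  - apply (Mult_mono N L L'); auto.
Qed.

Lemma TrN_scal N w c f : TrN N w f -> TrN N w (fun tau => c * f tau).
Proof.
  intros [L [HL T]]. exists L. split; auto. intros A e HA He HM tau Ht. rewrite (T A e); auto. ring.
Qed.

Lemma WP_mult N w w' f g : WP N w f -> WP N w' g -> WP N (w + w') (fun tau => f tau * g tau).
Proof.
  intros [T P] [T' P']. split; [apply TrN_mult; auto|]. intros A HA.
  eapply LS_ext; [|apply (LS_mult _ _ (P A HA) (P' A HA))]. intros tau Ht. cbv beta. rewrite Cpow_add_r. ring.
Qed.

Lemma WP_plus N w f g : WP N w f -> WP N w g -> WP N w (fun tau => f tau + g tau).
Proof.
  intros [T P] [T' P']. split; [apply TrN_plus; auto|]. intros A HA.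
  eapply LS_ext; [|apply (LS_plus _ _ (P A HA) (P' A HA))]. intros tau Ht. cbv beta. ring.
Qed.

Lemma WP_scal N w c f : WP N w f -> WP N w (fun tau => c * f tau).
Proof.
  intros [T P]. split; [apply TrN_scal; auto|]. intros A HA.
  eapply LS_ext; [|apply (LS_mult _ _ (LS_const c) (P A HA))]. intros tau Ht. cbv beta. ring.
Qed.

Lemma WP_lsum {I : Type} N w (f : I -> C -> C) l : (forall i, In i l -> WP N w (f i)) -> WP N w (fun tau => lsum (fun i => f i tau) l).
Proof.
  induction l as [|x l IH]; intros H.
  - split.
    + exists 1%nat. split; [lia|]. intros. simpl. ring.
    + intros A HA. eapply LS_ext; [|apply (LS_const 0)]. intros tau Ht. simpl. ring.
  - simpl. apply WP_plus; [apply H; left; auto|]. apply IH. intros i Hi. apply H. right. auto.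
Qed.

Lemma WI_mult N w w' f g : WI N w f -> WI N w' g -> WI N (w + w') (fun tau => f tau * g tau).
Proof.
  intros [T [P Z]] [T' [P' Z']]. split; [apply TrN_mult; auto|]. split.
  - intros A HA. eapply LS_ext; [|apply (LS_mult _ _ (P A HA) (P' A HA))]. intros tau Ht. cbv beta.
    assert (N1 := Z _ (mobius_H A tau HA Ht)). assert (N2 := Z' _ (mobius_H A tau HA Ht)).
    rewrite Cpow_add_r. field. auto.
  - intros tau Ht. apply Cmult_neq_0; auto.
Qed.

Lemma WP_div N w w' f g : WP N (w + w') f -> WI N w' g -> WP N w (fun tau => f tau / g tau).
Proof.
  intros [[L [HL T]] P] [[L' [HL' T']] [P' Z']]. split.
  - exists (L * L')%nat. split; [nia|]. intros A e HA He HM tau Ht.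
    assert (N2 := Z' tau Ht). assert (N3 := Z' _ (mobius_H A tau HA Ht)).
    assert (E2 : g (mobius A tau) = (e * Csqrt (autf A tau)) ^ w' * g tau).
    { apply T'; auto. apply (Mult_mono N L' L); auto. rewrite Nat.mul_comm. auto. }
    assert (E1 : f (mobius A tau) = (e * Csqrt (autf A tau)) ^ (w + w') * f tau).
    { apply T; auto. apply (Mult_mono N L L'); auto. }
    rewrite E1, E2, Cpow_add_r.
    assert (N4 : (e * Csqrt (autf A tau)) ^ w' <> 0).
    { intros E. apply N3. rewrite E2, E. ring. }
    field. auto.
  - intros A HA. eapply LS_ext; [|apply (LS_mult _ _ (P A HA) (P' A HA))]. intros tau Ht. cbv beta.
    assert (N3 := Z' _ (mobius_H A tau HA Ht)). assert (NC := Csqrt_neq0 _ (autf_neq0 A tau HA Ht)).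
    rewrite Cpow_add_r, !Cpow_inv by auto. assert (Nw := Cpow_nz _ w' NC). assert (Nw' := Cpow_nz _ w NC). field. auto.
Qed.

Lemma K_TrN N L al be : (1 <= L)%nat -> ratl L al -> ratl L be -> TrN N 1 (fun tau => K al be (RtoC (INR N) * tau)).
Proof.
  intros HL Ha Hb. exists L. split; auto. intros A e HA He HM tau Ht. rewrite HM by auto. ring.
Qed.

Lemma K_WP N L al be : (1 <= N)%nat -> (1 <= L)%nat -> ratl L al -> ratl L be -> WP N 1 (fun tau => K al be (RtoC (INR N) * tau)).
Proof.
  intros HN HL Ha Hb. split; [apply (K_TrN N L); auto|].
  destruct (K_cusp N 1 L al be HN ltac:(lia) HL Ha Hb) as [H _].
  intros A HA. eapply LS_ext; [|apply (H A HA)]. intros tau Ht. cbv beta. replace (INR N / INR 1)%R with (INR N) by (simpl; field). auto.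
Qed.

Lemma Im_Nat_pos N tau : (1 <= N)%nat -> (0 < Im tau)%R -> (0 < Im (RtoC (INR N) * tau))%R.
Proof. intros HN H. rewrite Im_scal. apply Rmult_lt_0_compat; auto. apply lt_0_INR. lia. Qed.

Lemma K_WI N L al be : (1 <= N)%nat -> (1 <= L)%nat -> ratl L al -> ratl L be -> ~ (isint al /\ isint be) ->
  WI N 1 (fun tau => K al be (RtoC (INR N) * tau)).
Proof.
  intros HN HL Ha Hb Hn. split; [apply (K_TrN N L); auto|]. split.
  - destruct (K_cusp N 1 L al be HN ltac:(lia) HL Ha Hb) as [_ H].
    intros A HA. eapply LS_ext; [|apply (H Hn A HA)]. intros tau Ht. cbv beta. replace (INR N / INR 1)%R with (INR N) by (simpl; field). auto.
  - intros tau Ht. apply K_neq0; auto. apply Im_Nat_pos; auto.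
Qed.

(** * From expansions to modular forms *)

Lemma principal_congruence_subgroup M : SL2Z_subgroup (principal_congruence M).
Proof.
  split; [intros A [H _]; auto|]. split; [|split].
  - split; [reflexivity|]. cbn [m11 m12 m21 m22 mat2_id]. repeat split; exists 0%Z; reflexivity.
  - intros A B [HA [[a Ha] [[b Hb] [[c Hc] [d Hd]]]]] [HB [[a' Ha'] [[b' Hb'] [[c' Hc'] [d' Hd']]]]].
    split; [apply SL2Z_mul; auto|]. unfold mat2_mul. cbn [m11 m12 m21 m22].
    set (m := Z.of_nat M) in *.
    replace (m11 A) with (a * m + 1)%Z by lia. replace (m22 A) with (d * m + 1)%Z by lia.
    replace (m11 B) with (a' * m + 1)%Z by lia. replace (m22 B) with (d' * m + 1)%Z by lia.
    rewrite Hb, Hc, Hb', Hc'. repeat split.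
    + exists (a * a' * m + a + a' + b * c' * m)%Z. ring.
    + exists (a * b' * m + b' + b * d' * m + b)%Z. ring.
    + exists (c * a' * m + c + d * c' * m + c')%Z. ring.
    + exists (c * b' * m + d * d' * m + d + d')%Z. ring.
  - intros A [HA [[a Ha] [[b Hb] [[c Hc] [d Hd]]]]]. split.
    + unfold SL2Z, mat2_inv in *. cbn [m11 m12 m21 m22]. lia.
    + unfold mat2_inv. cbn [m11 m12 m21 m22]. repeat split.
      * exists d. lia.
      * exists (- b)%Z. lia.
      * exists (- c)%Z. lia.
      * exists a. lia.
Qed.

(** Termwise differentiation by [expsum_deriv]; absolute convergence at a point with half the
    imaginary part pays for the second moment of the exponents. *)
Lemma series_deriv (k h : nat) (a : nat -> C) (f : C -> C) : (1 <= h)%nat ->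
  (forall tau, (0 < Im tau)%R -> summable (fun n => a n * ex (RtoC ((INR n - INR k) / INR h) * tau)) /\
    f tau = Sum (fun n => a n * ex (RtoC ((INR n - INR k) / INR h) * tau))) ->
  forall tau, (0 < Im tau)%R -> exists (l : C) (d M : R), (0 < d)%R /\ (0 <= M)%R /\
    forall w : C, (Cmod w <= d)%R -> (Cmod (f (tau + w) - f tau - w * l)%C <= M * (Cmod w * Cmod w))%R.
Proof.
  intros Hh Hf tau Ht. set (c := fun n => ((INR n - INR k) / INR h)%R).
  set (y := Im tau) in *. set (dl := (y / 8)%R). assert (Hdl : (0 < dl)%R) by (unfold dl; lra).
  set (B := fun n => (2 * PI * Ci * RtoC (c n))%C).
  assert (HPI := PI_RGT_0). assert (Hh0 : (0 < INR h)%R) by (apply lt_0_INR; lia).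
  assert (HB : forall n, Cmod (B n) = (2 * PI * Rabs (c n))%R).
  { intros n. unfold B. rewrite !Cmod_mult, Cmod_Ci, !Cmod_R, (Rabs_pos_eq 2), (Rabs_pos_eq PI) by lra. ring. }
  set (B0 := (2 * PI * (INR k / INR h))%R).
  assert (HB0 : (0 <= B0)%R).
  { unfold B0. assert (0 <= INR k / INR h)%R; [|nra]. apply Rmult_le_pos; [apply pos_INR|]. left. apply Rinv_0_lt_compat. auto. }
  assert (Hc : forall n, (- (INR k / INR h) <= c n)%R).
  { intros n. unfold c. replace (- (INR k / INR h))%R with ((- INR k) * / INR h)%R by (field; lra).
    unfold Rdiv. apply Rmult_le_compat_r; [left; apply Rinv_0_lt_compat; auto|]. assert (Q := pos_INR n). lra. }
  (* Exponents are at least - k / h; the constant [2 * B0] pays for the finitely many negative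
     ones. *)
  assert (HcB : forall n, (- (2 * PI * c n) <= - Cmod (B n) + 2 * B0)%R).
  { intros n. rewrite HB. unfold B0. assert (Q := Hc n). destruct (Rle_dec 0 (c n)).
    - rewrite Rabs_pos_eq by auto. unfold B0 in HB0. lra.
    - rewrite Rabs_left by lra. assert (0 <= PI * (c n + INR k / INR h))%R by (apply Rmult_le_pos; lra). nra. }
  set (t1 := (tau - Ci * RtoC (y / 2))).
  assert (Ht1 : Im t1 = (y / 2)%R).
  { unfold t1. C_simpl. fold y. lra. }
  destruct (Hf t1 ltac:(rewrite Ht1; lra)) as [[M1 HM1] _].
  destruct (Hf tau Ht) as [S0 E0].
  set (Cst := (/ (dl * dl) * exp (B0 * y))%R).
  assert (HC : (0 <= Cst)%R).
  { unfold Cst. apply Rmult_le_pos; [left; apply Rinv_0_lt_compat; nra|left; apply exp_pos]. }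
  assert (HM : rbound (fun n => (Cmod (a n * ex (RtoC (c n) * tau)) * (Cmod (B n) * Cmod (B n)) * exp (dl * Cmod (B n)))%R) (Cst * M1)).
  { eapply rbound_le; [|apply (rbound_scal _ Cst M1 HC HM1)]. intros n. cbv beta. fold (c n).
    rewrite !Cmod_mult, !Cmod_ex, !Im_scal, Ht1. fold y.
    set (b := Cmod (B n)). assert (Hb : (0 <= b)%R) by apply Cmod_ge_0.
    assert (X : (b * b <= / (dl * dl) * exp (2 * dl * b))%R).
    { assert (Q := abs_pow_exp (dl * b) 2). simpl in Q. rewrite Rmult_1_r, Rabs_pos_eq in Q by (apply Rle_0_sqr).
      rewrite Rabs_pos_eq in Q by (apply Rmult_le_pos; lra).
      apply (Rmult_le_reg_l (dl * dl)); [nra|]. replace (dl * dl * (/ (dl * dl) * exp (2 * dl * b)))%R with (exp (2 * dl * b)) by (field; lra).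
      replace (2 * dl * b)%R with ((1 + 1) * (dl * b))%R by ring. lra. }
    replace (-2 * PI * (c n * y))%R with (-2 * PI * (c n * (y / 2)) + - (2 * PI * c n) * (y / 2))%R by field.
    rewrite exp_plus. unfold Cst.
    set (e1 := exp (-2 * PI * (c n * (y / 2)))).
    assert (H1 : (exp (- (2 * PI * c n) * (y / 2)) <= exp ((- b + 2 * B0) * (y / 2)))%R).
    { apply exp_le_le. apply Rmult_le_compat_r; [lra|]. apply HcB. }
    assert (H2 : (exp ((- b + 2 * B0) * (y / 2)) * exp (2 * dl * b) * exp (dl * b) <= exp (B0 * y))%R).
    { rewrite <- !exp_plus. apply exp_le_le. unfold dl. nra. }
    assert (A1 := exp_pos (-2 * PI * (c n * (y / 2)))). fold e1 in A1.
    assert (A2 := Cmod_ge_0 (a n)). assert (A3 := exp_pos (dl * b)).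
    assert (A4 : (0 < / (dl * dl))%R) by (apply Rinv_0_lt_compat; nra).
    assert (A5 := exp_pos (2 * dl * b)). assert (A6 := exp_pos (- (2 * PI * c n) * (y / 2))).
    set (e2 := exp (- (2 * PI * c n) * (y / 2))) in *. set (e3 := exp (dl * b)) in *. set (e4 := exp (2 * dl * b)) in *.
    set (e5 := exp ((- b + 2 * B0) * (y / 2))) in *. set (e6 := exp (B0 * y)) in *. set (i2 := (/ (dl * dl))%R) in *.
    replace (Cmod (a n) * (e1 * e2) * (b * b) * e3)%R with ((Cmod (a n) * e1) * (e2 * (b * b) * e3))%R by ring.
    replace (i2 * e6 * (Cmod (a n) * e1))%R with ((Cmod (a n) * e1) * (i2 * e6))%R by ring.
    apply Rmult_le_compat_l; [apply Rmult_le_pos; lra|].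
    apply Rle_trans with (e5 * (i2 * e4) * e3)%R.
    - apply Rmult_le_compat_r; [lra|]. apply Rmult_le_compat; try lra. nra.
    - replace (e5 * (i2 * e4) * e3)%R with (i2 * (e5 * e4 * e3))%R by ring. apply Rmult_le_compat_l; lra. }
  destruct (expsum_deriv (fun n => a n * ex (RtoC (c n) * tau)) B dl (Cst * M1) ltac:(lra) S0 HM) as [S1 D].
  exists (Sum (fun i => a i * ex (RtoC (c i) * tau) * B i)), dl, (4 * (Cst * M1))%R.
  split; auto. split.
  { assert (Q := rbound_ge0 _ _ HM1). assert (Q2 := Rmult_le_pos _ _ HC Q). lra. }
  intros w Hw. destruct (D w Hw) as [S2 D2].
  assert (Hw' : (0 < Im (tau + w))%R).
  { rewrite Im_plus. fold y. assert (Q := im_le_Cmod w). apply Rabs_le_between in Q. unfold dl in Hw. lra. }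
  destruct (Hf _ Hw') as [_ ->]. rewrite E0.
  rewrite (Sum_ext (fun n => a n * ex (RtoC ((INR n - INR k) / INR h) * (tau + w))) (fun i => a i * ex (RtoC (c i) * tau) * Cexp (w * B i))); [exact D2|].
  intros n. fold (c n). rewrite Cmult_plus_distr_l, ex_plus. unfold B.
  replace (Cexp (w * (2 * PI * Ci * RtoC (c n)))) with (ex (RtoC (c n) * w)) by (unfold ex; f_equal; ring). ring.
Qed.

(** An error M |w|^2 is at most eps |w| once |w| <= eps / (M + 1). *)
Lemma quadratic_ex_derive (f : C -> C) tau l d M : (0 < d)%R -> (0 <= M)%R ->
  (forall w : C, (Cmod w <= d)%R -> (Cmod (f (tau + w) - f tau - w * l)%C <= M * (Cmod w * Cmod w))%R) ->
  ex_derive (K := C_AbsRing) (V := C_NormedModule) f tau.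
Proof.
  intros Hd HM H. exists l. split; [apply is_linear_scal_l|].
  intros x Hx eps. apply (is_filter_lim_locally_unique (K := C_AbsRing) (V := AbsRing_NormedModule C_AbsRing)) in Hx. subst x.
  assert (He := cond_pos eps).
  assert (Hr : (0 < Rmin d (eps / (M + 1)))%R) by (apply Rmin_pos; auto; apply Rdiv_lt_0_compat; lra).
  exists (mkposreal _ Hr). intros w Hw. 
  change (Cmod (w - tau) < Rmin d (eps / (M + 1)))%R in Hw.
  change (Cmod (f w - f tau - (w - tau) * l) <= eps * Cmod (w - tau))%R.
  assert (E : (w : C) = (tau + ((w : C) - tau))%C) by (change (AbsRing_UniformSpace C_AbsRing : Type) with C in w; apply C_eq; rewrite ?Re_plus, ?Im_plus, ?Re_minus, ?Im_minus; ring). rewrite E at 1.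
  assert (H1 := Rmin_l d (eps / (M + 1))). assert (H2 := Rmin_r d (eps / (M + 1))).
  eapply Rle_trans; [apply H; lra|].
  assert (H0 := Cmod_ge_0 (w - tau)). set (r := Cmod (w - tau)) in *.
  rewrite <- Rmult_assoc. apply Rmult_le_compat_r; auto.
  assert (H3 : (r * (M + 1) <= eps)%R).
  { apply Rle_trans with (eps / (M + 1) * (M + 1))%R; [apply Rmult_le_compat_r; lra|]. right. field. lra. }
  nra.
Qed.

Theorem WP_modular N f : (1 <= N)%nat -> WP N 1 f -> is_modular_half f.
Proof.
  intros HN [[L [HL T]] P].
  set (M := (N * (2 * L * L))%nat). exists (principal_congruence M). split; [|split; [|split]].
  - split; [apply principal_congruence_subgroup|]. exists M. split; [unfold M; nia|auto].
  - intros tau Ht. unfold upper_half_plane in Ht.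
    (* The expansion at infinity converges on the whole half-plane and therefore gives holomorphy
       there. *)
    destruct (P mat2_id eq_refl) as [h0 [Hh0 Hm]]. destruct (Hm 1%nat ltac:(lia)) as [k [a Ha]].
    assert (E : forall t, f (mobius mat2_id t) * (/ Csqrt (autf mat2_id t)) ^ 1 = f t).
    { intros t. assert (E1 : autf mat2_id t = 1) by (unfold autf; cbn [m21 m22 mat2_id]; ring).
      unfold mobius. rewrite E1, Csqrt_1. cbn [m11 m12 mat2_id].
      replace ((RtoC 1 * t + RtoC 0) / 1) with t by field. simpl. field. }
    destruct (series_deriv k (h0 * 1) a f ltac:(lia)) with (tau := tau) as [l [d [M' [Hd [HM' H]]]]]; auto.
    { intros t Ht'. destruct (Ha t Ht') as [A1 A2]. split; [exact A1|]. rewrite E in A2. exact A2. }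
    apply (quadratic_ex_derive f tau l d M'); auto.
  - intros A HA. destruct (P A HA) as [h0 [Hh0 Hm]]. destruct (Hm 1%nat ltac:(lia)) as [k [a Ha]].
    exists (h0 * 1)%nat, (- (INR k / INR (h0 * 1)))%R, a. split; [lia|]. intros tau Ht.
    destruct (Ha tau Ht) as [A1 A2].
    replace (/ Csqrt (autf A tau) * f (mobius A tau)) with (f (mobius A tau) * (/ Csqrt (autf A tau)) ^ 1) by (simpl; ring).
    rewrite A2. apply csum_is_series. eapply csum_ext; [|apply summable_csum; exact A1].
    intros n. cbv beta. rewrite qpow_ex. do 4 f_equal. field. apply not_0_INR. lia.
  (* The value at A is chosen among the unimodular numbers that serve all thetas of level N and
     denominator L. *)
  - exists (fun A => epsilon (inhabits (RtoC 1)) (fun e => Cmod e = 1%R /\ Mult N L A e)).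
    intros A HA. assert (Q := epsilon_spec (inhabits (RtoC 1)) (fun e => Cmod e = 1%R /\ Mult N L A e) (Mult_exists N L A HN HL HA)).
    cbv beta in Q. destruct Q as [Q1 Q2]. split; auto. intros tau Ht. rewrite (T A _ (proj1 HA) Q1 Q2 tau Ht). ring.
Qed.

(** * Theta quotients *)

Lemma csum_split (M : nat) (f : Z -> C) : (1 <= M)%nat -> summable f ->
  csum f (lsum (fun k => Sum (fun m => f (Z.of_nat k + Z.of_nat M * m)%Z)) (seq 0 M)).
Proof.
  intros HM Hf.
  set (g := fun (k : nat) (j : Z) => if Z.eq_dec (j mod Z.of_nat M) (Z.of_nat k) then f j else 0).
  assert (Hg : forall k, In k (seq 0 M) -> csum (g k) (Sum (fun m => f (Z.of_nat k + Z.of_nat M * m)%Z))).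
  { intros k Hk. apply in_seq in Hk.
    assert (Hin : forall x y, (Z.of_nat k + Z.of_nat M * x = Z.of_nat k + Z.of_nat M * y)%Z -> x = y).
    { intros x y E. apply (Z.mul_reg_l _ _ (Z.of_nat M)); lia. }
    apply (csum_push (fun m => (Z.of_nat k + Z.of_nat M * m)%Z) (g k)); auto.
    - intros j Hj. unfold g. destruct Z.eq_dec as [E|E]; auto. exfalso. apply (Hj (j / Z.of_nat M)%Z).
      assert (Q := Z.div_mod j (Z.of_nat M) ltac:(lia)). lia.
    - eapply csum_ext; [|apply summable_csum; apply (summable_inj (fun m => (Z.of_nat k + Z.of_nat M * m)%Z) f); auto].
      intros m. cbv beta. unfold g. destruct Z.eq_dec as [E|E]; auto. exfalso. apply E.
      rewrite Z.mul_comm, Z.mod_add, Z.mod_small by lia. auto. }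
  eapply csum_ext; [|apply (csum_lsum g _ _ Hg)]. intros j. cbv beta.
  set (k0 := Z.to_nat (j mod Z.of_nat M)). assert (Hb := Z.mod_pos_bound j (Z.of_nat M) ltac:(lia)).
  apply (csum_unique (fun k => g k j)).
  - apply csum_fin; [apply seq_NoDup|]. intros k Hk. unfold g. destruct Z.eq_dec as [E|E]; auto.
    exfalso. apply Hk. apply in_seq. lia.
  - replace (f j) with (g k0 j).
    + apply (csum_at (fun k => g k j)). intros k Hk. unfold g. destruct Z.eq_dec as [E|E]; auto. exfalso. apply Hk. unfold k0. lia.
    + unfold g, k0. rewrite Z2Nat.id by lia. destruct Z.eq_dec; tauto.
Qed.

Lemma Sum_split (M : nat) (f : Z -> C) : (1 <= M)%nat -> summable f ->
  Sum f = lsum (fun k => Sum (fun m => f (Z.of_nat k + Z.of_nat M * m)%Z)) (seq 0 M).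
Proof. intros HM Hf. apply csum_Sum. apply csum_split; auto. Qed.

Definition sq4 (tau : C) (n : Z) : C := ex (ZC n / 2 + tau * (ZC n * ZC n)).

Lemma sq4_tj tau n : sq4 tau n = tj (2 * tau) tau n.
Proof. rewrite tj_alt. unfold sq4. f_equal. field. Qed.

Lemma sq4_summable tau : (0 < Im tau)%R -> summable (sq4 tau).
Proof.
  intros H. apply (summable_ext (tj (2 * tau) tau)); [intros n; symmetry; apply sq4_tj|].
  apply tj_summable. rewrite (Im_scal 2). lra.
Qed.

Lemma th4_sq4 tau : th4 tau = Sum (sq4 tau).
Proof. unfold th4, jt. apply Sum_ext. intros n. symmetry. apply sq4_tj. Qed.

(** Sorting n = k + M m by residues turns (-1)^n q^(n^2) into Gaussian terms of level N. In its
    original form theta_4 is a theta of another level, with a possibly different multiplier. *)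
Lemma th4_split (M N n1 n2 : nat) tau : (1 <= M)%nat -> (1 <= n2)%nat -> (1 <= n1)%nat -> (n2 * N = 2 * M * M * n1)%nat -> (0 < Im tau)%R ->
  th4 (RtoC (INR n1 / INR n2) * tau) = lsum (fun k => th (INR k / INR M) (INR M / 2) (RtoC (INR N) * tau)) (seq 0 M).
Proof.
  intros HM Hn2 Hn1 HN Ht.
  assert (F1 : INR M <> 0%R) by (apply not_0_INR; lia). assert (F2 : INR n2 <> 0%R) by (apply not_0_INR; lia).
  assert (EN : INR N = (2 * INR M * INR M * (INR n1 / INR n2))%R).
  { apply (f_equal INR) in HN. rewrite !mult_INR in HN. simpl (INR 2) in HN. apply (Rmult_eq_reg_l (INR n2)); auto. rewrite HN. field. auto. }
  assert (Hr : (0 < INR n1 / INR n2)%R) by (apply Rdiv_lt_0_compat; apply lt_0_INR; lia).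
  rewrite th4_sq4, (Sum_split M) by (auto; apply sq4_summable; rewrite Im_scal; apply Rmult_lt_0_compat; auto).
  apply lsum_ext. intros k Hk. unfold th. apply Sum_ext. intros m. unfold sq4, gt. f_equal.
  rewrite EN. set (r := (INR n1 / INR n2)%R) in *.
  unfold ZC. rewrite plus_IZR, mult_IZR, <- !INR_IZR_INZ.
  replace ((IZR m + INR k / INR M) * (INR M / 2))%R with ((INR k + INR M * IZR m) / 2)%R by (field; auto).
  replace ((RtoC (INR k + INR M * IZR m) / 2)) with (RtoC ((INR k + INR M * IZR m) / 2)) by (rewrite RtoC_div by lra; auto).
  rewrite Cplus_comm. f_equal. rewrite !Cmult_assoc.
  rewrite (Cmult_comm _ tau), (Cmult_comm _ tau), <- !Cmult_assoc. f_equal. rewrite <- !RtoC_mult. f_equal. field. auto.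
Qed.

Lemma th_K a b : exists c, forall tau, th a b tau = c * K (a - 1 / 2) (b - 1 / 2) tau.
Proof.
  exists (/ ex (RtoC (- ((a - 1 / 2) * (b - 1 / 2) + (a - 1 / 2)) / 2))). intros tau. unfold K.
  replace (a - 1 / 2 + 1 / 2)%R with a by lra. replace (b - 1 / 2 + 1 / 2)%R with b by lra.
  field. apply ex_neq0.
Qed.

Lemma lsum_TrN {I : Type} N w (f : I -> C -> C) l : (forall i, In i l -> TrN N w (f i)) -> TrN N w (fun tau => lsum (fun i => f i tau) l).
Proof.
  induction l as [|x l IH]; intros H.
  - exists 1%nat. split; [lia|]. intros. simpl. ring.
  - simpl. apply TrN_plus; [apply H; left; auto|]. apply IH. intros i Hi. apply H. right. auto.
Qed.

Lemma jt_K al be : exists c : C, c <> 0 /\ forall tau, (0 < Im tau)%R ->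
  jt tau (RtoC al * tau + RtoC be) = c * ex (RtoC (- ((al - 1 / 2) * (al - 1 / 2) / 2)) * tau) * K al be tau.
Proof.
  set (c0 := ex (RtoC (- (al * be + al) / 2 - (1 / 2 - al) * (be + 1 / 2)))).
  assert (Hc : c0 <> 0) by apply ex_neq0.
  exists (/ c0). split; [intros E; assert (Q := Cinv_r c0 Hc); rewrite E, Cmult_0_r in Q; apply (f_equal Re) in Q; rewrite !Re_RtoC in Q; lra|].
  intros tau Ht. rewrite K_jt by auto. fold c0.
  replace (RtoC (- ((al - 1 / 2) * (al - 1 / 2) / 2)) * tau) with (- (RtoC ((al - 1 / 2) * (al - 1 / 2) / 2) * tau)) by (rewrite RtoC_opp; ring).
  rewrite ex_opp. field. split; auto. apply ex_neq0.
Qed.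

Lemma half_not_int : ~ isint (1 / 2).
Proof. intros [n Hn]. assert (E : (1 = 2 * IZR n)%R) by lra. rewrite <- mult_IZR in E. apply eq_IZR in E. lia. Qed.

Lemma ratl_mult L L' x : ratl L x -> ratl (L * L') x.
Proof. intros [u Hu]. exists (Z.of_nat L' * u)%Z. rewrite mult_INR, mult_IZR, <- Hu, <- INR_IZR_INZ. ring. Qed.

(** * Rational characteristics *)

Definition rat (x : R) : Prop := exists L, (1 <= L)%nat /\ ratl L x.

Lemma rat_common x y : rat x -> rat y -> exists L, (1 <= L)%nat /\ ratl L x /\ ratl L y.
Proof.
  intros [L [HL Hx]] [L' [HL' Hy]]. exists (L * L')%nat. split; [nia|]. split; [apply ratl_mult; auto|].
  rewrite Nat.mul_comm. apply ratl_mult; auto.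
Qed.

Lemma rat_plus x y : rat x -> rat y -> rat (x + y).
Proof.
  intros Hx Hy. destruct (rat_common x y Hx Hy) as [L [HL [[u Hu] [v Hv]]]]. exists L. split; auto.
  exists (u + v)%Z. rewrite plus_IZR, <- Hu, <- Hv. ring.
Qed.

Lemma rat_opp x : rat x -> rat (- x).
Proof. intros [L [HL [u Hu]]]. exists L. split; auto. exists (- u)%Z. rewrite opp_IZR, <- Hu. ring. Qed.

Lemma rat_minus x y : rat x -> rat y -> rat (x - y).
Proof. intros Hx Hy. apply rat_plus; auto. apply rat_opp; auto. Qed.

Lemma rat_div (m : Z) (n : nat) : (1 <= n)%nat -> rat (IZR m / INR n).
Proof. intros Hn. exists n. split; auto. exists m. field. apply not_0_INR. lia. Qed.

Lemma rat_half : rat (1 / 2).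
Proof. exact (rat_div 1 2 ltac:(lia)). Qed.

Lemma rat_int (m : Z) : rat (IZR m).
Proof. exists 1%nat. split; auto. exists m. simpl. ring. Qed.

Lemma K_rat_WP N al be : (1 <= N)%nat -> rat al -> rat be -> WP N 1 (fun tau => K al be (RtoC (INR N) * tau)).
Proof. intros HN Ha Hb. destruct (rat_common _ _ Ha Hb) as [L [HL [H1 H2]]]. apply (K_WP N L); auto. Qed.

Lemma K_rat_WI N al be : (1 <= N)%nat -> rat al -> rat be -> ~ (isint al /\ isint be) -> WI N 1 (fun tau => K al be (RtoC (INR N) * tau)).
Proof. intros HN Ha Hb Hn. destruct (rat_common _ _ Ha Hb) as [L [HL [H1 H2]]]. apply (K_WI N L); auto. Qed.

(** Two descriptions are combined: the splitting into level N gives the transformation, and the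
    single theta K(1/2, 0) at 2 n1 / n2 tau gives the expansions of the reciprocal, which a sum does
    not show. *)
Lemma th4_WI (M N n1 n2 : nat) : (1 <= M)%nat -> (1 <= n2)%nat -> (1 <= n1)%nat -> (n2 * N = 2 * M * M * n1)%nat ->
  WI N 1 (fun tau => th4 (RtoC (INR n1 / INR n2) * tau)).
Proof.
  intros HM Hn2 Hn1 HN.
  assert (HN1 : (1 <= N)%nat) by nia.
  assert (Hr : (0 < INR n1 / INR n2)%R) by (apply Rdiv_lt_0_compat; apply lt_0_INR; lia).
  assert (Hi : forall tau, (0 < Im tau)%R -> (0 < Im (RtoC (INR n1 / INR n2) * tau))%R).
  { intros tau Ht. rewrite Im_scal. apply Rmult_lt_0_compat; auto. }
  split; [|split].
  - eapply TrN_ext; [intros tau Ht; symmetry; apply (th4_split M N n1 n2 tau); auto|].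
    apply (lsum_TrN N 1 (fun k tau => th (INR k / INR M) (INR M / 2) (RtoC (INR N) * tau))). intros k _.
    destruct (th_K (INR k / INR M) (INR M / 2)) as [c Hc].
    eapply TrN_ext; [intros tau Ht; symmetry; apply Hc|]. apply TrN_scal.
    apply K_rat_WP; auto; apply rat_minus; try apply rat_half; rewrite !INR_IZR_INZ.
    + rewrite <- (INR_IZR_INZ M). apply rat_div. auto.
    + exact (rat_div (Z.of_nat M) 2 ltac:(lia)).
  - destruct (jt_K (1 / 2) 0) as [c [Hc E]].
    assert (Et : forall tau, (0 < Im tau)%R -> th4 (RtoC (INR n1 / INR n2) * tau) = c * K (1 / 2) 0 (RtoC (INR (2 * n1) / INR n2) * tau)).
    { intros tau Ht. unfold th4.
      replace (RtoC (INR (2 * n1) / INR n2) * tau) with (2 * (RtoC (INR n1 / INR n2) * tau)).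
      2:{ rewrite mult_INR. replace (INR 2) with 2%R by (simpl; lra). unfold Rdiv. rewrite !RtoC_mult. ring. }
      set (t := RtoC (INR n1 / INR n2) * tau).
      replace (jt (2 * t) t) with (jt (2 * t) (RtoC (1 / 2) * (2 * t) + RtoC 0)).
      2:{ f_equal. rewrite RtoC_div by lra. field. }
      rewrite E.
      - replace (1 / 2 - 1 / 2)%R with 0%R by lra. replace (- (0 * 0 / 2))%R with 0%R by lra. rewrite Cmult_0_l, ex_0. ring.
      - rewrite (Im_scal 2). assert (Q := Hi tau Ht). fold t in Q. lra. }
    destruct (K_cusp (2 * n1) n2 2 (1 / 2) 0 ltac:(lia) Hn2 ltac:(lia)) as [_ HI].
    { exists 1%Z. simpl. lra. }
    { exists 0%Z. simpl. lra. }
    assert (Hn : ~ (isint (1 / 2) /\ isint 0)) by (intros [Q _]; apply half_not_int; auto).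
    specialize (HI Hn). intros A HA.
    eapply LS_ext; [|apply (LS_mult (fun _ => / c) _ (LS_const (/ c)) (HI A HA))]. intros tau Ht. cbv beta.
    rewrite Et by (apply mobius_H; auto).
    assert (NK : K (1 / 2) 0 (RtoC (INR (2 * n1) / INR n2) * mobius A tau) <> 0).
    { apply K_neq0; auto. rewrite Im_scal. apply Rmult_lt_0_compat; [apply Rdiv_lt_0_compat; apply lt_0_INR; lia|apply mobius_H; auto]. }
    simpl. field. auto.
  - intros tau Ht. apply (th4_eq _ (Hi tau Ht)).
Qed.

Lemma jt_int al be tau : (0 < Im tau)%R -> ~ (isint al /\ isint be) -> notlat tau (RtoC al * tau + RtoC be).
Proof.
  intros H Hn m n E. apply Hn.
  assert (EI : (al * Im tau = IZR m * Im tau)%R).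
  { assert (X := f_equal Im E). rewrite (Im_plus (RtoC al * tau)), (Im_plus (RtoC (IZR m) * tau)), !Im_scal, !Im_RtoC in X. lra. }
  assert (Ea : al = IZR m) by (apply (Rmult_eq_reg_r (Im tau)); lra).
  split; [exists m; auto|]. exists n. apply RtoC_inj.
  rewrite Ea in E. replace (RtoC be) with (RtoC (IZR m) * tau + RtoC be - RtoC (IZR m) * tau) by ring. rewrite E. ring.
Qed.

Lemma J3_K : exists c : C, forall tau, (0 < Im tau)%R ->
  J3 tau = c * ex (RtoC (- (1 / 8)) * tau) * (K 0 (1 / 2) tau * K (1 / 2) 0 tau * K (1 / 2) (1 / 2) tau).
Proof.
  destruct (jt_K 0 (1 / 2)) as [c1 [_ E1]]. destruct (jt_K (1 / 2) 0) as [c2 [_ E2]]. destruct (jt_K (1 / 2) (1 / 2)) as [c3 [_ E3]].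
  exists (c1 * c2 * c3 / 2). intros tau Ht.
  assert (H : 2 * J3 tau = jt tau (RtoC 0 * tau + RtoC (1 / 2)) * jt tau (RtoC (1 / 2) * tau + RtoC 0) * jt tau (RtoC (1 / 2) * tau + RtoC (1 / 2))).
  { rewrite <- (J3_jt tau Ht). rewrite !RtoC_div by lra. do 3 f_equal; field. }
  rewrite E1, E2, E3 in H by auto.
  replace (- ((1 / 2 - 1 / 2) * (1 / 2 - 1 / 2) / 2))%R with 0%R in H by lra.
  replace (- ((0 - 1 / 2) * (0 - 1 / 2) / 2))%R with (- (1 / 8))%R in H by lra.
  rewrite Cmult_0_l, ex_0 in H.
  replace (J3 tau) with (2 * J3 tau / 2) by field. rewrite H. field.
Qed.

(* The exponent of [ex] is the one that makes the quotient of thetas modular;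
   it does not depend on [l]. *)
Lemma theta_quotient_WP (N : nat) (x1 x2 y1 y2 l m : R) : (1 <= N)%nat ->
  rat x1 -> rat x2 -> rat y1 -> rat y2 -> rat l -> rat m ->
  ~ (isint x1 /\ isint x2) -> ~ (isint l /\ isint m) -> ~ (isint (l + x1 - y1) /\ isint (m + x2 - y2)) ->
  WP N 2 (fun tau => let T := RtoC (INR N) * tau in
    ex (RtoC (x1 * y1 + x1 / 2 - x1 * x1 / 2) * T) *
    (J3 T * jt T (RtoC (l - y1) * T + RtoC (m - y2)) * jt T (RtoC (x1 + l) * T + RtoC (x2 + m))) /
    (jt T (RtoC x1 * T + RtoC x2) * jt T (RtoC l * T + RtoC m) * jt T (RtoC (l + x1 - y1) * T + RtoC (m + x2 - y2)))).
Proof.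
  intros HN Hx1 Hx2 Hy1 Hy2 Hl Hm Nx Nl Nr.
  destruct J3_K as [c0 E0].
  destruct (jt_K (l - y1) (m - y2)) as [c1 [_ E1]]. destruct (jt_K (x1 + l) (x2 + m)) as [c2 [_ E2]].
  destruct (jt_K x1 x2) as [c3 [N3 E3]]. destruct (jt_K l m) as [c4 [N4 E4]].
  destruct (jt_K (l + x1 - y1) (m + x2 - y2)) as [c5 [N5 E5]].
  assert (R0 : rat 0) by apply (rat_int 0). assert (Rh := rat_half).
  assert (W : WP N 2 (fun tau => c0 * c1 * c2 / (c3 * c4 * c5) *
    ((K 0 (1 / 2) (RtoC (INR N) * tau) * K (1 / 2) 0 (RtoC (INR N) * tau) * K (1 / 2) (1 / 2) (RtoC (INR N) * tau) *
     K (l - y1) (m - y2) (RtoC (INR N) * tau) * K (x1 + l) (x2 + m) (RtoC (INR N) * tau)) /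
    (K x1 x2 (RtoC (INR N) * tau) * K l m (RtoC (INR N) * tau) * K (l + x1 - y1) (m + x2 - y2) (RtoC (INR N) * tau))))).
  (* Five thetas above, three of them from [J3], and three below. *)
  { apply WP_scal. apply (WP_div N 2 3).
    - change (2 + 3)%nat with (1 + 1 + 1 + 1 + 1)%nat. repeat apply WP_mult; apply K_rat_WP; auto using rat_plus, rat_minus.
    - change 3%nat with (1 + 1 + 1)%nat. repeat apply WI_mult; apply K_rat_WI; auto using rat_plus, rat_minus. }
  eapply WP_ext; [|exact W]. intros tau Ht. cbv zeta beta.
  assert (HT : (0 < Im (RtoC (INR N) * tau))%R) by (apply Im_Nat_pos; auto).
  set (T := RtoC (INR N) * tau) in *.
  rewrite E0, E1, E2, E3, E4, E5 by auto.
  assert (K3 := K_neq0 x1 x2 T HT Nx). assert (K4 := K_neq0 l m T HT Nl). assert (K5 := K_neq0 _ _ T HT Nr).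
  set (k1 := K (l - y1) (m - y2) T). set (k2 := K (x1 + l) (x2 + m) T). set (k3 := K x1 x2 T) in *. set (k4 := K l m T) in *.
  set (k5 := K (l + x1 - y1) (m + x2 - y2) T) in *.
  set (A3 := RtoC (- ((x1 - 1 / 2) * (x1 - 1 / 2) / 2)) * T). set (A4 := RtoC (- ((l - 1 / 2) * (l - 1 / 2) / 2)) * T).
  set (A5 := RtoC (- ((l + x1 - y1 - 1 / 2) * (l + x1 - y1 - 1 / 2) / 2)) * T).
  set (A0 := RtoC (- (1 / 8)) * T). set (A1 := RtoC (- ((l - y1 - 1 / 2) * (l - y1 - 1 / 2) / 2)) * T).
  set (A2 := RtoC (- ((x1 + l - 1 / 2) * (x1 + l - 1 / 2) / 2)) * T). set (A := RtoC (x1 * y1 + x1 / 2 - x1 * x1 / 2) * T).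
  (* The Gaussian prefactors from [jt_K] and [J3_K] cancel exactly against the given exponent. *)
  assert (EX : ex A * ex A0 * ex A1 * ex A2 = ex A3 * ex A4 * ex A5).
  { rewrite <- !ex_plus. f_equal. unfold A, A0, A1, A2, A3, A4, A5. rewrite <- !Cmult_plus_distr_r, <- !RtoC_plus.
    do 2 f_equal. field. }
  assert (X3 := ex_neq0 A3). assert (X4 := ex_neq0 A4). assert (X5 := ex_neq0 A5).
  set (kk := K 0 (1 / 2) T * K (1 / 2) 0 T * K (1 / 2) (1 / 2) T).
  transitivity ((ex A3 * ex A4 * ex A5) * (c0 * c1 * c2 * (kk * k1 * k2)) / (c3 * ex A3 * k3 * (c4 * ex A4 * k4) * (c5 * ex A5 * k5))).
  - field. repeat split; auto.
  - rewrite <- EX. field. repeat split; auto.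
Qed.

(** * Overpartition ranks as bilateral sums *)

Lemma pole_neq0 T u n : notlat T u -> 1 - ex (u + ZC n * T) <> 0.
Proof.
  intros H E. assert (E1 : ex (u + ZC n * T) = 1).
  { replace (ex (u + ZC n * T)) with (1 - (1 - ex (u + ZC n * T))) by ring. rewrite E. ring. }
  destruct (ex_eq_1 _ E1) as [m Hm]. apply (H (- n)%Z m).
  rewrite <- Hm, opp_IZR, RtoC_opp. unfold ZC. ring.
Qed.

Definition sD (D : nat) (tau ze : C) (n : Z) : C :=
  sq4 tau n * ((1 + ex (ze + ZC n * (RtoC (INR D) * tau))) / (1 - ex (ze + ZC n * (RtoC (INR D) * tau)))).

Lemma sq4_div_summable tau T u : (0 < Im tau)%R -> (0 < Im T)%R -> notlat T u ->
  summable (fun n => sq4 tau n / (1 - ex (u + ZC n * T))).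
Proof.
  intros Ht HT Hu. destruct (den_bound T u HT Hu) as [B HB]. destruct (sq4_summable tau Ht) as [M HM].
  assert (HB0 : (0 <= B)%R) by (eapply Rle_trans; [apply Cmod_ge_0|apply (HB 0%Z)]).
  apply (summable_le _ (fun n => (B * Cmod (sq4 tau n))%R) (B * M)).
  - intros n. unfold Cdiv. rewrite Cmod_mult, Rmult_comm. apply Rmult_le_compat_r; [apply Cmod_ge_0|]. apply HB.
  - apply rbound_scal; auto.
Qed.

Lemma sD_alt D tau ze n : notlat (RtoC (INR D) * tau) ze ->
  sD D tau ze n = -(1) * sq4 tau n + 2 * (sq4 tau n / (1 - ex (ze + ZC n * (RtoC (INR D) * tau)))).
Proof. intros H. unfold sD. field. apply pole_neq0. auto. Qed.

Lemma sD_summable D tau ze : (1 <= D)%nat -> (0 < Im tau)%R -> notlat (RtoC (INR D) * tau) ze -> summable (sD D tau ze).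
Proof.
  intros HD Ht Hz. eapply summable_ext; [intros n; symmetry; apply sD_alt; auto|].
  apply summable_plus; apply summable_scal; [apply sq4_summable; auto|].
  apply sq4_div_summable; auto. apply Im_Nat_pos; auto.
Qed.

(** With X = q^(D n), the two fractions add up to 2 (1 - z^2) / ((1 - z X) (1 - z / X)), and the
    prefactors (-1)^n q^(n^2) agree at n and - n. *)
Lemma sD_pair D tau ze n : notlat (RtoC (INR D) * tau) ze ->
  sD D tau ze (Z.of_nat n) + sD D tau ze (- Z.of_nat n) =
  (1 + ex ze) / (1 - ex ze) * (2 * rank_term D (ex ze) (ex tau) n).
Proof.
  intros Hz. assert (P1 := pole_neq0 _ _ (Z.of_nat n) Hz). assert (P2 := pole_neq0 _ _ (- Z.of_nat n)%Z Hz).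
  assert (P0 := pole_neq0 _ _ 0%Z Hz).
  unfold sD, rank_term, sq4.
  replace (RtoC (-1)) with (- (1)) by (apply C_eq; C_simpl; lra). rewrite m1_pow, !ex_pow.
  replace (RtoC (INR (n * n + D * n)) * tau) with (tau * (ZC (Z.of_nat n) * ZC (Z.of_nat n)) + RtoC (INR (D * n)) * tau).
  2:{ unfold ZC. rewrite <- INR_IZR_INZ, plus_INR, !mult_INR, RtoC_plus, !RtoC_mult. ring. }
  set (Q := RtoC (INR (D * n)) * tau).
  assert (EQ : ZC (Z.of_nat n) * (RtoC (INR D) * tau) = Q).
  { unfold Q, ZC. rewrite <- INR_IZR_INZ, mult_INR, RtoC_mult. ring. }
  replace (ZC (- Z.of_nat n) * (RtoC (INR D) * tau)) with (- Q) in * by (rewrite <- EQ, ZC_opp; ring).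
  rewrite EQ in *. rewrite !ex_plus in *. rewrite ex_opp in *.
  replace (ZC 0 * (RtoC (INR D) * tau)) with (RtoC 0) in P0 by (unfold ZC; ring). rewrite ex_0 in P0.
  replace (ex (ZC (- Z.of_nat n) / 2)) with (ex (RtoC (INR n) / 2)).
  2:{ apply (ex_eqZ _ _ (Z.of_nat n)). rewrite ZC_opp. unfold ZC. rewrite <- INR_IZR_INZ. field. }
  replace (ZC (Z.of_nat n) / 2) with (RtoC (INR n) / 2) by (unfold ZC; rewrite <- INR_IZR_INZ; auto).
  replace (tau * (ZC (- Z.of_nat n) * ZC (- Z.of_nat n))) with (tau * (ZC (Z.of_nat n) * ZC (Z.of_nat n))) by (rewrite ZC_opp; ring).
  set (g := ex (tau * (ZC (Z.of_nat n) * ZC (Z.of_nat n)))). set (m := ex (RtoC (INR n) / 2)).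
  assert (NQ := ex_neq0 Q). assert (Nz := ex_neq0 ze). set (z := ex ze) in *. set (X := ex Q) in *.
  assert (P2' : X - z <> 0).
  { intros E. apply P2. replace (1 - z * / X) with ((X - z) / X) by (field; auto). rewrite E. field. auto. }
  assert (P0' : 1 - z <> 0) by (intros E; apply P0; rewrite <- E; ring).
  field. repeat split; auto. intros E. apply P2'. replace (X - z) with (- (z - X)) by ring. rewrite E. ring.
Qed.

Lemma overrank_sD D tau ze : (1 <= D)%nat -> (0 < Im tau)%R -> notlat (RtoC (INR D) * tau) ze ->
  (1 + ex ze) / (1 - ex ze) * overrank D (ex ze) (ex tau) = Sum (sD D tau ze) / th4 tau.
Proof.
  intros HD Ht Hz.
  assert (HS := csum_Z_series _ _ (summable_csum _ (sD_summable D tau ze HD Ht Hz))).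
  destruct (th4_eq tau Ht) as [N4 E4]. unfold overrank. rewrite E4.
  assert (P0 := pole_neq0 _ _ 0%Z Hz).
  replace (ze + ZC 0 * (RtoC (INR D) * tau)) with ze in P0 by (unfold ZC; ring).
  assert (E0 : sD D tau ze 0 = (1 + ex ze) / (1 - ex ze)).
  { unfold sD, sq4. replace (ze + ZC 0 * (RtoC (INR D) * tau)) with ze by (unfold ZC; ring).
    replace (ZC 0 / 2 + tau * (ZC 0 * ZC 0)) with (RtoC 0) by (unfold ZC; field). rewrite ex_0. ring. }
  set (z := ex ze) in *.
  assert (HS' : is_series (V := C_NormedModule) (fun n => (1 + z) / (1 - z) * (2 * rank_term D z (ex tau) (S n))) (Sum (sD D tau ze) - sD D tau ze 0)).
  { eapply is_series_ext; [|exact HS]. intros n. cbv beta. apply sD_pair. auto. }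
  (* At z = -1 both sides vanish; for other z the rank series is recovered from the bilateral one on
     division by 1 + z. *)
  destruct (classic (1 + z = 0)) as [Z|Z].
  - assert (E : Sum (sD D tau ze) - sD D tau ze 0 = 0).
    { rewrite <- (CSeries_unique _ _ HS'). apply CSeries_unique. apply (csum_is_series (fun n => (1 + z) / (1 - z) * (2 * rank_term D z (ex tau) (S n))) 0).
      eapply csum_ext; [|apply csum_zero]. intros n. cbv beta. rewrite Z. unfold Cdiv. ring. }
    rewrite E0 in E. replace (Sum (sD D tau ze)) with (Sum (sD D tau ze) - (1 + z) / (1 - z) + (1 + z) / (1 - z)) by ring.
    rewrite E, Z. unfold Cdiv. ring.
  - assert (HS2 := is_series_scal (K := C_AbsRing) (V := C_NormedModule) ((1 - z) / (2 * (1 + z))) _ _ HS').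
    rewrite (CSeries_unique (fun n => rank_term D z (ex tau) (S n)) ((1 - z) / (2 * (1 + z)) * (Sum (sD D tau ze) - sD D tau ze 0))).
    + rewrite E0. field. auto.
    + eapply is_series_ext; [|exact HS2]. intros n. cbv beta.
      change ((1 - z) / (2 * (1 + z)) * ((1 + z) / (1 - z) * (2 * rank_term D z (ex tau) (S n))) = rank_term D z (ex tau) (S n)).
      field. auto.
Qed.

(** [appell_final] at s = lam - v: then v + s = lam and u + s = lam + u - v, so the Appell sum on
    the right sees u and v only through their difference. *)
Lemma Ap_transform T u v lam : (0 < Im T)%R -> notlat T u -> (0 < Im lam)%R -> (Im lam < Im T)%R -> jt T (lam + u - v) <> 0 ->
  Ap T u v = J3 T * jt T (lam - v) * jt T (u + lam) / (jt T u * jt T lam * jt T (lam + u - v)) +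
    ex lam * (ex (- v) * jt T v) * (Ap T lam (lam + u - v) / jt T (lam + u - v)).
Proof.
  intros HT Hu H1 H2 Hr.
  assert (N1 := jt_neq0 T u HT Hu). assert (N2 := jt_neq0 T lam HT (strip_notlat T lam H1 H2)).
  assert (E := appell_final T u v (lam - v) HT Hu).
  replace (v + (lam - v)) with lam in E by ring. specialize (E H1 H2).
  replace (lam - v + u) with (lam + u - v) in E by ring. replace (u + (lam - v)) with (lam + u - v) in E by ring.
  replace (ex (lam - v)) with (ex lam * ex (- v)) in E by (rewrite <- ex_plus; f_equal; ring).
  replace (Ap T u v) with (jt T (lam + u - v) * Ap T u v / jt T (lam + u - v)) by (field; auto).
  rewrite E. field. auto.
Qed.

(** * Splitting into residue classes *)

Lemma notlat_mult (M : nat) T u (k : Z) : notlat T u -> notlat (RtoC (INR M) * T) (u + ZC k * T).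
Proof.
  intros H m n E. apply (H (m * Z.of_nat M - k)%Z n).
  replace u with (u + ZC k * T - ZC k * T) by ring. rewrite E, minus_IZR, mult_IZR, <- INR_IZR_INZ, RtoC_minus, RtoC_mult.
  unfold ZC. ring.
Qed.

Lemma notlat_double T u : notlat (2 * T) (2 * u) -> notlat T u.
Proof. intros H m n E. apply (H m (2 * n)%Z). rewrite E, mult_IZR, RtoC_mult. ring. Qed.

(** Collects the coefficients of the common Appell quotient [r]; their total [s] decides whether it
    survives. *)
Lemma lsum_transform (c a b : nat -> C) (r s : C) l : lsum (fun k => c k * b k) l = s ->
  lsum (fun k => c k * (a k + b k * r)) l = lsum (fun k => c k * a k) l + s * r.
Proof.
  intros <-. induction l as [|x l IH]; simpl; [ring|]. rewrite IH. ring.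
Qed.

Lemma odd_sum_zero (d : nat) tau : Nat.Odd d -> (0 < Im tau)%R ->
  Sum (fun n => ex (ZC n / 2 + tau * (ZC n * (ZC n - RtoC (INR d))))) = 0.
Proof.
  intros [j Hj] Ht. set (f := fun n => ex (ZC n / 2 + tau * (ZC n * (ZC n - RtoC (INR d))))).
  assert (Hf : summable f).
  { apply (summable_ext (tj (2 * tau) (tau - RtoC (INR d) * tau))).
    - intros n. rewrite tj_alt. unfold f. f_equal. field.
    - apply tj_summable. rewrite (Im_scal 2). lra. }
  assert (E : Sum f = - (1) * Sum f).
  { rewrite <- (Sum_scal (- (1)) f Hf).
    rewrite <- (Sum_bij (fun n => Z.of_nat d - n)%Z (fun n => Z.of_nat d - n)%Z f); [|intros; lia|intros; lia|auto].
    apply Sum_ext. intros n. unfold f.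
    replace (- (1)) with (ex (1 / 2)) by (rewrite ex_half; apply C_eq; C_simpl; lra).
    rewrite <- ex_plus. apply (ex_eqZ _ _ (Z.of_nat j - n)%Z). rewrite !ZC_minus.
    replace (RtoC (INR d)) with (ZC (Z.of_nat d)) by (unfold ZC; rewrite <- INR_IZR_INZ; auto).
    subst d. replace (Z.of_nat (2 * j + 1)) with (2 * Z.of_nat j + 1)%Z by lia. rewrite ZC_plus, ZC_mult. unfold ZC. field. }
  assert (E2 : 2 * Sum f = 0).
  { replace (2 * Sum f) with (Sum f - - (1) * Sum f) by ring. rewrite <- E. ring. }
  replace (Sum f) with (2 * Sum f / 2) by field. rewrite E2. field.
Qed.

(** * The difference of the two ranks for odd d *)

Section OddCase.
Variables (d : nat) (tau ze lam : C).
Hypothesis Hd : Nat.Odd d.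
Hypothesis Ht : (0 < Im tau)%R.
Let T := RtoC (INR (2 * d * d)) * tau.
Hypothesis Hz : notlat (RtoC (INR (2 * d)) * tau) (2 * ze).
Hypothesis H1 : (0 < Im lam)%R.
Hypothesis H2 : (Im lam < Im T)%R.
Hypothesis Hr : jt T (lam + 2 * ze) <> 0.
(** Parameters for the residue k: with n = k + d m the denominators become 1 - e(u k + m T), and c k
    collects what does not depend on m. *)
Let v (k : nat) := RtoC (INR (2 * d * k)) * tau.
Let u (k : nat) := 2 * ze + RtoC (INR (2 * d * k)) * tau.
Let c (k : nat) := sq4 tau (Z.of_nat k) * ex (ze + RtoC (INR (d * k)) * tau).

Lemma odd_d1 : (1 <= d)%nat.
Proof. destruct Hd as [j Hj]. lia. Qed.

Lemma odd_T : (0 < Im T)%R.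
Proof. apply Im_Nat_pos; auto. assert (Q := odd_d1). nia. Qed.

Lemma odd_u k : notlat T (u k).
Proof.
  replace T with (RtoC (INR d) * (RtoC (INR (2 * d)) * tau)).
  - replace (u k) with (2 * ze + ZC (Z.of_nat k) * (RtoC (INR (2 * d)) * tau)); [apply notlat_mult; auto|].
    unfold u, ZC. rewrite <- INR_IZR_INZ, !mult_INR, !RtoC_mult. ring.
  - unfold T. rewrite !mult_INR, !RtoC_mult. ring.
Qed.

Lemma odd_ze : notlat (RtoC (INR d) * tau) ze.
Proof.
  apply notlat_double. replace (2 * (RtoC (INR d) * tau)) with (RtoC (INR (2 * d)) * tau); auto.
  rewrite mult_INR, RtoC_mult. simpl (INR 2). rewrite RtoC_plus. ring.
Qed.

(** Half the difference of the two rank summands: with w = z q^(d n), (1 + w) / (1 - w) - (1 + w^2)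
    / (1 - w^2) = 2 w / (1 - w^2). *)
Let F (n : Z) := sq4 tau n * ex (ze + ZC n * (RtoC (INR d) * tau)) / (1 - ex (2 * ze + ZC n * (RtoC (INR (2 * d)) * tau))).

Lemma odd_F n : 2 * F n = sD d tau ze n - sD (2 * d) tau (2 * ze) n.
Proof.
  unfold F, sD. assert (P1 := pole_neq0 _ _ n odd_ze). assert (P2 := pole_neq0 _ _ n Hz).
  replace (2 * ze + ZC n * (RtoC (INR (2 * d)) * tau)) with ((ze + ZC n * (RtoC (INR d) * tau)) + (ze + ZC n * (RtoC (INR d) * tau))) in *.
  2:{ rewrite mult_INR, RtoC_mult. simpl (INR 2). rewrite RtoC_plus. ring. }
  set (w := ze + ZC n * (RtoC (INR d) * tau)) in *. rewrite (ex_plus w w) in *. field. auto.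
Qed.

Lemma odd_F_csum : csum (fun n => 2 * F n) (Sum (sD d tau ze) - Sum (sD (2 * d) tau (2 * ze))) /\ summable F.
Proof.
  assert (Q := odd_d1).
  assert (S1 := sD_summable d tau ze Q Ht odd_ze). assert (S2 := sD_summable (2 * d) tau (2 * ze) ltac:(lia) Ht Hz).
  split.
  - eapply csum_ext; [intros n; symmetry; apply odd_F|]. apply csum_minus; apply summable_csum; auto.
  - apply (summable_ext (fun n => / 2 * (sD d tau ze n + - (1) * sD (2 * d) tau (2 * ze) n))).
    + intros n. replace (sD d tau ze n + - (1) * sD (2 * d) tau (2 * ze) n) with (2 * F n) by (rewrite odd_F; ring). field.
    + apply summable_scal, summable_plus; auto. apply summable_scal; auto.
Qed.

Lemma odd_formula : Sum (sD d tau ze) - Sum (sD (2 * d) tau (2 * ze)) =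
  2 * lsum (fun k => c k * (J3 T * jt T (lam - v k) * jt T (u k + lam) / (jt T (u k) * jt T lam * jt T (lam + 2 * ze)))) (seq 0 d).
Proof.
  destruct odd_F_csum as [F1 F2]. rewrite <- (csum_Sum _ _ F1), Sum_scal by auto. f_equal.
  assert (Q := odd_d1). destruct Hd as [j Hj].
  assert (EZ : forall k : nat, ZC (Z.of_nat k) = RtoC (INR k)) by (intros k; unfold ZC; rewrite <- INR_IZR_INZ; auto).
  assert (E2 : RtoC (INR 2) = 2) by (f_equal; simpl; lra).
  assert (Ed : RtoC (INR d) = 2 * RtoC (INR j) + 1).
  { rewrite Hj, plus_INR, mult_INR, RtoC_plus, RtoC_mult, E2. auto. }
  rewrite (Sum_split d) by auto.
  rewrite (lsum_ext _ (fun k => c k * (J3 T * jt T (lam - v k) * jt T (u k + lam) / (jt T (u k) * jt T lam * jt T (lam + 2 * ze))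
     + (ex lam * (ex (- v k) * jt T (v k))) * (Ap T lam (lam + 2 * ze) / jt T (lam + 2 * ze))))).
  - rewrite (lsum_transform c _ _ _ 0); [ring|].
    (* With the residue classes put together again, the coefficient of the Appell sum at lam is the
       full sum over n treated by [odd_sum_zero]. *)
    transitivity (ex (lam + ze) * lsum (fun k => Sum (fun m => ex (ZC (Z.of_nat k + Z.of_nat d * m) / 2 + tau * (ZC (Z.of_nat k + Z.of_nat d * m) * (ZC (Z.of_nat k + Z.of_nat d * m) - RtoC (INR d)))))) (seq 0 d)).
    + rewrite <- lsum_scal. apply lsum_ext. intros k _.
      transitivity (c k * (ex lam * ex (- v k)) * jt T (v k)); [ring|].
      unfold jt. rewrite <- Sum_scal by (apply tj_summable; apply odd_T). rewrite <- Sum_scal.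
      * apply Sum_ext. intros m. rewrite tj_alt. unfold c, sq4. rewrite <- !ex_plus. unfold v, T.
        (* Since d = 2 j + 1, the signs (-1)^(d m) and (-1)^m agree: their half-integral phases
           differ by the integer j m. *)
        apply (ex_eqZ _ _ (- (Z.of_nat j * m))%Z). zc. rewrite !EZ, !mult_INR, !RtoC_mult.
        rewrite Ed, E2. field.
      * apply (summable_inj (fun m => (Z.of_nat k + Z.of_nat d * m)%Z) (fun n => ex (ZC n / 2 + tau * (ZC n * (ZC n - RtoC (INR d)))))).
        -- intros x y E. apply (Z.mul_reg_l _ _ (Z.of_nat d)); lia.
        -- apply (summable_ext (tj (2 * tau) (tau - RtoC (INR d) * tau))).
           ++ intros n. rewrite tj_alt. f_equal. field.
           ++ apply tj_summable. rewrite (Im_scal 2). lra.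
    + rewrite <- (Sum_split d (fun n => ex (ZC n / 2 + tau * (ZC n * (ZC n - RtoC (INR d)))))), odd_sum_zero; auto.
      * ring.
      * apply (summable_ext (tj (2 * tau) (tau - RtoC (INR d) * tau))).
        -- intros n. rewrite tj_alt. f_equal. field.
        -- apply tj_summable. rewrite (Im_scal 2). lra.
  - intros k _.
    assert (Euv : lam + u k - v k = lam + 2 * ze) by (unfold u, v; ring).
    rewrite <- Euv, <- (Ap_transform T (u k) (v k) lam); [|apply odd_T|apply odd_u|auto|auto|rewrite Euv; auto].
    unfold Ap. rewrite <- Sum_scal by (apply At_summable; [apply odd_T|apply odd_u]).
    apply Sum_ext. intros m. unfold At, F.
    replace (2 * ze + ZC (Z.of_nat k + Z.of_nat d * m) * (RtoC (INR (2 * d)) * tau)) with (u k + ZC m * T).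
    2:{ unfold u, T. zc. rewrite !EZ, !mult_INR, !RtoC_mult. ring. }
    unfold Cdiv. rewrite (Cmult_assoc (c k)). f_equal. rewrite ta_alt. unfold c, sq4. rewrite <- !ex_plus.
    apply (ex_eqZ _ _ (Z.of_nat j * m)%Z). unfold v, T. zc. rewrite !EZ, !mult_INR, !RtoC_mult.
    rewrite Ed, E2. field.
Qed.
End OddCase.

(** * A single rank for even d *)

Section EvenCase.
Variables (e : nat) (tau ze lam : C).
Hypothesis He : (1 <= e)%nat.
Hypothesis Ht : (0 < Im tau)%R.
Let T := RtoC (INR (2 * e * e)) * tau.
Let rho := ze - RtoC (INR (e + 1)) / 2 + T / 2.
Hypothesis Hz : notlat (RtoC (INR (2 * e)) * tau) ze.
Hypothesis H1 : (0 < Im lam)%R.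
Hypothesis H2 : (Im lam < Im T)%R.
Hypothesis Hr : jt T (lam + rho) <> 0.
(** The term (e + 1) / 2 turns the sign (-1)^m of the Appell sum into (-1)^(e m), and - T / 2
    replaces m (m + 1) / 2 by m^2 / 2, as the summand at n = k + e m requires. *)
Let v (k : nat) := RtoC (INR (e + 1)) / 2 + RtoC (INR (2 * e * k)) * tau - T / 2.
Let u (k : nat) := ze + RtoC (INR (2 * e * k)) * tau.

Lemma even_T : (0 < Im T)%R.
Proof. apply Im_Nat_pos; auto. nia. Qed.

Lemma even_u k : notlat T (u k).
Proof.
  replace T with (RtoC (INR e) * (RtoC (INR (2 * e)) * tau)).
  - replace (u k) with (ze + ZC (Z.of_nat k) * (RtoC (INR (2 * e)) * tau)); [apply notlat_mult; auto|].
    unfold u, ZC. rewrite <- INR_IZR_INZ, !mult_INR, !RtoC_mult. ring.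
  - unfold T. rewrite !mult_INR, !RtoC_mult. ring.
Qed.

(** The constant comes from (1 + w) / (1 - w) = -1 + 2 / (1 - w). The total coefficient of the
    Appell sum at lam is - e(lam) theta_4, so after division by theta_4 this part depends on T, rho
    and lam only. *)
Lemma even_formula : Sum (sD (2 * e) tau ze) / th4 tau =
  - (1) - 2 * ex lam * (Ap T lam (lam + rho) / jt T (lam + rho)) +
  2 * lsum (fun k => sq4 tau (Z.of_nat k) * (J3 T * jt T (lam - v k) * jt T (u k + lam) / (jt T (u k) * jt T lam * jt T (lam + rho)))) (seq 0 e) / th4 tau.
Proof.
  assert (EZ : forall k : nat, ZC (Z.of_nat k) = RtoC (INR k)) by (intros k; unfold ZC; rewrite <- INR_IZR_INZ; auto).
  assert (E2 : RtoC (INR 2) = 2) by (f_equal; simpl; lra). assert (E1 : RtoC (INR 1) = 1) by (f_equal; simpl; lra).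
  destruct (th4_eq tau Ht) as [N4 _].
  set (S0 := lsum (fun k => sq4 tau (Z.of_nat k) * (J3 T * jt T (lam - v k) * jt T (u k + lam) / (jt T (u k) * jt T lam * jt T (lam + rho)))) (seq 0 e)).
  set (R := Ap T lam (lam + rho) / jt T (lam + rho)).
  set (G := fun n => sq4 tau n / (1 - ex (ze + ZC n * (RtoC (INR (2 * e)) * tau)))).
  assert (HG : summable G) by (apply sq4_div_summable; auto; apply Im_Nat_pos; auto; lia).
  assert (ES : Sum (sD (2 * e) tau ze) = - th4 tau + 2 * Sum G).
  { rewrite (Sum_ext _ _ (fun n => sD_alt (2 * e) tau ze n Hz)).
    rewrite Sum_plus; [|apply summable_scal, sq4_summable; auto|apply summable_scal; exact HG].
    rewrite !Sum_scal; [|exact HG|apply sq4_summable; auto]. rewrite th4_sq4. fold G. ring. }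
  assert (EG : Sum G = S0 + ex lam * - th4 tau * R).
  { rewrite (Sum_split e) by auto.
    rewrite (lsum_ext _ (fun k => sq4 tau (Z.of_nat k) * (J3 T * jt T (lam - v k) * jt T (u k + lam) / (jt T (u k) * jt T lam * jt T (lam + rho))
     + (ex lam * (ex (- v k) * jt T (v k))) * R))).
    - rewrite (lsum_transform (fun k => sq4 tau (Z.of_nat k)) _ _ _ (ex lam * - th4 tau)); [auto|].
      rewrite th4_sq4, (Sum_split e) by (auto; apply sq4_summable; auto).
      replace (ex lam * - lsum (fun k => Sum (fun m => sq4 tau (Z.of_nat k + Z.of_nat e * m))) (seq 0 e))
        with ((- ex lam) * lsum (fun k => Sum (fun m => sq4 tau (Z.of_nat k + Z.of_nat e * m))) (seq 0 e)) by ring.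
      rewrite <- lsum_scal. apply lsum_ext. intros k _.
      transitivity ((- ex lam) * (sq4 tau (Z.of_nat k) * (- ex (- v k) * jt T (v k)))); [ring|]. f_equal.
      rewrite <- jt_plus_tau by apply even_T. unfold jt. rewrite <- Sum_scal by (apply tj_summable, even_T).
      apply Sum_ext. intros m. fold (ta T (v k) m). rewrite ta_alt. unfold sq4. rewrite <- ex_plus.
      apply (ex_eqZ _ _ m). unfold v, T. zc. rewrite !EZ, !plus_INR, !mult_INR, !RtoC_plus, !RtoC_mult.
      rewrite E2, E1. field.
    - intros k _.
      assert (Euv : lam + u k - v k = lam + rho) by (unfold u, v, rho; ring).
      unfold R. rewrite <- Euv, <- (Ap_transform T (u k) (v k) lam); [|apply even_T|apply even_u|auto|auto|rewrite Euv; auto].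
      unfold Ap. rewrite <- Sum_scal by (apply At_summable; [apply even_T|apply even_u]).
      apply Sum_ext. intros m. unfold At, G.
      replace (ze + ZC (Z.of_nat k + Z.of_nat e * m) * (RtoC (INR (2 * e)) * tau)) with (u k + ZC m * T).
      2:{ unfold u, T. zc. rewrite !EZ, !mult_INR, !RtoC_mult. ring. }
      unfold Cdiv. rewrite (Cmult_assoc (sq4 tau (Z.of_nat k))). f_equal. rewrite ta_alt. unfold sq4. rewrite <- !ex_plus.
      apply (ex_eqZ _ _ (- m)%Z). unfold v, T. zc. rewrite !EZ, !plus_INR, !mult_INR, !RtoC_plus, !RtoC_mult.
      rewrite E2, E1. field. }
  rewrite ES, EG. field. auto.
Qed.
End EvenCase.

(** * Modularity of the rank differences *)

Lemma rat_mult x y : rat x -> rat y -> rat (x * y).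
Proof.
  intros [L [HL [u Hu]]] [L' [HL' [v Hv]]]. exists (L * L')%nat. split; [nia|]. exists (u * v)%Z.
  rewrite mult_INR, mult_IZR, <- Hu, <- Hv. ring.
Qed.

Lemma rat_div_nat x n : (1 <= n)%nat -> rat x -> rat (x / INR n).
Proof.
  intros Hn Hx. apply rat_mult; auto. replace (/ INR n)%R with (IZR 1 / INR n)%R by (unfold Rdiv; ring).
  apply rat_div; auto.
Qed.

Lemma rat_nat n : rat (INR n).
Proof. rewrite INR_IZR_INZ. apply rat_int. Qed.

Lemma isint_lin x (m n : Z) : isint x -> isint (IZR m * x + IZR n).
Proof. intros [u ->]. exists (m * u + n)%Z. rewrite plus_IZR, mult_IZR. auto. Qed.

Lemma half_int_phase al be : be = (1 / 2)%R -> ~ (isint al /\ isint be).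
Proof. intros -> [_ H]. apply half_not_int. auto. Qed.

(** Stated at tau / n2 to cover both ranks: (M, n2) = (e, 1) and (2 e, 4) share N = 2 e^2. The
    condition on m gives [sig] the second characteristic 1/2, so that its theta has no zeros, and
    allows the same lam and sig in both uses. *)
Lemma even_half (M N n2 : nat) (B X m : R) : (1 <= M)%nat -> (1 <= n2)%nat -> (n2 * N = 2 * M * M * 1)%nat ->
  rat B -> rat X -> (m + X - INR (M + 1) / 2 = 1 / 2)%R ->
  ~ (isint (B * INR n2 / INR (2 * M)) /\ isint X) ->
  exists g, WP N 1 g /\ forall tau, (0 < Im tau)%R ->
    let T := RtoC (INR N) * tau in let ze := RtoC B * tau + RtoC X in
    let lam := RtoC (1 / 2) * T + RtoC m in let sig := RtoC (1 + B / INR N) * T + RtoC (1 / 2) in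
    let p := ex (RtoC (- (B * B / (2 * INR N))) * tau) in
    p * ((1 + ex ze) / (1 - ex ze) * overrank (2 * M) (ex ze) (ex (RtoC (INR 1 / INR n2) * tau))) =
    p * (- (1) - 2 * ex lam * (Ap T lam sig / jt T sig)) + g tau.
Proof.
  intros HM Hn2 HN HB HX Hm Hn.
  assert (HN1 : (1 <= N)%nat) by nia.
  assert (FM : INR M <> 0%R) by (apply not_0_INR; lia). assert (FN : INR N <> 0%R) by (apply not_0_INR; lia).
  assert (F2 : INR n2 <> 0%R) by (apply not_0_INR; lia).
  assert (I2 : INR 2 = 2%R) by (simpl; lra). assert (I1 : INR 1 = 1%R) by (simpl; lra).
  assert (EN : INR N = (2 * INR M * INR M / INR n2)%R).
  { apply (f_equal INR) in HN. rewrite !mult_INR, I2, I1 in HN. apply (Rmult_eq_reg_l (INR n2)); auto. rewrite HN. field. auto. }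
  (* Coordinates relative to T of the points in [even_formula]: u k = x1 k T + X and v k = y1 k T +
     y2. *)
  set (x1 := fun k : nat => ((B + 2 * INR M * INR k / INR n2) / INR N)%R).
  set (y1 := fun k : nat => (INR k / INR M - 1 / 2)%R).
  set (y2 := (INR (M + 1) / 2)%R).
  assert (Hxy : forall k, (x1 k - y1 k = 1 / 2 + B / INR N)%R).
  { intros k. unfold x1, y1. rewrite EN. field. auto. }
  assert (Hy2 : rat y2) by (exact (rat_div_nat (INR (M + 1)) 2 ltac:(lia) (rat_nat _))).
  assert (Rm : rat m).
  { replace m with (1 / 2 - X + y2)%R by (unfold y2; lra). apply rat_plus; auto. apply rat_minus; auto. apply rat_half. }
  assert (Nx : forall k, ~ (isint (x1 k) /\ isint X)).
  { intros k [Q1 Q2]. apply Hn. split; auto.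
    replace (B * INR n2 / INR (2 * M))%R with (IZR (Z.of_nat M) * x1 k + IZR (- Z.of_nat k))%R.
    - apply isint_lin. auto.
    - unfold x1. rewrite opp_IZR, <- !INR_IZR_INZ, EN, mult_INR, I2. field. auto. }
  set (Tq := fun k tau => let T := RtoC (INR N) * tau in
    ex (RtoC (x1 k * y1 k + x1 k / 2 - x1 k * x1 k / 2) * T) *
    (J3 T * jt T (RtoC (1 / 2 - y1 k) * T + RtoC (m - y2)) * jt T (RtoC (x1 k + 1 / 2) * T + RtoC (X + m))) /
    (jt T (RtoC (x1 k) * T + RtoC X) * jt T (RtoC (1 / 2) * T + RtoC m) * jt T (RtoC (1 / 2 + x1 k - y1 k) * T + RtoC (m + X - y2)))).
  assert (WT : forall k, WP N 2 (Tq k)).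
  { intros k. apply theta_quotient_WP; auto.
    - apply rat_div_nat; auto. apply rat_plus; auto. apply rat_div_nat; auto. repeat apply rat_mult; try apply rat_nat. apply (rat_int 2).
    - apply rat_minus; [apply rat_div_nat; auto; apply rat_nat|apply rat_half].
    - apply rat_half.
    - intros [Q _]. apply half_not_int. auto.
    - apply half_int_phase. unfold y2. lra. }
  exists (fun tau => 2 * lsum (fun k => ex (RtoC (INR k / 2)) * Tq k tau) (seq 0 M) / th4 (RtoC (INR 1 / INR n2) * tau)).
  split.
  { apply (WP_div N 1 1).
    - apply WP_scal. apply (WP_lsum N 2 (fun k tau => ex (RtoC (INR k / 2)) * Tq k tau)). intros k _. apply WP_scal. apply WT.
    - apply (th4_WI M N 1 n2); auto. }
  intros tau Ht. cbv zeta.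
  set (t := RtoC (INR 1 / INR n2) * tau).
  assert (Hr : (0 < INR 1 / INR n2)%R) by (apply Rdiv_lt_0_compat; apply lt_0_INR; lia).
  assert (Htt : (0 < Im t)%R) by (unfold t; rewrite Im_scal; apply Rmult_lt_0_compat; auto).
  assert (HTt : RtoC (INR (2 * M * M)) * t = RtoC (INR N) * tau).
  { unfold t. rewrite Cmult_assoc, <- RtoC_mult. do 2 f_equal. rewrite EN, !mult_INR, I2, I1. field. auto. }
  assert (HT : (0 < Im (RtoC (INR N) * tau))%R) by (apply Im_Nat_pos; auto).
  assert (Hze : notlat (RtoC (INR (2 * M)) * t) (RtoC B * tau + RtoC X)).
  { replace (RtoC B * tau) with (RtoC (B * INR n2 / INR (2 * M)) * (RtoC (INR (2 * M)) * t)).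
    - apply jt_int; auto. apply Im_Nat_pos; auto. lia.
    - unfold t. rewrite !Cmult_assoc, <- !RtoC_mult. do 2 f_equal. rewrite mult_INR, I2, I1. field. auto. }
  rewrite overrank_sD by (auto; lia).
  set (T := RtoC (INR N) * tau) in *. set (lam := RtoC (1 / 2) * T + RtoC m).
  assert (Elam : Im lam = (Im T / 2)%R) by (unfold lam; rewrite Im_plus, Im_scal, Im_RtoC; lra).
  assert (Esig : lam + (RtoC B * tau + RtoC X - RtoC (INR (M + 1)) / 2 + T / 2) = RtoC (1 + B / INR N) * T + RtoC (1 / 2)).
  { unfold lam. replace m with (1 / 2 - X + INR (M + 1) / 2)%R by lra.
    rewrite RtoC_plus, RtoC_minus, !RtoC_div by lra.
    replace (RtoC (1 + B / INR N) * T) with (T + RtoC B * tau).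
    2:{ unfold T. rewrite RtoC_plus, RtoC_div by auto. field. apply RtoC_neq0. auto. }
    field. }
  assert (Hsig : jt T (RtoC (1 + B / INR N) * T + RtoC (1 / 2)) <> 0).
  { apply jt_neq0; auto. apply jt_int; auto. apply half_int_phase. auto. }
  assert (E := even_formula M t (RtoC B * tau + RtoC X) lam HM Htt Hze). rewrite HTt, Esig in E.
  rewrite E; auto; try lra. clear E.
  rewrite Cmult_plus_distr_l. f_equal.
  set (W := fun k : nat => J3 T * jt T (lam - (RtoC (INR (M + 1)) / 2 + RtoC (INR (2 * M * k)) * t - T / 2)) *
     jt T (RtoC B * tau + RtoC X + RtoC (INR (2 * M * k)) * t + lam) /
     (jt T (RtoC B * tau + RtoC X + RtoC (INR (2 * M * k)) * t) * jt T lam * jt T (RtoC (1 + B / INR N) * T + RtoC (1 / 2)))).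
  transitivity (ex (RtoC (- (B * B / (2 * INR N))) * tau) * (2 * lsum (fun k => sq4 t (Z.of_nat k) * W k) (seq 0 M) / th4 t)); [reflexivity|].
  transitivity (2 * (ex (RtoC (- (B * B / (2 * INR N))) * tau) * lsum (fun k => sq4 t (Z.of_nat k) * W k) (seq 0 M)) / th4 t).
  { unfold Cdiv. ring. }
  do 2 f_equal. rewrite <- lsum_scal. apply lsum_ext. intros k _. rewrite Cmult_assoc.
  (* Completing the square: as x1 - y1 = 1/2 + B / N, the exponent from [theta_quotient_WP] equals
     (x1 - B / N)^2 / 2 - B^2 / (2 N^2). The first part is the exponent in theta_4, the second is
     the origin of p. *)
  replace (ex (RtoC (- (B * B / (2 * INR N))) * tau) * sq4 t (Z.of_nat k))
    with (ex (RtoC (INR k / 2)) * ex (RtoC (x1 k * y1 k + x1 k / 2 - x1 k * x1 k / 2) * T)).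
  2:{ unfold sq4. rewrite <- !ex_plus. f_equal. unfold ZC. rewrite <- INR_IZR_INZ. unfold T, t.
      transitivity (RtoC (INR k / 2) + RtoC ((x1 k * y1 k + x1 k / 2 - x1 k * x1 k / 2) * INR N) * tau); [rewrite (RtoC_mult _ (INR N)); ring|].
      transitivity (RtoC (INR k / 2) + RtoC (- (B * B / (2 * INR N)) + INR 1 / INR n2 * (INR k * INR k)) * tau).
      - do 3 f_equal. unfold x1, y1. rewrite EN, I1. field. auto.
      - rewrite RtoC_plus, !RtoC_mult, (RtoC_div (INR k) 2) by lra. ring. }
  unfold Tq. cbv zeta. fold T. rewrite <- Cmult_assoc. f_equal. unfold W.
  assert (Eu : RtoC B * tau + RtoC X + RtoC (INR (2 * M * k)) * t = RtoC (x1 k) * T + RtoC X).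
  { transitivity (RtoC (x1 k * INR N) * tau + RtoC X); [|unfold T; rewrite RtoC_mult; ring].
    transitivity (RtoC (B + INR (2 * M * k) * (INR 1 / INR n2)) * tau + RtoC X); [unfold t; rewrite RtoC_plus, RtoC_mult; ring|].
    do 3 f_equal. unfold x1. rewrite !mult_INR, I2, I1. field. auto. }
  assert (Ev : RtoC (INR (M + 1)) / 2 + RtoC (INR (2 * M * k)) * t - T / 2 = RtoC (y1 k) * T + RtoC y2).
  { transitivity (RtoC (y1 k * INR N) * tau + RtoC y2); [|unfold T; rewrite RtoC_mult; ring].
    transitivity (RtoC (INR (2 * M * k) * (INR 1 / INR n2) - INR N / 2) * tau + RtoC y2).
    - unfold t, T, y2. rewrite RtoC_minus, RtoC_mult, !RtoC_div by (auto; lra). field. apply RtoC_neq0. auto.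
    - do 3 f_equal. unfold y1. rewrite !mult_INR, I2, I1, EN. field. auto. }
  rewrite Eu, Ev.
  replace (lam - (RtoC (y1 k) * T + RtoC y2)) with (RtoC (1 / 2 - y1 k) * T + RtoC (m - y2)) by (unfold lam; rewrite !RtoC_minus; ring).
  replace (RtoC (x1 k) * T + RtoC X + lam) with (RtoC (x1 k + 1 / 2) * T + RtoC (X + m)) by (unfold lam; rewrite !RtoC_plus; ring).
  replace (1 / 2 + x1 k - y1 k)%R with (1 + B / INR N)%R by (assert (Q := Hxy k); lra).
  replace (m + X - y2)%R with (1 / 2)%R by (unfold y2; lra).
  fold lam. unfold Cdiv. ring.
Qed.

(** The assumption on B and X keeps 2 ze off the poles of the rank of index 2 d; by [notlat_double]
    this also keeps ze off those of the other rank. *)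
Lemma odd_WP (d : nat) (B X : R) : Nat.Odd d -> rat B -> rat X -> ~ (isint (B / INR d) /\ isint (2 * X)) ->
  WP (2 * d * d) 1 (fun tau => let ze := RtoC B * tau + RtoC X in
    ex (RtoC (- (B * B / (INR d * INR d))) * tau) *
    ((1 + ex ze) / (1 - ex ze) * overrank d (ex ze) (ex tau) -
     (1 + ex (2 * ze)) / (1 - ex (2 * ze)) * overrank (2 * d) (ex (2 * ze)) (ex tau))).
Proof.
  intros Hd HB HX Hn.
  assert (Hd1 : (1 <= d)%nat) by (destruct Hd; lia).
  set (N := (2 * d * d)%nat). assert (HN : (1 <= N)%nat) by (unfold N; nia).
  assert (Fd : INR d <> 0%R) by (apply not_0_INR; lia).
  assert (I2 : INR 2 = 2%R) by (simpl; lra). assert (I1 : INR 1 = 1%R) by (simpl; lra).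
  assert (EN : INR N = (2 * INR d * INR d)%R) by (unfold N; rewrite !mult_INR, I2; auto).
  (* Cancels 2 X, so that lam + 2 ze has second characteristic 1/2 and its theta no zeros. *)
  set (m := (1 / 2 - 2 * X)%R).
  set (x1 := fun k : nat => ((B + INR d * INR k) / INR d / INR d)%R).
  set (y1 := fun k : nat => (INR k / INR d)%R).
  assert (Hxy : forall k, (x1 k - y1 k = B / INR d / INR d)%R).
  { intros k. unfold x1, y1. field. auto. }
  assert (R2X : rat (2 * X)) by (apply rat_mult; auto; apply (rat_int 2)).
  assert (Rm : rat m) by (apply rat_minus; auto; apply rat_half).
  assert (Nx : forall k, ~ (isint (x1 k) /\ isint (2 * X))).
  { intros k [Q1 Q2]. apply Hn. split; auto.
    replace (B / INR d)%R with (IZR (Z.of_nat d) * x1 k + IZR (- Z.of_nat k))%R.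
    - apply isint_lin. auto.
    - unfold x1. rewrite opp_IZR, <- !INR_IZR_INZ. field. auto. }
  set (Tq := fun k tau => let T := RtoC (INR N) * tau in
    ex (RtoC (x1 k * y1 k + x1 k / 2 - x1 k * x1 k / 2) * T) *
    (J3 T * jt T (RtoC (1 / 2 - y1 k) * T + RtoC (m - 0)) * jt T (RtoC (x1 k + 1 / 2) * T + RtoC (2 * X + m))) /
    (jt T (RtoC (x1 k) * T + RtoC (2 * X)) * jt T (RtoC (1 / 2) * T + RtoC m) * jt T (RtoC (1 / 2 + x1 k - y1 k) * T + RtoC (m + 2 * X - 0)))).
  assert (WT : forall k, WP N 2 (Tq k)).
  { intros k. apply theta_quotient_WP; auto.
    - repeat apply rat_div_nat; auto. apply rat_plus; auto. apply rat_mult; apply rat_nat.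
    - apply rat_div_nat; auto; apply rat_nat.
    - apply (rat_int 0).
    - apply rat_half.
    - intros [Q _]. apply half_not_int. auto.
    - apply half_int_phase. unfold m. lra. }
  apply (WP_ext N 1 (fun tau => 2 * lsum (fun k => ex (RtoC (INR k / 2 + X)) * Tq k tau) (seq 0 d) / th4 (RtoC (INR 1 / INR 1) * tau))).
  2:{ apply (WP_div N 1 1).
    - apply WP_scal. apply (WP_lsum N 2 (fun k tau => ex (RtoC (INR k / 2 + X)) * Tq k tau)). intros k _. apply WP_scal. apply WT.
    - apply (th4_WI d N 1 1); auto. unfold N. lia. }
  intros tau Ht. cbv zeta.
  replace (RtoC (INR 1 / INR 1) * tau) with tau by (rewrite I1; replace (1 / 1)%R with 1%R by field; ring).
  set (ze := RtoC B * tau + RtoC X).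
  assert (HT : (0 < Im (RtoC (INR N) * tau))%R) by (apply Im_Nat_pos; auto).
  assert (Hz : notlat (RtoC (INR (2 * d)) * tau) (2 * ze)).
  { replace (2 * ze) with (RtoC (B / INR d) * (RtoC (INR (2 * d)) * tau) + RtoC (2 * X)).
    - apply jt_int; auto. apply Im_Nat_pos; auto. lia.
    - unfold ze. rewrite mult_INR, I2, RtoC_div, !RtoC_mult by auto. field. apply RtoC_neq0. auto. }
  assert (Hz1 : notlat (RtoC (INR d) * tau) ze).
  { apply notlat_double. replace (2 * (RtoC (INR d) * tau)) with (RtoC (INR (2 * d)) * tau); auto.
    rewrite mult_INR, I2, RtoC_mult. ring. }
  rewrite (overrank_sD d), (overrank_sD (2 * d)) by (auto; lia).
  set (T := RtoC (INR N) * tau) in *. set (lam := RtoC (1 / 2) * T + RtoC m).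
  assert (Elam : Im lam = (Im T / 2)%R) by (unfold lam; rewrite Im_plus, Im_scal, Im_RtoC; lra).
  assert (Esig : lam + 2 * ze = RtoC (1 / 2 + B / INR d / INR d) * T + RtoC (1 / 2)).
  { unfold lam, ze, m. replace (RtoC (1 / 2 + B / INR d / INR d) * T) with (RtoC (1 / 2) * T + 2 * (RtoC B * tau)).
    - rewrite (RtoC_minus (1 / 2)), (RtoC_mult 2 X). ring.
    - unfold T. rewrite EN, RtoC_plus. rewrite (RtoC_div (B / INR d)), (RtoC_div B), !RtoC_mult by auto. field. apply RtoC_neq0. auto. }
  assert (Hsig : jt T (lam + 2 * ze) <> 0).
  { rewrite Esig. apply jt_neq0; auto. apply jt_int; auto. apply half_int_phase. auto. }
  destruct (th4_eq tau Ht) as [N4 _].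
  assert (E := odd_formula d tau ze lam Hd Ht Hz). fold N in E. fold T in E.
  replace (Sum (sD d tau ze) / th4 tau - Sum (sD (2 * d) tau (2 * ze)) / th4 tau)
    with ((Sum (sD d tau ze) - Sum (sD (2 * d) tau (2 * ze))) / th4 tau) by (field; auto).
  rewrite E; auto; try lra. clear E.
  set (W := fun k : nat => J3 T * jt T (lam - RtoC (INR (2 * d * k)) * tau) *
     jt T (2 * ze + RtoC (INR (2 * d * k)) * tau + lam) /
     (jt T (2 * ze + RtoC (INR (2 * d * k)) * tau) * jt T lam * jt T (lam + 2 * ze))).
  transitivity (ex (RtoC (- (B * B / (INR d * INR d))) * tau) * (2 * lsum (fun k => sq4 tau (Z.of_nat k) * ex (ze + RtoC (INR (d * k)) * tau) * W k) (seq 0 d) / th4 tau)); [|reflexivity].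
  transitivity (2 * (ex (RtoC (- (B * B / (INR d * INR d))) * tau) * lsum (fun k => sq4 tau (Z.of_nat k) * ex (ze + RtoC (INR (d * k)) * tau) * W k) (seq 0 d)) / th4 tau).
  2:{ unfold Cdiv. ring. }
  do 2 f_equal. rewrite <- lsum_scal. apply lsum_ext. intros k _.
  rewrite (Cmult_assoc _ _ (W k)).
  (* As x1 - y1 = B / d^2, completing the square and multiplying by N gives k^2 - B^2 / d^2, while
     x1 / 2 accounts for the part of ze + d k tau proportional to tau. *)
  replace (ex (RtoC (- (B * B / (INR d * INR d))) * tau) * (sq4 tau (Z.of_nat k) * ex (ze + RtoC (INR (d * k)) * tau)))
    with (ex (RtoC (INR k / 2 + X)) * ex (RtoC (x1 k * y1 k + x1 k / 2 - x1 k * x1 k / 2) * T)).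
  2:{ unfold sq4. rewrite <- !ex_plus. f_equal. unfold ZC. rewrite <- INR_IZR_INZ. unfold T, ze.
      transitivity (RtoC (INR k / 2 + X) + RtoC ((x1 k * y1 k + x1 k / 2 - x1 k * x1 k / 2) * INR N) * tau); [rewrite (RtoC_mult _ (INR N)); ring|].
      transitivity (RtoC (INR k / 2 + X) + RtoC (- (B * B / (INR d * INR d)) + INR k * INR k + B + INR d * INR k) * tau).
      - do 3 f_equal. unfold x1, y1. rewrite EN. field. auto.
      - rewrite !RtoC_plus, mult_INR, !RtoC_mult, (RtoC_div (INR k) 2) by lra. ring. }
  unfold Tq. cbv zeta. fold T. unfold W.
  assert (Ev : RtoC (INR (2 * d * k)) * tau = RtoC (y1 k) * T).
  { transitivity (RtoC (y1 k * INR N) * tau); [|unfold T; rewrite RtoC_mult; ring].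
    do 2 f_equal. unfold y1. rewrite !mult_INR, I2, EN. field. auto. }
  rewrite Ev.
  replace (2 * ze + RtoC (y1 k) * T) with (RtoC (x1 k) * T + RtoC (2 * X)).
  2:{ replace (x1 k) with (y1 k + B / INR d / INR d)%R by (assert (Q := Hxy k); lra).
      replace (2 * ze) with (lam + 2 * ze - lam) by ring. rewrite Esig. unfold lam, m.
      rewrite !RtoC_plus, !RtoC_minus. ring. }
  rewrite Esig.
  replace (lam - RtoC (y1 k) * T) with (RtoC (1 / 2 - y1 k) * T + RtoC (m - 0)) by (unfold lam; rewrite !RtoC_minus; ring).
  replace (RtoC (x1 k) * T + RtoC (2 * X) + lam) with (RtoC (x1 k + 1 / 2) * T + RtoC (2 * X + m)) by (unfold lam; rewrite !RtoC_plus; ring).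
  replace (1 / 2 + x1 k - y1 k)%R with (1 / 2 + B / INR d / INR d)%R by (assert (Q := Hxy k); lra).
  replace (m + 2 * X - 0)%R with (1 / 2)%R by (unfold m; lra).
  fold lam. unfold Cdiv. ring.
Qed.

(** Both ranks are instances of [even_half] with the same lam, sig and prefactor p, so their Appell
    terms cancel in the difference; adding e / 2 to ze multiplies z by (-1)^e. *)
Lemma even_WP (e : nat) (B X : R) : (1 <= e)%nat -> rat B -> rat X -> ~ (isint (B / INR e) /\ isint (2 * X)) ->
  WP (2 * e * e) 1 (fun tau => let ze := RtoC B * tau + RtoC X in let ze' := ze + RtoC (INR e / 2) in
    ex (RtoC (- (B * B / (INR (2 * e) * INR (2 * e)))) * tau) *
    ((1 + ex ze) / (1 - ex ze) * overrank (2 * e) (ex ze) (ex tau) -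
     (1 + ex ze') / (1 - ex ze') * overrank (2 * (2 * e)) (ex ze') (ex (RtoC (1 / 4) * tau)))).
Proof.
  intros He HB HX Hn.
  assert (Fe : INR e <> 0%R) by (apply not_0_INR; lia).
  assert (I2 : INR 2 = 2%R) by (simpl; lra). assert (I1 : INR 1 = 1%R) by (simpl; lra). assert (I4 : INR 4 = 4%R) by (simpl; lra).
  set (N := (2 * e * e)%nat).
  assert (EN : (2 * INR N = INR (2 * e) * INR (2 * e))%R) by (unfold N; rewrite !mult_INR, I2; ring).
  (* This value serves both instances: replacing X by X + e / 2 and e + 1 by 2 e + 1 leaves the
     condition on m unchanged. *)
  set (m := (1 / 2 - X + INR (e + 1) / 2)%R).
  destruct (even_half e N 1 B X m) as [g [Wg Eg]]; auto.
  { unfold N. lia. }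
  { unfold m. lra. }
  { intros [[u Hu] [v Hv]]. apply Hn. split.
    - exists (2 * u)%Z. rewrite mult_IZR, <- Hu, mult_INR, I2, I1. field. auto.
    - exists (2 * v)%Z. rewrite mult_IZR, <- Hv. auto. }
  destruct (even_half (2 * e) N 4 B (X + INR e / 2) m) as [g' [Wg' Eg']]; auto; try lia.
  { apply rat_plus; auto. exact (rat_div_nat (INR e) 2 ltac:(lia) (rat_nat e)). }
  { unfold m. rewrite !plus_INR, mult_INR, I1, I2. field. }
  { intros [[u Hu] [v Hv]]. apply Hn. split.
    - exists u. rewrite <- Hu, !mult_INR, I2, I4. field. auto.
    - exists (2 * v - Z.of_nat e)%Z. rewrite minus_IZR, mult_IZR, <- Hv, <- INR_IZR_INZ. field. }
  apply (WP_ext N 1 (fun tau => g tau + - (1) * g' tau)).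
  2:{ apply WP_plus; auto. apply WP_scal. auto. }
  intros tau Ht. cbv zeta. specialize (Eg tau Ht). specialize (Eg' tau Ht). cbv zeta in Eg, Eg'.
  rewrite EN in Eg, Eg'.
  replace (RtoC (INR 1 / INR 1) * tau) with tau in Eg by (rewrite I1; replace (1 / 1)%R with 1%R by field; ring).
  rewrite I1, I4 in Eg'.
  replace (RtoC B * tau + RtoC (X + INR e / 2)) with (RtoC B * tau + RtoC X + RtoC (INR e / 2)) in Eg' by (rewrite RtoC_plus; ring).
  set (p := ex (RtoC (- (B * B / (INR (2 * e) * INR (2 * e)))) * tau)) in *.
  match type of Eg with ?a = ?r + _ => transitivity (a - (r + g' tau)) end.
  - rewrite Eg. ring.
  - rewrite <- Eg'. ring.
Qed.

Lemma int_divide (x y : Z) (n : nat) : (1 <= n)%nat -> (IZR x / INR n = IZR y)%R -> (Z.of_nat n | x)%Z.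
Proof.
  intros Hn H. exists y. apply eq_IZR. rewrite mult_IZR, <- INR_IZR_INZ, <- H. field. apply not_0_INR. lia.
Qed.

Lemma z_ex c a (s : R) tau : zeta c a * qpow s tau = ex (RtoC s * tau + RtoC (IZR a / INR c)).
Proof. rewrite zeta_ex, qpow_ex, <- ex_plus. f_equal. ring. Qed.

(** Unites both residues of d = 2 e modulo 4: the factor ex (e / 2) is the sign (-1)^e. *)
Lemma even_modular (a b : Z) (c e : nat) : (1 <= c)%nat -> (1 <= e)%nat ->
  ~ (Z.of_nat c | 2 * a)%Z \/ ~ (Z.of_nat (c * (2 * e)) | 2 * b)%Z ->
  is_modular_half (fun tau =>
    let z := zeta c a * qpow (IZR b / INR c) tau in
    let p := qpow (- (IZR b ^ 2 / (INR c ^ 2 * INR (2 * e) ^ 2))) tau in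
    (1 + z) / (1 - z) * p * overrank (2 * e) z (qpow 1 tau)
    - (1 + z * ex (RtoC (INR e / 2))) / (1 - z * ex (RtoC (INR e / 2))) * p * overrank (2 * (2 * e)) (z * ex (RtoC (INR e / 2))) (qpow (1 / 4) tau)).
Proof.
  intros Hc He H.
  assert (Fc : INR c <> 0%R) by (apply not_0_INR; lia). assert (Fe : INR e <> 0%R) by (apply not_0_INR; lia).
  assert (I2 : INR 2 = 2%R) by (simpl; lra).
  apply (WP_modular (2 * e * e)); [nia|].
  eapply WP_ext; [|apply (even_WP e (IZR b / INR c) (IZR a / INR c) He); try (apply rat_div; auto)].
  - intros tau Ht. cbv zeta. rewrite !z_ex, !qpow_ex, <- !ex_plus.
    replace (IZR b ^ 2 / (INR c ^ 2 * INR (2 * e) ^ 2))%R with (IZR b / INR c * (IZR b / INR c) / (INR (2 * e) * INR (2 * e)))%R.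
    2:{ field. split; auto. rewrite mult_INR, I2. lra. }
    replace (RtoC 1 * tau) with tau by ring. ring.
  (* Integrality of B / e and of 2 X would mean that 2 e c divides 2 b and that c divides 2 a. *)
  - intros [[u Hu] [v Hv]]. destruct H as [H|H]; apply H.
    + apply (int_divide _ v); auto. rewrite <- Hv, mult_IZR. field. auto.
    + apply (int_divide _ u); [nia|]. rewrite <- Hu, mult_IZR, !mult_INR, I2. field. auto.
Qed.

Theorem theorem8p2 (a b : Z) (c d : nat) (hc : (1 <= c)%nat) (hd : (1 <= d)%nat) :
  (Nat.Odd d ->
   ~ (Z.of_nat c | 2 * a)%Z \/ ~ (Z.of_nat (c * d) | b)%Z ->
   is_modular_half (fun tau =>
     let q := qpow 1 tau in
     let z := zeta c a * qpow (IZR b / INR c) tau in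
     let z2 := zeta c (2 * a) * qpow (IZR (2 * b) / INR c) tau in
     let p := qpow (- (IZR b ^ 2 / (INR c ^ 2 * INR d ^ 2))) tau in
     (1 + z) / (1 - z) * p * overrank d z q
     - (1 + z2) / (1 - z2) * p * overrank (2 * d) z2 q))
  /\
  ((d mod 4 = 2)%nat ->
   ~ (Z.of_nat c | 2 * a)%Z \/ ~ (Z.of_nat (c * d) | 2 * b)%Z ->
   is_modular_half (fun tau =>
     let q := qpow 1 tau in
     let q4 := qpow (1 / 4) tau in
     let z := zeta c a * qpow (IZR b / INR c) tau in
     let p := qpow (- (IZR b ^ 2 / (INR c ^ 2 * INR d ^ 2))) tau in
     (1 + z) / (1 - z) * p * overrank d z q
     - (1 - z) / (1 + z) * p * overrank (2 * d) (- z) q4))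
  /\
  ((d mod 4 = 0)%nat ->
   ~ (Z.of_nat c | 2 * a)%Z \/ ~ (Z.of_nat (c * d) | 2 * b)%Z ->
   is_modular_half (fun tau =>
     let q := qpow 1 tau in
     let q4 := qpow (1 / 4) tau in
     let z := zeta c a * qpow (IZR b / INR c) tau in
     let p := qpow (- (IZR b ^ 2 / (INR c ^ 2 * INR d ^ 2))) tau in
     (1 + z) / (1 - z) * p * overrank d z q
     - (1 + z) / (1 - z) * p * overrank (2 * d) z q4)).
Proof.
  assert (Fc : INR c <> 0%R) by (apply not_0_INR; lia). assert (Fd : INR d <> 0%R) by (apply not_0_INR; lia).
  split; [|split].
  - intros Hodd H. apply (WP_modular (2 * d * d)); [nia|].
    eapply WP_ext; [|apply (odd_WP d (IZR b / INR c) (IZR a / INR c) Hodd); try (apply rat_div; auto)].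
    + intros tau Ht. cbv zeta. rewrite !z_ex, !qpow_ex.
      replace (RtoC (IZR (2 * b) / INR c) * tau + RtoC (IZR (2 * a) / INR c)) with (2 * (RtoC (IZR b / INR c) * tau + RtoC (IZR a / INR c))).
      2:{ rewrite !mult_IZR, !RtoC_div, !RtoC_mult by auto. field. apply RtoC_neq0. auto. }
      replace (IZR b ^ 2 / (INR c ^ 2 * INR d ^ 2))%R with (IZR b / INR c * (IZR b / INR c) / (INR d * INR d))%R by (field; auto).
      replace (RtoC 1 * tau) with tau by ring. ring.
    + intros [[u Hu] [v Hv]]. destruct H as [H|H]; apply H.
      * apply (int_divide _ v); auto. rewrite <- Hv, mult_IZR. field. auto.
      * apply (int_divide _ u); [nia|]. rewrite <- Hu, !mult_INR. field. auto.
  - intros Hd4 H. set (e := (d / 2)%nat).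
    assert (Ed : d = (2 * e)%nat) by (assert (Q := Nat.div_mod d 4 ltac:(lia)); assert (Q2 := Nat.div_mod d 2 ltac:(lia)); assert (Q3 := Nat.mod_upper_bound d 2 ltac:(lia)); unfold e; lia).
    rewrite Ed in *.
    (* Here d = 4 k + 2, so e is odd. *)
    assert (Eh : ex (RtoC (INR e / 2)) = - (1)).
    { replace (- (1)) with (ex (1 / 2)) by (rewrite ex_half; apply C_eq; C_simpl; lra).
      assert (Q := Nat.div_mod (2 * e) 4 ltac:(lia)). set (k := (2 * e / 4)%nat) in Q.
      apply (ex_eqZ _ _ (Z.of_nat k)). replace e with (2 * k + 1)%nat by lia.
      unfold ZC. rewrite <- INR_IZR_INZ, plus_INR, mult_INR, RtoC_div, RtoC_plus, RtoC_mult by lra.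
      replace (INR 2) with 2%R by (simpl; lra). simpl (INR 1). field. }
    assert (M := even_modular a b c e hc ltac:(lia) H). rewrite Eh in M.
    replace (fun tau : C => _) with (fun tau : C =>
      let z := zeta c a * qpow (IZR b / INR c) tau in
      let p := qpow (- (IZR b ^ 2 / (INR c ^ 2 * INR (2 * e) ^ 2))) tau in
      (1 + z) / (1 - z) * p * overrank (2 * e) z (qpow 1 tau)
      - (1 + z * - (1)) / (1 - z * - (1)) * p * overrank (2 * (2 * e)) (z * - (1)) (qpow (1 / 4) tau)); [exact M|].
    apply functional_extensionality. intros tau. cbv zeta.
    set (z := zeta c a * qpow (IZR b / INR c) tau).
    replace (z * - (1)) with (- z) by ring. replace (1 - - z) with (1 + z) by ring. reflexivity.
  - intros Hd4 H. set (e := (d / 2)%nat).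
    assert (Ed : d = (2 * e)%nat) by (assert (Q := Nat.div_mod d 4 ltac:(lia)); assert (Q2 := Nat.div_mod d 2 ltac:(lia)); assert (Q3 := Nat.mod_upper_bound d 2 ltac:(lia)); unfold e; lia).
    rewrite Ed in *.
    (* Here d = 4 k, so e is even. *)
    assert (Eh : ex (RtoC (INR e / 2)) = 1).
    { rewrite <- ex_0. assert (Q := Nat.div_mod (2 * e) 4 ltac:(lia)). set (k := (2 * e / 4)%nat) in Q.
      apply (ex_eqZ _ _ (Z.of_nat k)). replace e with (2 * k)%nat by lia.
      unfold ZC. rewrite <- INR_IZR_INZ, mult_INR, RtoC_div, RtoC_mult by lra.
      replace (INR 2) with 2%R by (simpl; lra). field. }
    assert (M := even_modular a b c e hc ltac:(lia) H). rewrite Eh in M.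
    replace (fun tau : C => _) with (fun tau : C =>
      let z := zeta c a * qpow (IZR b / INR c) tau in
      let p := qpow (- (IZR b ^ 2 / (INR c ^ 2 * INR (2 * e) ^ 2))) tau in
      (1 + z) / (1 - z) * p * overrank (2 * e) z (qpow 1 tau)
      - (1 + z * 1) / (1 - z * 1) * p * overrank (2 * (2 * e)) (z * 1) (qpow (1 / 4) tau)); [exact M|].
    apply functional_extensionality. intros tau. cbv zeta. rewrite Cmult_1_r. reflexivity.
Qed.
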